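(* Let $\mathcal{G}$ be a Hausdorff, second countable, $\sigma$-compact LCA group. Let $0<p<\infty$, $a\in M^{p,\infty}(\mathcal{G}\times\widehat{\mathcal{G}})$ and $\psi_1,\psi_2\in\mathcal{S}_{\mathcal{C}}(\mathcal{G})\setminus\{0\}$. Suppose that $\sigma_P(A^{\psi_1,\psi_2}_a)\setminus\{0\}\neq\varnothing$ and let $\lambda\in\sigma_P(A^{\psi_1,\psi_2}_a)\setminus\{0\}$. Then any eigenfunction $f\in L^2(\mathcal{G})$ of the localization operator $A^{\psi_1,\psi_2}_a$ with eigenvalue $\lambda$ satisfies $$f\in\bigcap_{\gamma>0}M^\gamma(\mathcal{G}).$$
   Context: Setting. $\mathcal{G}$ is written additively; $\widehat{\mathcal{G}}$ is its dual group, $\langle\xi,x\rangle=\xi(x)$; $dx$, $d\xi$ dual Haar measures. $T_xf(y)=f(y-x)$, $M_\xi f(y)=\langle\xi,y\rangle f(y)$, $\pi(x,\xi)=M_\xi T_x$, $V_gf(x,\xi)=\langle f,\pi(x,\xi)g\rangle$. The same notions are used on the LCA group $\mathcal{G}\times\widehat{\mathcal{G}}$, whose dual is $\widehat{\mathcal{G}}\times\mathcal{G}$. By the structure theorem fix $\mathcal{G}\cong\mathbb{R}^d\times\mathcal{G}_0$, $\mathcal{G}_0$ an LCA group with compact open subgroup $\mathcal{K}$. Gaussian: $\varphi(x_1,x_2)=e^{-\pi x_1^2}\chi_{\mathcal{K}}(x_2)$; $\mathcal{S}_{\mathcal{C}}(\mathcal{G})=\mathrm{span}\{\pi(x,\xi)\varphi:(x,\xi)\in\mathcal{G}\times\widehat{\mathcal{G}}\}$.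 On $\mathcal{G}\times\widehat{\mathcal{G}}\cong\mathbb{R}^{2d}\times(\mathcal{G}_0\times\widehat{\mathcal{G}}_0)$ one uses the compact open subgroup $\mathcal{K}\times\mathcal{K}^\perp$. $S_0(\mathcal{G})=\{f\in L^2(\mathcal{G}):V_\varphi f\in L^1\}$ with norm $\|V_\varphi f\|_{L^1}$; $S_0'(\mathcal{G})$ is the space of continuous antilinear functionals on it. Modulation spaces (unweighted). $\|F\|_{L^{p,q}}=(\int_{\widehat{\mathcal{G}}}(\int_{\mathcal{G}}|F(x,\xi)|^pdx)^{q/p}d\xi)^{1/q}$ (usual modifications for $\infty$); $\mathsf{M}_QF(\mathbf{x})=\operatorname{ess\,sup}_{\mathbf{y}\in\mathbf{x}+Q}|F(\mathbf{y})|$, $Q$ a measurable relatively compact unit neighbourhood. For $0<p,q\le\infty$, $M^{p,q}(\mathcal{G})=\{f\in S_0'(\mathcal{G}):\mathsf{M}_QV_gf\in L^{p,q}\}$ with $\|f\|_{M^{p,q}}=\|\mathsf{M}_QV_gf\|_{L^{p,q}}$, $g\in\mathcal{S}_{\mathcal{C}}(\mathcal{G})\setminus\{0\}$ fixed (independent of $g,Q$ up to equivalence); $M^p=M^{p,p}$. $M^{p,q}(\mathcal{G}\times\widehat{\mathcal{G}})$ is the same with $\mathcal{G}$ replaced by $\mathcal{G}\times\widehat{\mathcal{G}}$. Localization operator. For $\psi_1,\psi_2\in S_0(\mathcal{G})$, $a\in S_0'(\mathcal{G}\times\widehat{\mathcal{G}})$, $A^{\psi_1,\psi_2}_a\colon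 S_0(\mathcal{G})\to S_0'(\mathcal{G})$ is defined weakly by $\langle A^{\psi_1,\psi_2}_af,g\rangle=\langle a,\overline{V_{\psi_1}f}\,V_{\psi_2}g\rangle$; formally $A^{\psi_1,\psi_2}_af=\int_{\mathcal{G}\times\widehat{\mathcal{G}}}a(u,\omega)V_{\psi_1}f(u,\omega)M_\omega T_u\psi_2\,du\,d\omega$. For the symbols and windows considered it extends to a bounded operator on $L^2(\mathcal{G})$. Point spectrum: $\sigma_P(T)=\{\lambda\in\mathbb{C}:\exists f\in L^2(\mathcal{G})\setminus\{0\},\ Tf=\lambda f\}$; such $f$ is an eigenfunction with eigenvalue $\lambda$. *)

(* Defs.v *)
(* Time-frequency analysis on a locally compact abelian group, built on
   MathComp-Analysis; scalars are R[i] for R : realType. *)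
From HB Require Import structures.
From mathcomp Require Import all_boot all_order all_algebra.
From mathcomp Require Import complex.
From mathcomp Require Import all_classical all_reals all_analysis.
From mathcomp Require Import ess_sup_inf.

Set Implicit Arguments.
Unset Strict Implicit.
Unset Printing Implicit Defensive.
Import Order.TTheory GRing.Theory Num.Theory.
Import numFieldNormedType.Exports.
Local Open Scope classical_set_scope.
Local Open Scope complex_scope.
Local Open Scope ring_scope.

#[short(type="measTopType")]
HB.structure Definition MeasTop d := {T of Measurable d T & Topological T}.

HB.instance Definition _ d1 d2 (T1 : measTopType d1) (T2 : measTopType d2) :=
  Topological.on (T1 * T2)%type.

HB.instance Definition _ (G H : PreTopologicalZmodule.type) :=
  Topological.on (G * H)%type.

HB.instance Definition _ (R : realType) m n := Topological.on 'M[R]_(m, n).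

(* A topological abelian group G with its Borel sigma-algebra. MathComp-Analysis
   has no structure joining Zmodule with Pointed (hence with Measurable), so the
   group law is that of G and the measurable structure that of [borel G]; the
   two types are convertible. *)
Definition borel (G : PreTopologicalZmodule.type) : Type := G.
HB.instance Definition _ (G : PreTopologicalZmodule.type) :=
  PreTopologicalZmodule.copy (borel G) G.
HB.instance Definition _ (G : PreTopologicalZmodule.type) :=
  isPointed.Build (borel G) (0 : G).
HB.instance Definition _ (G : PreTopologicalZmodule.type) :=
  Measurable.copy (borel G) (g_sigma_algebraType (@open (borel G))).

(* The measure m1 \x m2, under an alias for which sigma-finiteness is a
   canonical instance (the instance of the library is not exported). *)
Section ProductMeasure.
Context d1 d2 (T1 : measurableType d1) (T2 : measurableType d2) (R : realType).
Variables (m1 : {sigma_finite_measure set T1 -> \bar R})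
  (m2 : {sigma_finite_measure set T2 -> \bar R}).

Definition prod_measure : set (T1 * T2) -> \bar R := (m1 \x m2)%E.

HB.instance Definition _ := Measure.on prod_measure.

Lemma prod_measure_sigma_finite : sigma_finite setT prod_measure.
Proof.
have /sigma_finiteP[F [TF ndF Foo]] := sigma_finiteT m1.
have /sigma_finiteP[H [TH ndH Hoo]] := sigma_finiteT m2.
exists (fun n => F n `*` H n).
  rewrite -setXTT TF TH predeqE => -[x y]; split.
    move=> [/= [n _ Fnx] [k _ Hky]]; exists (maxn n k) => //; split.
      by move: x Fnx; exact/subsetPset/ndF/leq_maxl.
    by move: y Hky; exact/subsetPset/ndH/leq_maxr.
  by move=> [n _ []/= ? ?]; split; exists n.
move=> k; have [? ?] := Foo k; have [? ?] := Hoo k.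
split; first exact: measurableX.
by rewrite /prod_measure product_measure1E// lte_mul_pinfty// ge0_fin_numE.
Qed.

HB.instance Definition _ :=
  Measure_isSigmaFinite.Build _ _ _ prod_measure prod_measure_sigma_finite.

End ProductMeasure.

Definition cmod {R : realType} (z : R[i]) : R := complex.Re `|z|.

Section Dual.
Context (R : realType) (G : PreTopologicalZmodule.type).

Record dual := Character {
  dual_fun :> G -> R[i];
  dual_norm : forall x, `|dual_fun x| = 1;
  dual_add : forall x y, dual_fun (x + y) = dual_fun x * dual_fun y;
  dual_cont : continuous (dual_fun : G -> R[i]^o)
}.

Lemma dual_ext (xi eta : dual) : (forall x, xi x = eta x) -> xi = eta.
Proof.
case: xi eta => [f f1 f2 f3] [g g1 g2 g3] /= /funext fg; subst g.
by congr Character; exact: Prop_irrelevance.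
Qed.

HB.instance Definition _ := gen_eqMixin dual.
HB.instance Definition _ := gen_choiceMixin dual.

Lemma dual_neq0 (xi : dual) x : xi x != 0.
Proof. by rewrite -normr_eq0 dual_norm oner_neq0. Qed.

Fact dual0_norm (x : G) : `|1 : R[i]| = 1. Proof. exact: normr1. Qed.
Fact dual0_add (x y : G) : 1 = 1 * 1 :> R[i]. Proof. by rewrite mulr1. Qed.
Fact dual0_cont : continuous ((fun=> 1) : G -> R[i]^o).
Proof. exact: cst_continuous. Qed.
Definition dual0 : dual := Character (@dual0_norm) (@dual0_add) (@dual0_cont).

Fact dual_opp_norm (xi : dual) x : `|(xi x)^-1| = 1.
Proof. by rewrite normfV dual_norm invr1. Qed.
Fact dual_opp_add (xi : dual) x y : (xi (x + y))^-1 = (xi x)^-1 * (xi y)^-1.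
Proof. by rewrite dual_add invfM. Qed.
Fact dual_opp_cont (xi : dual) :
  continuous ((fun x => (xi x)^-1) : G -> R[i]^o).
Proof.
move=> x.
apply: (@continuousV R[i] G (xi : G -> R[i]^o) x (dual_neq0 xi x)).
exact: dual_cont.
Qed.
Definition dual_opp (xi : dual) : dual :=
  Character (@dual_opp_norm xi) (@dual_opp_add xi) (@dual_opp_cont xi).

Fact dual_mul_norm (xi eta : dual) x : `|xi x * eta x| = 1.
Proof. by rewrite normrM !dual_norm mulr1. Qed.
Fact dual_mul_add (xi eta : dual) x y :
  xi (x + y) * eta (x + y) = xi x * eta x * (xi y * eta y).
Proof. by rewrite !dual_add mulrACA. Qed.
Fact dual_mul_cont (xi eta : dual) :
  continuous ((fun x => xi x * eta x) : G -> R[i]^o).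
Proof.
move=> x.
by apply: (@continuousM R[i] G (xi : G -> R[i]^o) (eta : G -> R[i]^o));
  exact: dual_cont.
Qed.
Definition dual_mul (xi eta : dual) : dual :=
  Character (@dual_mul_norm xi eta) (@dual_mul_add xi eta)
    (@dual_mul_cont xi eta).

Lemma dual_addA : associative dual_mul.
Proof. by move=> a b c; apply: dual_ext => x /=; rewrite mulrA. Qed.
Lemma dual_addC : commutative dual_mul.
Proof. by move=> a b; apply: dual_ext => x /=; rewrite mulrC. Qed.
Lemma dual_add0 : left_id dual0 dual_mul.
Proof. by move=> a; apply: dual_ext => x /=; rewrite mul1r. Qed.
Lemma dual_addN : left_inverse dual0 dual_opp dual_mul.
Proof. by move=> a; apply: dual_ext => x /=; rewrite mulVf// dual_neq0. Qed.

HB.instance Definition _ :=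
  GRing.isZmodule.Build dual dual_addA dual_addC dual_add0 dual_addN.
HB.instance Definition _ := isPointed.Build dual (0 : dual).

Definition dual_co : dual -> {compact-open, G -> R[i]^o} := dual_fun.

HB.instance Definition _ := Topological.copy dual (initial_topology dual_co).

End Dual.

Section Groups.
Context (R : realType).

Definition sigma_compact (T : topologicalType) : Prop :=
  exists F : nat -> set T,
    (forall n, compact (F n)) /\ \bigcup_n F n = [set: T].

Definition lca_group (G : topologicalZmodType) : Prop :=
  hausdorff_space G /\ locally_compact [set: G].

Definition haar (G : PreTopologicalZmodule.type)
    (mu : {sigma_finite_measure set (borel G) -> \bar R}) : Prop :=
  [/\ forall (x : G) (A : set (borel G)), measurable A ->
        mu [set (x + y : G) | y in A] = mu A,
      forall A : set G, compact A -> (mu A < +oo)%E &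
      forall A : set G, open A -> A !=set0 -> (0 < mu A)%E].

Definition compact_open_subgroup (G : topologicalZmodType) (K : set G) : Prop :=
  [/\ compact K, open K, K 0 & forall x y, K x -> K y -> K (x - y)].

Definition topological_group_iso (G H : PreTopologicalZmodule.type)
    (Phi : G -> H) : Prop :=
  [/\ {morph Phi : x y / x + y}, continuous Phi &
      exists Phi' : H -> G,
        [/\ cancel Phi Phi', cancel Phi' Phi & continuous Phi']].

Definition annihilator (G : PreTopologicalZmodule.type) (K : set G) :
    set (dual R G) := [set xi | forall x, K x -> xi x = 1].

End Groups.

Section ComplexIntegration.
Context d (T : measurableType d) (R : realType).
Variable mu : {measure set T -> \bar R}.
Implicit Types f g : T -> R[i].

Definition cint f : R[i] :=
  (\int[mu]_x complex.Re (f x)) +i* (\int[mu]_x complex.Im (f x)).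

Definition inner f g : R[i] := cint (fun x => f x * (g x)^*).

Definition cLnorm (p : \bar R) f : \bar R :=
  Lnorm mu p (fun x => (cmod (f x))%:E).

Definition cLspace (p : \bar R) : set (T -> R[i]) := [set f |
  [/\ measurable_fun setT (fun x => complex.Re (f x)),
      measurable_fun setT (fun x => complex.Im (f x)) &
      (cLnorm p f < +oo)%E]].

Definition ceq_ae f g : Prop := {ae mu, forall x, f x = g x}.

(* Bounded linear operators on L^2, represented on functions and compared up
   to equality almost everywhere. *)
Definition bounded_L2_operator (S : (T -> R[i]) -> (T -> R[i])) : Prop :=
  [/\ forall f, cLspace 2%:E f -> cLspace 2%:E (S f),
      forall (c : R[i]) f g, cLspace 2%:E f -> cLspace 2%:E g ->
        ceq_ae (S (fun x => c * f x + g x)) (fun x => c * S f x + S g x) &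
      exists C : R, forall f, cLspace 2%:E f ->
        (cLnorm 2%:E (S f) <= C%:E * cLnorm 2%:E f)%E].

Definition eigenfunction (S : (T -> R[i]) -> (T -> R[i])) (lambda : R[i])
    f : Prop :=
  [/\ cLspace 2%:E f, ~ ceq_ae f (fun=> 0) &
      ceq_ae (S f) (fun x => lambda * f x)].

Definition point_spectrum (S : (T -> R[i]) -> (T -> R[i])) : set R[i] :=
  [set lambda | exists f, eigenfunction S lambda f].

End ComplexIntegration.

(* nu is the Haar measure on the dual for which Fourier inversion holds. *)
Definition dual_haar (R : realType) (G : PreTopologicalZmodule.type)
    (mu : {sigma_finite_measure set (borel G) -> \bar R})
    (nu : {sigma_finite_measure set (borel (dual R G)) -> \bar R}) : Prop :=
  let fourier f := fun xi : dual R G => inner mu f xi in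
  haar nu /\
  forall f : G -> R[i], continuous (f : G -> R[i]^o) ->
    cLspace mu 1%:E f -> cLspace nu 1%:E (fourier f) ->
    forall x, f x = cint nu (fun xi => fourier f xi * xi x).

Section Gaussian.
Context (R : realType).

Definition dotv n (x y : 'rV[R]_n) : R := \sum_i x 0 i * y 0 i.

Definition cexpi (t : R) : R[i] := cos t +i* sin t.

(* Gaussian in the coordinates Phi : X -> R^n * X0, for K a subset of X0. *)
Definition gaussian n (X X0 : Type) (Phi : X -> 'rV[R]_n * X0) (K : set X0)
    (x : X) : R[i] :=
  (expR (- (pi * dotv (Phi x).1 (Phi x).1)) * \1_K (Phi x).2)%:C.

Context (G G0 : PreTopologicalZmodule.type) (n : nat).
Variable Phi : G -> 'rV[R]_n * G0.

(* The isomorphism of the dual of G with R^n * (dual of G0) induced by Phi: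
   the unique w such that xi x = e^{2 pi i w_1 . x_1} w_2(x_2). *)
Definition dual_coord (xi : dual R G) : 'rV[R]_n * dual R G0 :=
  get [set w : 'rV[R]_n * dual R G0 | forall x,
    xi x = cexpi (2 * pi * dotv w.1 (Phi x).1) * w.2 (Phi x).2].

Definition double_coord (z : G * dual R G) :
    'rV[R]_(n + n) * (G0 * dual R G0) :=
  (row_mx (Phi z.1).1 (dual_coord z.2).1,
   ((Phi z.1).2, (dual_coord z.2).2)).

End Gaussian.

(* The data on which the time-frequency notions depend: a group X, its dual Y
   through an explicit pairing, their Haar measures and the Gaussian on X.
   It is a record so that the same definitions apply to G and to
   G * dual G, whose dual is dual G * G. *)
Record tfplane (R : realType) := TFPlane {
  tf_dX : measure_display;
  tf_X : measTopType tf_dX;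
  tf_dY : measure_display;
  tf_Y : measTopType tf_dY;
  tf_sub : tf_X -> tf_X -> tf_X;
  tf_zero : tf_X * tf_Y;
  tf_add : tf_X * tf_Y -> tf_X * tf_Y -> tf_X * tf_Y;
  tf_pair : tf_Y -> tf_X -> R[i];
  tf_mu : {sigma_finite_measure set tf_X -> \bar R};
  tf_nu : {sigma_finite_measure set tf_Y -> \bar R};
  tf_gauss : tf_X -> R[i]
}.

Arguments tf_gauss {R} t _.

Section Planes.
Context (R : realType) (G G0 : PreTopologicalZmodule.type) (n : nat).
Variables (mu : {sigma_finite_measure set (borel G) -> \bar R})
  (nu : {sigma_finite_measure set (borel (dual R G)) -> \bar R})
  (Phi : G -> 'rV[R]_n * G0) (K : set G0).
Local Notation Gd := (dual R G).

Definition base_plane : tfplane R :=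
  @TFPlane R _ (borel G) _ (borel Gd)
    (fun x y : G => x - y)
    (0 : G * Gd)
    (fun z w : G * Gd => z + w)
    (fun xi x => (xi : Gd) x)
    mu nu (gaussian Phi K).

Definition double_plane : tfplane R :=
  @TFPlane R _ (borel G * borel Gd)%type _ (borel Gd * borel G)%type
    (fun z w : G * Gd => z - w)
    (0 : (G * Gd) * (Gd * G))
    (fun z w : (G * Gd) * (Gd * G) => z + w)
    (fun eta z => (eta.1 : Gd) z.1 * (z.2 : Gd) eta.2)
    (prod_measure mu nu) (prod_measure nu mu)
    (gaussian (double_coord Phi) (K `*` annihilator (R := R) K)).

End Planes.

Section TimeFrequency.
Context (R : realType) (P : tfplane R).
Local Notation X := (tf_X P).
Local Notation Y := (tf_Y P).
Local Notation mu := (tf_mu P).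
Local Notation nu := (tf_nu P).
Local Notation munu := (prod_measure mu nu).

Definition translation (x : X) (f : X -> R[i]) : X -> R[i] :=
  fun y => f (tf_sub y x).
Definition modulation (xi : Y) (f : X -> R[i]) : X -> R[i] :=
  fun y => tf_pair xi y * f y.
Definition tfshift (z : X * Y) (f : X -> R[i]) : X -> R[i] :=
  modulation z.2 (translation z.1 f).

Definition stft (g f : X -> R[i]) (z : X * Y) : R[i] :=
  inner mu f (tfshift z g).

Definition SC : set (X -> R[i]) := [set f |
  exists (m : nat) (c : 'I_m -> R[i]) (z : 'I_m -> X * Y),
    f = fun y => \sum_(k < m) c k * tfshift (z k) (tf_gauss P) y].

Definition SC_nonzero : set (X -> R[i]) := SC `\ (fun=> 0).

Definition S0 : set (X -> R[i]) := [set f |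
  cLspace mu 2%:E f /\ cLspace munu 1%:E (stft (tf_gauss P) f)].

Definition S0norm (f : X -> R[i]) : \bar R :=
  cLnorm munu 1%:E (stft (tf_gauss P) f).

(* Functionals are represented by total maps; only their values on S0 matter. *)
Definition S0_dual : set ((X -> R[i]) -> R[i]) := [set u |
  (forall (c : R[i]) (f g : X -> R[i]), S0 f -> S0 g ->
     u (fun x => c * f x + g x) = c^* * u f + u g) /\
  (forall f : X -> R[i], S0 f -> forall e : R, 0 < e ->
     exists2 delta : R, 0 < delta &
       forall h : X -> R[i], S0 h ->
         (S0norm (fun x => (h x - f x)%R) < delta%:E)%E ->
         cmod (u h - u f) < e)].

Definition dstft (g : X -> R[i]) (u : (X -> R[i]) -> R[i]) (z : X * Y) : R[i] :=
  u (tfshift z g).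

Definition distribution_of (f : X -> R[i]) : (X -> R[i]) -> R[i] := inner mu f.

Definition Lpq_norm (p q : \bar R) (F : X * Y -> \bar R) : \bar R :=
  Lnorm nu q (fun xi => Lnorm mu p (fun x => F (x, xi))).

Definition unit_nbhd (Q : set (X * Y)) : Prop :=
  [/\ measurable Q, precompact Q & nbhs (tf_zero P) Q].

Definition local_max (Q : set (X * Y)) (F : X * Y -> R[i]) (z : X * Y) :
    \bar R :=
  ess_sup munu ((fun w => (cmod (F w))%:E) \_ [set tf_add z q | q in Q]).

Definition modulation_norm (g : X -> R[i]) (Q : set (X * Y)) (p q : \bar R)
    (u : (X -> R[i]) -> R[i]) : \bar R :=
  Lpq_norm p q (local_max Q (dstft g u)).

Definition modulation_space (g : X -> R[i]) (Q : set (X * Y)) (p q : \bar R) :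
    set ((X -> R[i]) -> R[i]) :=
  [set u | S0_dual u /\ (modulation_norm g Q p q u < +oo)%E].

End TimeFrequency.

Arguments SC {R} P _.
Arguments SC_nonzero {R} P _.
Arguments S0 {R} P _.
Arguments S0norm {R} P f.
Arguments S0_dual {R} P _.
Arguments stft {R} P g f z.
Arguments dstft {R} P g u z.
Arguments distribution_of {R} P f _.
Arguments unit_nbhd {R} P Q.
Arguments modulation_space {R} P g Q p q _.

Section Localization.
Context (R : realType) (G G0 : PreTopologicalZmodule.type) (n : nat).
Variables (mu : {sigma_finite_measure set (borel G) -> \bar R})
  (nu : {sigma_finite_measure set (borel (dual R G)) -> \bar R})
  (Phi : G -> 'rV[R]_n * G0) (K : set G0).
Local Notation P := (base_plane mu nu Phi K).

Definition localization_operator (psi1 psi2 : G -> R[i])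
    (a : (G * dual R G -> R[i]) -> R[i]) (f : G -> R[i]) :
    (G -> R[i]) -> R[i] :=
  fun g => a (fun z => (stft P psi1 f z)^* * stft P psi2 g z).

Definition L2_extension (psi1 psi2 : G -> R[i])
    (a : (G * dual R G -> R[i]) -> R[i]) (A : (G -> R[i]) -> (G -> R[i])) :
    Prop :=
  bounded_L2_operator mu A /\
  forall f g, S0 P f -> S0 P g ->
    distribution_of P (A f) g = localization_operator psi1 psi2 a f g.

End Localization.

(* Submission.v *)
(* Write F = |V_phi f| for the Gaussian phi. The functional a is applied to Gaussian
   atoms only, and the phase-space matrix <A pi(z) phi, pi(w) phi> is a finite sum of
   Gaussians in z - w times |V_Phi a| at the midpoint of z and w and at the frequency
   given by z - w. As f lies in the closure of the span of the atoms, the eigenvalue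
   equation turns into the pointwise inequality
     |lambda| F(w) <= C int F(w + h) Gauss(h) H_h(w) dh,
   where local suprema of H_h are in L^p uniformly in h because a is in M^(p,oo), the
   change of window being a Gaussian convolution. Starting from F bounded, the
   inequality puts local suprema of F in L^p, then in L^(p/2), and so on.

   The Gaussian is handled through its values: its Fourier transform follows from
   translation invariance of Haar measure, by a differential equation in the R^n
   direction and by orthogonality of characters on K, and only then the inversion
   formula is used. *)
From HB Require Import structures.
Require Import Defs.
From mathcomp Require Import all_boot all_order all_algebra.
From mathcomp Require Import complex.
From mathcomp Require Import all_classical all_reals all_analysis.
From mathcomp Require Import ess_sup_inf measurable_realfun.
From mathcomp Require Import ring lra.
Set Implicit Arguments.
Unset Strict Implicit.
Unset Printing Implicit Defensive.
Import Order.TTheory GRing.Theory Num.Theory.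
Import numFieldNormedType.Exports.
Local Open Scope classical_set_scope.
Local Open Scope complex_scope.
Local Open Scope ring_scope.

(** * Complex integrals and square integrable functions *)

(** The symbol is only a functional, constrained on S0 alone, and integrals of S0-valued functions
    are not formed: functionals are moved through integrals of atoms by Riemann sums
    ([lin_reproducing]). Exponents below 1 must be reached, where convexity gives nothing for
    Gaussian averages; the substitute is to bound a function by an integral of its local suprema
    ([le_int_sup], [int_pow]). Therefore true suprema over boxes, lower semicontinuous and hence
    measurable, are carried throughout. The midpoint of z and w asks for a halving map, which exists
    in R^n but in general not in G0: [hf] halves the R^n part and forgets the rest, which is
    harmless because the indicator of a subgroup does not separate points of one coset. The same
    estimates are needed on the group, on its time-frequency plane and on the plane over that plane,
    so they are proved for an abstract group with a Gaussian ([gspace], [gpair]), a notion stable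
    under products. The exponents p / m tend to 0, and boundedness of F fills in all gamma between
    them. *)

Section Cmod.
Context {R : realType}.
Implicit Types z w : R[i].

Lemma normc_cmod z : `|z| = (cmod z)%:C.
Proof. by rewrite /cmod normc_def. Qed.

Lemma cmodE z : cmod z = Num.sqrt (complex.Re z ^+ 2 + complex.Im z ^+ 2).
Proof. by rewrite /cmod normc_def. Qed.

Lemma cmod_ge0 z : 0 <= cmod z.
Proof. by rewrite cmodE sqrtr_ge0. Qed.

Lemma cmod0 : cmod (0 : R[i]) = 0.
Proof. by rewrite /cmod normr0. Qed.

Lemma cmod1 : cmod (1 : R[i]) = 1.
Proof. by rewrite /cmod normr1. Qed.

Lemma cmodM z w : cmod (z * w) = cmod z * cmod w.
Proof.
apply: (@complexI R); rewrite -normc_cmod normrM !normc_cmod.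
by rewrite -rmorphM.
Qed.

Lemma cmodN z : cmod (- z) = cmod z.
Proof. by rewrite /cmod normrN. Qed.

Lemma cmod_conj z : cmod (z^*) = cmod z.
Proof. by rewrite !cmodE; case: z => a b /=; rewrite sqrrN. Qed.

Lemma cmodD z w : cmod (z + w) <= cmod z + cmod w.
Proof. by rewrite -lecR rmorphD /= -!normc_cmod ler_normD. Qed.

Lemma cmodB z w : cmod (z - w) <= cmod z + cmod w.
Proof. by rewrite -(cmodN w) cmodD. Qed.

Lemma cmod_distC z w : cmod (z - w) = cmod (w - z).
Proof. by rewrite -cmodN opprB. Qed.

Lemma cmod_eq0 z : (cmod z == 0) = (z == 0).
Proof.
rewrite -(normr_eq0 z) normc_cmod; apply/eqP/eqP => [->//|].
by move=> /(@complexI R).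
Qed.

Lemma cmod_real (x : R) : cmod x%:C = `|x|.
Proof. by rewrite cmodE /= expr0n/= addr0 sqrtr_sqr. Qed.

Lemma cmod_sum I (r : seq I) (P : pred I) (F : I -> R[i]) :
  cmod (\sum_(i <- r | P i) F i) <= \sum_(i <- r | P i) cmod (F i).
Proof.
elim/big_ind2 : _ => [|x1 x2 y1 y2 h1 h2|//]; first by rewrite cmod0.
by rewrite (le_trans (cmodD _ _))// lerD.
Qed.

Lemma sqr_cmod z : cmod z ^+ 2 = complex.Re z ^+ 2 + complex.Im z ^+ 2.
Proof. by rewrite cmodE sqr_sqrtr// addr_ge0// sqr_ge0. Qed.

Lemma Re_le_cmod z : `|complex.Re z| <= cmod z.
Proof.
rewrite -(@ler_pXn2r _ 2) ?nnegrE ?cmod_ge0// sqr_cmod real_normK ?num_real//.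
by rewrite lerDl sqr_ge0.
Qed.

Lemma Im_le_cmod z : `|complex.Im z| <= cmod z.
Proof.
rewrite -(@ler_pXn2r _ 2) ?nnegrE ?cmod_ge0// sqr_cmod real_normK ?num_real//.
by rewrite lerDr sqr_ge0.
Qed.

Lemma cmod_le_ReIm z : cmod z <= `|complex.Re z| + `|complex.Im z|.
Proof.
rewrite -(@ler_pXn2r _ 2) ?nnegrE ?cmod_ge0 ?addr_ge0//.
rewrite sqr_cmod sqrrD !real_normK ?num_real//.
by rewrite addrAC lerDl mulrn_wge0// mulr_ge0.
Qed.

Lemma mulr_conjc z : z * z^* = (cmod z ^+ 2)%:C.
Proof.
rewrite sqr_cmod; case: z => a b /=; apply/eqP; rewrite eq_complex /=.
by apply/andP; split; apply/eqP; ring.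
Qed.

Lemma ReD z w : complex.Re (z + w) = complex.Re z + complex.Re w.
Proof. by case: z; case: w. Qed.
Lemma ImD z w : complex.Im (z + w) = complex.Im z + complex.Im w.
Proof. by case: z; case: w. Qed.
Lemma ReN z : complex.Re (- z) = - complex.Re z. Proof. by case: z. Qed.
Lemma ImN z : complex.Im (- z) = - complex.Im z. Proof. by case: z. Qed.
Lemma ReM z w : complex.Re (z * w) =
  complex.Re z * complex.Re w - complex.Im z * complex.Im w.
Proof. by case: z; case: w. Qed.
Lemma ImM z w : complex.Im (z * w) =
  complex.Re z * complex.Im w + complex.Im z * complex.Re w.
Proof. by case: z; case: w. Qed.
Lemma Reconj z : complex.Re z^* = complex.Re z. Proof. by case: z. Qed.
Lemma Imconj z : complex.Im z^* = - complex.Im z. Proof. by case: z. Qed.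

Lemma conj_realc (x : R) : (x%:C : R[i])^* = x%:C.
Proof. by apply/eqP; rewrite eq_complex /= oppr0 !eqxx. Qed.

Lemma complex_eq z w : complex.Re z = complex.Re w ->
  complex.Im z = complex.Im w -> z = w.
Proof. by case: z; case: w => /= a b c d -> ->. Qed.

End Cmod.

Section Cint.
Context d (T : measurableType d) (R : realType).
Implicit Types (f g : T -> R[i]).

(** Measurability is asked of the two real components separately, as in [cLspace]. *)
Definition cmeas f := measurable_fun setT (fun x => complex.Re (f x)) /\
  measurable_fun setT (fun x => complex.Im (f x)).

Lemma cmeas_cst c : cmeas (fun=> c).
Proof. by split; exact: measurable_cst. Qed.

Lemma cmeasD f g : cmeas f -> cmeas g -> cmeas (fun x => f x + g x).
Proof.
move=> [f1 f2] [g1 g2]; split.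
  by under eq_fun do rewrite ReD; exact: measurable_funD.
by under eq_fun do rewrite ImD; exact: measurable_funD.
Qed.

Lemma cmeasN f : cmeas f -> cmeas (fun x => - f x).
Proof.
move=> [f1 f2]; split.
  by under eq_fun do rewrite ReN; exact: measurableT_comp.
by under eq_fun do rewrite ImN; exact: measurableT_comp.
Qed.

Lemma cmeasB f g : cmeas f -> cmeas g -> cmeas (fun x => f x - g x).
Proof. by move=> ? ?; apply: cmeasD => //; exact: cmeasN. Qed.

Lemma cmeasM f g : cmeas f -> cmeas g -> cmeas (fun x => f x * g x).
Proof.
move=> [f1 f2] [g1 g2]; split.
  by under eq_fun do rewrite ReM; apply: measurable_funB; apply: measurable_funM.
by under eq_fun do rewrite ImM; apply: measurable_funD; apply: measurable_funM.
Qed.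

Lemma cmeas_conj f : cmeas f -> cmeas (fun x => (f x)^*).
Proof.
move=> [f1 f2]; split; first by under eq_fun do rewrite Reconj.
by under eq_fun do rewrite Imconj; exact: measurableT_comp.
Qed.

Lemma cmeas_real (h : T -> R) : measurable_fun setT h ->
  cmeas (fun x => (h x)%:C).
Proof. by move=> mh; split => //=; exact: measurable_cst. Qed.

Lemma cmeas_sum I (r : seq I) (F : I -> T -> R[i]) :
  (forall i, cmeas (F i)) -> cmeas (fun x => \sum_(i <- r) F i x).
Proof.
move=> mF; elim: r => [|i r ih].
  by under eq_fun do rewrite big_nil; exact: cmeas_cst.
by under eq_fun do rewrite big_cons; exact: cmeasD.
Qed.

Lemma cmeas_cmod f : cmeas f -> measurable_fun setT (fun x => cmod (f x)).
Proof.
move=> [f1 f2]; under eq_fun do rewrite cmodE.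
apply: (@measurableT_comp _ _ _ _ _ _ (@Num.sqrt R)) => //.
  by apply: continuous_measurable_fun => x; exact: sqrt_continuous.
by apply: measurable_funD; apply: measurable_funX.
Qed.

Lemma cmeas_cmodE f : cmeas f ->
  measurable_fun setT (fun x => (cmod (f x))%:E).
Proof. by move=> /cmeas_cmod mf; exact/measurable_EFinP. Qed.

End Cint.

Lemma cmeas_comp d d' (T : measurableType d) (T' : measurableType d')
    (R : realType) (h : T' -> T) (f : T -> R[i]) :
  measurable_fun setT h -> cmeas f -> cmeas (fun x => f (h x)).
Proof.
move=> mh [f1 f2]; split.
  exact: (measurableT_comp f1 mh).
exact: (measurableT_comp f2 mh).
Qed.

Section Cintegrable.
Context d (T : measurableType d) (R : realType).
Variable mu : {measure set T -> \bar R}.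
Implicit Types (f g : T -> R[i]).

Definition cintg f := cmeas f /\ (\int[mu]_x (cmod (f x))%:E < +oo)%E.

(** The integral of a nonnegative function is a supremum over the simple functions below it, so it
    is monotone without any measurability. Pointwise bounds can then be integrated at once. *)
Lemma ge0_le_integral_nomeas (F G : T -> \bar R) :
  (forall x, 0 <= F x)%E -> (forall x, F x <= G x)%E ->
  (\int[mu]_x F x <= \int[mu]_x G x)%E.
Proof.
move=> F0 FG; have G0 x : (0 <= G x)%E by exact: le_trans (FG x).
rewrite !ge0_integralTE//; apply: ereal_sup_le => _ [h hF <-].
apply: imageP => x.
exact: le_trans (hF x) (FG x).
Qed.

Lemma cintgP f : cintg f <->
  mu.-integrable setT (fun x => (complex.Re (f x))%:E) /\
  mu.-integrable setT (fun x => (complex.Im (f x))%:E).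
Proof.
split.
  move=> [[m1 m2] fi]; split; apply/integrableP; split.
  - exact/measurable_EFinP.
  - apply: le_lt_trans fi; apply: ge0_le_integral_nomeas => // x.
    by rewrite /= lee_fin Re_le_cmod.
  - exact/measurable_EFinP.
  - apply: le_lt_trans fi; apply: ge0_le_integral_nomeas => // x.
    by rewrite /= lee_fin Im_le_cmod.
move=> [/integrableP[m1 i1] /integrableP[m2 i2]].
move/measurable_EFinP in m1; move/measurable_EFinP in m2.
split => //; apply: (@le_lt_trans _ _
  (\int[mu]_x (`|(complex.Re (f x))%:E| + `|(complex.Im (f x))%:E|)))%E.
  apply: ge0_le_integral_nomeas => x; first by rewrite lee_fin cmod_ge0.
  by rewrite /= lee_fin cmod_le_ReIm.
rewrite ge0_integralD//.
- exact: lte_add_pinfty.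
- by apply/measurable_EFinP; exact: measurableT_comp.
- by apply/measurable_EFinP; exact: measurableT_comp.
Qed.

Lemma cintg_le f (F : T -> \bar R) : cmeas f ->
  (forall x, (cmod (f x))%:E <= F x)%E -> (\int[mu]_x F x < +oo)%E -> cintg f.
Proof.
move=> mf fF Foo; split => //; apply: le_lt_trans Foo.
by apply: ge0_le_integral_nomeas => // x; rewrite lee_fin cmod_ge0.
Qed.

Lemma cintgD f g : cintg f -> cintg g -> cintg (fun x => f x + g x).
Proof.
move=> /cintgP[f1 f2] /cintgP[g1 g2]; apply/cintgP; split.
  by under eq_fun do rewrite ReD EFinD; exact: integrableD.
by under eq_fun do rewrite ImD EFinD; exact: integrableD.
Qed.

Lemma cintD f g : cintg f -> cintg g ->
  cint mu (fun x => f x + g x) = cint mu f + cint mu g.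
Proof.
move=> /cintgP[f1 f2] /cintgP[g1 g2]; apply: complex_eq; rewrite ?ReD ?ImD /=.
  by rewrite -RintegralD//; apply: eq_Rintegral => x _; rewrite ReD.
by rewrite -RintegralD//; apply: eq_Rintegral => x _; rewrite ImD.
Qed.

Lemma cintgZ c f : cintg f -> cintg (fun x => c * f x).
Proof.
move=> [mf fi]; split; first by apply: cmeasM => //; exact: cmeas_cst.
under eq_integral do rewrite cmodM EFinM.
rewrite ge0_integralZl_EFin//.
- by rewrite lte_mul_pinfty// ?lee_fin ?cmod_ge0.
- by move=> x _; rewrite lee_fin cmod_ge0.
- exact: cmeas_cmodE.
- exact: cmod_ge0.
Qed.

Lemma cintZ c f : cintg f -> cint mu (fun x => c * f x) = c * cint mu f.
Proof.
move=> /cintgP[f1 f2]; apply: complex_eq; rewrite ?ReM ?ImM /=.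
  rewrite -!RintegralZl// -RintegralB//.
  - by apply: eq_Rintegral => x _; rewrite ReM.
  - exact: (@integrableZl _ _ _ mu setT measurableT _ _ f1).
  - exact: (@integrableZl _ _ _ mu setT measurableT _ _ f2).
rewrite -!RintegralZl// -RintegralD//.
- by apply: eq_Rintegral => x _; rewrite ImM.
- exact: (@integrableZl _ _ _ mu setT measurableT _ _ f2).
- exact: (@integrableZl _ _ _ mu setT measurableT _ _ f1).
Qed.

Lemma cintgN f : cintg f -> cintg (fun x => - f x).
Proof.
move=> fi; under eq_fun do rewrite -mulN1r; exact: cintgZ.
Qed.

Lemma cintN f : cintg f -> cint mu (fun x => - f x) = - cint mu f.
Proof.
by move=> fi; under eq_fun do rewrite -mulN1r; rewrite cintZ// mulN1r.
Qed.

Lemma cintgB f g : cintg f -> cintg g -> cintg (fun x => f x - g x).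
Proof. by move=> fi gi; apply: cintgD => //; exact: cintgN. Qed.

Lemma cintB f g : cintg f -> cintg g ->
  cint mu (fun x => f x - g x) = cint mu f - cint mu g.
Proof. by move=> fi gi; rewrite cintD ?cintN//; exact: cintgN. Qed.

Lemma cint_conj f : cintg f -> cint mu (fun x => (f x)^*) = (cint mu f)^*.
Proof.
move=> /cintgP[f1 f2]; apply: complex_eq; rewrite ?Reconj ?Imconj /=.
  by apply: eq_Rintegral => x _; rewrite Reconj.
rewrite -mulN1r -RintegralZl//.
by apply: eq_Rintegral => x _; rewrite Imconj mulN1r.
Qed.

Lemma cintg0 : cintg (fun=> 0).
Proof.
split; first exact: cmeas_cst.
by under eq_integral do rewrite cmod0; rewrite integral0.
Qed.

Lemma cint0 : cint mu (fun=> 0) = 0.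
Proof.
rewrite -[RHS](mul0r (cint mu (fun=> 0))) -(cintZ 0 cintg0).
by congr cint; apply/funext => x; rewrite mul0r.
Qed.

Lemma cintg_sum I (r : seq I) (F : I -> T -> R[i]) :
  (forall i, cintg (F i)) -> cintg (fun x => \sum_(i <- r) F i x).
Proof.
move=> iF; elim: r => [|i r ih].
  by under eq_fun do rewrite big_nil; exact: cintg0.
by under eq_fun do rewrite big_cons; exact: cintgD.
Qed.

Lemma cint_sum I (r : seq I) (F : I -> T -> R[i]) :
  (forall i, cintg (F i)) ->
  cint mu (fun x => \sum_(i <- r) F i x) = \sum_(i <- r) cint mu (F i).
Proof.
move=> iF; elim: r => [|i r ih].
  by under eq_fun do rewrite big_nil; rewrite cint0 big_nil.
under eq_fun do rewrite big_cons.
by rewrite cintD ?ih ?big_cons//; exact: cintg_sum.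
Qed.

Lemma cint_real (h : T -> R) :
  cint mu (fun x => (h x)%:C) = (\int[mu]_x h x)%:C.
Proof.
by apply: complex_eq => //=; rewrite /Rintegral integral0.
Qed.

Lemma cintg_fin_num f : cintg f ->
  (\int[mu]_x (cmod (f x))%:E)%E \is a fin_num.
Proof.
move=> [_ fi]; rewrite ge0_fin_numE//.
by apply: integral_ge0 => x _; rewrite lee_fin cmod_ge0.
Qed.

(* Rotating the integral onto the real axis reduces to the real inequality. *)
Lemma cmod_cint f : cintg f ->
  ((cmod (cint mu f))%:E <= \int[mu]_x (cmod (f x))%:E)%E.
Proof.
move=> fi; set I := cint mu f.
have [I0|I0] := eqVneq I 0.
  by rewrite I0 cmod0 integral_ge0// => x _; rewrite lee_fin cmod_ge0.
have cI0 : cmod I != 0 by rewrite cmod_eq0.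
pose u : R[i] := I^* / (cmod I)%:C.
have cu : cmod u = 1.
  rewrite /u cmodM cmod_conj -fmorphV cmod_real ger0_norm ?mulfV//.
  by rewrite invr_ge0 cmod_ge0.
have uI : u * I = (cmod I)%:C.
  rewrite /u mulrAC mulrC [I^* * I]mulrC mulr_conjc expr2 rmorphM/=.
  by rewrite mulKf//; apply/eqP => /(@complexI R)/eqP; exact/negP.
have ufi := cintgZ u fi; have /cintgP[r1 _] := ufi.
have E1 : cmod I = \int[mu]_x (complex.Re (u * f x)).
  by have := cintZ u fi; rewrite uI => /(congr1 (@complex.Re R)) /= <-.
rewrite E1 /Rintegral fineK; last exact: integrable_fin_num.
apply: le_integral => //=.
- apply/integrableP; split; first exact: cmeas_cmodE (fi.1).
  case: fi => _; congr (_ < _)%E; apply: eq_integral => x _ /=.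
  by rewrite ger0_norm ?cmod_ge0.
- move=> x _; rewrite lee_fin (le_trans (ler_norm _))//.
  by rewrite (le_trans (Re_le_cmod _))// cmodM cu mul1r.
Qed.

Lemma cint_ae f g : cintg f -> cmeas g -> ceq_ae mu f g ->
  cintg g /\ cint mu f = cint mu g.
Proof.
move=> fi mg fg; have [mf foo] := fi.
split.
  split => //; rewrite (ae_eq_integral (fun x => (cmod (f x))%:E))//.
  - exact: cmeas_cmodE.
  - exact: cmeas_cmodE.
  - by apply: filterS fg => x /= -> _.
apply: complex_eq; rewrite /= /Rintegral; congr fine; apply: ae_eq_integral => //.
- by apply/measurable_EFinP; exact: mf.1.
- by apply/measurable_EFinP; exact: mg.1.
- by apply: filterS fg => x -> _.
- by apply/measurable_EFinP; exact: mf.2.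
- by apply/measurable_EFinP; exact: mg.2.
- by apply: filterS fg => x -> _.
Qed.

End Cintegrable.

Section CFubini.
Context d1 d2 (T1 : measurableType d1) (T2 : measurableType d2) (R : realType).
Variables (m1 : {sigma_finite_measure set T1 -> \bar R})
  (m2 : {sigma_finite_measure set T2 -> \bar R}).
Implicit Type f : T1 * T2 -> R[i].
Local Notation m12 := (prod_measure m1 m2).

Lemma tonelli1 (F : T1 * T2 -> \bar R) : measurable_fun setT F ->
  (forall z, 0 <= F z)%E ->
  (\int[m12]_z F z = \int[m1]_x \int[m2]_y F (x, y))%E.
Proof. by move=> mF F0; exact: (@fubini_tonelli1 _ _ _ _ _ m1 m2). Qed.

Lemma tonelli (F : T1 * T2 -> \bar R) : measurable_fun setT F ->
  (forall z, 0 <= F z)%E ->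
  (\int[m1]_x \int[m2]_y F (x, y) = \int[m2]_y \int[m1]_x F (x, y))%E.
Proof. by move=> mF F0; exact: (@fubini_tonelli _ _ _ _ _ m1 m2). Qed.

Lemma cintg_section f : cintg m12 f ->
  {ae m1, forall x, cintg m2 (fun y => f (x, y))}.
Proof.
move=> /cintgP[f1 f2].
have := ae_integrable1 f1; have := ae_integrable1 f2.
by apply: filterS2 => x h2 h1; exact/cintgP.
Qed.

(** A real integral is the finite part of an extended one and takes a default value on sections that
    are not integrable. Those sections form a null set, which is why the identification is almost
    everywhere. *)
Let Rfubini (h : T1 * T2 -> R) : m12.-integrable setT (EFin \o h) ->
  measurable_fun setT (fun x => \int[m2]_y h (x, y)) /\
  ({ae m1, forall x, (\int[m2]_y h (x, y))%:E =
     (\int[m2]_y (h (x, y))%:E)%E} /\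
  \int[m1]_x (\int[m2]_y h (x, y)) = \int[m12]_z h z).
Proof.
move=> hi; have mF := measurable_fubini_F hi.
have ae1 : {ae m1, forall x, (\int[m2]_y h (x, y))%:E =
     (\int[m2]_y (h (x, y))%:E)%E}.
  have := ae_integrable1 hi; apply: filterS => x hx.
  by rewrite /Rintegral fineK//; exact: integrable_fin_num.
have mG : measurable_fun setT (fun x => \int[m2]_y h (x, y)).
  by apply: (measurableT_comp _ mF); exact: fine_measurable.
split => //; split => //.
rewrite {1}/Rintegral {2}/Rintegral -(integral12_prod_meas1 hi).
congr fine; apply: ae_eq_integral => //.
- exact/measurable_EFinP.
- by apply: filterS ae1 => x + _.
Qed.

Lemma cfubini1 f : cintg m12 f ->
  [/\ cmeas (fun x => cint m2 (fun y => f (x, y))),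
    cintg m1 (fun x => cint m2 (fun y => f (x, y))) &
    cint m1 (fun x => cint m2 (fun y => f (x, y))) = cint m12 f].
Proof.
move=> fi; have /cintgP[f1 f2] := fi.
have [a1 [a2 a3]] := Rfubini f1.
have [b1 [b2 b3]] := Rfubini f2.
have mI : cmeas (fun x => cint m2 (fun y => f (x, y))) by [].
split => //.
  split => //; have := fi.2; rewrite tonelli1; last 2 first.
  - exact: cmeas_cmodE fi.1.
  - by move=> z; rewrite lee_fin cmod_ge0.
  apply: le_lt_trans; apply: ae_ge0_le_integral => //.
  - by move=> x _; rewrite lee_fin cmod_ge0.
  - exact: cmeas_cmodE.
  - by move=> x _; apply: integral_ge0 => y _; rewrite lee_fin cmod_ge0.
  - apply: (@measurable_fun_fubini_tonelli_F _ _ _ _ _ m2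
      (fun z => (cmod (f z))%:E)); first exact: cmeas_cmodE fi.1.
    by move=> z; rewrite lee_fin cmod_ge0.
  - by apply: filterS (cintg_section fi) => x /cmod_cint.
by apply: complex_eq; rewrite /= ?a3 ?b3.
Qed.

End CFubini.

Section CFubiniSwap.
Context d1 d2 (T1 : measurableType d1) (T2 : measurableType d2) (R : realType).
Variables (m1 : {sigma_finite_measure set T1 -> \bar R})
  (m2 : {sigma_finite_measure set T2 -> \bar R}).
Implicit Type f : T1 * T2 -> R[i].

Lemma measurable_swapT : measurable_fun setT (fun z : T2 * T1 => (z.2, z.1)).
Proof. by apply: measurable_fun_pair; exact: measurable_snd || exact: measurable_fst. Qed.

Lemma cintg_swap f : cintg (prod_measure m1 m2) f ->
  cintg (prod_measure m2 m1) (fun z => f (z.2, z.1)).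
Proof.
move=> fi; split; first exact: cmeas_comp measurable_swapT fi.1.
have := fi.2; rewrite !tonelli1.
- by rewrite (@tonelli _ _ _ _ _ m1 m2 (fun z => (cmod (f z))%:E))//;
    [exact: cmeas_cmodE fi.1 | move=> z; rewrite lee_fin cmod_ge0].
- by apply: cmeas_cmodE; exact: cmeas_comp measurable_swapT fi.1.
- by move=> z; rewrite lee_fin cmod_ge0.
- exact: cmeas_cmodE fi.1.
- by move=> z; rewrite lee_fin cmod_ge0.
Qed.

Lemma cint_swap f : cintg (prod_measure m1 m2) f ->
  cint m1 (fun x => cint m2 (fun y => f (x, y))) =
  cint m2 (fun y => cint m1 (fun x => f (x, y))).
Proof.
move=> fi; have /cintgP[f1 f2] := fi.
have [_ _ ->] := cfubini1 fi.
have [_ _ E] := cfubini1 (cintg_swap fi).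
rewrite /= in E; rewrite E; apply: complex_eq => /=.
  rewrite /Rintegral -(integral12_prod_meas1 f1) (Fubini f1).
  have /cintgP[g1 g2] := cintg_swap fi.
  by rewrite -(integral12_prod_meas1 g1).
rewrite /Rintegral -(integral12_prod_meas1 f2) (Fubini f2).
have /cintgP[g1 g2] := cintg_swap fi.
by rewrite -(integral12_prod_meas1 g2).
Qed.

End CFubiniSwap.

Section L2.
Context d (T : measurableType d) (R : realType).
Variable mu : {measure set T -> \bar R}.
Implicit Types (f g h : T -> R[i]).

Definition L2n f : \bar R := (\int[mu]_x (cmod (f x) ^+ 2)%:E)%E.
Definition nsq f : R := fine (L2n f).
Definition nrm f : R := Num.sqrt (nsq f).
Local Notation L2 := (cLspace mu 2%:E).
Local Notation inner := (inner mu).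

Lemma L2n_ge0 f : (0 <= L2n f)%E.
Proof. by apply: integral_ge0 => x _; rewrite lee_fin sqr_ge0. Qed.

Lemma cLnorm1E f : cLnorm mu 1%:E f = (\int[mu]_x (cmod (f x))%:E)%E.
Proof.
rewrite /cLnorm Lnorm1; apply: eq_integral => x _.
by rewrite gee0_abs// lee_fin cmod_ge0.
Qed.

Lemma L1P f : cLspace mu 1%:E f <-> cintg mu f.
Proof. by rewrite /cLspace /= cLnorm1E; split => [[? ? ?]|[[? ?] ?]]. Qed.

Lemma cLnorm2E f : cLnorm mu 2%:E f = (L2n f `^ 2^-1)%E.
Proof.
rewrite /cLnorm unlock /L2n; congr (_ `^ _)%E; apply: eq_integral => x _.
rewrite gee0_abs ?lee_fin ?cmod_ge0// poweR_EFin powR_mulrn ?cmod_ge0//.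
Qed.

Lemma L2P f : L2 f <-> cmeas f /\ (L2n f < +oo)%E.
Proof.
rewrite /cLspace /= cLnorm2E; split.
  move=> [m1 m2 fi]; split; first by [].
  by apply: lty_poweRy fi; rewrite invr_neq0// pnatr_eq0.
by move=> [[m1 m2] fi]; split => //; exact: poweR_lty.
Qed.

Lemma cmeas_sqr f : cmeas f ->
  measurable_fun setT (fun x => (cmod (f x) ^+ 2)%:E).
Proof.
by move=> mf; apply/measurable_EFinP; apply: measurable_funX; exact: cmeas_cmod.
Qed.

Lemma L2n_fin f : L2 f -> L2n f = (nsq f)%:E.
Proof. by move=> /L2P[_ fi]; rewrite fineK// ge0_fin_numE// L2n_ge0. Qed.

Lemma nsq_ge0 f : 0 <= nsq f.
Proof. by rewrite fine_ge0// L2n_ge0. Qed.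

Lemma nrm_ge0 f : 0 <= nrm f. Proof. exact: sqrtr_ge0. Qed.

Lemma nrm_sqr f : nrm f ^+ 2 = nsq f.
Proof. by rewrite sqr_sqrtr// nsq_ge0. Qed.

Lemma cLnorm2_nrm f : L2 f -> cLnorm mu 2%:E f = (nrm f)%:E.
Proof.
move=> fL; rewrite cLnorm2E L2n_fin// poweR_EFin /nrm.
by rewrite powR12_sqrt// nsq_ge0.
Qed.

Lemma L2Z c f : L2 f -> L2 (fun x => c * f x).
Proof.
move=> /L2P[mf fi]; apply/L2P; split.
  by apply: cmeasM => //; exact: cmeas_cst.
rewrite /L2n; under eq_integral do rewrite cmodM exprMn EFinM.
rewrite ge0_integralZl_EFin ?sqr_ge0//.
- by rewrite lte_mul_pinfty ?lee_fin ?sqr_ge0.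
- by move=> x _; rewrite lee_fin sqr_ge0.
- exact: cmeas_sqr.
Qed.

Lemma L2D f g : L2 f -> L2 g -> L2 (fun x => f x + g x).
Proof.
move=> /L2P[mf fi] /L2P[mg gi]; apply/L2P; split; first exact: cmeasD.
apply: (@le_lt_trans _ _
  (\int[mu]_x (2%:E * (cmod (f x) ^+ 2)%:E + 2%:E * (cmod (g x) ^+ 2)%:E)))%E.
  apply: ge0_le_integral_nomeas => x; first by rewrite lee_fin sqr_ge0.
  rewrite -!EFinM -EFinD lee_fin.
  apply: (@le_trans _ _ ((cmod (f x) + cmod (g x)) ^+ 2)).
    by rewrite ler_pXn2r ?nnegrE ?addr_ge0 ?cmod_ge0// cmodD.
  rewrite -subr_ge0.
  rewrite (_ : _ - _ = (cmod (f x) - cmod (g x)) ^+ 2) ?sqr_ge0//; ring.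
rewrite ge0_integralD//.
- rewrite !ge0_integralZl//; try exact: cmeas_sqr;
    try by move=> x _; rewrite lee_fin sqr_ge0.
  by apply: lte_add_pinfty; apply: lte_mul_pinfty => //; rewrite lee_fin.
- by move=> x _; rewrite mule_ge0 ?lee_fin ?sqr_ge0.
- by apply: emeasurable_funM => //; exact: cmeas_sqr.
- by move=> x _; rewrite mule_ge0 ?lee_fin ?sqr_ge0.
- by apply: emeasurable_funM => //; exact: cmeas_sqr.
Qed.

Lemma L2N f : L2 f -> L2 (fun x => - f x).
Proof.
by move=> /(L2Z (-1)); under eq_fun do rewrite mulN1r.
Qed.

Lemma L2B f g : L2 f -> L2 g -> L2 (fun x => f x - g x).
Proof. by move=> ? ?; apply: L2D => //; exact: L2N. Qed.

Lemma L2_0 : L2 (fun=> 0).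
Proof.
apply/L2P; split; first exact: cmeas_cst.
rewrite /L2n; under eq_integral do rewrite cmod0 expr0n/=.
by rewrite integral0.
Qed.

Lemma cintg_inner f g : L2 f -> L2 g -> cintg mu (fun x => f x * (g x)^*).
Proof.
move=> /L2P[mf fi] /L2P[mg gi].
apply: (@cintg_le _ _ _ _ _
  (fun x => (cmod (f x) ^+ 2)%:E + (cmod (g x) ^+ 2)%:E)%E).
- by apply: cmeasM => //; exact: cmeas_conj.
- move=> x; rewrite -EFinD lee_fin cmodM cmod_conj.
  have := sqr_ge0 (cmod (f x) - cmod (g x)).
  have := cmod_ge0 (f x); have := cmod_ge0 (g x); nra.
- rewrite ge0_integralD//.
  + exact: lte_add_pinfty.
  + by move=> x _; rewrite lee_fin sqr_ge0.
  + exact: cmeas_sqr.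
  + by move=> x _; rewrite lee_fin sqr_ge0.
  + exact: cmeas_sqr.
Qed.

Lemma innerDl f g h : L2 f -> L2 g -> L2 h ->
  inner (fun x => f x + g x) h = inner f h + inner g h.
Proof.
move=> fL gL hL; rewrite /inner -cintD; [|exact: cintg_inner..].
by congr cint; apply/funext => x; rewrite mulrDl.
Qed.

Lemma innerZl c f h : L2 f -> L2 h ->
  inner (fun x => c * f x) h = c * inner f h.
Proof.
move=> fL hL; rewrite /inner -cintZ; last exact: cintg_inner.
by congr cint; apply/funext => x; rewrite mulrA.
Qed.

Lemma inner_conj f g : L2 f -> L2 g -> inner g f = (inner f g)^*.
Proof.
move=> fL gL; rewrite /inner -cint_conj; last exact: cintg_inner.
by congr cint; apply/funext => x; rewrite rmorphM/= conjCK mulrC.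
Qed.

Lemma innerBl f g h : L2 f -> L2 g -> L2 h ->
  inner (fun x => f x - g x) h = inner f h - inner g h.
Proof.
move=> fL gL hL; rewrite innerDl//; last exact: L2N.
congr (_ + _); rewrite /inner -cintN; last exact: cintg_inner.
by congr cint; apply/funext => x; rewrite mulNr.
Qed.

Lemma innerDr f g h : L2 f -> L2 g -> L2 h ->
  inner h (fun x => f x + g x) = inner h f + inner h g.
Proof.
move=> fL gL hL.
by rewrite inner_conj// ?innerDl// ?rmorphD/= -?inner_conj//; exact: L2D.
Qed.

Lemma innerZr c f h : L2 f -> L2 h ->
  inner h (fun x => c * f x) = c^* * inner h f.
Proof.
move=> fL hL.
by rewrite inner_conj// ?innerZl// ?rmorphM/= -?inner_conj//; exact: L2Z.
Qed.

Lemma innerBr f g h : L2 f -> L2 g -> L2 h ->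
  inner h (fun x => f x - g x) = inner h f - inner h g.
Proof.
move=> fL gL hL.
by rewrite inner_conj// ?innerBl// ?rmorphB/= -?inner_conj//; exact: L2B.
Qed.

Lemma inner_self f : inner f f = (nsq f)%:C.
Proof.
rewrite /inner -[RHS]/((Rintegral mu setT (fun x => cmod (f x) ^+ 2))%:C).
by rewrite -cint_real; congr cint; apply/funext => x; rewrite mulr_conjc.
Qed.

(** The single quadratic expansion behind the Cauchy-Schwarz and triangle inequalities, the
    parallelogram law and the projection. *)
Lemma nsqB c f g : L2 f -> L2 g ->
  nsq (fun x => f x - c * g x) =
  nsq f - 2 * complex.Re (c^* * inner f g) + cmod c ^+ 2 * nsq g.
Proof.
move=> fL gL; have cgL := L2Z c gL; have fcgL := L2B fL cgL.
apply: (@complexI R); rewrite -inner_self innerBl// !innerBr//.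
rewrite innerZr// !innerZl// !innerZr// !inner_self.
rewrite (inner_conj fL gL); set I := inner f g.
rewrite mulrA mulr_conjc.
apply: complex_eq; rewrite ?(ReD, ImD, ReN, ImN, ReM, ImM, Reconj, Imconj) /=; ring.
Qed.

Lemma cauchy_schwarz f g : L2 f -> L2 g -> cmod (inner f g) <= nrm f * nrm g.
Proof.
move=> fL gL; set I := inner f g.
have key (t : R) : 0 <= nsq f - 2 * t * cmod I ^+ 2 + t ^+ 2 * cmod I ^+ 2 * nsq g.
  have := nsq_ge0 (fun x => f x - (t%:C * I) * g x).
  rewrite nsqB// -/I cmodM cmod_real exprMn real_normK ?num_real//.
  have -> : (t%:C * I)^* * I = (t * cmod I ^+ 2)%:C.
    by apply: complex_eq; rewrite !(ReM, ImM, Reconj, Imconj) sqr_cmod /=; ring.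
  by rewrite /= mulrA.
rewrite -(@ler_pXn2r _ 2) ?nnegrE ?mulr_ge0 ?cmod_ge0 ?nrm_ge0//.
rewrite exprMn !nrm_sqr.
have [g0|g0] := eqVneq (nsq g) 0.
  rewrite g0 mulr0 leNgt; apply/negP => I0.
  (* With [nsq g = 0] the expression is affine in t; this t makes it equal to -1. *)
  have := key ((nsq f + 1) / (2 * cmod I ^+ 2)).
  rewrite g0 mulr0 addr0; move: I0; set w := cmod I ^+ 2 => w0.
  rewrite (_ : 2 * _ * _ = nsq f + 1); last by field; rewrite gt_eqF.
  by rewrite opprD addNKr ler0N1.
have gp : 0 < nsq g by rewrite lt0r g0 nsq_ge0.
(* The minimizer of the quadratic in t. *)
have := key (nsq g)^-1.
rewrite (_ : _ + _ = nsq f - cmod I ^+ 2 / nsq g); last by field.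
by rewrite subr_ge0 ler_pdivrMr.
Qed.

Lemma le_nrmD f g : L2 f -> L2 g -> nrm (fun x => f x + g x) <= nrm f + nrm g.
Proof.
move=> fL gL.
rewrite -(@ler_pXn2r _ 2) ?nnegrE ?addr_ge0 ?nrm_ge0// nrm_sqr sqrrD !nrm_sqr.
have -> : nsq (fun x => f x + g x) = nsq (fun x => f x - (-1) * g x).
  by congr nsq; apply/funext => x; rewrite mulN1r opprK.
rewrite nsqB// cmodN cmod1 expr1n mul1r rmorphN rmorph1 mulN1r ReN mulrN opprK.
rewrite lerD2r lerD2l mulr_natl lerMn2r/=.
apply: le_trans (cauchy_schwarz fL gL).
by apply: le_trans (Re_le_cmod _); exact: ler_norm.
Qed.

Lemma nrmZ c f : L2 f -> nrm (fun x => c * f x) = cmod c * nrm f.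
Proof.
move=> fL; rewrite /nrm.
have -> : nsq (fun x => c * f x) = cmod c ^+ 2 * nsq f.
  apply: (@complexI R); rewrite -inner_self innerZl//; last exact: L2Z.
  by rewrite innerZr// inner_self mulrA mulr_conjc -rmorphM.
by rewrite sqrtrM ?sqr_ge0// sqrtr_sqr ger0_norm// cmod_ge0.
Qed.

Lemma nrm_distC f g : nrm (fun x => f x - g x) = nrm (fun x => g x - f x).
Proof.
rewrite /nrm /nsq /L2n; congr (Num.sqrt (fine _)).
by apply: eq_integral => x _; rewrite cmod_distC.
Qed.

Lemma le_nrm_dist h f g : L2 f -> L2 g -> L2 h ->
  nrm (fun x => f x - g x) <= nrm (fun x => f x - h x) + nrm (fun x => h x - g x).
Proof.
move=> fL gL hL; apply: le_trans (le_nrmD (L2B fL hL) (L2B hL gL)).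
rewrite le_eqVlt; apply/orP; left; apply/eqP.
by congr nrm; apply/funext => x; rewrite addrA subrK.
Qed.

Lemma inner_ae f g h : ceq_ae mu f g -> L2 f -> L2 g -> L2 h ->
  inner f h = inner g h.
Proof.
move=> fg fL gL hL; apply: (cint_ae _ _ _).2.
- exact: cintg_inner.
- exact: (cintg_inner gL hL).1.
- by apply: filterS fg => x /= ->.
Qed.

Lemma nsq0_ae f : L2 f -> nsq f = 0 -> ceq_ae mu f (fun=> 0).
Proof.
move=> fL f0; have [mf _] := (L2P f).1 fL.
have : (\int[mu]_x `|(cmod (f x) ^+ 2)%:E| = 0)%E.
  transitivity (L2n f); last by rewrite L2n_fin// f0.
  by apply: eq_integral => x _; rewrite gee0_abs// lee_fin sqr_ge0.
move=> /(ae_eq_integral_abs mu measurableT (cmeas_sqr mf)).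
apply: filterS => x /= /(_ I) [] /eqP; rewrite sqrf_eq0 cmod_eq0.
by move/eqP.
Qed.

(** Cauchy-Schwarz applied to the moduli of f and g. Absolute integrability, needed before Fubini,
    asks for this form with the modulus inside the integral. *)
Lemma integral_cmodM f g : L2 f -> L2 g ->
  (\int[mu]_x (cmod (f x) * cmod (g x))%:E <= (nrm f * nrm g)%:E)%E.
Proof.
move=> fL gL.
pose a h := fun x => (cmod (h x))%:C : R[i].
have aL h : L2 h -> L2 (a h) /\ nrm (a h) = nrm h.
  move=> /L2P[mh hi]; have e : L2n (a h) = L2n h.
    apply: eq_integral => x _.
    by rewrite /a cmod_real ger0_norm ?cmod_ge0.
  split; last by rewrite /nrm /nsq e.
  apply/L2P; split; last by rewrite e.
  by apply: cmeas_real; exact: cmeas_cmod.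
have [afL <-] := aL _ fL; have [agL <-] := aL _ gL.
have := cauchy_schwarz afL agL; rewrite -lee_fin; apply: le_trans.
have E : inner (a f) (a g) = (Rintegral mu setT (fun x => cmod (f x) * cmod (g x)))%:C.
  rewrite -cint_real; congr cint; apply/funext => x.
  by rewrite /a conj_realc -rmorphM.
rewrite E cmod_real ger0_norm; last first.
  by apply: Rintegral_ge0 => x _; rewrite mulr_ge0 ?cmod_ge0.
rewrite fineK// ge0_fin_numE; last first.
  by apply: integral_ge0 => x _; rewrite lee_fin mulr_ge0 ?cmod_ge0.
have [_] := cintg_inner fL gL.
by under eq_integral do rewrite cmodM cmod_conj.
Qed.

End L2.

Lemma limn_einf_ub (R : realType) (u : (\bar R)^nat) (M : \bar R) :
  (forall n, u n <= M)%E -> (limn_einf u <= M)%E.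
Proof.
move=> h; rewrite limn_einf_lim; apply: lime_le; first exact: is_cvg_einfs.
apply: nearW => n; apply: le_trans (h n); apply: ereal_inf_lbound.
by exists n => //=.
Qed.

(** * Completeness of L^2 along fast sequences, and orthogonal projection *)

Section RieszFischer.
Context d (T : measurableType d) (R : realType).
Variable mu : {measure set T -> \bar R}.
Local Notation L2 := (cLspace mu 2%:E).

Lemma geometric_steps_cvg (u : nat -> R) (C : R) :
  (forall n, `|u n.+1 - u n| <= C * (2^-1) ^+ n) -> cvgn u.
Proof.
move=> h.
have cg : cvgn (series (fun n => C * (2^-1 : R) ^+ n)).
  apply: (@is_cvg_geometric_series R C 2^-1).
  by rewrite ger0_norm ?invr_ge0// invf_lt1// ltr1n.
have cn : cvgn [normed series (fun n => u n.+1 - u n)].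
  by apply: (series_le_cvg _ _ _ cg) => n //=; exact: le_trans (h n).
have cs : cvgn (series (fun n => u n.+1 - u n)) by exact: normed_cvg.
have -> : u = (fun n => u 0%N + series (fun n => u n.+1 - u n) n).
  by apply/funext => n; rewrite seriesEnat/= telescope_sumr// addrC subrK.
by apply: is_cvgD => //; exact: is_cvg_cst.
Qed.

(** The square of [2 ^+ n * D n] is at most W, and x^2 <= W implies x <= W + 1, which avoids a
    square root. *)
Lemma cmod_lt_geo (D : nat -> R) (W : R) : (forall n, 0 <= D n) ->
  (forall n, 4 ^+ n * D n ^+ 2 <= W) ->
  forall n, D n <= (W + 1) * (2^-1) ^+ n.
Proof.
move=> D0 DW n.
have W0 : 0 <= W by apply: le_trans (DW 0%N); rewrite mulr_ge0 ?exprn_ge0 ?sqr_ge0.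
rewrite exprVn ler_pdivlMr ?exprn_gt0//.
have e : (D n * 2 ^+ n) ^+ 2 <= W.
  apply: le_trans (DW n); rewrite exprMn mulrC -exprM mulnC exprM.
  by rewrite expr2 -natrM.
have x0 : 0 <= D n * 2 ^+ n by rewrite mulr_ge0// exprn_ge0.
rewrite leNgt; apply/negP => lt; move: e; apply/negP; rewrite -ltNge.
move: x0 lt; set x := D n * _ => x0 lt.
nra.
Qed.

(** The sum W of 4^n |s_(n+1) - s_n|^2 has integral at most the sum of 4^n 16^-n, so it is finite
    almost everywhere. There the increments are O(2^-n) and the sequence converges pointwise;
    Fatou's lemma turns this into convergence in norm. *)
Lemma riesz_fischer (s : nat -> T -> R[i]) :
  (forall n, L2 (s n)) ->
  (forall n, nsq mu (fun x => s n.+1 x - s n x) <= (16^-1) ^+ n) ->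
  exists2 f, L2 f & (fun n => nrm mu (fun x => s n x - f x)) @ \oo --> 0.
Proof.
move=> sL hs.
pose D n x : R := cmod (s n.+1 x - s n x).
have sm n : cmeas (s n) by have /L2P[] := sL n.
have mD n : measurable_fun setT (fun x => (4 ^+ n * D n x ^+ 2)%:E).
  apply/measurable_EFinP; apply: measurable_funM => //.
  by apply: measurable_funX; apply: cmeas_cmod; exact: cmeasB.
pose W x : \bar R := (\sum_(n <oo) (4 ^+ n * D n x ^+ 2)%:E)%E.
have W0 n x : (0 <= (4 ^+ n * D n x ^+ 2)%:E)%E.
  by rewrite lee_fin; apply: mulr_ge0; rewrite ?sqr_ge0 ?exprn_ge0.
have iW : (\int[mu]_x W x < +oo)%E.
  rewrite integral_nneseries//.
  apply: (@le_lt_trans _ _ (\sum_(n <oo) ((4^-1 : R) ^+ n)%:E)%E).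
    apply: lee_nneseries => n _.
      by rewrite integral_ge0// => x _; rewrite W0.
    under eq_integral do rewrite EFinM.
    rewrite ge0_integralZl_EFin ?exprn_ge0//; last 2 first.
    - by move=> x _; rewrite lee_fin sqr_ge0.
    - by apply: cmeas_sqr; exact: cmeasB.
    have := L2n_fin (L2B (sL n.+1) (sL n)); rewrite /L2n => ->.
    rewrite -EFinM lee_fin.
    apply: le_trans (ler_wpM2l _ (hs n)) _; first by rewrite exprn_ge0.
    by rewrite -exprMn (_ : 4 * 16^-1 = 4^-1 :> R)//; field.
  have cg : cvgn (series (fun n => (4^-1 : R) ^+ n)).
    have := @is_cvg_geometric_series R 1 4^-1.
    rewrite (_ : geometric 1 4^-1 = (fun n => (4^-1 : R) ^+ n)); last first.
      by apply/funext => n; rewrite /geometric/= mul1r.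
    by apply; rewrite ger0_norm ?invr_ge0// invf_lt1// ltr1n.
  rewrite (_ : (\sum_(n <oo) _)%E = (limn (series (fun n => (4^-1 : R) ^+ n)))%:E) ?ltry//.
  rewrite -EFin_lim//; congr (limn _); apply/funext => n /=.
  by rewrite seriesEnat/= sumEFin.
have W00 x : (0 <= W x)%E by apply: nneseries_ge0 => n _ _; exact: W0.
have mW : measurable_fun setT W.
  by apply: ge0_emeasurable_sum => // n x _ _; exact: W0.
have aeW : {ae mu, forall x, W x \is a fin_num}.
  have : mu.-integrable setT W.
    apply/integrableP; split => //.
    by under eq_integral do rewrite gee0_abs//.
  by move=> /(integrable_ae measurableT); apply: filterS => x; exact.
have DW x n : W x \is a fin_num -> 4 ^+ n * D n x ^+ 2 <= fine (W x).
  move=> Wf; rewrite -lee_fin fineK//.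
  apply: le_trans (nneseries_lim_ge n.+1 _) => //.
  by rewrite big_nat_recr//= leeDr// sume_ge0.
(* An upper limit is measurable and defined at every point, also where the sequence diverges. *)
pose Lr x := fine (limn_esup (fun n => (complex.Re (s n x))%:E)).
pose Li x := fine (limn_esup (fun n => (complex.Im (s n x))%:E)).
pose f x : R[i] := Lr x +i* Li x.
have mf : cmeas f.
  split => /=.
    apply: (measurableT_comp (fine_measurable measurableT)).
    by apply: measurable_fun_limn_esup => n; apply/measurable_EFinP; exact: (sm n).1.
  apply: (measurableT_comp (fine_measurable measurableT)).
  by apply: measurable_fun_limn_esup => n; apply/measurable_EFinP; exact: (sm n).2.
have cvgR x : W x \is a fin_num ->
  (fun n => complex.Re (s n x)) @ \oo --> complex.Re (f x) /\
  (fun n => complex.Im (s n x)) @ \oo --> complex.Im (f x).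
  move=> Wf.
  have Dg := cmod_lt_geo (fun n => cmod_ge0 (s n.+1 x - s n x)) (fun n => DW x n Wf).
  have fcvg (u : nat -> R) : cvgn u ->
      u @ \oo --> fine (limn_esup (fun n => (u n)%:E)).
    move=> cu; have ce : (fun n => (u n)%:E) @ \oo --> (limn u)%:E.
      by apply: cvg_EFin => //; exact: nearW.
    by rewrite (cvg_limn_einf_sup ce).2.
  split; apply: fcvg; apply: geometric_steps_cvg => n.
    by apply: le_trans (Dg n); rewrite -ReN -ReD Re_le_cmod.
  by apply: le_trans (Dg n); rewrite -ImN -ImD Im_le_cmod.
have step m k : nrm mu (fun x => s (m + k)%N x - s m x) <=
    \sum_(i < k) (4^-1) ^+ (m + i).
  elim: k => [|k ih].
    rewrite big_ord0 addn0.
    rewrite (_ : (fun x => _) = (fun=> 0)); last by apply/funext => x; rewrite subrr.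
    by rewrite /nrm /nsq /L2n; under eq_integral do rewrite cmod0 expr0n/=;
      rewrite integral0/= sqrtr0.
  rewrite big_ord_recr/= addnS.
  apply: le_trans (le_nrm_dist (sL _) (sL _) (sL (m + k)%N)) _.
  rewrite addrC lerD//.
  rewrite -(@ler_pXn2r _ 2) ?nnegrE ?nrm_ge0 ?exprn_ge0 ?invr_ge0//.
  rewrite nrm_sqr -exprM mulnC exprM (le_trans (hs _))//.
  by rewrite expr2 -invfM -natrM.
have geo m k : \sum_(i < k) (4^-1 : R) ^+ (m + i) <= 2 * (4^-1) ^+ m.
  rewrite (_ : \sum_(i < k) _ = (4^-1) ^+ m * \sum_(i < k) (4^-1 : R) ^+ i); last first.
    by rewrite mulr_sumr; apply: eq_bigr => i _; rewrite exprD.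
  rewrite mulrC ler_wpM2r ?exprn_ge0 ?invr_ge0//.
  have : (1 - 4^-1 : R) * (\sum_(i < k) (4^-1 : R) ^+ i) <= 1.
    rewrite -opprB mulNr -subrX1 opprB lerBlDr lerDl.
    by rewrite exprn_ge0 ?invr_ge0.
  lra.
(* Fatou for n to infinity in |s_m - s_(m+n)|^2; the bound is the sum of the geometric steps from m
   on. *)
have fat m : (L2n mu (fun x => s m x - f x)%R <= ((2 * (4^-1) ^+ m) ^+ 2)%:E)%E.
  have cv : {ae mu, forall x, limn_einf (fun n => (cmod (s m x - s (m + n)%N x) ^+ 2)%:E)
       = (cmod (s m x - f x) ^+ 2)%:E}.
    apply: filterS aeW => x /cvgR[c1 c2].
    have ce : (fun n => (cmod (s m x - s (m + n)%N x) ^+ 2)%:E) @ \oo -->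
       (cmod (s m x - f x) ^+ 2)%:E.
      apply: cvg_EFin; first exact: nearW.
      rewrite (_ : _ \o _ = (fun n => (complex.Re (s m x) - complex.Re (s (m + n)%N x)) ^+ 2 +
         (complex.Im (s m x) - complex.Im (s (m + n)%N x)) ^+ 2)); last first.
        by apply/funext => n /=; rewrite sqr_cmod !(ReD, ImD, ReN, ImN).
      rewrite sqr_cmod !(ReD, ImD, ReN, ImN).
      have sh (u : nat -> R) (l : R) : u @ \oo --> l -> (fun n => u (m + n)%N) @ \oo --> l.
        rewrite -(cvg_shiftn m) => ul.
        rewrite (_ : (fun n => u (m + n)%N) = (fun n => u (n + m)%N))//.
        by apply/funext => k; rewrite addnC.
      rewrite !expr2; under eq_cvg do rewrite !expr2.
      have b1 : (fun n => complex.Re (s m x) - complex.Re (s (m + n)%N x)) @ \oo -->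
          complex.Re (s m x) - complex.Re (f x).
        by apply: cvgB; [exact: cvg_cst | exact: (sh (fun n => complex.Re (s n x)))].
      have b2 : (fun n => complex.Im (s m x) - complex.Im (s (m + n)%N x)) @ \oo -->
          complex.Im (s m x) - complex.Im (f x).
        by apply: cvgB; [exact: cvg_cst | exact: (sh (fun n => complex.Im (s n x)))].
      by apply: cvgD; apply: cvgM.
    by rewrite (cvg_limn_einf_sup ce).1.
  have mm n : measurable_fun setT (fun x => (cmod (s m x - s (m + n)%N x) ^+ 2)%:E).
    by apply: cmeas_sqr; exact: cmeasB.
  have mE : measurable_fun setT
      (fun x => limn_einf (fun n => (cmod (s m x - s (m + n)%N x) ^+ 2)%:E)).
    rewrite (_ : (fun x => limn_einf _) = (fun x => - limn_esup (fun n =>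
      - (cmod (s m x - s (m + n)%N x) ^+ 2)%:E))%E)//.
    apply: measurableT_comp => //; apply: measurable_fun_limn_esup => n.
    exact: measurableT_comp.
  have mS : measurable_fun setT (fun x => (cmod (s m x - f x) ^+ 2)%:E).
    by apply: cmeas_sqr; exact: cmeasB.
  have := fatou mu measurableT mm (fun n x _ => _).
  have <- : (\int[mu]_x limn_einf (fun n => (cmod (s m x - s (m + n)%N x) ^+ 2)%:E) =
      L2n mu (fun x => s m x - f x)%R)%E.
    by apply: ae_eq_integral => //; apply: filterS cv => x /= ->.
  move=> /(_ _)/le_trans; apply.
    by move=> n x; rewrite lee_fin sqr_ge0.
  apply: limn_einf_ub => n.
  rewrite -/(L2n mu (fun x => s m x - s (m + n)%N x)) L2n_fin; last exact: L2B.
  rewrite lee_fin -nrm_sqr ler_pXn2r ?nnegrE ?nrm_ge0 ?mulr_ge0 ?exprn_ge0 ?invr_ge0//.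
  by rewrite nrm_distC (le_trans (step m n)).
have fL : L2 f.
  have h0 : L2 (fun x => s 0%N x - f x).
    by apply/L2P; split; [exact: cmeasB | exact: le_lt_trans (fat 0%N) (ltry _)].
  have := L2B (sL 0%N) h0.
  by rewrite (_ : (fun x => _) = f)//; apply/funext => x; rewrite opprB addrC subrK.
exists f => //.
apply: (@squeeze_cvgr _ _ _ _ (fun=> 0) (fun n => 2 * (4^-1) ^+ n)).
- apply: nearW => n; rewrite nrm_ge0/= -(@ler_pXn2r _ 2) ?nnegrE ?nrm_ge0 ?mulr_ge0 ?exprn_ge0 ?invr_ge0//.
  by rewrite nrm_sqr -lee_fin -L2n_fin//; exact: L2B.
- exact: cvg_cst.
- rewrite -(mulr0 2); apply: cvgM; first exact: cvg_cst.
  by apply: cvg_expr; rewrite ger0_norm ?invr_ge0// invf_lt1// ltr1n.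
Qed.

End RieszFischer.

Lemma lim_le_cst (R : realType) (u : nat -> R) (l M : R) :
  u @ \oo --> l -> (forall n, u n <= M) -> l <= M.
Proof.
move=> ul h; rewrite -(cvg_lim _ ul)//; apply: limr_le; last exact: nearW.
by apply/cvg_ex; exists l.
Qed.

Lemma lim_ge_cst (R : realType) (u : nat -> R) (l M : R) :
  u @ \oo --> l -> (forall n, M <= u n) -> M <= l.
Proof.
move=> ul h; rewrite -(cvg_lim _ ul)//; apply: limr_ge; last exact: nearW.
by apply/cvg_ex; exists l.
Qed.

Section Projection.
Context d (T : measurableType d) (R : realType).
Variable mu : {measure set T -> \bar R}.
Local Notation L2 := (cLspace mu 2%:E).
Local Notation nrm := (nrm mu).
Local Notation nsq := (nsq mu).

Lemma parallelogram f g : L2 f -> L2 g ->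
  nsq (fun x => f x + g x) + nsq (fun x => f x - g x) = 2 * nsq f + 2 * nsq g.
Proof.
move=> fL gL.
have -> : nsq (fun x => f x + g x) = nsq (fun x => f x - (-1) * g x).
  by congr nsq; apply/funext => x; rewrite mulN1r opprK.
have -> : nsq (fun x => f x - g x) = nsq (fun x => f x - 1 * g x).
  by congr nsq; apply/funext => x; rewrite mul1r.
rewrite !nsqB// !(ReM, ReN, ImN, Reconj, Imconj) cmodN cmod1 /=; ring.
Qed.

Variable V : set (T -> R[i]).
Hypothesis VL2 : forall v, V v -> L2 v.
Hypothesis V0 : V (fun=> 0).
Hypothesis VDZ : forall c u v, V u -> V v -> V (fun x => c * u x + v x).

(** V need not be closed: the projection is produced as an L^2 limit of elements of V, and the
    approximating sequence is returned because later arguments act on it. *)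
Lemma projection h : L2 h -> exists s : nat -> T -> R[i], exists2 Ph,
  [/\ forall n, V (s n), L2 Ph & (fun n => nrm (fun x => s n x - Ph x)) @ \oo --> 0] &
  forall v, V v -> inner mu (fun x => h x - Ph x) v = 0.
Proof.
move=> hL.
have VZ c v : V v -> V (fun x => c * v x).
  move=> Vv; have := VDZ c Vv V0.
  by under eq_fun do rewrite addr0.
pose S := [set nsq (fun x => h x - v x) | v in V].
have S0 : has_inf S.
  split; first by exists (nsq (fun x => h x - 0)), (fun=> 0).
  by exists 0 => _ [v _ <-]; exact: nsq_ge0.
pose dl := inf S.
have dlP v : V v -> dl <= nsq (fun x => h x - v x).
  by move=> Vv; apply: ge_inf; [exact: S0.2 | exists v].
have dl0 : 0 <= dl by apply: lb_le_inf S0.1 _ => _ [v _ <-]; exact: nsq_ge0.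
(* The tolerance is chosen so that the parallelogram law yields squared increments of at most 16^-n,
   as [riesz_fischer] requires. *)
have ex n : exists v, V v /\ nsq (fun x => h x - v x) < dl + 4^-1 * (16^-1) ^+ n.
  have e0 : 0 < 4^-1 * (16^-1) ^+ n :> R by rewrite mulr_gt0// ?exprn_gt0// invr_gt0.
  have [_ [v Vv <-] lt] := inf_adherent e0 S0.
  by exists v.
pose s n := projT1 (cid (ex n)).
have [Vs hs] : (forall n, V (s n)) /\
    forall n, nsq (fun x => h x - s n x) < dl + 4^-1 * (16^-1) ^+ n.
  by split => n; rewrite /s; case: cid => v [].
have sL n := VL2 (Vs n).
have step n : nsq (fun x => s n.+1 x - s n x) <= (16^-1) ^+ n.
  have Vm : V (fun x => 2^-1 * s n x + 2^-1 * s n.+1 x) by apply: VDZ => //; exact: VZ.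
  have := parallelogram (L2B hL (sL n)) (L2B hL (sL n.+1)).
  have -> : nsq (fun x => (h x - s n x) + (h x - s n.+1 x)) =
      4 * nsq (fun x => h x - (2^-1 * s n x + 2^-1 * s n.+1 x)).
    have e4 : 4 = 2 ^+ 2 :> R by rewrite -natrX.
    rewrite -!nrm_sqr e4 -exprMn; congr (_ ^+ 2).
    have -> : 2 = cmod (2 : R[i]).
      by rewrite -(rmorph_nat (real_complex R) 2) cmod_real ger0_norm.
    rewrite -nrmZ; last by apply: L2B => //; exact: VL2.
    congr nrm; apply/funext => x.
    have t2 : (2 : R[i]) != 0 by rewrite pnatr_eq0.
    by field.
  have -> : nsq (fun x => h x - s n x - (h x - s n.+1 x)) =
      nsq (fun x => s n.+1 x - s n x).
    by congr nsq; apply/funext => x; ring.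
  have := dlP _ Vm; have := hs n; have := hs n.+1.
  have : (16^-1) ^+ n.+1 <= (16^-1 : R) ^+ n.
    by rewrite exprS ler_piMl ?exprn_ge0 ?invr_ge0// invf_le1// ler1n.
  move: (nsq _) (nsq _) (nsq _) (nsq _) => A B C D.
  set p := _ ^+ n.+1; set q := _ ^+ n; lra.
have [Ph PhL cv] := riesz_fischer sL step.
exists s, Ph => // v Vv; have vL := VL2 Vv.
set I := inner mu _ _; pose hP x := h x - Ph x.
have hPL : L2 hP by exact: L2B.
(* [Ph + c v] is a limit of the elements [c v + s n] of V, so its distance to h is at least the
   infimum. *)
have lo c : dl <= nsq (fun x => hP x - c * v x).
  rewrite -nrm_sqr -(sqr_sqrtr dl0) ler_pXn2r ?nnegrE ?nrm_ge0 ?sqrtr_ge0//.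
  have k n : Num.sqrt dl - nrm (fun x => s n x - Ph x) <= nrm (fun x => hP x - c * v x).
    rewrite lerBlDr; have Vn := VDZ c Vv (Vs n).
    have := dlP _ Vn; rewrite -nrm_sqr => d1.
    have : Num.sqrt dl <= nrm (fun x => h x - (c * v x + s n x)).
      by rewrite -(ger0_norm (nrm_ge0 mu _)) -sqrtr_sqr ler_wsqrtr.
    move=> /le_trans; apply.
    have := le_nrm_dist hL (VL2 Vn) (L2D PhL (L2Z c vL)) => /le_trans; apply.
    rewrite lerD//.
      rewrite le_eqVlt; apply/orP; left; apply/eqP; congr nrm.
      by apply/funext => x; rewrite /hP; ring.
    rewrite le_eqVlt nrm_distC; apply/orP; left; apply/eqP; congr nrm.
    by apply/funext => x; ring.
  apply: (lim_le_cst _ k); rewrite -[X in _ --> X]subr0.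
  by apply: cvgB => //; exact: cvg_cst.
have hi : nsq hP <= dl.
  have k n : nrm hP <= Num.sqrt (dl + 4^-1 * (16^-1) ^+ n) + nrm (fun x => s n x - Ph x).
    apply: le_trans (le_nrm_dist hL PhL (sL n)) _; rewrite lerD2r.
    by rewrite /nrm ler_wsqrtr// ltW.
  have cv2 : (fun n => Num.sqrt (dl + 4^-1 * (16^-1) ^+ n) + nrm (fun x => s n x - Ph x))
      @ \oo --> Num.sqrt dl.
    rewrite -[X in _ --> X]addr0; apply: cvgD => //.
    have c3 : (fun n => dl + 4^-1 * (16^-1) ^+ n) @ \oo --> dl.
      rewrite -[X in _ --> X]addr0; apply: cvgD; first exact: cvg_cst.
      rewrite -(mulr0 4^-1); apply: cvgM; first exact: cvg_cst.
      by apply: cvg_expr; rewrite ger0_norm ?invr_ge0// invf_lt1// ltr1n.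
    exact: (continuous_cvg _ (@sqrt_continuous R dl) c3).
  rewrite -nrm_sqr -(sqr_sqrtr dl0) ler_pXn2r ?nnegrE ?nrm_ge0 ?sqrtr_ge0//.
  exact: lim_ge_cst cv2 k.
have key (t : R) : 0 <= t -> 2 * t * cmod I ^+ 2 <= t ^+ 2 * (cmod I ^+ 2 * nsq v).
  move=> t0; have := lo (t%:C * I); rewrite nsqB// -/I cmodM cmod_real exprMn.
  rewrite real_normK ?num_real//.
  have -> : (t%:C * I)^* * I = (t * cmod I ^+ 2)%:C.
    by apply: complex_eq; rewrite !(ReM, ImM, Reconj, Imconj) sqr_cmod /=; ring.
  rewrite /=; move: hi; move: (nsq hP) (cmod I ^+ 2) (nsq v) => a b c hi h1.
  have -> : t ^+ 2 * (b * c) = t ^+ 2 * b * c by ring.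
  lra.
apply/eqP; rewrite -cmod_eq0 -sqrf_eq0 eq_le sqr_ge0 andbT.
move: (sqr_ge0 (cmod I)) (nsq_ge0 mu v) key; move: (cmod I ^+ 2) (nsq v) => b c b0 c0 key.
(* Any t with 0 < t and t c < 2 forces b = 0; this one is defined for c = 0 as well. *)
have := key (c + 1)^-1; rewrite invr_ge0 addr_ge0// => /(_ isT) h1.
have c1 : 0 < c + 1 by rewrite ltr_wpDl.
have : (c + 1) ^+ 2 * (2 * (c + 1)^-1 * b) <= (c + 1) ^+ 2 * ((c + 1)^-1 ^+ 2 * (b * c)).
  by rewrite ler_wpM2l// sqr_ge0.
have -> : (c + 1) ^+ 2 * (2 * (c + 1)^-1 * b) = 2 * (c + 1) * b by field; rewrite gt_eqF.
have -> : (c + 1) ^+ 2 * ((c + 1)^-1 ^+ 2 * (b * c)) = b * c by field; rewrite gt_eqF.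
nra.
Qed.

End Projection.

(** * Groups with a Gaussian *)

Section SecondCountable.
Context {T : topologicalType}.

Lemma second_countable_seq : @second_countable T ->
  exists2 b : nat -> set T, (forall n, open (b n)) &
    forall (x : T) (U : set T), nbhs x U -> exists2 n, b n x & b n `<=` U.
Proof.
move=> [B cB [Bo Bb]].
have [B0|[f]] : B = set0 \/ $|{surjfun [set: nat] >-> B}| by exact/pfcard_geP.
  exists (fun=> set0) => [n|x U xU]; first exact: open0.
  have [V [BV _] _] := Bb x U xU.
  by move: BV; rewrite B0.
exists f => [n|x U xU]; first by apply: Bo; exact: (@funS _ _ _ _ f n I).
have [V [BV Vx] VU] := Bb x U xU.
have [n _ fn] := @surj _ _ _ _ f V BV.
by exists n; rewrite fn.
Qed.

Lemma second_countable_of_seq (b : nat -> set T) : (forall n, open (b n)) ->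
  (forall (x : T) (U : set T), nbhs x U -> exists2 n, b n x & b n `<=` U) ->
  @second_countable T.
Proof.
move=> bo bb; exists (range b).
  by apply: card_le_trans (card_image_le _ _) _; exact: countableP.
split => [_ [n _ <-]//|x U xU].
have [n bx bU] := bb x U xU.
by exists (b n) => //; split => //; exists n.
Qed.

(** A basic set contained in some [U z] selects one such z. The countable cover yields the step
    functions behind the Riemann sums of [lin_reproducing]. *)
Lemma lindelof (x0 : T) (U : T -> set T) : @second_countable T ->
  (forall x, nbhs x (U x)) ->
  exists s : nat -> T, forall x, exists j, U (s j) x.
Proof.
move=> /second_countable_seq[b bo bb] Ux.
pose s j := if pselect (exists z, b j `<=` U z) is left e then projT1 (cid e) else x0.
exists s => x; have [j bx bU] := bb x (U x) (Ux x).
exists j; rewrite /s; case: pselect => [e|]; last by case; exists x.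
by case: cid => z /= bz; exact: bz.
Qed.

End SecondCountable.

Lemma second_countable_prod (T1 T2 : topologicalType) :
  @second_countable T1 -> @second_countable T2 ->
  @second_countable (T1 * T2)%type.
Proof.
move=> /second_countable_seq[b bo bb] /second_countable_seq[c co cc].
pose bc n : set (T1 * T2) := let: (i, j) := odflt (0%N, 0%N) (unpickle n) in b i `*` c j.
apply: (@second_countable_of_seq _ bc) => [n|[x y] U [[V W] /= [xV yW] VWU]].
  rewrite /bc; case: (odflt _ _) => i j; rewrite openE => -[x y] [/= bx cy].
  by exists (b i, c j) => //=; split; apply: open_nbhs_nbhs; split.
have [i bx bV] := bb _ _ xV; have [j cy cW] := cc _ _ yW.
exists (pickle (i, j)); rewrite /bc pickleK//= => -[u v] [/= bu cv].
by apply: VWU; split; [exact: bV | exact: cW].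
Qed.

Section Std.
Context (R : realType).

(** Second countability is included so that the notion passes to products, where the sigma-algebra
    is generated by rectangles and must still contain every open set. *)
Definition std d (T : measTopType d) := @second_countable T /\
  forall U : set T, open U -> measurable U.

Lemma std_prod d1 d2 (T1 : measTopType d1) (T2 : measTopType d2) :
  std T1 -> std T2 -> std (T1 * T2)%type.
Proof.
move=> [s1 m1] [s2 m2]; split; first exact: (second_countable_prod s1 s2).
move=> U Uo.
have [b bo bb] := second_countable_seq s1.
have [c co cc] := second_countable_seq s2.
have -> : U = \bigcup_i \bigcup_(j in [set j | b i `*` c j `<=` U]) (b i `*` c j).
  apply/seteqP; split => [[x y] Uxy|z [i _ [j ij bc]]]; last exact: ij.
  have : nbhs (x, y) U by exact: open_nbhs_nbhs.
  move=> [[V W] /= [xV yW] VWU].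
  have [i bx bV] := bb _ _ xV; have [j cy cW] := cc _ _ yW.
  exists i => //; exists j => //= -[u v] [/= bu cv].
  by apply: VWU; split; [exact: bV | exact: cW].
apply: bigcup_measurable => i _.
apply: bigcup_measurable => j _; apply: measurableX; [exact: m1 | exact: m2].
Qed.

Section std_meas.
Context d (T : measTopType d).
Hypothesis sT : std T.

Lemma std_continuous_fun d2 (T2 : measTopType d2) (f : T -> T2) : std T2 ->
  (forall U : set T2, measurable U = <<s @open T2 >> U) ->
  continuous f -> measurable_fun setT f.
Proof.
move=> s2 m2 cf; apply: (@measurability _ _ _ _ setT f (@open T2)).
  by apply/seteqP; split => U; rewrite m2.
move=> _ [U Uo <-]; rewrite setTI; apply: sT.2.
by apply: open_comp => // x _; exact: cf.
Qed.

(** Used for local suprema over uncountable sets: superlevel sets of a supremum are unions of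
    superlevel sets, so openness survives where a direct measurability argument would fail. *)
Lemma lsc_measurable (F : T -> \bar R) :
  (forall r : R, open [set x | (r%:E < F x)%E]) -> measurable_fun setT F.
Proof.
move=> oF; apply: (measurability _ (ErealGenOInfty.measurableE R)).
move=> /= _ [_ [a ->]] <-; apply: measurableI => //; apply: sT.2.
by rewrite preimage_itvoy; exact: oF.
Qed.

Lemma cont_measurable (f : T -> R) : continuous f -> measurable_fun setT f.
Proof.
move=> cf; apply/measurable_EFinP; apply: lsc_measurable => r.
rewrite (_ : [set x | _] = f @^-1` [set y | r < y]).
  by apply: open_comp => [x _|]; [exact: cf | exact: open_gt].
by apply/seteqP; split => x /=; rewrite lte_fin.
Qed.

End std_meas.

Lemma std_continuous_comp d1 d2 (T : measTopType d1) (T2 : measTopType d2)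
    (f : T -> T2) (F : T2 -> \bar R) : std T ->
  continuous f -> (forall r : R, open [set x | (r%:E < F x)%E]) ->
  measurable_fun setT (F \o f).
Proof.
move=> sT cf oF; apply: (lsc_measurable sT) => r.
rewrite (_ : [set x | _] = f @^-1` [set y | (r%:E < F y)%E])//.
by apply: open_comp => // x _; exact: cf.
Qed.

End Std.

(* A group together with a topology and a sigma-algebra on the same carrier. The
   group law is kept apart because the types [borel G] and [borel G * borel Gd]
   carry no canonical Zmodule structure. *)
Record tgroup := TGroup {
  tg_zmod :> zmodType;
  tg_disp : measure_display;
  tg_class : MeasTop.axioms_ tg_disp tg_zmod }.

Definition mt (A : tgroup) : measTopType (tg_disp A) := MeasTop.Pack (tg_class A).

Definition tgprod (A B : tgroup) : tgroup :=
  @TGroup (A * B)%type _ (MeasTop.class (mt A * mt B)%type).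

Section GSpace.
Context (R : realType) (A : tgroup).

(* The group R^n x G0 without coordinates: [N x] stands for |x_1|^2, [kap] for
   R^n x K and [hf x] for (x_1 / 2, 0). *)
Record gspace (mu : {sigma_finite_measure set (mt A) -> \bar R}) (N : A -> R)
    (kap : set A) (hf : A -> A) : Prop := GSpace {
  gs_std : std (mt A);
  gs_sub : continuous (fun z : mt A * mt A => ((z.1 : A) - (z.2 : A) : mt A));
  gs_mshift : forall a : A, measurable_fun setT (fun x : mt A => (x : A) + a : mt A);
  gs_inv : forall (a : A) (U : set (mt A)), measurable U ->
    mu ([set x : A | U (x + a)] : set (mt A)) = mu U;
  gs_pos : forall U : set (mt A), open U -> U !=set0 -> (0 < mu U)%E;
  gs_Nc : continuous (N : mt A -> R);
  gs_N0 : forall x, 0 <= N x;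
  gs_Npar : forall x y, N (x + y) + N (x - y) = 2 * N x + 2 * N y;
  gs_Nhf : forall t x y,
    N (t - x) + N (t - y) = 2^-1 * N (x - y) + 2 * N (t - x - hf (y - x));
  gs_hfB : {morph hf : x y / x - y};
  gs_hfc : continuous (hf : mt A -> mt A);
  gs_hfk : forall x, kap (hf x);
  gs_ko : open (kap : set (mt A));
  gs_k0 : kap 0;
  gs_kB : forall x y, kap x -> kap y -> kap (x - y);
  gs_gauss : forall a, 0 < a ->
    (\int[mu]_x (expR (- (a * N x)) * \1_kap x)%:E < +oo)%E;
  gs_tb : forall (O : set (mt A)) (r : R), nbhs ((0 : A) : mt A) O ->
    exists s : seq A, forall x, kap x -> N x <= r ->
      exists2 t, t \in s & O (x - t)
}.

End GSpace.

Section GSpaceTheory.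
Context (R : realType) (A : tgroup).
Variables (mu : {sigma_finite_measure set (mt A) -> \bar R}) (N : A -> R)
    (kap : set A) (hf : A -> A).
Hypothesis gs : gspace mu N kap hf.
Implicit Types x y t : A.

Section Continuity.
Context {S : topologicalType}.
Implicit Types f g : S -> mt A.

Lemma gs_contB f g : continuous f -> continuous g ->
  continuous (fun s => (f s : A) - (g s : A) : mt A).
Proof.
move=> cf cg s.
exact: (@continuous2_cvg S (mt A) (mt A) (mt A) (nbhs s) _ f g
  (fun a b : A => a - b) (f s) (g s) (@gs_sub _ _ _ _ _ _ gs (f s, g s)) (cf s) (cg s)).
Qed.

Lemma gs_contN f : continuous f -> continuous (fun s => - (f s : A) : mt A).
Proof.
move=> cf; have := gs_contB (f := fun=> (0 : A) : mt A) _ cf.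
rewrite (_ : (fun s => - (f s : A)) = (fun s => (0 : A) - (f s : A) : mt A)).
  by apply => s; exact: cvg_cst.
by apply/funext => s; rewrite sub0r.
Qed.

Lemma gs_contD f g : continuous f -> continuous g ->
  continuous (fun s => (f s : A) + (g s : A) : mt A).
Proof.
move=> cf cg; have := gs_contB cf (gs_contN cg).
by under eq_fun do rewrite opprK.
Qed.

End Continuity.

Lemma cont_cst (S T : topologicalType) (c : T) : continuous (fun _ : S => c).
Proof. by move=> s; exact: cvg_cst. Qed.

Lemma cont_id (S : topologicalType) : continuous (fun x : S => x).
Proof. by move=> s; exact: cvg_id. Qed.

Lemma gs_addr a : continuous (fun x : mt A => (x : A) + a : mt A).
Proof. by apply: gs_contD; [exact: cont_id | exact: cont_cst]. Qed.

Lemma gs_open_shift (U : set (mt A)) a : open U -> open ([set x : A | U (x + a)] : set (mt A)).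
Proof.
move=> Uo; apply: (@open_comp _ _ (fun x : mt A => (x : A) + a : mt A)) => //.
by move=> x _; exact: gs_addr.
Qed.

Lemma gs_open_sup (O : set A) (F : A -> \bar R) :
  (forall r : R, open ([set x | (r%:E < F x)%E] : set (mt A))) ->
  forall r : R, open ([set x | (r%:E < ereal_sup [set F (x + o)%R | o in O])%E] : set (mt A)).
Proof.
move=> oF r.
rewrite (_ : [set x | _] = \bigcup_(o in O) [set x | (r%:E < F (x + o)%R)%E]).
  by apply: bigcup_open => o _; apply: (gs_open_shift (U := [set x | (r%:E < F x)%E])).
apply/seteqP; split => [x /=|x [b Ob /= h]].
  by move=> /ereal_sup_gt [_ [b Ob <-] h]; exists b.
by apply: lt_le_trans h _; apply: ereal_sup_ubound; exists b.
Qed.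

Lemma gs_int_shift (F : mt A -> \bar R) a : measurable_fun setT F ->
  (forall x, 0 <= F x)%E ->
  (\int[mu]_x F ((x : A) + a)%R = \int[mu]_x F x)%E.
Proof.
move=> mF F0; have ms := gs_mshift gs a.
have := @ge0_integral_pushforward _ _ _ _ R _ ms mu setT F measurableT mF
  (fun y _ => F0 y).
rewrite preimage_setT /comp => <-.
by apply: eq_measure_integral => U mU _; rewrite /pushforward; exact: (gs_inv gs).
Qed.

Lemma gs_int_shift_fun (F : mt A -> \bar R) a : measurable_fun setT F ->
  (\int[mu]_x F ((x : A) + a)%R = \int[mu]_x F x)%E.
Proof.
move=> mF; rewrite integralE [RHS]integralE; congr (_ - _)%E.
  transitivity (\int[mu]_x F^\+ ((x : A) + a)%R)%E.
    by apply: eq_integral => x _; rewrite ?funeposE ?funenegE.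
  by apply: gs_int_shift; [exact: measurable_funepos | move=> x; exact: funepos_ge0].
transitivity (\int[mu]_x F^\- ((x : A) + a)%R)%E.
    by apply: eq_integral => x _; rewrite ?funeposE ?funenegE.
  by apply: gs_int_shift; [exact: measurable_funeneg | move=> x; exact: funeneg_ge0].
Qed.

Lemma gs_cintg_shift (f : mt A -> R[i]) a : cintg mu f ->
  cintg mu (fun x => f ((x : A) + a)).
Proof.
move=> [mf fi]; split; first exact: (cmeas_comp (gs_mshift gs a) mf).
rewrite (gs_int_shift a (F := fun x => (cmod (f x))%:E))//; first exact: cmeas_cmodE.
by move=> x; rewrite lee_fin cmod_ge0.
Qed.

Lemma gs_cint_shift (f : mt A -> R[i]) a : cmeas f ->
  cint mu (fun x => f ((x : A) + a)) = cint mu f.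
Proof.
move=> [m1 m2]; apply: complex_eq => /=; rewrite /Rintegral; congr fine.
  by rewrite (gs_int_shift_fun a (F := fun x => (complex.Re (f x))%:E))//; exact/measurable_EFinP.
by rewrite (gs_int_shift_fun a (F := fun x => (complex.Im (f x))%:E))//; exact/measurable_EFinP.
Qed.

Lemma gs_N00 : N 0 = 0.
Proof. have := gs_Npar gs 0 0; rewrite addr0 subr0; lra. Qed.

Lemma gs_NN x : N (- x) = N x.
Proof. have := gs_Npar gs 0 x; rewrite add0r sub0r gs_N00; lra. Qed.

Lemma gs_ND x y : N (x + y) <= 2 * N x + 2 * N y.
Proof. have := gs_Npar gs x y; have := gs_N0 gs (x - y); lra. Qed.

Lemma gs_NB x y : N (x - y) <= 2 * N x + 2 * N y.
Proof. by have := gs_ND x (- y); rewrite gs_NN. Qed.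

Lemma gs_Nhf4 x : N (hf x) = 4^-1 * N x.
Proof.
have := gs_Nhf gs 0 0 x; rewrite subrr !sub0r subr0 gs_N00 !gs_NN; lra.
Qed.

Lemma gs_kN x : kap x -> kap (- x).
Proof. by move=> kx; rewrite -sub0r; apply: (gs_kB gs) => //; exact: (gs_k0 gs). Qed.

Lemma gs_kD x y : kap x -> kap y -> kap (x + y).
Proof. by move=> kx ky; rewrite -[y]opprK; apply: (gs_kB gs) => //; exact: gs_kN. Qed.

Lemma gs_kBE x y : kap (x - y) -> (kap x <-> kap y).
Proof.
move=> kxy; split => h; last by rewrite -(subrK y x); exact: gs_kD.
by rewrite -[y](subKr x); exact: (gs_kB gs).
Qed.

Definition gG (a : R) (x : A) : R := expR (- (a * N x)) * \1_kap x.

Lemma gG_ge0 a x : 0 <= gG a x.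
Proof. by rewrite mulr_ge0// expR_ge0. Qed.

Lemma gG_kap a x : kap x -> gG a x = expR (- (a * N x)).
Proof. by move=> kx; rewrite /gG indicE mem_set// mulr1. Qed.

Lemma gG_nkap a x : ~ kap x -> gG a x = 0.
Proof. by move=> kx; rewrite /gG indicE memNset// mulr0. Qed.

Lemma gG_le1 a x : 0 <= a -> gG a x <= 1.
Proof.
move=> a0; have [k|k] := pselect (kap x); last by rewrite gG_nkap.
by rewrite gG_kap// -expR0 ler_expR oppr_le0 mulr_ge0// (gs_N0 gs).
Qed.

Lemma gGN a x : gG a (- x) = gG a x.
Proof.
have [k|k] := pselect (kap x); first by rewrite !gG_kap ?gs_NN//; exact: gs_kN.
rewrite !gG_nkap// => /gs_kN; rewrite opprK.
exact: k.
Qed.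

Lemma gGBC a x y : gG a (x - y) = gG a (y - x).
Proof. by rewrite -gGN opprB. Qed.

Lemma gGM a b x : gG a x * gG b x = gG (a + b) x.
Proof.
have [k|k] := pselect (kap x); last by rewrite !gG_nkap// mulr0.
by rewrite !gG_kap// -expRD; congr expR; ring.
Qed.

(** From N y <= 2 N x + 2 N (x - y): a bounded displacement costs a constant factor and half of the
    exponent. *)
Lemma gG_near a r x y : 0 <= a -> kap (x - y) -> N (x - y) <= r ->
  gG a x <= expR (a * r) * gG (a / 2) y.
Proof.
move=> a0 kxy Nr.
have [k|k] := pselect (kap x); last by rewrite gG_nkap// mulr_ge0 ?expR_ge0 ?gG_ge0.
have ky : kap y by apply/(gs_kBE kxy).
rewrite !gG_kap// -expRD ler_expR.
have := gs_NB x (x - y); rewrite subKr => h.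
have h2 : a * N y <= a * (2 * N x + 2 * r).
  by rewrite ler_wpM2l// (le_trans h)// lerD2l ler_pM2l.
have -> : a / 2 * N y = 2^-1 * (a * N y) by ring.
move: h2; rewrite mulrDr !(mulrCA a); lra.
Qed.

(** An open subgroup has a locally constant indicator. *)
Lemma gG_cont a : continuous (gG a : mt A -> R).
Proof.
move=> x.
have nx : nbhs (x : mt A) ([set y : A | kap (y - x)] : set (mt A)).
  apply: open_nbhs_nbhs; split; last by rewrite /= subrr; exact: (gs_k0 gs).
  by apply: (gs_open_shift (U := kap)); exact: (gs_ko gs).
have e : {near (x : mt A), (fun y => expR (- (a * N y)) * \1_kap x) =1 (gG a : mt A -> R)}.
  apply: filterS nx => y /= kyx; rewrite /gG; congr (_ * _).
  have [h1 h2] := gs_kBE kyx.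
  rewrite !indicE; congr (_%:R); congr nat_of_bool.
  by apply/idP/idP; rewrite !inE.
rewrite /continuous_at; apply: (cvg_trans (near_eq_cvg e)).
rewrite {1}/gG; apply: cvgM; last exact: cvg_cst.
apply: (continuous_comp (f := fun y : mt A => - (a * N y)) (g := @expR R)); last first.
  exact: continuous_expR.
by apply: cvgN; apply: cvgM; [exact: cvg_cst | exact: (gs_Nc gs)].
Qed.

Lemma gG_meas a : measurable_fun setT (gG a : mt A -> R).
Proof. by apply: (cont_measurable (gs_std gs)); exact: gG_cont. Qed.

Lemma gG_int a : 0 < a -> (\int[mu]_x (gG a x)%:E < +oo)%E.
Proof. exact: (gs_gauss gs). Qed.

(** These boxes play the role of balls. Here r bounds the square of a Euclidean length, hence the
    factors 2 when boxes are added in [gboxD]. *)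
Definition gbox (r : R) : set A := [set x | kap x /\ N x < r].

Lemma gbox_open r : open (gbox r : set (mt A)).
Proof.
apply: openI; first exact: (gs_ko gs).
apply: (@open_comp _ _ (N : mt A -> R) [set y | y < r]).
  by move=> x _; exact: (gs_Nc gs).
exact: open_lt.
Qed.

Lemma gbox0 r : 0 < r -> gbox r 0.
Proof. by move=> r0; split; [exact: (gs_k0 gs) | rewrite gs_N00]. Qed.

Lemma gboxN r x : gbox r x -> gbox r (- x).
Proof. by move=> [k n]; split; [exact: gs_kN | rewrite gs_NN]. Qed.

Lemma gboxD r s x y : gbox r x -> gbox s y -> gbox (2 * r + 2 * s) (x + y).
Proof.
move=> [k n] [k' n']; split; first exact: gs_kD.
by apply: le_lt_trans (gs_ND _ _) _; rewrite ltrD// ltr_pM2l.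
Qed.

Lemma gbox_measurable r : measurable (gbox r : set (mt A)).
Proof. by apply: (gs_std gs).2; exact: gbox_open. Qed.

(** The indicator of the box is at most e^r times the Gaussian of exponent 1. *)
Lemma gbox_fin r : (mu (gbox r : set (mt A)) < +oo)%E.
Proof.
have [_ h] : True /\ (\int[mu]_x ((expR r)%:E * (gG 1 x)%:E) < +oo)%E.
  split => //; rewrite ge0_integralZl_EFin ?expR_ge0//.
  - by apply: lte_mul_pinfty; rewrite ?lee_fin ?expR_ge0//; exact: gG_int.
  - by move=> x _; rewrite lee_fin gG_ge0.
  - by apply/measurable_EFinP; exact: gG_meas.
apply: le_lt_trans h.
rewrite -[X in (mu X <= _)%E]setIT -integral_indic//; last exact: gbox_measurable.
apply: ge0_le_integral_nomeas => x; first by rewrite lee_fin.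
rewrite -EFinM lee_fin indicE; case: (boolP (x \in _)) => [|_]; last first.
  by rewrite mulr_ge0 ?expR_ge0 ?gG_ge0.
rewrite inE => -[k n]; rewrite gG_kap// -expRD mul1r.
by have : 1 <= expR (r - N x) by rewrite -expR0 ler_expR subr_ge0 ltW.
Qed.

(** Boxes are symmetric, so every y in the box about x has x in its own box and F x is below the
    local supremum at y. Averaging over such y gives the bound, with C the inverse of the measure of
    the box. *)
Lemma le_int_sup : exists2 C : R, 0 < C & forall F : A -> \bar R,
  (forall x, 0 <= F x)%E ->
  (forall r : R, open ([set x | (r%:E < F x)%E] : set (mt A))) ->
  forall x, (F x <= C%:E * \int[mu]_y ereal_sup [set F ((y : A) + o)%R | o in gbox 1])%E.
Proof.
have m0 : (0 < mu (gbox 1 : set (mt A)))%E.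
  by apply: (gs_pos gs); [exact: gbox_open | exists 0; exact: gbox0].
have mf : mu (gbox 1 : set (mt A)) \is a fin_num.
  by rewrite ge0_fin_numE ?gbox_fin// ltW.
have fm0 : 0 < fine (mu (gbox 1 : set (mt A))) by rewrite fine_gt0// m0 gbox_fin.
exists (fine (mu (gbox 1 : set (mt A))))^-1; first by rewrite invr_gt0.
set m := fine _ in fm0 *; move=> F F0 oF x.
rewrite (_ : F x = (m^-1)%:E * (m%:E * F x))%E; last first.
  by rewrite muleA -EFinM mulVf ?mul1e// gt_eqF.
apply: lee_wpmul2l; first by rewrite lee_fin invr_ge0 ltW.
pose S : set (mt A) := [set y : A | gbox 1 (y - x)].
have So : open S by apply: (gs_open_shift (U := gbox 1)); exact: gbox_open.
have mS : measurable S by exact: (gs_std gs).2.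
have -> : m%:E = mu S.
  by rewrite /m fineK// -(gs_inv gs (- x) (gbox_measurable 1)).
rewrite muleC -integral_cst// integral_mkcond.
apply: ge0_le_integral_nomeas => y; rewrite /patch.
  by case: ifPn => //= _; exact: F0.
case: ifPn => [|_].
  rewrite inE => Sy /=; apply: ereal_sup_ubound; exists (x - y).
    by rewrite -opprB; exact: gboxN.
  by rewrite addrC subrK.
apply: le_trans (F0 y) _; apply: ereal_sup_ubound; exists 0; first exact: gbox0.
by rewrite addr0.
Qed.

End GSpaceTheory.

Section ProdGSpace.
Context (R : realType) (A B : tgroup).
Variables (mu : {sigma_finite_measure set (mt A) -> \bar R})
  (nu : {sigma_finite_measure set (mt B) -> \bar R})
  (NA : A -> R) (kA : set A) (hA : A -> A) (NB : B -> R) (kB : set B) (hB : B -> B).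
Hypotheses (gA : gspace mu NA kA hA) (gB : gspace nu NB kB hB).
Local Notation Z := (tgprod A B).

Definition pmeas : {sigma_finite_measure set (mt Z) -> \bar R} :=
  (prod_measure mu nu : {sigma_finite_measure set (mt A * mt B)%type -> \bar R}).

Definition prodN (z : Z) : R := NA z.1 + NB z.2.
Definition prodk : set Z := [set z : Z | kA z.1 /\ kB z.2].
Definition prodh (z : Z) : Z := (hA z.1, hB z.2).

Lemma gG_prod a (z : Z) : gG prodN prodk a z = gG NA kA a z.1 * gG NB kB a z.2.
Proof.
rewrite /gG mulrACA -expRD; congr (expR _ * _); first by rewrite /prodN; ring.
rewrite !indicE -natrM mulnb; congr (_%:R); congr nat_of_bool.
apply/idP/andP; first by rewrite !inE => -[].
by rewrite !inE => -[? ?].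
Qed.

Lemma cont_fst (S T : topologicalType) : continuous (fun z : S * T => z.1).
Proof. by move=> z; exact: cvg_fst. Qed.
Lemma cont_snd (S T : topologicalType) : continuous (fun z : S * T => z.2).
Proof. by move=> z; exact: cvg_snd. Qed.
Lemma cont_pair (U S T : topologicalType) (f : U -> S) (g : U -> T) :
  continuous f -> continuous g -> continuous (fun u => (f u, g u)).
Proof. by move=> cf cg u; apply: cvg_pair; [exact: cf | exact: cg]. Qed.
Lemma cont_comp (U S T : topologicalType) (f : U -> S) (g : S -> T) :
  continuous f -> continuous g -> continuous (fun u => g (f u)).
Proof. by move=> cf cg u; apply: continuous_comp; [exact: cf | exact: cg]. Qed.

(** The plane A x B and the plane over it are again groups with a Gaussian, so every estimate for A
    holds on them. Squared lengths add, Gaussians multiply, and finite nets are products of finite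
    nets. *)
Lemma prod_gspace : gspace pmeas prodN prodk prodh.
Proof.
have sA := gs_std gA; have sB := gs_std gB.
have cN : continuous (prodN : (mt A * mt B)%type -> R).
  move=> z; apply: cvgD.
    exact: (cont_comp (@cont_fst (mt A) (mt B)) (gs_Nc gA)).
  exact: (cont_comp (@cont_snd (mt A) (mt B)) (gs_Nc gB)).
have fin (d : measure_display) (T : measurableType d) (m : {measure set T -> \bar R})
    (g : T -> R) : measurable_fun setT g -> (forall x, 0 <= g x) ->
    (\int[m]_x (g x)%:E < +oo)%E -> (\int[m]_x (g x)%:E)%E \is a fin_num.
  by move=> _ g0 gi; rewrite ge0_fin_numE// integral_ge0// => x _; rewrite lee_fin.
split.
- exact: (std_prod sA sB).
- apply: (@cont_pair ((mt A * mt B) * (mt A * mt B))%type (mt A) (mt B)).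
    apply: (gs_contB gA).
      exact: (cont_comp (@cont_fst (mt A * mt B)%type _) (@cont_fst (mt A) (mt B))).
    exact: (cont_comp (@cont_snd _ (mt A * mt B)%type) (@cont_fst (mt A) (mt B))).
  apply: (gs_contB gB).
    exact: (cont_comp (@cont_fst (mt A * mt B)%type _) (@cont_snd (mt A) (mt B))).
  exact: (cont_comp (@cont_snd _ (mt A * mt B)%type) (@cont_snd (mt A) (mt B))).
- move=> a; apply: (@measurable_fun_pair _ _ _ (mt A * mt B)%type (mt A) (mt B)).
    exact: (measurableT_comp (gs_mshift gA a.1) measurable_fst).
  exact: (measurableT_comp (gs_mshift gB a.2) measurable_snd).
- move=> a U mU.
  have mF : measurable_fun setT (nu \o xsection (U : set (mt A * mt B))).
    exact: measurable_fun_xsection.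
  transitivity (\int[mu]_x (nu \o xsection (U : set (mt A * mt B))) x)%E; last by [].
  rewrite -(gs_int_shift gA a.1 mF)//.
  apply: eq_integral => x _ /=.
  rewrite -[RHS](gs_inv gB a.2); last first.
    exact: (@measurable_xsection _ _ (mt A) (mt B) U (x + a.1 : A) mU).
  congr (nu _); apply/seteqP; split => y /=; rewrite /xsection /= !inE/=;
    by rewrite in_setE.
- move=> U Uo [[x y] Uxy].
  have : nbhs ((x, y) : mt A * mt B) U by exact: open_nbhs_nbhs.
  move=> [[V W] /= [xV yW] VWU].
  have [V' [V'o V'x] V'V] : exists2 V', open_nbhs (x : mt A) V' & V' `<=` V.
    by exists (interior V); [split; [exact: open_interior | exact: xV] | exact: interior_subset].
  have [W' [W'o W'y] W'W] : exists2 W', open_nbhs (y : mt B) W' & W' `<=` W.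
    by exists (interior W); [split; [exact: open_interior | exact: yW] | exact: interior_subset].
  have mV := sA.2 _ V'o; have mW := sB.2 _ W'o.
  apply: (@lt_le_trans _ _ (prod_measure mu nu (V' `*` W'))).
    rewrite /prod_measure product_measure1E// mule_gt0//.
      by apply: (gs_pos gA) => //; exists x.
    by apply: (gs_pos gB) => //; exists y.
  apply: le_measure; rewrite ?inE.
  + exact: measurableX.
  + exact: (std_prod sA sB).2.
  + by move=> [u v] [/= Vu Wv]; apply: VWU; split; [exact: V'V | exact: W'W].
- exact: cN.
- by move=> z; rewrite addr_ge0// ?(gs_N0 gA)// (gs_N0 gB).
- move=> z w; rewrite /prodN /=.
  have := gs_Npar gA z.1 w.1; have := gs_Npar gB z.2 w.2; lra.
- move=> t z w; rewrite /prodN /=.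
  have := gs_Nhf gA t.1 z.1 w.1; have := gs_Nhf gB t.2 z.2 w.2; lra.
- by move=> z w; rewrite /prodh /= (gs_hfB gA) (gs_hfB gB).
- apply: (@cont_pair (mt A * mt B)%type (mt A) (mt B)).
    exact: (cont_comp (@cont_fst (mt A) (mt B)) (gs_hfc gA)).
  exact: (cont_comp (@cont_snd (mt A) (mt B)) (gs_hfc gB)).
- by move=> z; split; [exact: (gs_hfk gA) | exact: (gs_hfk gB)].
- apply: openI.
    apply: (@open_comp _ _ (fun z : mt A * mt B => z.1) kA); last exact: (gs_ko gA).
    by move=> x _; exact: cont_fst.
  apply: (@open_comp _ _ (fun z : mt A * mt B => z.2) kB); last exact: (gs_ko gB).
  by move=> x _; exact: cont_snd.
- by split; [exact: (gs_k0 gA) | exact: (gs_k0 gB)].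
- by move=> z w [? ?] [? ?]; split; [exact: (gs_kB gA) | exact: (gs_kB gB)].
- move=> a a0; have iA := gG_int gA a0; have iB := gG_int gB a0.
  have fB := fin _ _ nu _ (gG_meas gB a) (gG_ge0 NB kB a) iB.
  have E (z : mt A * mt B) : (expR (- (a * prodN z)) * \1_prodk z)%:E =
      ((gG NA kA a z.1)%:E * (gG NB kB a z.2)%:E)%E.
    by rewrite -EFinM -gG_prod.
  under eq_integral do rewrite E.
  have mF : measurable_fun setT (fun z : mt A * mt B =>
      (gG NA kA a z.1)%:E * (gG NB kB a z.2)%:E)%E.
    apply: emeasurable_funM; apply/measurable_EFinP.
      exact: (measurableT_comp (gG_meas gA a) measurable_fst).
    exact: (measurableT_comp (gG_meas gB a) measurable_snd).
  have F0 (z : mt A * mt B) : (0 <= (gG NA kA a z.1)%:E * (gG NB kB a z.2)%:E)%E.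
    by rewrite -EFinM lee_fin mulr_ge0// gG_ge0.
  have -> : (\int[pmeas]_z ((gG NA kA a z.1)%:E * (gG NB kB a z.2)%:E) =
     \int[mu]_x \int[nu]_y ((gG NA kA a x)%:E * (gG NB kB a y)%:E))%E.
    exact: (tonelli1 mu nu mF F0).
  have E2 x : (\int[nu]_y ((gG NA kA a x)%:E * (gG NB kB a y)%:E) =
      (fine (\int[nu]_y (gG NB kB a y)%:E))%:E * (gG NA kA a x)%:E)%E.
    rewrite ge0_integralZl_EFin ?gG_ge0//.
    - by rewrite fineK// muleC.
    - by move=> y _; rewrite lee_fin gG_ge0.
    - by apply/measurable_EFinP; exact: (gG_meas gB).
  under eq_integral do rewrite E2.
  have b0 : 0 <= fine (\int[nu]_y (gG NB kB a y)%:E).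
    by apply: fine_ge0; apply: integral_ge0 => y _; rewrite lee_fin gG_ge0.
  rewrite ge0_integralZl_EFin//.
  + by apply: lte_mul_pinfty.
  + by move=> y _; rewrite lee_fin gG_ge0.
  + by apply/measurable_EFinP; exact: (gG_meas gA).
- move=> O r [[V W] /= [V0 W0] VWO].
  have [s sP] := gs_tb gA r V0; have [t tP] := gs_tb gB r W0.
  exists [seq (x, y) | x <- s, y <- t] => z [k1 k2] Nz.
  have N1 := gs_N0 gA z.1; have N2 := gs_N0 gB z.2.
  have M1 : NA z.1 <= r by move: Nz; rewrite /prodN; lra.
  have M2 : NB z.2 <= r by move: Nz; rewrite /prodN; lra.
  have [x xs Vx] := sP z.1 k1 M1; have [y yt Wy] := tP z.2 k2 M2.
  exists (x, y); first by apply/allpairsP; exists (x, y).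
  by apply: VWO; split.
Qed.

End ProdGSpace.

(** * Gaussian atoms and Moyal's formula *)

Section CCont.
Context (R : realType).

(** Continuity by components, which feeds measurability directly. [ccont_contC] and [contC_ccont]
    compare it with the topology of [R[i]^o]. *)
Definition ccont (S : topologicalType) (f : S -> R[i]) :=
  continuous (fun x => complex.Re (f x)) /\ continuous (fun x => complex.Im (f x)).

Section S.
Context {S : topologicalType}.
Implicit Types f g : S -> R[i].

Lemma ccont_cst c : ccont (fun _ : S => c).
Proof. by split; exact: cont_cst. Qed.

Lemma ccontD f g : ccont f -> ccont g -> ccont (fun x => f x + g x).
Proof.
move=> [f1 f2] [g1 g2]; split => x.
  by under eq_fun do rewrite ReD; apply: cvgD; [exact: f1 | exact: g1].
by under eq_fun do rewrite ImD; apply: cvgD; [exact: f2 | exact: g2].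
Qed.

Lemma ccontM f g : ccont f -> ccont g -> ccont (fun x => f x * g x).
Proof.
move=> [f1 f2] [g1 g2]; split => x.
  under eq_fun do rewrite ReM; apply: cvgB; apply: cvgM;
    [exact: f1 | exact: g1 | exact: f2 | exact: g2].
under eq_fun do rewrite ImM; apply: cvgD; apply: cvgM;
    [exact: f1 | exact: g2 | exact: f2 | exact: g1].
Qed.

Lemma ccont_conj f : ccont f -> ccont (fun x => (f x)^*).
Proof.
move=> [f1 f2]; split => x; first by under eq_fun do rewrite Reconj; exact: f1.
by under eq_fun do rewrite Imconj; apply: cvgN; exact: f2.
Qed.

Lemma ccont_real (h : S -> R) : continuous h -> ccont (fun x => (h x)%:C).
Proof. by move=> ch; split => //=; exact: cont_cst. Qed.

Lemma ccont_sum I (r : seq I) (F : I -> S -> R[i]) :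
  (forall i, ccont (F i)) -> ccont (fun x => \sum_(i <- r) F i x).
Proof.
move=> mF; elim: r => [|i r ih].
  by under eq_fun do rewrite big_nil; exact: ccont_cst.
by under eq_fun do rewrite big_cons; exact: ccontD.
Qed.

Lemma ccont_cmod f : ccont f -> continuous (fun x => cmod (f x)).
Proof.
move=> [f1 f2] x; under eq_fun do rewrite cmodE !expr2.
apply: (continuous_comp (f := fun x => complex.Re (f x) * complex.Re (f x) +
  complex.Im (f x) * complex.Im (f x)) (g := @Num.sqrt R)); last exact: sqrt_continuous.
by apply: cvgD; apply: cvgM; (exact: f1 || exact: f2).
Qed.

End S.

Lemma ccont_comp (S T : topologicalType) (h : S -> T) (f : T -> R[i]) :
  continuous h -> ccont f -> ccont (fun x => f (h x)).
Proof. by move=> ch [f1 f2]; split; [exact: (cont_comp ch f1) | exact: (cont_comp ch f2)]. Qed.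

Lemma ccont_cmeas d (T : measTopType d) (f : T -> R[i]) : std T -> ccont f -> cmeas f.
Proof. by move=> sT [f1 f2]; split; exact: (cont_measurable sT). Qed.

End CCont.

Section GMid.
Context (R : realType) (A : tgroup).
Variables (mu : {sigma_finite_measure set (mt A) -> \bar R}) (N : A -> R)
    (kap : set A) (hf : A -> A).
Hypothesis gs : gspace mu N kap hf.

(** Completing the square, in the form of [gs_Nhf]. The point [x + hf (y - x)] is the midpoint in
    the R^n direction; in the other direction it stays with x, which suffices because all the points
    involved lie in one coset of [kap] unless both sides vanish. *)
Lemma gG_mid a (t x y : A) : gG N kap a (t - x) * gG N kap a (t - y) =
  gG N kap (a / 2) (x - y) * gG N kap (2 * a) (t - (x + hf (y - x))).
Proof.
have E : t - (x + hf (y - x)) = t - x - hf (y - x) by rewrite opprD addrA.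
have [k1|k1] := pselect (kap (t - x)); last first.
  rewrite [gG N kap a (t - x)]gG_nkap// mul0r E [X in _ * X]gG_nkap ?mulr0// => k.
  by apply: k1; rewrite -(subrK (hf (y - x)) (t - x)); apply: (gs_kD gs) => //; exact: (gs_hfk gs).
have k2 : kap (t - (x + hf (y - x))).
  by rewrite E; apply: (gs_kB gs) => //; exact: (gs_hfk gs).
have xyE : x - y = (t - y) - (t - x) by rewrite opprB [RHS]addrC addrA subrK.
have [k3|k3] := pselect (kap (t - y)); last first.
  rewrite [gG N kap a (t - y)]gG_nkap// mulr0 [gG N kap _ (x - y)]gG_nkap ?mul0r// => k.
  apply: k3; rewrite -(subrK (t - x) (t - y)).
  by apply: (gs_kD gs) => //; rewrite -xyE.
rewrite !gG_kap//; last by rewrite xyE; exact: (gs_kB gs).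
rewrite -!expRD; congr expR; rewrite E; have := gs_Nhf gs t x y.
move: (N (t - x)) (N (t - y)) (N (x - y)) (N (t - x - _)) => p q r s h.
have -> : - (a * p) + - (a * q) = - (a * (p + q)) by ring.
by rewrite h; field.
Qed.

Lemma gG_cintg a (u : A -> R[i]) (M : R) : 0 < a -> cmeas (u : mt A -> R[i]) ->
  (forall x, cmod (u x) <= M) -> cintg mu (fun x => (gG N kap a x)%:C * u x).
Proof.
move=> a0 mu_ uM.
have M0 : 0 <= M by exact: le_trans (cmod_ge0 (u 0)) (uM 0).
apply: (@cintg_le _ _ _ _ _ (fun x : mt A => M%:E * (gG N kap a x)%:E)%E).
- by apply: cmeasM => //; apply: cmeas_real; exact: (gG_meas gs).
- move=> x; rewrite -EFinM lee_fin cmodM cmod_real ger0_norm ?gG_ge0// mulrC.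
  by rewrite ler_wpM2r// gG_ge0.
- rewrite ge0_integralZl_EFin//.
  + by apply: lte_mul_pinfty; rewrite ?lee_fin//; exact: (gG_int gs).
  + by move=> x _; rewrite lee_fin gG_ge0.
  + by apply/measurable_EFinP; exact: (gG_meas gs).
Qed.

End GMid.

Section GPair.
Context (R : realType) (A B : tgroup).
Variables (mu : {sigma_finite_measure set (mt A) -> \bar R})
  (nu : {sigma_finite_measure set (mt B) -> \bar R})
  (NA : A -> R) (kA : set A) (NB : B -> R) (kB : set B).
Variable (pr : B -> A -> R[i]).

(* The Gaussian is exp(- pi N); the two transforms below are at the widths met
   by products of two translates. *)
Record gpair (c : R) : Prop := GPair {
  gp_c : 0 < c;
  gp_norm : forall y x, cmod (pr y x) = 1;
  gp_Dl : forall y y' x, pr (y + y') x = pr y x * pr y' x;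
  gp_Dr : forall y x x', pr y (x + x') = pr y x * pr y x';
  gp_cont : ccont (fun z : (mt B * mt A)%type => pr z.1 z.2);
  gp_F1 : forall y, cint mu (fun x : mt A => (gG NA kA (2 * pi) x)%:C * (pr y x)^*) =
    (c * gG NB kB (pi / 2) y)%:C;
  gp_F2 : forall x, cint nu (fun y : mt B => (gG NB kB (pi / 2) y)%:C * pr y x) =
    (c^-1 * gG NA kA (2 * pi) x)%:C
}.

(** [base_plane] and [double_plane] both become instances of this plane once their Gaussians are
    written with [gG]. *)
Definition gplane : tfplane R :=
  @TFPlane R _ (mt A) _ (mt B) (fun x y : A => x - y) (0 : (A * B)%type)
    (fun z w : (A * B)%type => z + w) pr mu nu (fun x => (gG NA kA pi x)%:C).

End GPair.

Section GPlane.
Context (R : realType) (A B : tgroup).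
Variables (mu : {sigma_finite_measure set (mt A) -> \bar R})
  (nu : {sigma_finite_measure set (mt B) -> \bar R})
  (NA : A -> R) (kA : set A) (hA : A -> A) (NB : B -> R) (kB : set B) (hB : B -> B).
Hypotheses (gA : gspace mu NA kA hA) (gB : gspace nu NB kB hB).
Variables (pr : B -> A -> R[i]) (c : R).
Hypothesis gp : gpair mu nu NA kA NB kB pr c.
Local Notation Z := (tgprod A B).
Local Notation mnu := (prod_measure mu nu).
Local Notation GA := (gG NA kA).
Local Notation GB := (gG NB kB).
Local Notation L2 := (cLspace mu 2%:E).
Local Notation inner := (inner mu).
Implicit Types (z w v : Z) (x t : A) (y : B).

Lemma pr0l x : pr 0 x = 1.
Proof.
have h := gp_Dl gp 0 0 x; rewrite addr0 in h.
have n0 : pr 0 x != 0 by rewrite -cmod_eq0 (gp_norm gp) oner_eq0.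
by apply: (mulfI n0); rewrite -h mulr1.
Qed.

Lemma pr0r y : pr y 0 = 1.
Proof.
have h := gp_Dr gp y 0 0; rewrite addr0 in h.
have n0 : pr y 0 != 0 by rewrite -cmod_eq0 (gp_norm gp) oner_eq0.
by apply: (mulfI n0); rewrite -h mulr1.
Qed.

Lemma pr_conjM y x : pr y x * (pr y x)^* = 1.
Proof. by rewrite mulr_conjc (gp_norm gp) expr1n. Qed.

Lemma prNl y x : pr (- y) x = (pr y x)^*.
Proof.
have n0 : pr y x != 0 by rewrite -cmod_eq0 (gp_norm gp) oner_eq0.
by apply: (mulfI n0); rewrite -(gp_Dl gp) subrr pr0l pr_conjM.
Qed.

Lemma prNr y x : pr y (- x) = (pr y x)^*.
Proof.
have n0 : pr y x != 0 by rewrite -cmod_eq0 (gp_norm gp) oner_eq0.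
by apply: (mulfI n0); rewrite -(gp_Dr gp) subrr pr0r pr_conjM.
Qed.

Definition phi : A -> R[i] := fun x => (GA pi x)%:C.
Definition ts z (f : A -> R[i]) : A -> R[i] := fun t => pr z.2 t * f (t - z.1).

Lemma pr_cont1 y : ccont (pr y : mt A -> R[i]).
Proof.
apply: (ccont_comp (h := fun x : mt A => (y : mt B, x)) (f := fun z : (mt B * mt A)%type => pr z.1 z.2)).
  by apply: cont_pair; [exact: cont_cst | exact: cont_id].
exact: (gp_cont gp).
Qed.

Lemma pr_cont2 x : ccont (fun y : mt B => pr y x).
Proof.
apply: (ccont_comp (h := fun y : mt B => (y, x : mt A)) (f := fun z : (mt B * mt A)%type => pr z.1 z.2)).
  by apply: cont_pair; [exact: cont_id | exact: cont_cst].
exact: (gp_cont gp).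
Qed.

Lemma pr_ccont (S : topologicalType) (f : S -> mt B) (g : S -> mt A) :
  continuous f -> continuous g -> ccont (fun s => pr (f s) (g s)).
Proof.
move=> cf cg.
apply: (ccont_comp (h := fun s => (f s, g s)) (f := fun z : (mt B * mt A)%type => pr z.1 z.2)).
  exact: cont_pair.
exact: (gp_cont gp).
Qed.

Lemma phi_ccont : ccont (phi : mt A -> R[i]).
Proof. by apply: ccont_real; exact: (gG_cont gA). Qed.

Lemma phi_ge0 x : cmod (phi x) = GA pi x.
Proof. by rewrite /phi cmod_real ger0_norm// gG_ge0. Qed.

Lemma phiN x : phi (- x) = phi x.
Proof. by rewrite /phi (gGN gA). Qed.

Lemma phi_conj x : (phi x)^* = phi x.
Proof. exact: conj_realc. Qed.

Lemma phi_L2 : L2 phi.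
Proof.
apply/L2P; split; first by apply: (ccont_cmeas (gs_std gA)); exact: phi_ccont.
rewrite /L2n; under eq_integral do rewrite phi_ge0 expr2 gGM.
by apply: (gG_int gA); rewrite addr_gt0// pi_gt0.
Qed.

Lemma ts_L2 z f : L2 f -> L2 (ts z f) /\ nsq mu (ts z f) = nsq mu f.
Proof.
move=> /L2P[mf fi].
have E : L2n mu (ts z f) = L2n mu f.
  rewrite /L2n /ts; under eq_integral do rewrite cmodM (gp_norm gp) mul1r.
  rewrite (gs_int_shift gA (- z.1) (F := fun x => (cmod (f x) ^+ 2)%:E))//.
    exact: cmeas_sqr.
  by move=> x; rewrite lee_fin sqr_ge0.
split; last by rewrite /nsq E.
apply/L2P; rewrite E; split => //; apply: cmeasM.
  by apply: (ccont_cmeas (gs_std gA)); exact: pr_cont1.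
exact: (cmeas_comp (gs_mshift gA (- z.1)) mf).
Qed.

Lemma tsL2 z f : L2 f -> L2 (ts z f). Proof. by move=> /(ts_L2 z)[]. Qed.

Lemma ts_nrm z f : L2 f -> nrm mu (ts z f) = nrm mu f.
Proof. by move=> /(ts_L2 z)[_ h]; rewrite /nrm h. Qed.

Lemma ts_ts z w f : ts z (ts w f) = fun t => (pr w.2 z.1)^* * ts (z + w) f t.
Proof.
apply/funext => t; rewrite /ts /= (gp_Dr gp) prNr (gp_Dl gp) opprD addrA; ring.
Qed.

Lemma ts_inner z f g : cmeas (fun t : mt A => f t * (g t)^*) ->
  inner (ts z f) (ts z g) = inner f g.
Proof.
move=> m; rewrite /inner -(gs_cint_shift gA (- z.1) m); congr cint.
apply/funext => t; rewrite /ts rmorphM/= mulrACA pr_conjM mul1r//.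
Qed.

(* Cross-ambiguity function of the Gaussian. *)
Definition am z w : R[i] := inner (ts z phi) (ts w phi).

(** By [gG_mid] the product of the two translates is a Gaussian of exponent 2 pi about the midpoint,
    whose Fourier transform is [gp_F1]; moving the midpoint to 0 produces the phase. *)
Lemma amE z w : am z w =
  (c * (GA (pi / 2) (z.1 - w.1) * GB (pi / 2) (z.2 - w.2)))%:C *
    pr (z.2 - w.2) (z.1 + hA (w.1 - z.1)).
Proof.
set m := z.1 + hA (w.1 - z.1); set eta := z.2 - w.2.
pose F (t : mt A) : R[i] := (GA (2 * pi) t)%:C * (pr (- eta) t)^*.
have iF : cintg mu F.
  apply: (gG_cintg gA (M := 1)).
  - by rewrite mulr_gt0// pi_gt0.
  - by apply: cmeas_conj; apply: (ccont_cmeas (gs_std gA)); exact: pr_cont1.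
  - by move=> x; rewrite cmod_conj (gp_norm gp).
have E t : ts z phi t * (ts w phi t)^* =
    ((GA (pi / 2) (z.1 - w.1))%:C * pr eta m) * F ((t : A) + - m).
  rewrite /ts /F rmorphM/= phi_conj mulrACA -prNl -(gp_Dl gp) -/eta.
  rewrite {1 2}/phi -[in X in _ * X]rmorphM/= (gG_mid gA) rmorphM/=.
  rewrite -prNl opprK (gp_Dr gp) prNr.
  transitivity (pr eta t * ((GA (pi / 2) (z.1 - w.1))%:C * (GA (2 * pi) (t - m))%:C) *
     (pr eta m * (pr eta m)^*)); last by ring.
  by rewrite pr_conjM mulr1.
rewrite /am /inner; under eq_fun do rewrite E.
rewrite cintZ; last exact: (gs_cintg_shift gA).
rewrite (gs_cint_shift gA _ iF.1) /F (gp_F1 gp) (gGN gB) -/eta.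
by rewrite !rmorphM/=; ring.
Qed.

Definition gZ a z : R := GA a z.1 * GB a z.2.

Lemma am_cmod z w : cmod (am z w) = c * gZ (pi / 2) (z - w).
Proof.
rewrite amE cmodM (gp_norm gp) mulr1 cmod_real ger0_norm//.
by rewrite mulr_ge0 ?(ltW (gp_c gp))// mulr_ge0// gG_ge0.
Qed.

Lemma gZ_ge0 a z : 0 <= gZ a z.
Proof. by rewrite mulr_ge0// gG_ge0. Qed.

Lemma gZE a : gZ a = gG (prodN NA NB) (prodk kA kB) a.
Proof. by apply/funext => z; rewrite gG_prod. Qed.

Let gAB := prod_gspace gA gB.

Lemma am_ccont2 (S : topologicalType) (f g : S -> (mt A * mt B)%type) :
  continuous f -> continuous g -> ccont (fun s => am (f s) (g s)).
Proof.
move=> cf cg.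
have f1 : continuous (fun s => (f s).1 : mt A) by exact: (cont_comp cf (@cont_fst _ _)).
have f2 : continuous (fun s => (f s).2 : mt B) by exact: (cont_comp cf (@cont_snd _ _)).
have g1 : continuous (fun s => (g s).1 : mt A) by exact: (cont_comp cg (@cont_fst _ _)).
have g2 : continuous (fun s => (g s).2 : mt B) by exact: (cont_comp cg (@cont_snd _ _)).
rewrite (_ : (fun s => _) = (fun s => (c * (GA (pi / 2) ((f s).1 - (g s).1 : A) *
    GB (pi / 2) ((f s).2 - (g s).2 : B)))%:C *
    pr ((f s).2 - (g s).2 : B) ((f s).1 + hA ((g s).1 - (f s).1) : A))); last first.
  by apply/funext => s; rewrite amE.
apply: ccontM.
  have h1 : continuous (fun s => GA (pi / 2) ((f s).1 - (g s).1 : A)).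
    exact: (cont_comp (gs_contB gA f1 g1) (gG_cont gA (a := pi / 2))).
  have h2 : continuous (fun s => GB (pi / 2) ((f s).2 - (g s).2 : B)).
    exact: (cont_comp (gs_contB gB f2 g2) (gG_cont gB (a := pi / 2))).
  apply: ccont_real => s; apply: cvgM; first exact: cvg_cst.
  by apply: cvgM; [exact: h1 | exact: h2].
apply: (pr_ccont (gs_contB gB f2 g2)).
apply: (gs_contD gA f1); exact: (cont_comp (gs_contB gA g1 f1) (gs_hfc gA)).
Qed.

Lemma ts_phi_ccont (S : topologicalType) (f : S -> (mt A * mt B)%type) (g : S -> mt A) :
  continuous f -> continuous g -> ccont (fun s => ts (f s) phi (g s)).
Proof.
move=> cf cg.
have f1 : continuous (fun s => (f s).1 : mt A) by exact: (cont_comp cf (@cont_fst _ _)).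
have f2 : continuous (fun s => (f s).2 : mt B) by exact: (cont_comp cf (@cont_snd _ _)).
apply: ccontM; first exact: pr_ccont.
exact: (ccont_comp (gs_contB gA cg f1) phi_ccont).
Qed.

Lemma cmod_ts_phi z t : cmod (ts z phi t) = GA pi (t - z.1).
Proof. by rewrite /ts cmodM (gp_norm gp) mul1r phi_ge0. Qed.

(** Integrating over the frequency of the second argument is a Fourier inversion: [gp_F2] removes
    the frequency Gaussian, and [gG_mid], read backwards, splits the result into the two
    translates. *)
Lemma am_inv v x t :
  cintg nu (fun y : mt B => am v (x, y : B) * pr y t) /\
  cint nu (fun y : mt B => am v (x, y : B) * pr y t) = ts v phi t * phi (t - x).
Proof.
set m := v.1 + hA (x - v.1).
pose F (y : mt B) : R[i] := (GB (pi / 2) y)%:C * pr y (t - m).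
have iF : cintg nu F.
  apply: (gG_cintg gB (M := 1)).
  - by rewrite divr_gt0// pi_gt0.
  - by apply: (ccont_cmeas (gs_std gB)); exact: pr_cont2.
  - by move=> y; rewrite (gp_norm gp).
pose K := (c * GA (pi / 2) (v.1 - x))%:C * pr v.2 t.
have E y : am v (x, y) * pr y t = K * F ((y : B) + - v.2).
  rewrite amE /= -/m /F /K (gGBC gB) (gp_Dr gp) prNr !(gp_Dl gp) !prNl.
  move: (GA _ _) (GB _ _) => ga gb; rewrite !rmorphM/= conjCK.
  transitivity (c%:C * ga%:C * gb%:C * (pr v.2 m * (pr y m)^* * pr y t) *
    (pr v.2 t * (pr v.2 t)^*)); last by ring.
  by rewrite pr_conjM; ring.
split; first by under eq_fun do rewrite E; apply: cintgZ; exact: (gs_cintg_shift gB).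
under eq_fun do rewrite E.
rewrite cintZ; last exact: (gs_cintg_shift gB).
rewrite (gs_cint_shift gB _ iF.1) (gp_F2 gp) /K /ts /phi.
have c0 : c != 0 by rewrite gt_eqF// (gp_c gp).
rewrite mulrAC -rmorphM/= mulrC -mulrA -[in RHS]rmorphM/= (gG_mid gA) -/m; congr (_ * _%:C).
by field.
Qed.

(* The constants of Moyal's formulas [moyal_atom] and [moyal] are [kap0] and [kapS]. *)
Definition kap0 z0 z1 : R[i] :=
  am ((- z0.1 : A, z0.2) : (A * B)%type) ((- z1.1 : A, z1.2) : (A * B)%type).

Lemma gZ_int a : 0 < a -> (\int[mnu]_z (gZ a z)%:E < +oo)%E.
Proof. by move=> a0; have := gG_int gAB a0; rewrite -gZE. Qed.

Lemma gZ_meas a : measurable_fun setT (gZ a : (mt A * mt B)%type -> R).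
Proof. by rewrite gZE; exact: (gG_meas gAB). Qed.

Lemma gZ_cont (a : R) : continuous (gZ a : (mt A * mt B)%type -> R).
Proof. by rewrite gZE; exact: (gG_cont gAB). Qed.

Lemma gZ_int_shift a w : 0 < a -> (\int[mnu]_z (gZ a ((z : Z) + w))%:E =
  \int[mnu]_z (gZ a z)%:E)%E.
Proof.
move=> a0; apply: (gs_int_shift gAB w (F := fun z => (gZ a z)%:E)).
  by apply/measurable_EFinP; exact: gZ_meas.
by move=> z; rewrite lee_fin gZ_ge0.
Qed.

Lemma am_cintg v w (u : Z -> R[i]) M : cmeas (u : (mt A * mt B)%type -> R[i]) ->
  (forall z, cmod (u z) <= M) ->
  cintg mnu (fun z => am v ((z : Z) + w) * u z).
Proof.
move=> mu_ uM.
have M0 : 0 <= M by exact: le_trans (cmod_ge0 (u 0)) (uM 0).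
apply: (@cintg_le _ _ _ _ _ (fun z : (mt A * mt B)%type =>
  (c * M)%:E * (gZ (pi / 2) ((z : Z) + (w - v)))%:E)%E).
- apply: cmeasM => //; apply: (ccont_cmeas (std_prod (gs_std gA) (gs_std gB))).
  by apply: am_ccont2; [exact: cont_cst | exact: (gs_addr gAB)].
- move=> z; rewrite -EFinM lee_fin cmodM am_cmod gZE (gGBC gAB) -addrA mulrAC.
  rewrite -[leRHS]mulrA -[leLHS]mulrA.
  by rewrite ler_wpM2l ?(ltW (gp_c gp))// ler_wpM2r// gG_ge0.
- rewrite ge0_integralZl_EFin.
  + apply: lte_mul_pinfty; rewrite ?lee_fin ?mulr_ge0 ?(ltW (gp_c gp))//.
    by rewrite gZ_int_shift ?gZ_int// divr_gt0// pi_gt0.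
  + by [].
  + by move=> z _; rewrite lee_fin gZ_ge0.
  + apply/measurable_EFinP; apply: (cont_measurable (std_prod (gs_std gA) (gs_std gB))).
    exact: (cont_comp (f := fun z : (mt A * mt B)%type => (z : Z) + (w - v) : (mt A * mt B)%type)
      (gs_addr gAB (a := w - v)) (gZ_cont (a := pi / 2))).
  + by rewrite mulr_ge0 ?(ltW (gp_c gp)).
Qed.

(** Moyal's formula at a fixed point t, before pairing with a function: the frequency integral is
    [am_inv], and the remaining integral over positions no longer depends on t after a
    translation. *)
Lemma reproducing v z0 z1 t :
  cint mnu (fun z => am v ((z : Z) + z0) * (pr (z0.2 - z1.2) z.1 * ts ((z : Z) + z1) phi t)) =
  kap0 z0 z1 * ts v phi t.
Proof.
pose u (z : Z) := pr (z0.2 - z1.2) z.1 * ts (z + z1) phi t.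
have mu_ : cmeas (u : (mt A * mt B)%type -> R[i]).
  apply: (ccont_cmeas (std_prod (gs_std gA) (gs_std gB))); apply: ccontM.
    exact: (ccont_comp (@cont_fst _ _) (pr_cont1 _)).
  by apply: ts_phi_ccont; [exact: (gs_addr gAB) | exact: cont_cst].
have iu : cintg mnu (fun z => am v ((z : Z) + z0) * u z).
  apply: (@am_cintg v z0 u 1) => // z.
  by rewrite /u cmodM (gp_norm gp) mul1r cmod_ts_phi (gG_le1 gA)// pi_ge0.
have [_ _ <-] := cfubini1 iu.
(* Positions occur as t - x, and the Gaussian is even; written in x - t the shifts change sign,
   whence the reflected points in [kap0]. *)
pose J (x : mt A) : R[i] := ts ((- z0.1 : A, z0.2) : (A * B)%type) phi x *
  (ts ((- z1.1 : A, z1.2) : (A * B)%type) phi x)^*.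
have iJ : cintg mu J by apply: cintg_inner; apply: tsL2; exact: phi_L2.
have E x : cint nu (fun y => am v ((x, y) + z0) * u (x, y)) =
    ts v phi t * J ((x : A) + - t).
  pose K := pr (z0.2 - z1.2) x * (pr (z1.2 - z0.2) t * phi (t - x - z1.1)).
  have E1 (y : mt B) : am v ((x, y : B) + z0) * u (x, y) =
      K * (am v (x + z0.1, (y : B) + z0.2) * pr ((y : B) + z0.2) t).
    rewrite /u /K /ts /= !opprD !addrA.
    have -> : pr ((y : B) + z1.2) t = pr (z1.2 - z0.2) t * pr ((y : B) + z0.2) t.
      by rewrite -(gp_Dl gp) [(y : B) + z0.2]addrC addrA subrK addrC.
    by ring.
  under eq_fun do rewrite E1.
  have [i1 i2] := am_inv v (x + z0.1) t.
  rewrite cintZ; last exact: (gs_cintg_shift gB z0.2 i1).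
  rewrite (gs_cint_shift gB z0.2 i1.1) i2 /K opprD addrA /J /ts /= !opprK.
  have s1 a : phi (x - t + a) = phi (t - x - a) by rewrite -phiN opprD opprB.
  rewrite !s1 rmorphM/= phi_conj !(gp_Dr gp) !prNr !(gp_Dl gp) !prNl.
  by rewrite rmorphM/= conjCK; ring.
under eq_fun do rewrite E.
rewrite cintZ; last exact: (gs_cintg_shift gA).
by rewrite (gs_cint_shift gA _ iJ.1) mulrC.
Qed.

(** Fubini turns [reproducing] into a statement about inner products. Absolute convergence holds
    because the ambiguity function is integrable and the t-integral is bounded by Cauchy-Schwarz
    uniformly in z. *)
Lemma moyal_atom v z0 z1 (h : A -> R[i]) : L2 h ->
  cintg mnu (fun z => am v ((z : Z) + z0) *
    (pr (z0.2 - z1.2) z.1 * inner (ts ((z : Z) + z1) phi) h)) /\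
  cint mnu (fun z => am v ((z : Z) + z0) *
    (pr (z0.2 - z1.2) z.1 * inner (ts ((z : Z) + z1) phi) h)) =
  kap0 z0 z1 * inner (ts v phi) h.
Proof.
move=> hL; have [mh _] := (L2P mu h).1 hL.
pose F (zt : (mt A * mt B) * mt A) : R[i] := am v ((zt.1 : Z) + z0) *
  (pr (z0.2 - z1.2) zt.1.1 * ts ((zt.1 : Z) + z1) phi zt.2) * (h zt.2)^*.
have sZ := std_prod (gs_std gA) (gs_std gB).
have mF : cmeas F.
  apply: cmeasM; last first.
    have m2 := @measurable_snd _ _ (mt A * mt B)%type (mt A).
    exact: (cmeas_conj (cmeas_comp m2 mh)).
  apply: (ccont_cmeas (std_prod sZ (gs_std gA))); apply: ccontM.
    apply: am_ccont2; first exact: cont_cst.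
    exact: (cont_comp (@cont_fst _ _) (gs_addr gAB (a := z0))).
  apply: ccontM.
    apply: (ccont_comp (h := fun zt : (mt A * mt B) * mt A => zt.1.1)).
      exact: (cont_comp (@cont_fst _ _) (@cont_fst _ _)).
    exact: pr_cont1.
  apply: ts_phi_ccont; last exact: cont_snd.
  exact: (cont_comp (@cont_fst _ _) (gs_addr gAB (a := z1))).
have M0 : 0 <= nrm mu phi * nrm mu h by rewrite mulr_ge0 ?nrm_ge0.
have iF : cintg (prod_measure mnu mu) F.
  split => //; rewrite tonelli1; last 2 first.
  - exact: cmeas_cmodE.
  - by move=> z; rewrite lee_fin cmod_ge0.
  apply: (@le_lt_trans _ _ (\int[mnu]_z ((nrm mu phi * nrm mu h)%:E *
     (cmod (am v ((z : Z) + z0) * 1))%:E)))%E.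
    apply: ge0_le_integral_nomeas => z.
      by apply: integral_ge0 => t _; rewrite lee_fin cmod_ge0.
    rewrite (_ : (fun t => _) = (fun t => (cmod (am v ((z : Z) + z0) * 1))%:E *
      (cmod (ts ((z : Z) + z1) phi t) * cmod (h t))%:E)%E); last first.
      apply/funext => t; rewrite -EFinM /F !cmodM (gp_norm gp) cmod_conj cmod1.
      by congr (_%:E); ring.
    have tL := tsL2 ((z : Z) + z1) phi_L2.
    rewrite ge0_integralZl_EFin ?cmod_ge0//.
    - rewrite muleC lee_wpmul2r ?lee_fin ?cmod_ge0//.
      by rewrite -(ts_nrm ((z : Z) + z1) phi_L2) integral_cmodM.
    - by move=> t _; rewrite lee_fin mulr_ge0 ?cmod_ge0.
    - apply/measurable_EFinP; apply: measurable_funM; apply: cmeas_cmod => //.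
      by have /L2P[] := tL.
  have [mA iA] := @am_cintg v z0 (fun=> 1) 1 (cmeas_cst _ _) (fun=> ltac:(rewrite cmod1//)).
  rewrite ge0_integralZl_EFin//.
  - by apply: lte_mul_pinfty; rewrite ?lee_fin.
  - by move=> z _; rewrite lee_fin cmod_ge0.
  - exact: cmeas_cmodE.
have E1 z : cint mu (fun t => F (z, t)) = am v ((z : Z) + z0) *
    (pr (z0.2 - z1.2) z.1 * inner (ts ((z : Z) + z1) phi) h).
  rewrite mulrA /inner -cintZ; last exact: (cintg_inner (tsL2 _ phi_L2) hL).
  by congr cint; apply/funext => t; rewrite /F /=; ring.
have [_ i1 i2] := cfubini1 iF.
split; first by move: i1; under eq_fun do rewrite E1.
have := cint_swap iF; under eq_fun do rewrite E1.
move=> ->.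
have E2 t : cint mnu (fun z => F (z, t)) = kap0 z0 z1 * (ts v phi t * (h t)^*).
  rewrite mulrA -reproducing [RHS]mulrC -cintZ; last first.
    apply: (@am_cintg v z0 (fun z => pr (z0.2 - z1.2) z.1 * ts (z + z1) phi t) 1).
      apply: (ccont_cmeas sZ); apply: ccontM.
        exact: (ccont_comp (@cont_fst _ _) (pr_cont1 _)).
      by apply: ts_phi_ccont; [exact: (gs_addr gAB) | exact: cont_cst].
    move=> z; rewrite cmodM (gp_norm gp) mul1r cmod_ts_phi (gG_le1 gA)//.
    exact: pi_ge0.
  by congr cint; apply/funext => z; rewrite /F /=; ring.
under eq_fun do rewrite E2.
by rewrite cintZ//; exact: (cintg_inner (tsL2 _ phi_L2) hL).
Qed.

End GPlane.

(** * Finite spans of atoms and their S0 norm *)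

Section Span.
Context (R : realType) (A B : tgroup).
Variables (mu : {sigma_finite_measure set (mt A) -> \bar R})
  (nu : {sigma_finite_measure set (mt B) -> \bar R})
  (NA : A -> R) (kA : set A) (hA : A -> A) (NB : B -> R) (kB : set B) (hB : B -> B).
Hypotheses (gA : gspace mu NA kA hA) (gB : gspace nu NB kB hB).
Variables (pr : B -> A -> R[i]) (c : R).
Hypothesis gp : gpair mu nu NA kA NB kB pr c.
Local Notation Z := (tgprod A B).
Local Notation mnu := (prod_measure mu nu).
Local Notation P := (gplane mu nu NA kA pr).
Local Notation L2 := (cLspace mu 2%:E).
Local Notation inner := (inner mu).
Local Notation phi := (phi NA kA).
Local Notation ts := (ts pr).
Local Notation am := (am mu NA kA pr).
Local Notation kap0 := (kap0 mu NA kA pr).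
Local Notation gZ := (gZ NA kA NB kB).
Local Notation nrm := (nrm mu).
Implicit Types (z w v : Z).

Let gAB := prod_gspace gA gB.
Let sZ := std_prod (gs_std gA) (gs_std gB).
Let phiL := phi_L2 gA.

(** Lists of coefficients and points, where [SC] uses families over ordinals: induction,
    concatenation and mapping are then available. *)
Definition atoms (s : seq (R[i] * Z)) : A -> R[i] :=
  fun t => \sum_(p <- s) p.1 * ts p.2 phi t.

Lemma SCP f : SC P f <-> exists s, f = atoms s.
Proof.
split => [[m [a [z ->]]]|[s ->]].
  exists [seq (a i, z i) | i <- enum 'I_m]; apply/funext => t.
  by rewrite /atoms big_map -big_enum.
exists (size s), (fun i => (tnth (in_tuple s) i).1), (fun i => (tnth (in_tuple s) i).2).
by apply/funext => t; rewrite /atoms (big_tnth _ _ s).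
Qed.

Lemma atoms_lin a s s' : (fun t => a * atoms s t + atoms s' t) =
  atoms ([seq (a * p.1, p.2) | p <- s] ++ s').
Proof.
apply/funext => t; rewrite /atoms big_cat big_map mulr_sumr; congr (_ + _).
by apply: eq_bigr => p _; rewrite mulrA.
Qed.

Lemma SC_lin a f g : SC P f -> SC P g -> SC P (fun t => a * f t + g t).
Proof.
by move=> /SCP[s ->] /SCP[s' ->]; apply/SCP; rewrite atoms_lin; eexists.
Qed.

Lemma SC_0 : SC P (fun=> 0).
Proof. by apply/SCP; exists [::]; apply/funext => t; rewrite /atoms big_nil. Qed.

Lemma ts_atoms w s : ts w (atoms s) =
  atoms [seq (p.1 * (pr p.2.2 w.1)^*, (w + p.2 : Z)) | p <- s].
Proof.
apply/funext => t; rewrite /atoms big_map {1}/ts mulr_sumr.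
apply: eq_bigr => p _.
have := ts_ts gp w p.2 phi => /(congr1 (fun f => f t)); rewrite {1}/ts => E.
by rewrite mulrCA E mulrA.
Qed.

Lemma SC_ts w f : SC P f -> SC P (ts w f).
Proof. by move=> /SCP[s ->]; apply/SCP; rewrite ts_atoms; eexists. Qed.

Lemma ts0 f : ts 0 f = f.
Proof. by apply/funext => t; rewrite /ts (pr0l gp) mul1r subr0. Qed.

Lemma phi_atom : phi = atoms [:: (1, 0)].
Proof. by apply/funext => t; rewrite /atoms big_seq1 ts0 mul1r. Qed.

Lemma SC_phi z : SC P (ts z phi).
Proof. by apply: SC_ts; apply/SCP; exists [:: (1, 0)]; exact: phi_atom. Qed.

Lemma SC_L2 f : SC P f -> L2 f.
Proof.
move=> /SCP[s ->]; rewrite /atoms; elim: s => [|p s ih].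
  by under eq_fun do rewrite big_nil; exact: L2_0.
under eq_fun do rewrite big_cons.
by apply: L2D => //; apply: L2Z; exact: (tsL2 gA gp).
Qed.

Lemma inner_atoms s h : L2 h ->
  inner (atoms s) h = \sum_(p <- s) p.1 * inner (ts p.2 phi) h.
Proof.
move=> hL; rewrite /atoms; elim: s => [|p s ih].
  rewrite big_nil; under [X in inner X]eq_fun do rewrite big_nil.
  rewrite /inner -[RHS](cint0 mu); congr cint.
  by apply/funext => t; rewrite mul0r.
have sL : L2 (fun t => \sum_(q <- s) q.1 * ts q.2 phi t).
  by apply: SC_L2; apply/SCP; exists s.
have tL := tsL2 gA gp p.2 phiL.
rewrite big_cons -ih -(innerZl _ tL hL) -(innerDl (L2Z _ tL) sL hL).
by congr inner; apply/funext => t; rewrite big_cons.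
Qed.

Lemma cmod_inner_atoms s w : cmod (inner (atoms s) (ts w phi)) <=
  \sum_(p <- s) cmod p.1 * (c * gZ (pi / 2) (p.2 - w)).
Proof.
rewrite inner_atoms; last exact: (tsL2 gA gp).
apply: le_trans (cmod_sum _ _ _) _; apply: ler_sum => p _.
by rewrite cmodM (am_cmod gA gB gp).
Qed.

Lemma inner_atoms_ccont (S : topologicalType) (f : S -> (mt A * mt B)%type) s :
  continuous f -> ccont (fun x => inner (atoms s) (ts (f x) phi)).
Proof.
move=> cf.
rewrite (_ : (fun x => _) = (fun x => \sum_(p <- s) p.1 * am p.2 (f x))); last first.
  by apply/funext => x; rewrite inner_atoms//; exact: (tsL2 gA gp).
apply: ccont_sum => p; apply: ccontM; first exact: ccont_cst.
by apply: (am_ccont2 gA gB gp) => //; exact: cont_cst.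
Qed.

Lemma atoms_ccont s : ccont (atoms s : mt A -> R[i]).
Proof.
apply: ccont_sum => p; apply: ccontM; first exact: ccont_cst.
by apply: (ts_phi_ccont gA gp); [exact: cont_cst | exact: cont_id].
Qed.

Definition sn h : \bar R := (\int[mnu]_v (cmod (inner h (ts v phi)))%:E)%E.

Lemma snE h : S0norm P h = sn h.
Proof. exact: cLnorm1E. Qed.

Lemma sn_ge0 h : (0 <= sn h)%E.
Proof. by apply: integral_ge0 => v _; rewrite lee_fin cmod_ge0. Qed.

Lemma gZ_fin a : 0 < a -> exists I : R, (\int[mnu]_z (gZ a z)%:E)%E = I%:E.
Proof.
move=> a0; exists (fine (\int[mnu]_z (gZ a z)%:E)%E); rewrite fineK// ge0_fin_numE.
  exact: (gZ_int gA gB).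
by apply: integral_ge0 => z _; rewrite lee_fin gZ_ge0.
Qed.

Lemma gZ_int_sub a w : 0 < a -> (\int[mnu]_z (gZ a (w - (z : Z)))%:E =
  \int[mnu]_z (gZ a z)%:E)%E.
Proof.
move=> a0; rewrite -(gZ_int_shift gA gB (- w) a0).
by apply: eq_integral => z _; rewrite !gZE (gGBC gAB).
Qed.

Lemma gZ_sub_meas (a : R) w :
  measurable_fun setT (fun z : mt A * mt B => (gZ a (w - (z : Z)))%:E).
Proof.
apply/measurable_EFinP; apply: (cont_measurable sZ).
apply: (cont_comp (f := fun z : mt A * mt B => w - (z : Z) : mt A * mt B)).
  by apply: (gs_contB gAB); [exact: cont_cst | exact: cont_id].
exact: (gZ_cont gA gB).
Qed.

Lemma atoms_sn_fin s : (sn (atoms s) < +oo)%E.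
Proof.
have pi2 : 0 < pi / 2 :> R by rewrite divr_gt0// pi_gt0.
have c0 := ltW (gp_c gp).
apply: (@le_lt_trans _ _ (\int[mnu]_v (\sum_(p <- s)
   ((cmod p.1 * c)%:E * (gZ (pi / 2) (p.2 - (v : Z)))%:E)))%E).
  apply: ge0_le_integral_nomeas => v; first by rewrite lee_fin cmod_ge0.
  apply: le_trans (_ : (\sum_(p <- s) cmod p.1 * (c * gZ (pi / 2) (p.2 - v)))%:E <= _)%E.
    by rewrite lee_fin cmod_inner_atoms.
  by rewrite -sumEFin; under eq_bigr do rewrite mulrA EFinM.
rewrite ge0_integral_sum//.
- elim: s => [|p s ih]; first by rewrite big_nil.
  rewrite big_cons; apply: lte_add_pinfty => //.
  rewrite ge0_integralZl_EFin ?mulr_ge0 ?cmod_ge0//.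
  + rewrite gZ_int_sub//; apply: lte_mul_pinfty; rewrite ?lee_fin ?mulr_ge0 ?cmod_ge0//.
    exact: (gZ_int gA gB).
  + by move=> v _; rewrite lee_fin gZ_ge0.
  + exact: gZ_sub_meas.
- by move=> p; apply: emeasurable_funM => //; exact: gZ_sub_meas.
- by move=> p v _; rewrite mule_ge0// lee_fin ?mulr_ge0 ?cmod_ge0// gG_ge0.
Qed.

Lemma SC_S0 f : SC P f -> S0 P f.
Proof.
move=> fS; split; first exact: SC_L2.
move: fS => /SCP[s ->].
have m : cmeas (stft P (tf_gauss P) (atoms s)).
  by apply: (ccont_cmeas sZ); exact: (@inner_atoms_ccont _ (fun z : (mt A * mt B)%type => z) s (@cont_id _)).
by split; [exact: m.1 | exact: m.2 | rewrite -/(S0norm P (atoms s)) snE atoms_sn_fin].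
Qed.

(** The set where f is nonzero is open, and nonempty open sets have positive measure. *)
Lemma cont_ae0 (f : A -> R[i]) : ccont (f : mt A -> R[i]) ->
  ceq_ae mu f (fun=> 0) -> forall x, f x = 0.
Proof.
move=> cf [N [mN N0 sub]] x; apply/eqP; apply: contrapT => /negP fx.
pose U : set (mt A) := [set y | 0 < cmod (f y)].
have Uo : open U.
  apply: (@open_comp _ _ (fun y : mt A => cmod (f y)) [set r | 0 < r]).
    by move=> y _; exact: ccont_cmod.
  exact: open_gt.
have : (0 < mu U)%E.
  by apply: (gs_pos gA) => //; exists x; rewrite /U/= lt0r cmod_eq0 fx cmod_ge0.
apply/negP; rewrite -leNgt -N0; apply: le_measure; rewrite ?inE//.
  exact: (gs_std gA).2.
move=> y Uy; apply: sub => /= fy; move: Uy.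
by rewrite /U/= fy cmod0 ltxx.
Qed.

Definition kapS z0 s : R[i] := \sum_(p <- s) p.1 * kap0 z0 p.2.

(** As a function of z0 this constant is the pairing of the atoms with t -> conj (atoms s (- t)). If
    it vanished identically, that function would be orthogonal to all atoms, hence to itself. *)
Lemma kapS_neq0 s : atoms s <> (fun=> 0) -> exists z0, kapS z0 s != 0.
Proof.
move=> s0; apply: contrapT => /forallNP h; apply: s0.
pose rf z : Z := (- z.1, z.2).
pose s' := [seq ((p.1)^*, rf p.2) | p <- s].
have L' : L2 (atoms s') by apply: SC_L2; apply/SCP; exists s'.
have k z0 : kapS z0 s = inner (ts (rf z0) phi) (atoms s').
  rewrite (inner_conj L' (tsL2 gA gp _ phiL)) inner_atoms; last exact: (tsL2 gA gp).
  rewrite rmorph_sum big_map; apply: eq_bigr => p _ /=.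
  rewrite rmorphM/= conjCK /kap0 -inner_conj//; exact: (tsL2 gA gp).
have z' : ceq_ae mu (atoms s') (fun=> 0).
  apply: (nsq0_ae L'); apply: (@complexI R); rewrite -inner_self inner_atoms//.
  rewrite big_map big1// => p _ /=.
  by have := h p.2; rewrite k => /negP/negPn/eqP ->; rewrite mulr0.
have z'' := cont_ae0 (atoms_ccont s') z'.
apply/funext => t; apply: (can_inj conjCK); rewrite rmorph0 -(z'' (- t)).
rewrite /atoms rmorph_sum big_map; apply: eq_bigr => p _ /=.
rewrite rmorphM/= /ts/= rmorphM/= (phi_conj) (prNr gp) opprK.
by rewrite -(phiN gA) opprB addrC.
Qed.

(** The short-time Fourier transform of an atom with window [ts z0 phi]. The freedom in z0 lets the
    analysing window pair nontrivially with any nonzero [atoms s]. *)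
Definition vg z0 v z := inner (ts v phi) (ts z (ts z0 phi)).

Lemma vgE z0 v z : vg z0 v z = pr z0.2 z.1 * am v (z + z0).
Proof.
have tL := tsL2 gA gp _ phiL.
rewrite /vg (ts_ts gp) innerZr//; first by rewrite conjCK.
Qed.

Lemma moyal v z0 s h : L2 h ->
  cintg mnu (fun z => vg z0 v z * inner (ts z (atoms s)) h) /\
  cint mnu (fun z => vg z0 v z * inner (ts z (atoms s)) h) =
    kapS z0 s * inner (ts v phi) h.
Proof.
move=> hL.
have E (z : mt A * mt B) : vg z0 v z * inner (ts z (atoms s)) h =
    \sum_(p <- s) p.1 * (am v ((z : Z) + z0) *
    (pr (z0.2 - p.2.2) z.1 * inner (ts ((z : Z) + p.2) phi) h)).
  rewrite ts_atoms inner_atoms// big_map mulr_sumr; apply: eq_bigr => p _ /=.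
  by rewrite vgE (gp_Dl gp) (prNl gp); ring.
under eq_fun do rewrite E.
have M p := moyal_atom gA gB gp v z0 p hL.
split; first by apply: cintg_sum => p; apply: cintgZ; exact: (M p.2).1.
rewrite cint_sum => [|p]; last by apply: cintgZ; exact: (M p.2).1.
rewrite /kapS mulr_suml; apply: eq_bigr => p _.
by rewrite cintZ ?(M p.2).2 ?mulrA//; exact: (M p.2).1.
Qed.

Lemma SC_inner_meas f : SC P f ->
  cmeas (fun x : mt A * mt B => inner f (ts x phi)).
Proof.
move=> /SCP[s ->]; apply: (ccont_cmeas sZ).
exact: (@inner_atoms_ccont _ (fun z : (mt A * mt B)%type => z) s (@cont_id _)).
Qed.

Lemma sn_lin a f g : SC P f -> SC P g ->
  (sn (fun t => (a * f t + g t)%R) <= (cmod a)%:E * sn f + sn g)%E.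
Proof.
move=> fS gS; have fL := SC_L2 fS; have gL := SC_L2 gS.
have mf := cmeas_cmodE (SC_inner_meas fS); have mg := cmeas_cmodE (SC_inner_meas gS).
have f0 (v : mt A * mt B) : (0 <= (cmod (inner f (ts v phi)))%:E)%E by rewrite lee_fin cmod_ge0.
rewrite -ge0_integralZl_EFin ?cmod_ge0// -ge0_integralD//; last 3 first.
- by move=> v _; rewrite mule_ge0// lee_fin cmod_ge0.
- exact: emeasurable_funM.
- by move=> v _; rewrite lee_fin cmod_ge0.
apply: ge0_le_integral_nomeas => v; first by rewrite lee_fin cmod_ge0.
have tL := tsL2 gA gp v phiL.
rewrite (innerDl (L2Z a fL) gL tL) innerZl// -EFinM -EFinD lee_fin -cmodM.
exact: cmodD.
Qed.

(** The transform of the difference has two bounds: one by its L^2 norm, small but not integrable,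
    and one by two Gaussians, integrable but not small. Their geometric mean is both; the square
    root turns the exponent pi / 2 into pi / 4. *)
Lemma sn_shift_atom p z z' :
  (sn (fun t => (ts z (ts p phi) t - ts z' (ts p phi) t)%R) <=
   (Num.sqrt (nrm (fun t => (ts z (ts p phi) t - ts z' (ts p phi) t)%R)) *
    (Num.sqrt (nrm phi * c) * (2 * fine (\int[mnu]_v (gZ (pi / 4) v)%:E)%E)))%:E)%E.
Proof.
have pi4 : 0 < pi / 4 :> R by rewrite divr_gt0// pi_gt0.
have pi4E : pi / 4 + pi / 4 = pi / 2 :> R by field.
have c0 := ltW (gp_c gp).
pose f z := ts z (ts p phi); rewrite -/(f z) -/(f z').
have fL x : L2 (f x) by apply: (tsL2 gA gp); exact: (tsL2 gA gp).
set h := fun t => f z t - f z' t.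
have hL : L2 h by exact: L2B.
set M := nrm h; have M0 : 0 <= M by exact: nrm_ge0.
have [I4 I4E] := gZ_fin pi4; rewrite I4E /=.
have fb x v : cmod (inner (f x) (ts v phi)) = c * gZ (pi / 4) (x + p - v) ^+ 2.
  have E := ts_ts gp x p phi; rewrite /f E innerZl; try exact: (tsL2 gA gp).
  rewrite cmodM cmod_conj (gp_norm gp) mul1r (am_cmod gA gB gp) expr2 !gZE gGM.
  by rewrite pi4E.
have bnd v : cmod (inner h (ts v phi)) <= Num.sqrt M * Num.sqrt (nrm phi * c) *
   (gZ (pi / 4) (z + p - v) + gZ (pi / 4) (z' + p - v)).
  have tL := tsL2 gA gp v phiL.
  have b1 : cmod (inner h (ts v phi)) <= M * nrm phi.
    by rewrite -(ts_nrm gA gp v phiL); exact: cauchy_schwarz.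
  have b2 : cmod (inner h (ts v phi)) <= c * (gZ (pi / 4) (z + p - v) ^+ 2 + gZ (pi / 4) (z' + p - v) ^+ 2).
    by rewrite mulrDr -!fb /h innerBl// cmodB.
  have a0 := gZ_ge0 NA kA NB kB (pi / 4) (z + p - v).
  have a0' := gZ_ge0 NA kA NB kB (pi / 4) (z' + p - v).
  move: b1 b2 a0 a0'; move: (gZ _ (z + p - v)) (gZ _ (z' + p - v)) => a a' b1 b2 a0 a0'.
  have := cmod_ge0 (inner h (ts v phi)); move: b1 b2; move: (cmod _) => X b1 b2 x0.
  have n0 := nrm_ge0 mu phi.
  rewrite -(@ler_pXn2r _ 2) ?nnegrE//; last by rewrite !mulr_ge0 ?sqrtr_ge0 ?addr_ge0.
  rewrite !exprMn !sqr_sqrtr ?mulr_ge0//.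
  apply: le_trans (_ : (M * nrm phi) * (c * (a ^+ 2 + a' ^+ 2)) <= _).
    by rewrite [leLHS]expr2; apply: ler_pM.
  have -> : M * (nrm phi * c) * (a + a') ^+ 2 = (M * nrm phi) * (c * (a + a') ^+ 2) by ring.
  rewrite ler_wpM2l ?mulr_ge0// ler_wpM2l//.
  rewrite sqrrD addrAC lerDl mulrn_wge0// mulr_ge0//.
pose K := Num.sqrt M * Num.sqrt (nrm phi * c).
have K0 : 0 <= K by rewrite mulr_ge0 ?sqrtr_ge0.
apply: (@le_trans _ _ (\int[mnu]_v (K%:E * ((gZ (pi / 4) (z + p - (v : Z)))%:E +
    (gZ (pi / 4) (z' + p - (v : Z)))%:E))))%E.
  apply: ge0_le_integral_nomeas => v; first by rewrite lee_fin cmod_ge0.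
  by rewrite -EFinD -EFinM lee_fin; exact: bnd.
rewrite ge0_integralZl_EFin//.
- rewrite ge0_integralD//; try exact: gZ_sub_meas; try by move=> v _; rewrite lee_fin gZ_ge0.
  rewrite (gZ_int_sub (z + p) pi4) (gZ_int_sub (z' + p) pi4) I4E -EFinD -EFinM.
  by rewrite mulr_natl mulr2n /K -mulrA.
- by move=> v _; rewrite -EFinD lee_fin addr_ge0// gZ_ge0.
- by apply: emeasurable_funD; exact: gZ_sub_meas.
Qed.

(** Shifts preserve the norm, so the squared distance is twice [nsq mu phi] minus twice the real
    part of an ambiguity function, which is explicit and continuous. *)
Lemma nsq_shift_cont p z : continuous (fun z' : mt A * mt B =>
  nsq mu (fun t => ts z (ts p phi) t - ts z' (ts p phi) t)).
Proof.
have fL x : L2 (ts x (ts p phi)) by apply: (tsL2 gA gp); exact: (tsL2 gA gp).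
have E (z' : mt A * mt B) : nsq mu (fun t => ts z (ts p phi) t - ts z' (ts p phi) t) =
  2 * nsq mu phi - 2 * complex.Re (((pr p.2 z.1)^* * pr p.2 z'.1) * am (z + p) ((z' : Z) + p)).
  have -> : (fun t => ts z (ts p phi) t - ts z' (ts p phi) t) =
     (fun t => ts z (ts p phi) t - 1 * ts z' (ts p phi) t).
    by apply/funext => t; rewrite mul1r.
  rewrite nsqB// cmod1 expr1n mul1r.
  have n1 x : nsq mu (ts x (ts p phi)) = nsq mu phi.
    by rewrite (ts_L2 gA gp x (tsL2 gA gp p phiL)).2 (ts_L2 gA gp p phiL).2.
  rewrite !n1 (ts_ts gp z) (ts_ts gp z') innerZl ?innerZr; try apply: L2Z; try exact: (tsL2 gA gp).
  rewrite rmorph1 mul1r conjCK -/(am _ _) [X in complex.Re X]mulrA.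
  by move: (complex.Re _) => x; ring.
under eq_fun do rewrite E.
have cc : ccont (fun z' : mt A * mt B =>
    ((pr p.2 z.1)^* * pr p.2 z'.1) * am (z + p) ((z' : Z) + p)).
  apply: ccontM.
    apply: ccontM; first exact: ccont_cst.
    exact: (ccont_comp (@cont_fst _ _) (pr_cont1 gp _)).
  by apply: (am_ccont2 gA gB gp); [exact: cont_cst | exact: (gs_addr gAB)].
move=> x; apply: cvgB; first exact: cvg_cst.
by apply: cvgM; [exact: cvg_cst | exact: cc.1].
Qed.

(** Continuity of z -> ts z (atoms s) in the S0 norm. It makes bounded functionals continuous along
    shifts and lets step functions approximate this map. *)
Lemma S0_shift_cont s z e : 0 < e ->
  nbhs (z : mt A * mt B) [set z' : mt A * mt B |
    (sn (fun t => (ts z (atoms s) t - ts z' (atoms s) t)%R) <= e%:E)%E].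
Proof.
elim: s e => [|p s ih] e e0.
  apply: (@filterS _ _ (@nbhs_filter (mt A * mt B)%type z) setT); last exact: (@filterT _ _ (@nbhs_filter (mt A * mt B)%type z)).
  move=> z' _ /=.
  rewrite (_ : (fun t => _) = (fun=> 0)); last first.
    by apply/funext => t; rewrite /ts /atoms !big_nil !mulr0 subr0.
  rewrite /sn (_ : (fun v => _) = cst 0%E) ?integral0 ?lee_fin ?ltW//.
  apply/funext => v /=; rewrite /inner (_ : (fun x => _) = (fun=> 0)) ?cint0 ?cmod0//.
  by apply/funext => t; rewrite mul0r.
set Q := Num.sqrt (nrm phi * c) * (2 * fine (\int[mnu]_v (gZ (pi / 4) v)%:E)%E).
(* One square root comes from [sn_shift_atom], the other from passing from the squared norm to the
   norm. *)
pose F (z' : mt A * mt B) : R := cmod p.1 * (Num.sqrt (Num.sqrt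
  (nsq mu (fun t => ts z (ts p.2 phi) t - ts z' (ts p.2 phi) t))) * Q).
have cF : continuous F.
  move=> x; apply: cvgM; first exact: cvg_cst.
  apply: cvgM; last exact: cvg_cst.
  have c1 := @cont_comp (mt A * mt B)%type R R _ _ (nsq_shift_cont (p := p.2) (z := z)) (@sqrt_continuous R).
  exact: (@cont_comp (mt A * mt B)%type R R _ _ c1 (@sqrt_continuous R) x).
have F0 : F z = 0.
  rewrite /F (_ : (fun t => _) = (fun=> 0)); last by apply/funext => t; rewrite subrr.
  have -> : nsq mu (fun=> 0) = 0.
    by rewrite /nsq /L2n; under eq_integral do rewrite cmod0 expr0n/=; rewrite integral0.
  by rewrite !sqrtr0 mul0r mulr0.
have n1 : nbhs (z : mt A * mt B) [set z' | F z' < e / 2].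
  by apply: (cvgr_lt _ (cF z)); rewrite F0 divr_gt0.
have n2 := ih (e / 2) (divr_gt0 e0 (ltr0n _ 2)).
apply: (@filterS2 _ _ (@nbhs_filter (mt A * mt B)%type z) _ _ _ _ n1 n2) => z' /= h1 h2.
have E : (fun t => ts z (atoms (p :: s)) t - ts z' (atoms (p :: s)) t) =
  (fun t => p.1 * (ts z (ts p.2 phi) t - ts z' (ts p.2 phi) t) +
    (ts z (atoms s) t - ts z' (atoms s) t)).
  by apply/funext => t; rewrite /atoms /ts !big_cons /ts; ring.
have SB f g : SC P f -> SC P g -> SC P (fun t => f t - g t).
  move=> fS gS; have := SC_lin (-1) gS fS.
  by under eq_fun do rewrite mulN1r addrC.
rewrite E; apply: le_trans (sn_lin _ _ _) _.
- by apply: SB; apply: SC_ts; exact: SC_phi.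
- by apply: SB; apply: SC_ts; apply/SCP; exists s.
have -> : e = e / 2 + e / 2 by field.
rewrite EFinD leeD//; apply: le_trans (lee_wpmul2l _ (sn_shift_atom _ _ _)) _.
  by rewrite lee_fin cmod_ge0.
by rewrite -EFinM lee_fin; exact: ltW.
Qed.

End Span.

(** * The reproducing formula for functionals *)

Section Tail.
Context d (T : measurableType d) (R : realType).
Variable mu : {measure set T -> \bar R}.

Lemma cvg_tail (G : T -> R[i]) (U : nat -> set T) : cintg mu G ->
  (forall j, measurable (U j)) -> (forall x, exists j, U j x) ->
  (\int[mu]_x (cmod (G x) * \1_(~` \big[setU/set0]_(j < n) U j) x)%:E)%E @[n --> \oo]
    --> (0%E : \bar R).
Proof.
move=> iG mU cU.
have -> : 0%E = (\int[mu]_x (cst (0%E : \bar R) x))%E by rewrite integral0.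
apply: (@dominated_cvg _ _ _ mu setT measurableT _ _ (fun x => (cmod (G x))%:E)).
- move=> n; apply/measurable_EFinP/measurable_funM; first exact: cmeas_cmod iG.1.
  by apply: measurable_indic; apply: measurableC; apply: bigsetU_measurable.
- move=> x _; apply: cvg_near_cst; have [j Uj] := cU x.
  exists j.+1 => // n /= jn; rewrite indicE memNset ?mulr0//= => h; apply: h.
  by rewrite -bigcup_mkord; exists j.
- by [].
- apply/integrableP; split; first exact: cmeas_cmodE iG.1.
  under eq_integral do rewrite gee0_abs ?lee_fin ?cmod_ge0//.
  exact: iG.2.
- by move=> n x _; rewrite gee0_abs ?lee_fin ?mulr_ge0 ?cmod_ge0// ler_piMr ?cmod_ge0// indicE lern1 leq_b1.
Qed.

(** The error of the step function with value [q (x j)] on [E j] for j < n and 0 elsewhere. *)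
Definition stepd (E : nat -> set T) (x : nat -> T) n (q : T -> R[i]) (z : T) : R[i] :=
  q z - \sum_(j <- iota 0 n) (\1_(E j) z)%:C * q (x j).

Lemma stepd_in E x n q z j : trivIset setT E -> (j < n)%N -> E j z ->
  stepd E x n q z = q z - q (x j).
Proof.
move=> tE jn Ez; rewrite /stepd (bigD1_seq j) ?mem_iota ?iota_uniq//=.
rewrite indicE mem_set// mul1r big1 ?addr0// => i ij.
rewrite indicE memNset ?mul0r// => Ei; move/eqP: ij; apply.
by apply: tE => //; exists z.
Qed.

Lemma stepd_out E x n q z : (forall j, (j < n)%N -> ~ E j z) ->
  stepd E x n q z = q z.
Proof.
move=> h; rewrite /stepd big_seq big1 ?subr0// => j.
by rewrite mem_iota add0n => /h jz; rewrite indicE memNset ?mul0r.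
Qed.

Lemma stepd_int E x n q G : (forall j, measurable (E j)) -> cintg mu G ->
  cintg mu (fun z => G z * q z) ->
  cintg mu (fun z => G z * stepd E x n q z) /\
  cint mu (fun z => G z * stepd E x n q z) = cint mu (fun z => G z * q z) -
    \sum_(j <- iota 0 n) cint mu (fun z => G z * (\1_(E j) z)%:C) * q (x j).
Proof.
move=> mE iG iGq.
have iE j : cintg mu (fun z => G z * (\1_(E j) z)%:C).
  apply: (@cintg_le _ _ _ _ _ (fun z => (cmod (G z))%:E)); last exact: iG.2.
    by apply: cmeasM; [exact: iG.1 | apply: cmeas_real; exact: measurable_indic].
  move=> z; rewrite lee_fin cmodM cmod_real ger0_norm ?indicE//.
  by rewrite ler_piMr ?cmod_ge0// lern1 leq_b1.
have EE : (fun z => G z * stepd E x n q z) = (fun z => G z * q z -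
    \sum_(j <- iota 0 n) q (x j) * (G z * (\1_(E j) z)%:C)).
  apply/funext => z; rewrite /stepd mulrBr mulr_sumr; congr (_ - _).
  by apply: eq_bigr => j _; ring.
rewrite EE.
have iS : cintg mu (fun z => \sum_(j <- iota 0 n) q (x j) * (G z * (\1_(E j) z)%:C)).
  by apply: cintg_sum => j; exact: cintgZ.
split; first exact: cintgB.
rewrite cintB// cint_sum => [|j]; last exact: cintgZ.
by congr (_ - _); apply: eq_bigr => j _; rewrite cintZ// mulrC.
Qed.

End Tail.

Lemma ccontP (R : realType) (S : topologicalType) (F : S -> R[i]) :
  (forall z e, 0 < e -> nbhs z [set z' | cmod (F z - F z') <= e]) -> ccont F.
Proof.
move=> key; split => z; apply/(@cvgrPdist_le _ _ _ _ (nbhs_filter z)) => e e0.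
  apply: (@filterS _ _ (nbhs_filter z) _ _ _ (key z e e0)) => z'.
  by rewrite /= -ReN -ReD; apply: le_trans; exact: Re_le_cmod.
apply: (@filterS _ _ (nbhs_filter z) _ _ _ (key z e e0)) => z'.
by rewrite /= -ImN -ImD; apply: le_trans; exact: Im_le_cmod.
Qed.

Section Riemann.
Context (R : realType) (A B : tgroup).
Variables (mu : {sigma_finite_measure set (mt A) -> \bar R})
  (nu : {sigma_finite_measure set (mt B) -> \bar R})
  (NA : A -> R) (kA : set A) (hA : A -> A) (NB : B -> R) (kB : set B) (hB : B -> B).
Hypotheses (gA : gspace mu NA kA hA) (gB : gspace nu NB kB hB).
Variables (pr : B -> A -> R[i]) (c : R).
Hypothesis gp : gpair mu nu NA kA NB kB pr c.
Local Notation Z := (tgprod A B).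
Local Notation mnu := (prod_measure mu nu).
Local Notation P := (gplane mu nu NA kA pr).
Local Notation inner := (inner mu).
Local Notation phi := (phi NA kA).
Local Notation ts := (ts pr).
Local Notation am := (am mu NA kA pr).
Local Notation atoms := (atoms NA kA pr).
Local Notation vg := (vg mu NA kA pr).
Local Notation kapS := (kapS mu NA kA pr).
Local Notation sn := (sn mu nu NA kA pr).
Implicit Types (z w v : Z).

Let gAB := prod_gspace gA gB.
Let sZ := std_prod (gs_std gA) (gs_std gB).
Let phiL := phi_L2 gA.

Lemma Zint_shift (F : mt A * mt B -> \bar R) w : measurable_fun setT F ->
  (forall z, 0 <= F z)%E -> (\int[mnu]_z F ((z : Z) + w)%R = \int[mnu]_z F z)%E.
Proof. exact: (gs_int_shift gAB w (F := F)). Qed.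

(** A shift translates the short-time Fourier transform up to a unimodular factor, and the product
    measure is invariant. *)
Lemma sn_ts z f : SC P f -> sn (ts z f) = sn f.
Proof.
move=> fS; rewrite /Submission.sn.
have mf := cmeas_cmodE (SC_inner_meas gA gB gp fS).
rewrite -(Zint_shift (- z) mf); last by move=> v; rewrite lee_fin cmod_ge0.
apply: eq_integral => w _; congr (_%:E).
have fL := SC_L2 gA gp fS.
have -> : ts w phi = fun t => (pr ((w : Z) - z).2 z.1) * ts z (ts ((w : Z) - z) phi) t.
  apply/funext => t; rewrite (ts_ts gp) mulrA (pr_conjM gp) mul1r addrC subrK//.
have tL := tsL2 gA gp ((w : Z) - z) phiL.
rewrite innerZr ?cmodM ?cmod_conj ?(gp_norm gp) ?mul1r; try exact: (tsL2 gA gp).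
rewrite (ts_inner gA gp)//; exact: (cintg_inner fL tL).1.
Qed.

Lemma SC_sum I (r : seq I) (b : I -> R[i]) (g : I -> A -> R[i]) :
  (forall i, SC P (g i)) -> SC P (fun t => \sum_(i <- r) b i * g i t).
Proof.
move=> gS; elim: r => [|i r ih].
  by under eq_fun do rewrite big_nil; exact: SC_0.
by under eq_fun do rewrite big_cons; apply: SC_lin.
Qed.

Section Functional.
Variable l : (A -> R[i]) -> R[i].
Hypothesis lD : forall a f g, SC P f -> SC P g ->
  l (fun t => a * f t + g t) = a * l f + l g.

Lemma fun_l0 : l (fun=> 0) = 0.
Proof.
have := lD (f := fun=> 0) (g := fun=> 0) 1 (SC_0 mu nu NA kA pr) (SC_0 mu nu NA kA pr).
under eq_fun do rewrite mulr0 addr0.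
by rewrite mul1r => /eqP; rewrite addrC -subr_eq subrr => /eqP.
Qed.

Lemma SC_Z a f : SC P f -> SC P (fun t => a * f t).
Proof.
move=> fS; have := SC_lin a fS (SC_0 mu nu NA kA pr).
by under eq_fun do rewrite addr0.
Qed.

Lemma SC_B f g : SC P f -> SC P g -> SC P (fun t => f t - g t).
Proof.
move=> fS gS; have := SC_lin (-1) gS fS.
by under eq_fun do rewrite mulN1r addrC.
Qed.

Lemma fun_lZ a f : SC P f -> l (fun t => a * f t) = a * l f.
Proof.
move=> fS; rewrite -[RHS]addr0 -fun_l0 -(lD _ fS (SC_0 mu nu NA kA pr)).
by congr l; apply/funext => t; rewrite addr0.
Qed.

Lemma fun_lsum I (r : seq I) (b : I -> R[i]) (g : I -> A -> R[i]) :
  (forall i, SC P (g i)) ->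
  l (fun t => \sum_(i <- r) b i * g i t) = \sum_(i <- r) b i * l (g i).
Proof.
move=> gS; elim: r => [|i r ih].
  by under eq_fun do rewrite big_nil; rewrite big_nil fun_l0.
under eq_fun do rewrite big_cons.
by rewrite big_cons lD ?ih//; exact: SC_sum.
Qed.

Lemma fun_lB f g : SC P f -> SC P g -> l (fun t => f t - g t) = l f - l g.
Proof.
move=> fS gS; have := lD (-1) gS fS; rewrite mulN1r addrC => <-.
by congr l; apply/funext => t; rewrite mulN1r addrC.
Qed.

End Functional.

Section Bounded.
Variables (l : (A -> R[i]) -> R[i]) (C : R).
Hypothesis lD : forall a f g, SC P f -> SC P g ->
  l (fun t => a * f t + g t) = a * l f + l g.
Hypothesis lC : forall f, SC P f -> ((cmod (l f))%:E <= C%:E * sn f)%E.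
Hypothesis C0 : 0 <= C.

Lemma fun_l_ccont s : ccont (fun z : mt A * mt B => l (ts z (atoms s))).
Proof.
have SA : SC P (atoms s) by apply/SCP; exists s.
apply: ccontP => z e e0.
have e1 : 0 < e / (C + 1) by rewrite divr_gt0// ltr_wpDl.
apply: (@filterS _ _ (@nbhs_filter (mt A * mt B)%type z) _ _ _ (S0_shift_cont gA gB gp s z e1)).
move=> z' /= h; rewrite -(fun_lB lD); try exact: (SC_ts gp).
rewrite -lee_fin; apply: le_trans (lC _) _.
  by apply: SC_B; exact: (SC_ts gp).
apply: le_trans (lee_wpmul2l _ h) _; first by rewrite lee_fin.
rewrite -EFinM lee_fin mulrCA ler_piMr ?(ltW e0)//.
by rewrite ler_pdivrMr ?mul1r ?lerDl ?ltr_wpDl.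
Qed.

Lemma fun_l_bound s z : ((cmod (l (ts z (atoms s))))%:E <= C%:E * sn (atoms s))%E.
Proof.
have SA : SC P (atoms s) by apply/SCP; exists s.
by rewrite -(sn_ts z SA); apply: lC; exact: (SC_ts gp).
Qed.

Lemma vg_cintg z0 v (u : Z -> R[i]) M : cmeas (u : (mt A * mt B)%type -> R[i]) ->
  (forall z, cmod (u z) <= M) -> cintg mnu (fun z => vg z0 v z * u z).
Proof.
move=> mu_ uM.
have := am_cintg gA gB gp v z0 (u := fun z => pr z0.2 z.1 * u z) (M := M).
have E : (fun z : mt A * mt B => vg z0 v z * u z) = (fun x => am v ((x : Z) + z0) * (pr z0.2 x.1 * u x)).
  by apply/funext => z; rewrite (vgE gA gp) [X in X * _]mulrC mulrA.
rewrite E; apply.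
  apply: cmeasM => //; apply: (ccont_cmeas sZ).
  exact: (ccont_comp (@cont_fst _ _) (pr_cont1 gp _)).
by move=> z; rewrite cmodM (gp_norm gp) mul1r.
Qed.

Lemma vg_int z0 v : cintg mnu (vg z0 v).
Proof.
have := @vg_cintg z0 v (fun=> 1) 1 (cmeas_cst _ _).
by under eq_fun do rewrite mulr1; apply => z; rewrite cmod1.
Qed.

Lemma inner_ts_ccont (S : topologicalType) (f g : S -> (mt A * mt B)%type) s :
  continuous f -> continuous g ->
  ccont (fun x => inner (ts (f x) (atoms s)) (ts (g x) phi)).
Proof.
move=> cf cg.
have E (x : S) : inner (ts (f x) (atoms s)) (ts (g x) phi) =
    \sum_(p <- s) (p.1 * (pr p.2.2 (f x).1)^*) * am ((f x : Z) + p.2) (g x).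
  rewrite (ts_atoms gp) (inner_atoms gA gp) ?big_map//; exact: (tsL2 gA gp).
under eq_fun do rewrite E.
apply: ccont_sum => p; apply: ccontM.
  apply: ccontM; first exact: ccont_cst.
  apply: ccont_conj; apply: (pr_ccont gp); first exact: cont_cst.
  exact: (cont_comp cf (@cont_fst _ _)).
apply: (am_ccont2 gA gB gp) => //.
by apply: (gs_contD gAB); [exact: cf | exact: cont_cst].
Qed.

(* Riemann sums of the integral converge in the norm [sn]: [z |-> ts z (atoms s)]
   is [sn]-continuous, so a Lindelof cover yields step functions. *)
Lemma lin_reproducing z0 v s :
  cintg mnu (fun z => vg z0 v z * l (ts z (atoms s))) /\
  cint mnu (fun z => vg z0 v z * l (ts z (atoms s))) = kapS z0 s * l (ts v phi).
Proof.
have SA : SC P (atoms s) by apply/SCP; exists s.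
pose T z := ts z (atoms s); pose G := vg z0 v.
have ST z : SC P (T z) by exact: (SC_ts gp).
have Sv : SC P (ts v phi) by exact: (SC_phi gp).
have sfin : sn (atoms s) \is a fin_num.
  by rewrite ge0_fin_numE ?sn_ge0//; exact: (atoms_sn_fin gA gB gp).
pose S := fine (sn (atoms s)).
have SE : sn (atoms s) = S%:E by rewrite fineK.
have S0 : 0 <= S by rewrite fine_ge0// sn_ge0.
have iG : cintg mnu G by exact: vg_int.
pose I := fine (\int[mnu]_z (cmod (G z))%:E)%E.
have IE : (\int[mnu]_z (cmod (G z))%:E)%E = I%:E by exact: (esym (fineK (cintg_fin_num iG))).
have I0 : 0 <= I by rewrite fine_ge0// integral_ge0// => z _; rewrite lee_fin cmod_ge0.
have lb z : cmod (l (T z)) <= C * S.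
  by rewrite -lee_fin EFinM -SE; exact: fun_l_bound.
have iGl : cintg mnu (fun z => G z * l (T z)).
  by apply: (@vg_cintg z0 v (fun z => l (T z)) (C * S)) => //; apply: (ccont_cmeas sZ); exact: fun_l_ccont.
split=> //; apply/eqP; rewrite -subr_eq0 -cmod_eq0 cmod_distC -/G.
set X := cmod _.
suff key e : 0 < e -> X <= 2 * C * I * e.
  rewrite eq_le cmod_ge0 andbT; apply/ler_addgt0Pr => e e0; rewrite add0r.
  have K0 : 0 <= 2 * C * I by rewrite !mulr_ge0.
  apply: le_trans (key (e / (2 * C * I + 1)) _) _.
    by rewrite divr_gt0// ltr_wpDl.
  by rewrite mulrCA ler_piMr ?(ltW e0)// ler_pdivrMr ?mul1r ?lerDl ?ltr_wpDl.
move=> e0.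
pose U z : set (mt A * mt B)%type := interior [set x : mt A * mt B |
  (sn (fun t => (T z t - T x t)%R) <= e%:E)%E].
have nU (z : (mt A * mt B)%type) : nbhs z (U z).
  by apply: nbhs_interior; exact: (S0_shift_cont gA gB gp s z e0).
(* Countably many S0-balls of radius e cover the orbit of [atoms s]; made disjoint, they carry the
   step functions. *)
have [x Ux] := @lindelof (mt A * mt B)%type (0 : Z) U sZ.1 nU.
pose V j := U (x j); pose E := seqDU V.
have mV j : measurable (V j) by apply: sZ.2; exact: open_interior.
have mE j : measurable (E j) by exact: seqDU_measurable.
have tE : trivIset setT E by exact: trivIset_seqDU.
pose rest n := ~` \big[setU/set0]_(j < n) V j.
have step n z : (exists2 j, (j < n)%N & E j z) \/
    (rest n z /\ forall j, (j < n)%N -> ~ E j z).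
  have [h|h] := pselect (rest n z); [right|left].
    split => // j jn Ej; apply: h; rewrite -bigcup_mkord; exists j => //.
    exact: (subDsetl Ej).
  have /contrapT := h; rewrite bigsetU_seqDU -bigcup_mkord => -[j jn Ej].
  by exists j.
have Vsn j z : E j z -> (sn (fun t => (T (x j) t - T z t)%R) <= e%:E)%E.
  by move=> [Vz _]; exact: (interior_subset Vz).
pose a n := (\int[mnu]_z (cmod (G z) * \1_(rest n) z)%:E)%E.
have afin n : a n = (fine (a n))%:E.
  rewrite fineK// ge0_fin_numE; last first.
    by apply: integral_ge0 => z _; rewrite lee_fin mulr_ge0 ?cmod_ge0.
  apply: (@le_lt_trans _ _ I%:E); last exact: ltry.
  rewrite -IE; apply: ge0_le_integral_nomeas => z; rewrite lee_fin.
    by rewrite mulr_ge0 ?cmod_ge0.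
  by rewrite ler_piMr ?cmod_ge0// indicE lern1 leq_b1.
have a0 n : 0 <= fine (a n).
  by rewrite fine_ge0// integral_ge0// => z _; rewrite lee_fin mulr_ge0 ?cmod_ge0.
have alim : fine (a n) @[n --> \oo] --> 0.
  by apply: fine_cvg; exact: (cvg_tail iG mV Ux).
suff key2 n : X <= 2 * C * (e * I + S * fine (a n)).
  have : (2 * C * (e * I + S * fine (a n))) @[n --> \oo] --> 2 * C * (e * I + S * 0).
    by apply: cvgM; [exact: cvg_cst | apply: cvgD; [exact: cvg_cst | apply: cvgM; [exact: cvg_cst | exact: alim]]].
  rewrite mulr0 addr0 mulrA mulrAC => /lim_ge_cst; apply; exact: key2.
(* Pointwise size of the step error: at most e on the first n pieces, and at most the full norm S on
   what they leave uncovered, a set on which the integral of |G| tends to 0. *)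
pose W z := e + S * \1_(rest n) z.
have ind0 (z : mt A * mt B) : 0 <= \1_(rest n) z :> R by rewrite indicE ler0n.
have We z : e <= W z by rewrite /W lerDl; exact: (mulr_ge0 S0 (ind0 z)).
have W0 z : 0 <= W z by exact: le_trans (ltW e0) (We z).
have mrest : measurable (rest n) by apply: measurableC; apply: bigsetU_measurable.
have WI : (\int[mnu]_z ((cmod (G z))%:E * (W z)%:E) = (e * I + S * fine (a n))%:E)%E.
  rewrite (_ : (fun z => _) = (fun z => e%:E * (cmod (G z))%:E +
     S%:E * (cmod (G z) * \1_(rest n) z)%:E)%E); last first.
    by apply/funext => z; rewrite -!EFinM -EFinD /W; congr (_%:E); ring.
  have mG := cmeas_cmodE iG.1.
  have m2 : measurable_fun setT (fun z : mt A * mt B => (cmod (G z) * \1_(rest n) z)%:E).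
    apply/measurable_EFinP/measurable_funM; first exact: cmeas_cmod iG.1.
    exact: measurable_indic.
  have p2 z : (0 <= (cmod (G z) * \1_(rest n) z)%:E)%E by rewrite lee_fin mulr_ge0 ?cmod_ge0.
  have S0' : (0 <= S%:E)%E by rewrite lee_fin; exact: S0.
  have p1 z : (0 <= (cmod (G z))%:E)%E by rewrite lee_fin cmod_ge0.
  rewrite ge0_integralD//.
  - rewrite (ge0_integralZl_EFin mnu measurableT (fun z _ => p1 z) mG (ltW e0)).
    rewrite (ge0_integralZl_EFin mnu measurableT (fun z _ => p2 z) m2 S0).
    by rewrite IE -/(a n) afin -!EFinM -EFinD.
  - by move=> z _; rewrite mule_ge0// lee_fin ltW.
  - exact: emeasurable_funM.
  - exact: (fun z _ => mule_ge0 S0' (p2 z)).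
  - exact: emeasurable_funM.
pose b j := cint mnu (fun z => G z * (\1_(E j) z)%:C).
(* [r1] is the function that the integral should produce and [r2] its Riemann sum. Both lie in SC,
   so l applies to the difference. *)
pose r1 t := kapS z0 s * ts v phi t.
pose r2 t := \sum_(j <- iota 0 n) b j * T (x j) t.
have S1 : SC P r1 by exact: SC_Z.
have S2 : SC P r2 by exact: SC_sum.
have Sr : SC P (fun t => r1 t - r2 t) by exact: SC_B.
have lr : l (fun t => r1 t - r2 t) = kapS z0 s * l (ts v phi) -
    \sum_(j <- iota 0 n) b j * l (T (x j)).
  by rewrite (fun_lB lD)// (fun_lZ lD)// (fun_lsum lD).
have [i1 i2] := stepd_int x n mE iG iGl.
have stepl z : cmod (stepd E x n (fun z => l (T z)) z) <= C * W z.
  have [[j jn Ej]|[rz h]] := step n z.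
    rewrite (stepd_in _ _ tE jn Ej) cmod_distC -(fun_lB lD)// -lee_fin.
    apply: le_trans (lC _) _; first exact: SC_B.
    rewrite EFinM lee_wpmul2l ?lee_fin//; apply: le_trans (Vsn _ _ Ej) _.
    by rewrite lee_fin We.
  rewrite stepd_out//; apply: le_trans (lb z) _; rewrite ler_wpM2l// /W.
  by rewrite indicE mem_set// mulr1 lerDr ltW.
have stepsn z : (\int[mnu]_w (cmod (stepd E x n (fun z => inner (T z) (ts w phi)) z))%:E
    <= (W z)%:E)%E.
  have TL y := SC_L2 gA gp (ST y); have tL w := tsL2 gA gp w phiL.
  have [[j jn Ej]|[rz h]] := step n z.
    under eq_integral do rewrite (stepd_in _ _ tE jn Ej) cmod_distC -(innerBl (TL _) (TL _) (tL _)).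
    by apply: le_trans (Vsn _ _ Ej) _; rewrite lee_fin We.
  under eq_integral do rewrite stepd_out//.
  rewrite -/(sn (T z)) (sn_ts z SA) SE lee_fin /W.
  by rewrite indicE mem_set// mulr1 lerDr ltW.
have snr : (sn (fun t => (r1 t - r2 t)%R) <= (e * I + S * fine (a n))%:E)%E.
  have TL y := SC_L2 gA gp (ST y); have tL w := tsL2 gA gp w phiL.
  have Er w : inner (fun t => r1 t - r2 t) (ts w phi) =
      cint mnu (fun z => G z * stepd E x n (fun z => inner (T z) (ts w phi)) z).
    have [m1 m2'] := moyal gA gB gp v z0 s (tL w).
    have [_ ->] := stepd_int x n mE iG m1.
    have iD a' f g : SC P f -> SC P g -> inner (fun t => a' * f t + g t) (ts w phi) =
        a' * inner f (ts w phi) + inner g (ts w phi).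
      move=> /(SC_L2 gA gp) fL /(SC_L2 gA gp) gL.
      by rewrite innerDl ?innerZl//; exact: L2Z.
    rewrite (fun_lB (l := fun f => inner f (ts w phi)) iD)//.
    rewrite (fun_lZ (l := fun f => inner f (ts w phi)) iD)//.
    by rewrite (fun_lsum (l := fun f => inner f (ts w phi)) iD)// m2'.
  (* Minkowski's integral inequality through Tonelli: Moyal's formula writes the transform of
     [r1 - r2] as an integral of step errors, so its L^1 norm is at most the integral of their L^1
     norms. *)
  pose F (p : (mt A * mt B) * (mt A * mt B)) : \bar R :=
    ((cmod (G p.2))%:E * (cmod (stepd E x n (fun z => inner (T z) (ts p.1 phi)) p.2))%:E)%E.
  have FE w z : F (w, z) = ((cmod (G z))%:E *
      (cmod (stepd E x n (fun z => inner (T z) (ts w phi)) z))%:E)%E by [].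
  have F0 p : (0 <= F p)%E by rewrite mule_ge0// lee_fin cmod_ge0.
  have cst2 : measurable_fun setT (fun p : (mt A * mt B) * (mt A * mt B) => p.2) by exact: measurable_snd.
  have mst : cmeas (fun p : (mt A * mt B) * (mt A * mt B) =>
      stepd E x n (fun z => inner (T z) (ts p.1 phi)) p.2).
    have sZZ := std_prod sZ sZ.
    apply: cmeasB.
      apply: (ccont_cmeas sZZ).
      by apply: inner_ts_ccont; [exact: cont_snd | exact: cont_fst].
    apply: cmeas_sum => j; apply: cmeasM.
      apply: cmeas_real; apply: (measurableT_comp (measurable_indic (mE j)) cst2).
    apply: (ccont_cmeas sZZ).
    by apply: inner_ts_ccont; [exact: cont_cst | exact: cont_fst].
  have mF : measurable_fun setT F.
    apply: emeasurable_funM; last exact: cmeas_cmodE.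
    exact: (measurableT_comp (cmeas_cmodE iG.1) cst2).
  apply: (@le_trans _ _ (\int[mnu]_w \int[mnu]_z F (w, z))%E).
    apply: ge0_le_integral_nomeas => w; first by rewrite lee_fin cmod_ge0.
    rewrite Er; have [m1 m2'] := moyal gA gB gp v z0 s (tL w).
    have [m3 _] := stepd_int x n mE iG m1.
    apply: le_trans (cmod_cint m3) _.
    by apply: ge0_le_integral_nomeas => z; rewrite ?FE -?EFinM -?cmodM// lee_fin cmod_ge0.
  rewrite (tonelli mnu mnu mF F0) -WI.
  apply: ge0_le_integral_nomeas => z; first exact: integral_ge0.
  under eq_integral do rewrite FE.
  rewrite ge0_integralZl_EFin ?cmod_ge0//.
  - by rewrite lee_wpmul2l ?lee_fin ?cmod_ge0//; exact: stepsn.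
  - by move=> w _; rewrite lee_fin cmod_ge0.
  - exact: (measurableT_comp (cmeas_cmodE mst) (measurable_pair2 z)).
(* Two errors of equal size: l applied to [r1 - r2], and the scalar integral of the step error of l
   along the orbit. *)
have XE : X = cmod (l (fun t => r1 t - r2 t) - cint mnu (fun z => G z * stepd E x n (fun z => l (T z)) z)).
  by rewrite i2 lr /X -/b; congr cmod; rewrite opprB addrA subrK.
rewrite XE; apply: le_trans (cmodB _ _) _.
have -> : 2 * C * (e * I + S * fine (a n)) = C * (e * I + S * fine (a n)) + C * (e * I + S * fine (a n)) by ring.
apply: lerD; rewrite -lee_fin.
  apply: le_trans (lC Sr) _; rewrite EFinM lee_wpmul2l ?lee_fin//.
apply: le_trans (cmod_cint i1) _; rewrite EFinM -WI -ge0_integralZl_EFin//.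
- apply: ge0_le_integral_nomeas => z; first by rewrite lee_fin cmod_ge0.
  by rewrite cmodM -!EFinM lee_fin mulrCA ler_wpM2l ?cmod_ge0.
- by move=> z _; rewrite mule_ge0// lee_fin ?cmod_ge0.
- apply: emeasurable_funM; first exact: cmeas_cmodE iG.1.
  apply/measurable_EFinP/measurable_funD; first exact: measurable_cst.
  by apply: measurable_funM => //; exact: measurable_indic.
Qed.

End Bounded.
End Riemann.

(** * Local suprema and change of window *)

Section PowR.
Context (R : realType).
Implicit Types x y p : R.

Lemma powRK p x : 0 < p -> 0 <= x -> (x `^ p) `^ p^-1 = x.
Proof. by move=> p0 x0; rewrite -powRrM mulfV ?gt_eqF// powRr1. Qed.

Lemma powRVK p x : 0 < p -> 0 <= x -> (x `^ p^-1) `^ p = x.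
Proof. by move=> p0 x0; rewrite -powRrM mulVf ?gt_eqF// powRr1. Qed.

Lemma ler_pow p x y : 0 < p -> 0 <= x -> x <= y -> x `^ p <= y `^ p.
Proof.
by move=> p0 x0 xy; apply: ge0_ler_powR; rewrite ?nnegrE ?(ltW p0)//; exact: le_trans xy.
Qed.

Lemma le_root p x y : 0 < p -> 0 <= x -> x `^ p <= y -> x <= y `^ p^-1.
Proof.
move=> p0 x0 xy; rewrite -[leLHS](powRK p0 x0).
by apply: ler_pow; rewrite ?invr_gt0// powR_ge0.
Qed.

Lemma pow_open (S : topologicalType) (X : S -> R) p : 0 < p ->
  (forall s, 0 <= X s) -> continuous X ->
  forall r : R, open [set s | (r%:E < (X s `^ p)%:E)%E].
Proof.
move=> p0 X0 cX r; have [r0|r0] := ltP r 0.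
  rewrite (_ : [set s | _] = setT); first exact: openT.
  by apply/seteqP; split => // s _ /=; rewrite lte_fin (lt_le_trans r0)// powR_ge0.
rewrite (_ : [set s | _] = [set s | r `^ p^-1 < X s]).
  by apply: (@open_comp _ _ X [set y | r `^ p^-1 < y]) => [s _|]; [exact: cX|exact: open_gt].
apply/seteqP; split => s /=; rewrite lte_fin !ltNge => /negP h; apply/negP => h2; apply: h.
  by rewrite -[leRHS](powRVK p0 r0) ler_pow.
by apply: le_root.
Qed.

End PowR.

Section LocalSup.
Context (R : realType) (A : tgroup).
Variables (mu : {sigma_finite_measure set (mt A) -> \bar R}) (N : A -> R)
    (kap : set A) (hf : A -> A).
Hypothesis gs : gspace mu N kap hf.
Local Notation gbox := (gbox N kap).
Local Notation gG := (gG N kap).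
Implicit Types (F : A -> \bar R) (O : set A).

(** A supremum over all points in place of the essential one of [local_max], because values at
    single points are estimated. The exchange is made in [le_local_max] and, back again, in
    [eigen_modulation]. *)
Definition bsup O F x : \bar R := ereal_sup [set F (x + o)%R | o in O].

Lemma bsup_ub O F x b : O b -> (F (x + b)%R <= bsup O F x)%E.
Proof. by move=> Ob; apply: ereal_sup_ubound; exists b. Qed.

Lemma bsup_le O F x M : (forall b, O b -> (F (x + b)%R <= M)%E) -> (bsup O F x <= M)%E.
Proof. by move=> h; apply: ge_ereal_sup => _ [b Ob <-]; exact: h. Qed.

Lemma bsup_ge0 O F x : O !=set0 -> (forall x, 0 <= F x)%E -> (0 <= bsup O F x)%E.
Proof. by move=> [b Ob] F0; apply: le_trans (bsup_ub _ _ Ob). Qed.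

Lemma bsup_shift O F x a : bsup O (fun y => F (y + a)%R) x = bsup O F (x + a)%R.
Proof.
by congr ereal_sup; apply/seteqP; split => _ [b Ob <-]; exists b => //; rewrite addrAC.
Qed.

Lemma bsup_meas O F : (forall r : R, open ([set x | (r%:E < F x)%E] : set (mt A))) ->
  measurable_fun setT (bsup O F : mt A -> \bar R).
Proof.
by move=> oF; apply: (lsc_measurable (gs_std gs)); apply: (gs_open_sup gs).
Qed.

(** A box is covered by finitely many translates of O ([gs_tb]). The list is chosen before F, so the
    same translates serve all functions. *)
Lemma bsup_cover O r : nbhs ((0 : A) : mt A) O -> exists s : seq A,
  forall F, (forall x, 0 <= F x)%E ->
  forall x, (bsup (gbox r) F x <= \sum_(t <- s) bsup O F (x + t)%R)%E.
Proof.
move=> nO; have [s hs] := gs_tb gs r nO; exists s => F F0 x.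
have O0 : O !=set0 by exists 0; exact: nbhs_singleton nO.
apply: bsup_le => b [kb Nb]; have [t ts Ob] := hs b kb (ltW Nb).
apply: (@le_trans _ _ (bsup O F (x + t)%R)).
  by apply: le_trans (bsup_ub F (x + t) Ob); rewrite addrA addrAC addrK.
elim: s ts {hs} => // t' s ih; rewrite inE big_cons => /predU1P[->|ts].
  by rewrite leeDl// sume_ge0// => ? _; exact: bsup_ge0.
by apply: le_trans (ih ts) _; rewrite leeDr//; exact: bsup_ge0.
Qed.

Lemma gbox_nbhs r : 0 < r -> nbhs ((0 : A) : mt A) (gbox r).
Proof.
by move=> r0; apply: open_nbhs_nbhs; split; [exact: (gbox_open gs) | exact: (gbox0 gs)].
Qed.

Lemma gG_pow a p x : 0 < p -> gG a x `^ p = gG (a * p) x.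
Proof.
move=> p0; have [k|k] := pselect (kap x); last by rewrite !gG_nkap// powR0// gt_eqF.
by rewrite !gG_kap// -expRM; congr expR; ring.
Qed.

Lemma gG_fin a : 0 < a -> exists2 I : R, 0 <= I & (\int[mu]_x (gG a x)%:E)%E = I%:E.
Proof.
move=> a0; have h : (0 <= \int[mu]_x (gG a x)%:E)%E.
  by apply: integral_ge0 => x _; rewrite lee_fin gG_ge0.
exists (fine (\int[mu]_x (gG a x)%:E)%E); first exact: fine_ge0.
by rewrite fineK// ge0_fin_numE//; exact: (gG_int gs).
Qed.

Lemma gG_bsup a r F : 0 <= a -> (forall x, 0 <= F x)%E -> forall x,
  (bsup (gbox r) (fun y => (gG a y)%:E * F y) x <=
   (expR (a * r))%:E * ((gG (a / 2) x)%:E * bsup (gbox r) F x))%E.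
Proof.
move=> a0 F0 x; apply: bsup_le => b [kb Nb].
apply: (@le_trans _ _ ((expR (a * r) * gG (a / 2) x)%:E * F (x + b)%R)%E).
  rewrite lee_wpmul2r// lee_fin; apply: (gG_near gs) => //.
    by rewrite addrC addKr.
  by rewrite addrC addKr ltW.
rewrite EFinM muleA lee_wpmul2l//; last by apply: bsup_ub.
by rewrite -EFinM lee_fin mulr_ge0 ?expR_ge0 ?gG_ge0.
Qed.

(* For exponents below 1 Jensen's inequality fails; one bounds the integral by
   the supremum of the integrand and the supremum by an integral of local
   suprema. *)
Lemma int_pow a p : 0 < a -> 0 < p -> exists2 C : R, 0 <= C &
  forall (X : A -> R) (V : R), (forall x, 0 <= X x) -> continuous (X : mt A -> R) ->
  0 <= V -> (V%:E <= \int[mu]_x (gG a x * X x)%:E)%E ->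
  ((V `^ p)%:E <= C%:E * \int[mu]_x
     ((gG (a / 4 * p) x)%:E * bsup (gbox 1) (fun y => (X y `^ p)%:E) x))%E.
Proof.
move=> a0 p0; have a2 : 0 < a / 2 by rewrite divr_gt0.
have [C0 C00 hC0] := le_int_sup gs.
have [J J0 JE] := gG_fin a2.
have ap0 : 0 <= a / 2 * p by rewrite mulr_ge0 ?ltW.
exists ((J + 1) `^ p * C0 * expR (a / 2 * p)).
  by rewrite !mulr_ge0 ?powR_ge0 ?expR_ge0// ltW.
move=> X V X0 cX V0 hV.
(* The Gaussian is split into two equal halves: one stays with X under the supremum, the other is
   integrated and gives J. *)
pose Xp y := (X y `^ p)%:E; pose G y := ((gG (a / 2) y * X y) `^ p)%:E.
have GE y : G y = ((gG (a / 2 * p) y)%:E * Xp y)%E.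
  by rewrite /G powRM ?gG_ge0// gG_pow.
have Xp0 y : (0 <= Xp y)%E by rewrite lee_fin powR_ge0.
have G0 y : (0 <= G y)%E by rewrite lee_fin powR_ge0.
have oG : forall r : R, open ([set x | (r%:E < G x)%E] : set (mt A)).
  apply: pow_open => // [s|]; first by rewrite mulr_ge0 ?gG_ge0.
  by move=> s; apply: cvgM; [exact: (gG_cont gs) | exact: cX].
have oX : forall r : R, open ([set x | (r%:E < Xp x)%E] : set (mt A)) by exact: pow_open.
have nb : gbox 1 !=set0 by exists 0; exact: (gbox0 gs).
pose T := (\int[mu]_y bsup (gbox 1) G y)%E.
have T0 : (0 <= T)%E by apply: integral_ge0 => y _; exact: bsup_ge0.
have GT y : (G y <= C0%:E * T)%E by exact: hC0.
have VT : ((V `^ p)%:E <= ((J + 1) `^ p * C0)%:E * T)%E.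
  (* [J + 1] in place of J keeps the constant positive, which settles the case of an infinite T. *)
  have [Toe|Tn] := eqVneq T +oo%E.
    by rewrite Toe gt0_muley ?leey// lte_fin mulr_gt0// powR_gt0// ltr_wpDl.
  have Tf : T \is a fin_num by rewrite ge0_fin_numE// ltey.
  rewrite -(fineK Tf) -EFinM lee_fin -mulrA.
  set t := C0 * fine T.
  have t0 : 0 <= t by rewrite mulr_ge0 ?fine_ge0// ltW.
  have gt y : gG (a / 2) y * X y <= t `^ p^-1.
    apply: le_root => //; first by rewrite mulr_ge0 ?gG_ge0.
    by rewrite -lee_fin /t EFinM (fineK Tf); exact: GT.
  have : (V%:E <= (J * t `^ p^-1)%:E)%E.
    apply: le_trans hV _.
    rewrite mulrC EFinM -JE -ge0_integralZl_EFin ?powR_ge0//.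
    - apply: ge0_le_integral_nomeas => x; first by rewrite lee_fin mulr_ge0 ?gG_ge0.
      rewrite -EFinM lee_fin (_ : gG a x = gG (a / 2) x * gG (a / 2) x).
        by rewrite -mulrA mulrC ler_wpM2r ?gG_ge0.
      by rewrite gGM (_ : a / 2 + a / 2 = a)//; field.
    - by move=> x _; rewrite lee_fin gG_ge0.
    - by apply/measurable_EFinP; exact: (gG_meas gs).
  rewrite lee_fin => h; apply: le_trans (_ : ((J + 1) * t `^ p^-1) `^ p <= _).
    by apply: ler_pow => //; apply: le_trans h _; rewrite ler_wpM2r ?powR_ge0// lerDl.
  by rewrite powRM ?powR_ge0 ?addr_ge0// powRVK.
apply: le_trans VT _; rewrite [((J + 1) `^ p * C0 * _)%:E]EFinM -muleA.
apply: lee_wpmul2l; first by rewrite lee_fin mulr_ge0 ?powR_ge0// ltW.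
rewrite -ge0_integralZl_EFin ?expR_ge0//.
- apply: ge0_le_integral_nomeas => y; first exact: bsup_ge0.
  have := gG_bsup 1 ap0 Xp0 y; rewrite mulr1.
  have -> : a / 2 * p / 2 = a / 4 * p by field.
  apply: le_trans; rewrite le_eqVlt; apply/orP; left; apply/eqP.
  by congr ereal_sup; apply/seteqP; split => _ [b ob <-]; exists b => //; rewrite GE.
- by move=> y _; rewrite mule_ge0 ?lee_fin ?gG_ge0//; exact: bsup_ge0.
- apply: emeasurable_funM; first by apply/measurable_EFinP; exact: (gG_meas gs).
  exact: bsup_meas.
Qed.

End LocalSup.

(** * Inversion, bounded functionals and change of window *)

Section Window.
Context (R : realType) (A B : tgroup).
Variables (mu : {sigma_finite_measure set (mt A) -> \bar R})
  (nu : {sigma_finite_measure set (mt B) -> \bar R})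
  (NA : A -> R) (kA : set A) (hA : A -> A) (NB : B -> R) (kB : set B) (hB : B -> B).
Hypotheses (gA : gspace mu NA kA hA) (gB : gspace nu NB kB hB).
Variables (pr : B -> A -> R[i]) (c : R).
Hypothesis gp : gpair mu nu NA kA NB kB pr c.
Local Notation Z := (tgprod A B).
Local Notation mnu := (prod_measure mu nu).
Local Notation P := (gplane mu nu NA kA pr).
Local Notation L2 := (cLspace mu 2%:E).
Local Notation inner := (inner mu).
Local Notation phi := (phi NA kA).
Local Notation ts := (ts pr).
Local Notation gZ := (gZ NA kA NB kB).
Local Notation nrm := (nrm mu).
Local Notation atoms := (atoms NA kA pr).
Local Notation vg := (vg mu NA kA pr).
Local Notation kapS := (kapS mu NA kA pr).
Local Notation sn := (sn mu nu NA kA pr).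
Implicit Types (z w v : Z).

Let gAB := prod_gspace gA gB.
Let sZ := std_prod (gs_std gA) (gs_std gB).
Let phiL := phi_L2 gA.

Let c0 : 0 < c := gp_c gp.

(** For the window [phi] itself the constant in Moyal's formula is the squared norm of the Gaussian,
    here c. *)
Lemma kapS00 : kapS 0 [:: (1, 0)] = c%:C.
Proof.
rewrite /Submission.kapS big_seq1 mul1r /Submission.kap0 /= oppr0 (amE gA gB gp) !subrr (pr0l gp) mulr1.
rewrite !gG_kap; [|exact: (gs_k0 gB)|exact: (gs_k0 gA)].
by rewrite (gs_N00 gA) (gs_N00 gB) !mulr0 oppr0 expR0 !mulr1.
Qed.

Lemma inversion f h : SC P f -> L2 h ->
  cintg mnu (fun z => inner f (ts z phi) * inner (ts z phi) h) /\
  cint mnu (fun z => inner f (ts z phi) * inner (ts z phi) h) = c%:C * inner f h.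
Proof.
move=> /SCP[s ->] hL.
have M v := moyal gA gB gp v 0 [:: (1, 0)] hL.
have E (z : mt A * mt B) : inner (atoms s) (ts z phi) * inner (ts z phi) h =
    \sum_(p <- s) p.1 * (vg 0 p.2 z * inner (ts z (atoms [:: (1, 0)])) h).
  rewrite (inner_atoms gA gp); last exact: (tsL2 gA gp).
  rewrite mulr_suml; apply: eq_bigr => p _; rewrite (vgE gA gp) (pr0l gp) mul1r addr0.
  by rewrite -(phi_atom gp) mulrA.
under eq_fun do rewrite E.
split; first by apply: cintg_sum => p; apply: cintgZ; exact: (M p.2).1.
rewrite cint_sum => [|p]; last by apply: cintgZ; exact: (M p.2).1.
rewrite (inner_atoms gA gp)// mulr_sumr; apply: eq_bigr => p _.
rewrite cintZ ?(M p.2).2; last exact: (M p.2).1.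
by rewrite kapS00; ring.
Qed.

Lemma inner_SC_bound f h : SC P f -> L2 h ->
  ((c * cmod (inner f h))%:E <= (nrm h * nrm phi)%:E * sn f)%E.
Proof.
move=> fS hL; have [i1 i2] := inversion fS hL.
have -> : c * cmod (inner f h) = cmod (c%:C * inner f h).
  by rewrite cmodM cmod_real gtr0_norm.
rewrite -i2; apply: le_trans (cmod_cint i1) _.
rewrite -ge0_integralZl_EFin ?mulr_ge0 ?nrm_ge0//.
- apply: ge0_le_integral_nomeas => z; first by rewrite lee_fin cmod_ge0.
  rewrite -EFinM lee_fin cmodM mulrC ler_wpM2r ?cmod_ge0//.
  have := cauchy_schwarz (tsL2 gA gp z phiL) hL.
  by rewrite (ts_nrm gA gp z phiL) mulrC.
- by move=> z _; rewrite lee_fin cmod_ge0.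
- exact: (cmeas_cmodE (SC_inner_meas gA gB gp fS)).
Qed.

(** The inversion integral with the other factor bounded: f enters through its L^2 norm and h
    through its S0 norm. In this form the bound passes to L^2 limits of f. *)
Lemma inner_SC_bound' f h : SC P f -> L2 h -> cmeas (fun z : mt A * mt B => inner h (ts z phi)) ->
  ((c * cmod (inner f h))%:E <= (nrm f * nrm phi)%:E * sn h)%E.
Proof.
move=> fS hL mh; have [i1 i2] := inversion fS hL.
have fL := SC_L2 gA gp fS.
have -> : c * cmod (inner f h) = cmod (c%:C * inner f h).
  by rewrite cmodM cmod_real gtr0_norm.
rewrite -i2; apply: le_trans (cmod_cint i1) _.
rewrite -ge0_integralZl_EFin ?mulr_ge0 ?nrm_ge0//.
- apply: ge0_le_integral_nomeas => z; first by rewrite lee_fin cmod_ge0.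
  have tL := tsL2 gA gp z phiL.
  rewrite -EFinM lee_fin cmodM -(cmod_conj (inner (ts z phi) h)) -(inner_conj tL hL).
  rewrite ler_wpM2r ?cmod_ge0// -(ts_nrm gA gp z phiL).
  exact: cauchy_schwarz.
- by move=> z _; rewrite lee_fin cmod_ge0.
- exact: cmeas_cmodE.
Qed.

Lemma nrm_SC_bound f : SC P f -> ((c * nrm f)%:E <= (nrm phi)%:E * sn f)%E.
Proof.
move=> fS; have fL := SC_L2 gA gp fS.
have [n0|n0] := eqVneq (nrm f) 0.
  by rewrite n0 mulr0 mule_ge0 ?lee_fin ?nrm_ge0 ?sn_ge0.
have np : 0 < nrm f by rewrite lt0r n0 nrm_ge0.
have := inner_SC_bound fS fL; rewrite inner_self cmod_real ger0_norm ?nsq_ge0//.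
rewrite -nrm_sqr expr2 mulrA EFinM [X in (_ <= X%:E * _)%E]mulrC EFinM muleC.
rewrite [X in (_ <= X)%E](_ : _ = (nrm f)%:E * ((nrm phi)%:E * sn f))%E; last first.
  by rewrite muleCA muleA.
by rewrite lee_pmul2l ?lte_fin.
Qed.

Lemma S0_sn f : S0 P f -> sn f \is a fin_num.
Proof.
move=> [_ [_ _ h]]; rewrite ge0_fin_numE ?sn_ge0// -snE; exact: h.
Qed.

Lemma snZ a f : L2 f -> cmeas (fun z : mt A * mt B => inner f (ts z phi)) ->
  sn (fun t => a * f t) = ((cmod a)%:E * sn f)%E.
Proof.
move=> fL mf; rewrite /Submission.sn -ge0_integralZl_EFin ?cmod_ge0//; last 2 first.
- by move=> z _; rewrite lee_fin cmod_ge0.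
- exact: cmeas_cmodE.
apply: eq_integral => z _; rewrite innerZl//; last exact: (tsL2 gA gp).
by rewrite cmodM EFinM.
Qed.

Lemma S0_meas f : S0 P f -> cmeas (fun z : mt A * mt B => inner f (ts z phi)).
Proof. by move=> [_ [h1 h2 _]]; split; [exact: h1 | exact: h2]. Qed.

Lemma S0_Z a f : S0 P f -> S0 P (fun t => a * f t).
Proof.
move=> fS; have fL : L2 f := fS.1; have mf := S0_meas fS.
split; first exact: L2Z.
have E : stft P (tf_gauss P) (fun t => a * f t) = (fun z => a * inner f (ts z phi)).
  by apply/funext => z; rewrite -innerZl//; exact: (tsL2 gA gp).
have [m1 m2] := cmeasM (cmeas_cst _ a) mf.
split; [by rewrite E; exact: m1|by rewrite E; exact: m2|].
rewrite -/(S0norm P (fun t => a * f t)) snE snZ//.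
by rewrite -(fineK (S0_sn fS)) -EFinM ltry.
Qed.

Section DualBound.
Variable u : (A -> R[i]) -> R[i].
Hypothesis uD : S0_dual P u.

Lemma S0_dual0 : u (fun=> 0) = 0.
Proof.
have z0 : S0 P (fun=> 0) := SC_S0 gA gB gp (SC_0 mu nu NA kA pr).
have := uD.1 1 _ _ z0 z0.
rewrite (_ : (fun x : A => 1 * 0 + 0) = fun=> 0); last by apply/funext => t; rewrite mulr0 addr0.
rewrite rmorph1 mul1r.
by move=> /eqP; rewrite addrC -subr_eq subrr => /eqP.
Qed.

Lemma S0_dualZ a f : S0 P f -> u (fun t => a * f t) = a^* * u f.
Proof.
have z0 : S0 P (fun=> 0) := SC_S0 gA gB gp (SC_0 mu nu NA kA pr).
move=> fS; have := uD.1 a _ _ fS z0; rewrite S0_dual0 addr0 => <-.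
by congr u; apply/funext => t; rewrite addr0.
Qed.

Lemma S0_dual_bound : exists2 C : R, 0 <= C &
  forall f, S0 P f -> ((cmod (u f))%:E <= C%:E * sn f)%E.
Proof.
have z0 : S0 P (fun=> 0) := SC_S0 gA gB gp (SC_0 mu nu NA kA pr).
have [d d0 hd] := uD.2 _ z0 1 ltr01.
exists d^-1; first by rewrite invr_ge0 ltW.
move=> f fS; have ff := S0_sn fS.
rewrite -(fineK ff) -EFinM lee_fin; apply/ler_addgt0Pr => e e0.
set s := fine (sn f); have s0 : 0 <= s by rewrite fine_ge0// sn_ge0.
(* Scaling f by d / s would divide by 0 when s = 0 and only reach norm d; the extra d e makes the
   norm strictly less than d. *)
pose M := s + d * e; have M0 : 0 < M by rewrite ltr_wpDl// mulr_gt0.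
have t0 : 0 < d / M by rewrite divr_gt0.
have := hd (fun t => (d / M)%:C * f t) (S0_Z _ fS).
rewrite S0_dual0 subr0 S0_dualZ// cmodM cmod_conj cmod_real gtr0_norm//.
rewrite (_ : (fun x => _) = (fun t => (d / M)%:C * f t)); last first.
  by apply/funext => t; rewrite subr0.
rewrite snE (snZ _ fS.1 (S0_meas fS)) cmod_real gtr0_norm// -(fineK ff) -/s -EFinM lte_fin.
have h : d / M * s < d.
  by rewrite -mulrA gtr_pMr// mulrC ltr_pdivrMr// mul1r ltrDl mulr_gt0.
move=> /(_ h); rewrite -mulrA mulrCA ltr_pdivrMl// mulr1 mulrC => h2.
have -> : d^-1 * s + e = d^-1 * M by rewrite /M mulrDr mulKf// gt_eqF.
by rewrite ler_pdivlMl// mulrC ltW.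
Qed.

Let l f := (u f)^*.

(** Elements of [S0_dual] are antilinear; their conjugates are the linear functionals to which the
    reproducing formula applies. *)
Lemma S0_dual_lin a f g : SC P f -> SC P g ->
  l (fun t => a * f t + g t) = a * l f + l g.
Proof.
move=> /(SC_S0 gA gB gp) fS /(SC_S0 gA gB gp) gS.
by rewrite /l (uD.1 a _ _ fS gS) rmorphD/= rmorphM/= conjCK.
Qed.

End DualBound.

Section Change.
Variables (l : (A -> R[i]) -> R[i]) (C : R).
Hypothesis lD : forall a f g, SC P f -> SC P g ->
  l (fun t => a * f t + g t) = a * l f + l g.
Hypothesis lC : forall f, SC P f -> ((cmod (l f))%:E <= C%:E * sn f)%E.
Hypothesis C0 : 0 <= C.
Variable s : seq (R[i] * Z).
Hypothesis s0 : atoms s <> (fun=> 0).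

Let Hg z := cmod (l (ts z (atoms s))).
Let H z := cmod (l (ts z phi)).

Lemma Hg_cont : continuous (Hg : mt A * mt B -> R).
Proof. exact: (ccont_cmod (fun_l_ccont gA gB gp lD lC C0 s)). Qed.

Lemma H_cont : continuous (H : mt A * mt B -> R).
Proof.
have := ccont_cmod (fun_l_ccont gA gB gp lD lC C0 [:: (1, 0)]).
by rewrite /H (phi_atom gp).
Qed.

(** [lin_reproducing] solved for the value at [ts w phi], with z0 from [kapS_neq0]. The weight is
    the modulus of an ambiguity function, hence a Gaussian; a translation centres it at 0. *)
Lemma winchange : exists z0 : Z, exists2 K : R, 0 < K & forall w,
  ((H w)%:E <= K%:E * \int[mnu]_z (gZ (pi / 2) z * Hg ((z : Z) + (w - z0)))%:E)%E.
Proof.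
have [z0 k0] := kapS_neq0 gA gp s0.
have kp : 0 < cmod (kapS z0 s) by rewrite lt0r cmod_eq0 k0 cmod_ge0.
exists z0, ((cmod (kapS z0 s))^-1 * c); first by rewrite mulr_gt0// invr_gt0.
move=> w; have [i1 i2] := lin_reproducing gA gB gp lD lC C0 z0 w s.
have m1 : measurable_fun setT (fun z : mt A * mt B => (gZ (pi / 2) z * Hg ((z : Z) + (w - z0)))%:E).
  apply/measurable_EFinP/measurable_funM; first exact: (gZ_meas gA gB).
  apply: (cont_measurable sZ); apply: (cont_comp (g := Hg : mt A * mt B -> R)).
    exact: (gs_addr gAB).
  exact: Hg_cont.
rewrite [in leRHS]EFinM -muleA -(@lee_pmul2l _ (cmod (kapS z0 s))%:E) ?lte_fin//.
rewrite [leRHS]muleA -[in leRHS]EFinM mulfV ?mul1e ?gt_eqF// -EFinM -cmodM -i2.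
apply: le_trans (cmod_cint i1) _.
rewrite -ge0_integralZl_EFin ?(ltW c0)//; last first.
  by move=> z _; rewrite lee_fin mulr_ge0 ?gZ_ge0 ?cmod_ge0.
rewrite -(Zint_shift gA gB (z0 - w) (F := fun z => c%:E * (gZ (pi / 2) z * Hg ((z : Z) + (w - z0)))%:E)%E).
- rewrite le_eqVlt; apply/orP; left; apply/eqP; apply: eq_integral => z _.
  have e1 : gZ (pi / 2) (w - ((z : Z) + z0)) = gZ (pi / 2) ((z : Z) + (z0 - w)).
    by rewrite !gZE (gGBC gAB) addrA.
  have e2 : (z : Z) + (z0 - w) + (w - z0) = z by rewrite -addrA -opprB addNr addr0.
  rewrite cmodM (vgE gA gp) cmodM (gp_norm gp) mul1r (am_cmod gA gB gp) -EFinM e1 e2 /Hg.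
  by move: (gZ _ _) => x; rewrite mulrA.
- by apply: emeasurable_funM => //; exact: measurable_cst.
- by move=> z; rewrite mule_ge0 ?lee_fin ?(ltW c0) ?mulr_ge0 ?gZ_ge0 ?cmod_ge0.
Qed.

End Change.
End Window.

Section LnormE.
Context d (T : measurableType d) (R : realType) (mu : {measure set T -> \bar R}).
Implicit Types f : T -> \bar R.

Lemma Lnorm_finE (r : R) f :
  Lnorm mu r%:E f = ((\int[mu]_x (`|f x| `^ r)) `^ r^-1)%E.
Proof. by rewrite unlock. Qed.

Lemma Lnorm_ooE f : (0 < mu setT)%E -> Lnorm mu +oo f = ess_sup mu (abse \o f).
Proof. by rewrite unlock => ->. Qed.

Lemma le_poweRV (I : \bar R) (p M : R) : 0 < p -> (0 <= I)%E -> 0 <= M ->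
  (I `^ p^-1 <= M%:E)%E -> (I <= (M `^ p)%:E)%E.
Proof.
move=> p0; case: I => [r| |//]; rewrite ?lee_fin.
  by move=> r0 M0 /(ler_pow p0 (powR_ge0 _ _)); rewrite powRVK.
by rewrite poweRyr ?invr_neq0 ?gt_eqF.
Qed.

End LnormE.

(** * From essential to pointwise local suprema in mixed norms *)

Section Amalgam.
Context (R : realType) (A B : tgroup).
Variables (mu : {sigma_finite_measure set (mt A) -> \bar R})
  (nu : {sigma_finite_measure set (mt B) -> \bar R})
  (NA : A -> R) (kA : set A) (hA : A -> A) (NB : B -> R) (kB : set B) (hB : B -> B).
Hypotheses (gA : gspace mu NA kA hA) (gB : gspace nu NB kB hB).
Variables (pr : B -> A -> R[i]) (c : R).
Hypothesis gp : gpair mu nu NA kA NB kB pr c.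
Local Notation Z := (tgprod A B).
Local Notation mnu := (prod_measure mu nu).
Local Notation P := (gplane mu nu NA kA pr).
Local Notation phi := (phi NA kA).
Local Notation ts := (ts pr).
Local Notation gZ := (gZ NA kA NB kB).
Local Notation atoms := (atoms NA kA pr).
Local Notation sn := (sn mu nu NA kA pr).
Implicit Types (z w v : Z).

Let gAB := prod_gspace gA gB.
Let sZ := std_prod (gs_std gA) (gs_std gB).
Let phiL := phi_L2 gA.

Lemma nbhs0_add (G : tgroup) (m : {sigma_finite_measure set (mt G) -> \bar R})
    N k h (gG : gspace m N k h) (W : set (mt G)) : nbhs ((0 : G) : mt G) W ->
  exists V : set (mt G), [/\ open V, V (0 : G) & forall x y : G, V x -> V y -> W (x + y)].
Proof.
move=> nW.
have cD : continuous (fun z : mt G * mt G => (z.1 : G) + (z.2 : G) : mt G).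
  exact: (gs_contD gG (@cont_fst _ _) (@cont_snd _ _)).
have nW' : nbhs (((0 : G) + (0 : G)) : mt G) W by rewrite (addr0 (0 : G)).
have [[U V] /= [nU nV] UV] := cD ((0 : G), (0 : G)) _ nW'.
exists (interior U `&` interior V); split.
- by apply: openI; exact: open_interior.
- by split; [exact: nU|exact: nV].
- move=> x y [Ux _] [_ Vy]; apply: (UV (x, y)).
  by split; [exact: interior_subset Ux | exact: interior_subset Vy].
Qed.

Section Hyp.
Variables (Hg : Z -> R) (Q : set Z) (p : R).
Hypothesis Hg0 : forall z, 0 <= Hg z.
Hypothesis cHg : continuous (Hg : mt A * mt B -> R).
Hypothesis p0 : 0 < p.
Hypothesis Qn : nbhs ((0 : Z) : (mt A * mt B)%type) Q.

Let lm (z : mt A * mt B) : \bar R :=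
  ess_sup mnu ((fun w => (Hg w)%:E) \_ [set (z : Z) + q | q in Q]).

(** If the value at z exceeded the essential supremum, continuity would make it exceeded on a
    nonempty open subset of (x, y) + Q, a set of positive measure. *)
Lemma le_local_max (x : A) (y : B) (W1 : set (mt A)) (W2 : set (mt B)) z :
  open W1 -> open W2 -> W1 `*` W2 `<=` Q ->
  W1 (z.1 - x) -> W2 (z.2 - y) -> ((Hg z)%:E <= lm (x, y))%E.
Proof.
move=> o1 o2 W h1 h2; rewrite leNgt; apply/negP => lt.
set M := lm (x, y) in lt.
pose O : set (mt A * mt B) := [set z' | [/\ W1 ((z'.1 : A) - x), W2 ((z'.2 : B) - y) & (M < (Hg z')%:E)%E]].
have oO : open O.
  have -> : O = [set z' : mt A * mt B | W1 ((z'.1 : A) - x)] `&` [set z' | W2 ((z'.2 : B) - y)] `&`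
     [set z' | (M < (Hg z')%:E)%E].
    by apply/seteqP; split => z' /=; [move=> [] | move=> [[]]].
  apply: openI; first apply: openI.
  - apply: (@open_comp _ _ (fun z' : mt A * mt B => (z'.1 : A) - x : mt A)) => // z' _.
    by apply: (gs_contB gA); [exact: cont_fst | exact: cont_cst].
  - apply: (@open_comp _ _ (fun z' : mt A * mt B => (z'.2 : B) - y : mt B)) => // z' _.
    by apply: (gs_contB gB); [exact: cont_snd | exact: cont_cst].
  - apply: (@open_comp _ _ (Hg : mt A * mt B -> R) [set r | (M < r%:E)%E]).
      by move=> z' _; exact: cHg.
    exact: open_ereal_gt.
have mO : measurable O by exact: sZ.2.
have : (0 < mnu O)%E by apply: (gs_pos gAB) => //; exists z.
have [N [mN N0 sub]] := ess_sup_ge mnu ((fun w => (Hg w)%:E) \_ [set ((x, y) : Z) + q | q in Q]).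
apply/negP; rewrite -leNgt -N0; apply: le_measure; rewrite ?inE// => z' [a1 a2 a3].
apply: sub => /=; rewrite patchE mem_set; first by rewrite -/(lm (x, y)) -/M leNgt a3.
exists ((z'.1 : A) - x, (z'.2 : B) - y); first exact: W.
have e (G : zmodType) (a b : G) : a + (b - a) = b by rewrite addrC subrK.
by rewrite [RHS]surjective_pairing; congr (_, _); exact: e.
Qed.

(** The supremum over frequencies is essential, so the bound holds at almost every frequency only.
    Every om has such a frequency xi nearby, and the neighbourhood Q at xi contains a smaller one at
    om. *)
Lemma hyp_bound : (Lnorm nu +oo (fun xi => Lnorm mu p%:E (fun x => lm (x, xi))) < +oo)%E ->
  exists W : set Z, nbhs ((0 : Z) : (mt A * mt B)%type) W /\ exists2 M : R, 0 <= M &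
  forall om : B, (\int[mu]_x bsup W (fun z => (Hg z `^ p)%:E) (x, om) <= M%:E)%E.
Proof.
have nuT : (0 < nu setT)%E.
  by apply: (gs_pos gB); [exact: openT | exists (0 : B)].
rewrite Lnorm_ooE//; set F := abse \o _ => fin.
have F0 xi : (0 <= F xi)%E by exact: abse_ge0.
pose M := fine (ess_sup nu F).
have Me : (ess_sup nu F <= `|M|%:E)%E.
  rewrite /M; move: fin; case: (ess_sup nu F) => [r _| //|_]; last by rewrite leNye.
  by rewrite lee_fin ler_norm.
move: Qn => [[Q1 Q2] /= [n1 n2] Q12].
pose W1 : set (mt A) := interior Q1; pose W2 : set (mt B) := interior Q2.
have nW1 : nbhs ((0 : A) : mt A) W1 := @nbhs_interior (mt A) _ _ n1.
have nW2 : nbhs ((0 : B) : mt B) W2 := @nbhs_interior (mt B) _ _ n2.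
(* Room for two displacements in frequency: from xi to om, and the offset inside the local
   supremum. *)
have [V [oV V0 hV]] := nbhs0_add gB nW2.
have W12 : W1 `*` W2 `<=` Q.
  by move=> [z1 z2] [/= h1 h2]; apply: Q12; split; [exact: interior_subset h1 | exact: interior_subset h2].
exists (W1 `*` V); split.
  exists (W1, V) => //; split; first exact: nW1.
  by apply: open_nbhs_nbhs; split.
exists (`|M| `^ p); first exact: powR_ge0.
move=> om.
have [N [mN N0 sub]] := ess_sup_ge nu F.
pose O : set (mt B) := [set xi : B | V (om - xi)].
have oO : open O.
  apply: (@open_comp _ _ (fun xi : mt B => om - (xi : B) : mt B)) => // xi _.
  by apply: (gs_contB gB); [exact: cont_cst | exact: cont_id].
have [xi [Oxi Fxi]] : exists xi, O xi /\ (F xi <= ess_sup nu F)%E.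
  apply: contrapT => /forallNP h.
  have : (0 < nu O)%E by apply: (gs_pos gB) => //; exists om; rewrite /O/= subrr.
  apply/negP; rewrite -leNgt -N0; apply: le_measure; rewrite ?inE//.
    exact: (gs_std gB).2.
  by move=> xi Oxi; apply: sub => /= hF; apply: (h xi).
have lm0 z : (0 <= lm z)%E.
  have [h|/negP] := pselect (0 <= lm z)%E; first by [].
  rewrite -ltNge => lz.
  have : (0 < mnu setT)%E by apply: (gs_pos gAB); [exact: openT | exists z].
  move=> /ess_sup_gee => h; suff : (0 <= lm z)%E by rewrite leNgt lz.
  apply: h; apply: (@filterS _ _ _ setT); last exact: filterT.
  by move=> w _; rewrite patchE; case: ifP => // _; rewrite lee_fin.
have FM : (F xi <= `|M|%:E)%E by exact: le_trans Me.
move: FM; rewrite /F /= Lnorm_finE gee0_abs ?poweR_ge0// => /le_poweRV h.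
apply: le_trans (h p0 _ (normr_ge0 _)); last by apply: integral_ge0 => x _; exact: poweR_ge0.
apply: ge0_le_integral_nomeas => x.
  apply: bsup_ge0; first by exists 0; split; [exact: n1 | exact: V0].
  by move=> z; rewrite lee_fin powR_ge0.
apply: bsup_le => o [/= o1 o2]; rewrite -poweR_EFin.
have k : ((Hg ((x, om) + o)%R)%:E <= lm (x, xi))%E.
  apply: (@le_local_max x xi W1 W2); [exact: open_interior|exact: open_interior|exact: W12| | ].
    by rewrite /= addrC addKr.
  by rewrite /= addrAC; apply: hV.
by apply: gt0_ler_poweR; rewrite ?(ltW p0)// ?in_itv/= ?lee_fin ?Hg0 ?leey ?abse_ge0// gee0_abs.
Qed.

End Hyp.

Section Bound.
Variables (l : (A -> R[i]) -> R[i]) (C : R).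
Hypothesis lD : forall a f g, SC P f -> SC P g ->
  l (fun t => a * f t + g t) = a * l f + l g.
Hypothesis lC : forall f, SC P f -> ((cmod (l f))%:E <= C%:E * sn f)%E.
Hypothesis C0 : 0 <= C.
Variables (s : seq (R[i] * Z)) (Q : set Z) (p : R).
Hypothesis s0 : atoms s <> (fun=> 0).
Hypothesis p0 : 0 < p.
Hypothesis Qn : nbhs ((0 : Z) : (mt A * mt B)%type) Q.
Hypothesis fin : (Lpq_norm (P := P) p%:E +oo
  (local_max (P := P) Q (fun z => l (ts z (atoms s)))) < +oo)%E.

Let Hg z := cmod (l (ts z (atoms s))).
Let H z := cmod (l (ts z phi)).
Local Notation gboxZ := (gbox (prodN NA NB) (prodk kA kB)).
Local Notation GZ := (gG (prodN NA NB) (prodk kA kB)).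

(** The change of window is a Gaussian average; [int_pow] brings the exponent p inside it. The
    average is then harmless, because translating in position preserves the integral and the bound
    is uniform in frequency. *)
Lemma amalgam r : 0 < r -> exists2 K : R, 0 <= K & forall om : B,
  (\int[mu]_x bsup (gboxZ r) (fun z => (H z `^ p)%:E) (x, om) <= K%:E)%E.
Proof.
move=> r0; have cHg : continuous (Hg : mt A * mt B -> R) := Hg_cont gA gB gp lD lC C0 (s := s).
have Hg0 z : 0 <= Hg z by exact: cmod_ge0.
have [W [nW [M M0 hM]]] := hyp_bound Hg0 cHg p0 Qn fin.
have [z0 [K K0 wc]] := winchange gA gB gp lD lC C0 s0.
have [sq hs] := bsup_cover gAB 1 nW.
have pi4 : 0 < pi / 4 :> R by rewrite divr_gt0// pi_gt0.
have [C1 C10 ip] := int_pow gAB pi4 p0.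
set a' := pi / 4 / 4 * p in ip.
have a'0 : 0 < a' by rewrite mulr_gt0// divr_gt0.
have [I I0 IE] := gG_fin gAB a'0.
pose Hgp z := (Hg z `^ p)%:E; pose B' := bsup W Hgp.
have Hgp0 z : (0 <= Hgp z)%E by rewrite lee_fin powR_ge0.
have oHgp : forall r : R, open ([set x | (r%:E < Hgp x)%E] : set (mt A * mt B)) by exact: pow_open.
have oB : forall r : R, open ([set x | (r%:E < B' x)%E] : set (mt A * mt B)) := @gs_open_sup _ _ _ _ _ _ gAB W _ oHgp.
have W0 : W !=set0 by exists 0; exact: nbhs_singleton nW.
have B0 z : (0 <= B' z)%E by exact: bsup_ge0.
(* The cost, by [gG_near], of moving the Gaussian of exponent pi / 2 within the box; the exponent
   drops to pi / 4. *)
pose e := expR (pi / 2 * r); have e0 : 0 < e by exact: expR_gt0.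
have Ke : 0 < K * e by rewrite mulr_gt0.
pose Bs z := (\sum_(t <- sq) B' (z + t)%R)%E.
have Bs0 z : (0 <= Bs z)%E by exact: sume_ge0.
pose D w := (\int[mnu]_y ((GZ a' y)%:E * Bs ((y : Z) + (w - z0))%R))%E.
have HD w : (bsup (gboxZ r) (fun z => (H z `^ p)%:E) w <= (((K * e) `^ p) * C1)%:E * D w)%E.
  apply: bsup_le => b [kb Nb].
  pose X z := Hg (z + (w - z0)).
  have cX : continuous (X : mt A * mt B -> R).
    apply: (cont_comp (g := Hg : mt A * mt B -> R)); last exact: cHg.
    exact: (gs_addr gAB).
  have X0 z : 0 <= X z by exact: Hg0.
  pose V := H (w + b) / (K * e).
  have V0 : 0 <= V by rewrite divr_ge0 ?cmod_ge0// ltW.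
  have VE : H (w + b) = (K * e) * V by rewrite /V mulrCA mulfV ?mulr1// gt_eqF.
  have hV : (V%:E <= \int[mnu]_z (GZ (pi / 4) z * X z)%:E)%E.
    rewrite -(@lee_pmul2l _ (K * e)%:E) ?lte_fin// -EFinM -VE.
    apply: le_trans (wc _) _; rewrite EFinM -muleA lee_pmul2l ?lte_fin//.
    pose F (z : mt A * mt B) := (gZ (pi / 2) z * Hg ((z : Z) + (w + b - z0)))%:E.
    have mF : measurable_fun setT F.
      apply/measurable_EFinP/measurable_funM; first exact: (gZ_meas gA gB).
      apply: (cont_measurable sZ); apply: (cont_comp (g := Hg : mt A * mt B -> R)) => //.
      exact: (gs_addr gAB).
    rewrite -/(F _) -(Zint_shift gA gB (- b) mF); last first.
      by move=> z; rewrite lee_fin mulr_ge0 ?gZ_ge0.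
    rewrite -ge0_integralZl_EFin ?(ltW e0)//.
    - apply: ge0_le_integral_nomeas => z; first by rewrite lee_fin mulr_ge0 ?gZ_ge0.
      have zE : (z : Z) - b + (w + b - z0) = (z : Z) + (w - z0).
        by rewrite -addrA; congr (_ + _); rewrite (addrAC w) addrC addrK.
      rewrite /F zE -EFinM lee_fin mulrA -/(X z); apply: ler_wpM2r; first exact: X0.
      rewrite gZE.
      have -> : pi / 4 = pi / 2 / 2 :> R by field.
      have kb' : prodk kA kB (- b) by exact: (gs_kN gAB).
      apply: (gG_near gAB); rewrite ?divr_ge0 ?pi_ge0//.
        by rewrite addrC addKr.
      by rewrite addrC addKr (gs_NN gAB) ltW.
    - by move=> z _; rewrite lee_fin; apply: mulr_ge0; [exact: gG_ge0 | exact: X0].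
    - apply/measurable_EFinP/measurable_funM; first exact: (gG_meas gAB).
      exact: (cont_measurable sZ).
  have := ip X V X0 cX V0 hV => h.
  rewrite VE powRM ?(ltW Ke)// EFinM [(_ * C1)%:E]EFinM -muleA.
  rewrite lee_wpmul2l ?lee_fin ?powR_ge0//; apply: le_trans h _.
  rewrite lee_wpmul2l ?lee_fin//.
  apply: ge0_le_integral_nomeas => y.
    apply: mule_ge0; first by rewrite lee_fin; exact: gG_ge0.
    apply: bsup_ge0 => [|z]; last by rewrite lee_fin; exact: powR_ge0.
    by exists 0; apply: (gbox0 gAB); exact: ltr01.
  rewrite lee_wpmul2l ?lee_fin ?gG_ge0//.
  rewrite (bsup_shift (gboxZ 1) Hgp y (w - z0)).
  exact: hs.
exists (((K * e) `^ p * C1) * (I * ((size sq)%:R * M))).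
  by rewrite !mulr_ge0 ?powR_ge0.
move=> om.
pose G (q : mt A * (mt A * mt B)) : \bar R :=
  ((GZ a' q.2)%:E * Bs ((q.2 : Z) + ((q.1, om) - z0))%R)%E.
have G0 q : (0 <= G q)%E by rewrite mule_ge0 ?lee_fin ?gG_ge0.
have sAZ := std_prod (gs_std gA) sZ.
have mG : measurable_fun setT G.
  apply: emeasurable_funM.
    apply/measurable_EFinP; apply: (cont_measurable sAZ).
    exact: (cont_comp (@cont_snd _ _) (gG_cont gAB (a := a'))).
  rewrite /Bs; elim: sq {hs Bs Bs0 D HD G G0} => [|t sq ih].
    by under eq_fun do rewrite big_nil; exact: measurable_cst.
  under eq_fun do rewrite big_cons; apply: emeasurable_funD => //.
  apply: (std_continuous_comp (f := fun q : mt A * (mt A * mt B) =>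
    (q.2 : Z) + ((q.1, om) - z0) + t : mt A * mt B) sAZ _ oB).
  apply: (gs_contD gAB); last exact: cont_cst.
  apply: (gs_contD gAB); first exact: cont_snd.
  apply: (gs_contB gAB); last exact: cont_cst.
  by apply: (@cont_pair _ (mt A) (mt B)); [exact: cont_fst | exact: cont_cst].
apply: (@le_trans _ _ (\int[mu]_x (((K * e) `^ p * C1)%:E * D (x, om)))%E).
  apply: ge0_le_integral_nomeas => x; last exact: HD.
  apply: bsup_ge0; last by move=> z; rewrite lee_fin powR_ge0.
  by exists 0; exact: (gbox0 gAB).
have mD : measurable_fun setT (fun x : mt A => D (x, om)).
  exact: (@measurable_fun_fubini_tonelli_F _ _ _ _ _ mnu G mG G0).
have D0 w : (0 <= D w)%E by apply: integral_ge0 => y _; rewrite mule_ge0 ?lee_fin ?gG_ge0.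
rewrite ge0_integralZl_EFin ?mulr_ge0 ?powR_ge0//.
rewrite [leRHS]EFinM lee_wpmul2l ?lee_fin ?mulr_ge0 ?powR_ge0//.
(* Integrating in x first: each translate of B' becomes B' at some shifted frequency, where the
   bound M applies. *)
have -> : (\int[mu]_x D (x, om) = \int[mnu]_y \int[mu]_x G (x, y))%E.
  exact: (tonelli mu mnu mG G0).
apply: (@le_trans _ _ (\int[mnu]_y ((GZ a' y)%:E * ((size sq)%:R * M)%:E))%E).
  apply: ge0_le_integral_nomeas => y; first by apply: integral_ge0 => x _; exact: G0.
  have mBt t : measurable_fun setT (fun x : mt A => B' ((y : Z) + ((x, om) - z0) + t)).
    apply: (std_continuous_comp (f := fun x : mt A =>
      (y : Z) + ((x, om) - z0) + t : mt A * mt B) (gs_std gA) _ oB).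
    apply: (gs_contD gAB); last exact: cont_cst.
    apply: (gs_contD gAB); first exact: cont_cst.
    apply: (gs_contB gAB); last exact: cont_cst.
    by apply: (@cont_pair _ (mt A) (mt B)); [exact: cont_id | exact: cont_cst].
  have mBs' : measurable_fun setT (fun x : mt A => Bs ((y : Z) + ((x, om) - z0))).
    by rewrite /Bs; apply: emeasurable_sum => t.
  rewrite /G /= ge0_integralZl_EFin ?gG_ge0//.
  rewrite lee_wpmul2l ?lee_fin ?gG_ge0// /Bs ge0_integral_sum//.
  rewrite [leRHS](_ : _ = \sum_(t <- sq) M%:E)%E; last first.
    by rewrite sumEFin big_const_seq count_predT iter_addr_0 mulr_natl.
  apply: lee_sum => t _.
  pose om' : B := y.2 + (om - z0.2) + t.2.
  rewrite (_ : (fun x => _) = (fun x : mt A => B' ((x : A) + (y.1 - z0.1 + t.1), om'))); last first.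
    apply/funext => x; congr (B' (_, _)) => /=.
    by rewrite addrCA -addrA.
  rewrite (gs_int_shift gA _ (F := fun x => B' (x, om')))//.
  apply: (std_continuous_comp (f := fun x : mt A => (x, om' : mt B) : mt A * mt B) (gs_std gA) _ oB).
  by apply: (@cont_pair _ (mt A) (mt B)); [exact: cont_id | exact: cont_cst].
rewrite ge0_integralZr//; last 3 first.
- by apply/measurable_EFinP; exact: (gG_meas gAB).
- by move=> y _; rewrite lee_fin gG_ge0.
- by rewrite lee_fin mulr_ge0.
by rewrite [X in (X * _)%E]IE EFinM.
Qed.

End Bound.
End Amalgam.

(** * The kernel of the localization operator *)

Section ZmodReflect.
Variable V : zmodType.

Inductive zexpr := Zvar of nat | Zzero | Zadd of zexpr & zexpr | Zopp of zexpr.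

Fixpoint zeval (e : seq V) x : V :=
  match x with
  | Zvar n => e`_n | Zzero => 0
  | Zadd a b => zeval e a + zeval e b | Zopp a => - zeval e a
  end.

Fixpoint zcoef x (n : nat) : int :=
  match x with
  | Zvar m => if n == m then 1 else 0 | Zzero => 0
  | Zadd a b => zcoef a n + zcoef b n | Zopp a => - zcoef a n
  end.

Lemma zevalE e x : zeval e x = \sum_(n < size e) e`_n *~ zcoef x n.
Proof.
elim: x => [m||a iha b ihb|a iha] /=.
- have [ms|ms] := ltnP m (size e).
    rewrite (bigD1 (Ordinal ms))//= eqxx mulr1z big1 ?addr0// => i.
    by rewrite -val_eqE /= => /negbTE ->; rewrite mulr0z.
  rewrite nth_default// big1// => i _; case: eqP => [im|_]; last by rewrite mulr0z.
  by move: (ltn_ord i); rewrite im ltnNge ms.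
- by rewrite big1// => i _; rewrite mulr0z.
- by rewrite iha ihb -big_split; apply: eq_bigr => i _; rewrite mulrzDr.
- by rewrite iha -sumrN; apply: eq_bigr => i _; rewrite mulrNz.
Qed.

(** Equality is reduced to a boolean comparison of integer coefficients, one for each variable in
    the list, which evaluates by computation. *)
Lemma zeval_eq e x y : all (fun n => zcoef x n == zcoef y n) (iota 0 (size e)) ->
  zeval e x = zeval e y.
Proof.
move=> /allP h; rewrite !zevalE; apply: eq_bigr => i _.
by rewrite (eqP (h i _))// mem_iota /= add0n.
Qed.

End ZmodReflect.

Ltac zm_index l x :=
  match l with
  | x :: _ => constr:(0%N)
  | _ :: ?t => let n := zm_index t x in constr:(S n)
  end.
Ltac zm_mem l x :=
  match l with
  | x :: _ => constr:(true)
  | _ :: ?t => zm_mem t x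
  | _ => constr:(false)
  end.
Ltac zm_vars l x :=
  match x with
  | (?a + ?b)%R => let l1 := zm_vars l a in zm_vars l1 b
  | (- ?a)%R => zm_vars l a
  | 0%R => l
  | _ => match zm_mem l x with true => l | false => constr:(x :: l) end
  end.
Ltac zm_reify l x :=
  match x with
  | (?a + ?b)%R => let a1 := zm_reify l a in let b1 := zm_reify l b in constr:(Zadd a1 b1)
  | (- ?a)%R => let a1 := zm_reify l a in constr:(Zopp a1)
  | 0%R => constr:(Zzero)
  | _ => let n := zm_index l x in constr:(Zvar n)
  end.
(* Decides equations between Z-linear combinations in an abelian group. *)
Ltac zmod :=
  match goal with
  | |- @eq ?T ?x ?y =>
    let l0 := constr:(@nil T) in
    let l1 := zm_vars l0 x in let l := zm_vars l1 y in
    let x1 := zm_reify l x in let y1 := zm_reify l y in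
    exact: (@zeval_eq _ l x1 y1 isT)
  end.

Lemma cint_prod d1 d2 (T1 : measurableType d1) (T2 : measurableType d2) (R : realType)
    (m1 : {sigma_finite_measure set T1 -> \bar R})
    (m2 : {sigma_finite_measure set T2 -> \bar R}) (f : T1 -> R[i]) (g : T2 -> R[i]) :
  cintg m1 f -> cintg m2 g ->
  cint (prod_measure m1 m2) (fun z => f z.1 * g z.2) = cint m1 f * cint m2 g.
Proof.
move=> fi gi; have [mf _] := fi; have [mg _] := gi.
have mfg : cmeas (fun z : T1 * T2 => f z.1 * g z.2).
  by apply: cmeasM; [exact: (cmeas_comp measurable_fst mf) | exact: (cmeas_comp measurable_snd mg)].
have ifg : cintg (prod_measure m1 m2) (fun z => f z.1 * g z.2).
  split => //; rewrite tonelli1//; [|exact: cmeas_cmodE|by move=> z; rewrite lee_fin cmod_ge0].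
  under eq_integral => x _.
    under eq_integral do rewrite /= cmodM EFinM.
    rewrite ge0_integralZl_EFin ?cmod_ge0//; last 2 first.
    - by move=> y _; rewrite lee_fin cmod_ge0.
    - exact: cmeas_cmodE.
    over.
  rewrite -(fineK (cintg_fin_num gi)) ge0_integralZr//; last 3 first.
  - exact: cmeas_cmodE.
  - by move=> x _; rewrite lee_fin cmod_ge0.
  - by rewrite lee_fin fine_ge0// integral_ge0// => y _; rewrite lee_fin cmod_ge0.
  by rewrite -(fineK (cintg_fin_num fi)) -EFinM ltry.
have [_ _ <-] := cfubini1 ifg.
rewrite (_ : (fun x => _) = (fun x => cint m2 g * f x)); last first.
  by apply/funext => x; rewrite mulrC; exact: (cintZ (f x) gi).
by rewrite cintZ// mulrC.
Qed.

Section Double.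
Context (R : realType) (A B : tgroup).
Variables (mu : {sigma_finite_measure set (mt A) -> \bar R})
  (nu : {sigma_finite_measure set (mt B) -> \bar R})
  (NA : A -> R) (kA : set A) (hA : A -> A) (NB : B -> R) (kB : set B) (hB : B -> B).
Hypotheses (gA : gspace mu NA kA hA) (gB : gspace nu NB kB hB).
Variables (pr : B -> A -> R[i]) (c c' : R).
Hypothesis gp : gpair mu nu NA kA NB kB pr c.
Hypothesis gp' : gpair nu mu NB kB NA kA (fun x y => pr y x) c'.

Definition pr2 (eta : tgprod B A) (z : tgprod A B) : R[i] := pr eta.1 z.1 * pr z.2 eta.2.

Lemma pr2_cint (a : R) (eta : tgprod B A) : 0 < a ->
  cint (pmeas mu nu) (fun z : mt (tgprod A B) =>
    (gG (prodN NA NB) (prodk kA kB) a z)%:C * (pr2 eta z)^*) =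
  cint mu (fun x : mt A => (gG NA kA a x)%:C * (pr eta.1 x)^*) *
  cint nu (fun y : mt B => (gG NB kB a y)%:C * (pr y eta.2)^*).
Proof.
move=> a0.
have i1 : cintg mu (fun x : mt A => (gG NA kA a x)%:C * (pr eta.1 x)^*).
  apply: (gG_cintg gA (M := 1)) => //; last by move=> x; rewrite cmod_conj (gp_norm gp).
  by apply: cmeas_conj; apply: (ccont_cmeas (gs_std gA)); exact: (pr_cont1 gp).
have i2 : cintg nu (fun y : mt B => (gG NB kB a y)%:C * (pr y eta.2)^*).
  apply: (gG_cintg gB (M := 1)) => //; last by move=> x; rewrite cmod_conj (gp_norm gp).
  by apply: cmeas_conj; apply: (ccont_cmeas (gs_std gB)); exact: (pr_cont2 gp).
rewrite -(cint_prod i1 i2); congr cint; apply/funext => z.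
by rewrite gG_prod /pr2; move: (gG _ _ _ _) (gG _ _ _ _) => u u'; rewrite !rmorphM/=; ring.
Qed.

(** Transforms on the product factor into one transform on A and one on B. The latter is [gp'], the
    pair with the two groups exchanged, so the constants multiply. *)
Lemma gpair2 : gpair (pmeas mu nu) (pmeas nu mu) (prodN NA NB) (prodk kA kB)
  (prodN NB NA) (prodk kB kA) pr2 (c * c').
Proof.
have N1 y x : cmod (pr y x) = 1 by exact: (gp_norm gp).
have pi2 : 0 < pi / 2 :> R by rewrite divr_gt0// pi_gt0.
have pi1 : 0 < 2 * pi :> R by rewrite mulr_gt0// pi_gt0.
have cc y x : (pr (- y) x)^* = pr y x by rewrite (prNl gp) conjCK.
have cc' y x : (pr y (- x))^* = pr y x by rewrite (prNr gp) conjCK.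
split.
- by rewrite mulr_gt0// ?(gp_c gp)// (gp_c gp').
- by move=> y x; rewrite /pr2 cmodM !N1 mulr1.
- by move=> y y' x; rewrite /pr2 /= (gp_Dl gp) (gp_Dr gp) mulrACA.
- by move=> y x x'; rewrite /pr2 /= (gp_Dl gp) (gp_Dr gp) mulrACA.
- apply: ccontM; apply: (pr_ccont gp).
  + exact: (cont_comp (@cont_fst (mt B * mt A)%type (mt A * mt B)%type) (@cont_fst (mt B) (mt A))).
  + exact: (cont_comp (@cont_snd (mt B * mt A)%type (mt A * mt B)%type) (@cont_fst (mt A) (mt B))).
  + exact: (cont_comp (@cont_snd (mt B * mt A)%type (mt A * mt B)%type) (@cont_snd (mt A) (mt B))).
  + exact: (cont_comp (@cont_fst (mt B * mt A)%type (mt A * mt B)%type) (@cont_snd (mt B) (mt A))).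
- move=> y; rewrite pr2_cint// (gp_F1 gp) (gp_F1 gp' y.2) gG_prod.
  by move: (gG _ _ _ _) (gG _ _ _ _) => u u'; rewrite -rmorphM/=; congr (_%:C); ring.
- move=> x.
  have i1 : cintg nu (fun y : mt B => (gG NB kB (pi / 2) y)%:C * pr y x.1).
    apply: (gG_cintg gB (M := 1)) => //; last by move=> y; rewrite (gp_norm gp).
    by apply: (ccont_cmeas (gs_std gB)); exact: (pr_cont2 gp).
  have i2 : cintg mu (fun y : mt A => (gG NA kA (pi / 2) y)%:C * pr x.2 y).
    apply: (gG_cintg gA (M := 1)) => //; last by move=> y; rewrite (gp_norm gp).
    by apply: (ccont_cmeas (gs_std gA)); exact: (pr_cont1 gp).
  transitivity (cint (prod_measure nu mu) (fun z : mt B * mt A =>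
     ((gG NB kB (pi / 2) z.1)%:C * pr z.1 x.1) * ((gG NA kA (pi / 2) z.2)%:C * pr x.2 z.2))).
    congr cint; apply/funext => z.
    by rewrite gG_prod /pr2; move: (gG _ _ _ _) (gG _ _ _ _) => u u'; rewrite !rmorphM/=; ring.
  rewrite (cint_prod i1 i2) (gp_F2 gp) (gp_F2 gp' x.2) gG_prod.
  move: (gG _ _ _ _) (gG _ _ _ _) => u u'; rewrite -rmorphM/= invfM; congr (_%:C).
  by move: c^-1 c'^-1 => e e'; ring.
Qed.

(** Compatibility of the halving maps with the pairing: x - 2 hA x is the part of x outside R^n, on
    which the characters in kB are trivial for x in kA, and y - 2 hB y is a character trivial on
    R^n, where hA takes its values. *)
Hypothesis th1 : forall y x, kB y -> kA x -> pr y (x - hA x - hA x) = 1.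
Hypothesis th2 : forall y x, pr (y - hB y - hB y) (hA x) = 1.

Local Notation Z := (tgprod A B).
Local Notation am := (am mu NA kA pr).
Local Notation gZ := (gZ NA kA NB kB).
Local Notation ts2 := (ts pr2).
Local Notation phi2 := (phi (prodN NA NB) (prodk kA kB)).
Local Notation hZ := (prodh hA hB).
Let gAB := prod_gspace gA gB.

Lemma hA_B x y : hA (x - y) = hA x - hA y. Proof. exact: (gs_hfB gA). Qed.
Lemma hA_0 : hA 0 = 0. Proof. by have := hA_B 0 0; rewrite subrr subrr. Qed.
Lemma hA_N x : hA (- x) = - hA x. Proof. by have := hA_B 0 x; rewrite !sub0r hA_0 sub0r. Qed.
Lemma hA_D x y : hA (x + y) = hA x + hA y.
Proof. by rewrite -[y]opprK hA_B !hA_N !opprK. Qed.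

(** All phases collect into a constant times a character of (x, y). The terms containing halves
    cancel by [th1] and by the hypothesis on a' - a, which is what makes the product in [prod_am] an
    exact atom. *)
Lemma phase (a b a' b' : B) (d e d' e' : A) (y : B) (x : A) : kB y -> kA x ->
  (forall u, pr (a' - a) (hA u) = 1) ->
  pr (a + y) (d + (x - hA x)) * pr (a' - y) (d' + hA x) * ((pr b (e + x))^* * pr b' (e + x)) =
  (pr a d * pr a' d' * ((pr b e)^* * pr b' e)) * (pr (a + b' - b) x * pr y (d - d')).
Proof.
move=> ky kx h.
have E1 : pr y (x - hA x) = pr y (hA x).
  have := th1 ky kx; rewrite (gp_Dr gp) (prNr gp) => E.
  by rewrite -[RHS]mul1r -E -mulrA [X in _ * X]mulrC (pr_conjM gp) mulr1.
have E2 : pr a (x - hA x) = pr a x * (pr a (hA x))^* by rewrite (gp_Dr gp) (prNr gp).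
have E3 : pr a' (hA x) = pr a (hA x).
  have := h x; rewrite (gp_Dl gp) (prNl gp) => E.
  by rewrite -[RHS]mul1r -E -mulrA [X in _ * X]mulrC (pr_conjM gp) mulr1.
move: E1 E2; move: (x - hA x) => xx E1 E2.
rewrite !(gp_Dl gp) !(gp_Dr gp) E1 E2 !(prNl gp) !(prNr gp) E3 rmorphM/=.
have I1 := pr_conjM gp y (hA x); have I2 := pr_conjM gp a (hA x).
(* [ring] does not see that p1 and p2 have modulus 1; their inverses are supplied by multiplying the
   right-hand side by 1. *)
set p1 := pr y (hA x) in I1 *; set p2 := pr a (hA x) in I2 *.
rewrite -[RHS]mulr1 -I1 -[RHS]mulr1 -[X in _ = _ * X]I2.
by ring.
Qed.

(** As functions of x the two factors are Gaussians about t1 and t2 times characters. [gG_mid]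
    merges the Gaussians at the midpoint m, leaving a Gaussian in t1 - t2, and [phase] merges the
    characters into the frequency om. *)
Lemma prod_am (p q z w x : Z) :
  let t1 := z - p in let t2 := w - q in
  let m := t1 + hZ (t2 - t1) in
  let om : tgprod B A := (hB (t2.2 - t1.2) + q.2 - p.2,
    (z.1 - w.1) + (hA (t2.1 - t1.1) + hA (t2.1 - t1.1)) -
     (hA (hA (t2.1 - t1.1)) + hA (hA (t2.1 - t1.1)))) in
  exists2 C0 : R[i], cmod C0 = c ^+ 2 * gZ (pi / 4) (t1 - t2) &
  forall x : Z, (pr p.2 x.1)^* * pr q.2 x.1 * (am (x + p) z * am w (x + q)) =
    C0 * ts2 (m, om) phi2 x.
Proof.
move=> t1 t2 m om.
(* The arguments of the two phases of [amE] at x = m; their increments away from m are the y and X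
   below. *)
pose a := m.2 - t1.2; pose a' := t2.2 - m.2.
pose d := m.1 + p.1 + hA (t1.1 - m.1); pose d' := w.1 + hA (m.1 - t2.1).
pose C1 := pr a d * pr a' d' * ((pr p.2 m.1)^* * pr q.2 m.1).
pose C0 := (c ^+ 2 * gZ (pi / 4) (t1 - t2))%:C * (C1 * (pr2 om m)^*).
have N1 y x' : cmod (pr y x') = 1 by exact: (gp_norm gp).
exists C0.
  rewrite /C0 /C1 /pr2 !cmodM ?(cmod_conj, cmodM) !N1 !mulr1 cmod_real ger0_norm//.
  by rewrite mulr_ge0 ?sqr_ge0 ?gZ_ge0.
have adE : a' - a = (t2.2 - t1.2) - hB (t2.2 - t1.2) - hB (t2.2 - t1.2).
  rewrite /a' /a /m /=; move: (hB _) => hd; zmod.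
have om1 : a + q.2 - p.2 = om.1 by rewrite /a /om /= /m /= [_ + hB _]addrC addrK.
have om2 : d - d' = om.2.
  pose D := hA (t2.1 - t1.1).
  have e1 : t1.1 - m.1 = - D by rewrite /m /= -/D; zmod.
  have e2 : m.1 - t2.1 = D - (t2.1 - t1.1) by rewrite /m /= -/D; zmod.
  rewrite /d /d' /om e1 e2 hA_N hA_B -/D /=.
  rewrite -[hA (w.1 - q.1 - (z.1 - p.1))]/D.
  move: (hA D) => D'; move: D {e1 e2} => D; zmod.
move=> x'; pose X := x'.1 - m.1; pose y := x'.2 - m.2.
have -> : C0 * ts2 (m, om) phi2 x' = (c ^+ 2 * (gZ (pi / 4) (t1 - t2) *
    gG (prodN NA NB) (prodk kA kB) pi (x' - m)))%:C * (C1 * (pr om.1 X * pr y om.2)).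
  have -> : pr om.1 X * pr y om.2 = (pr2 om m)^* * pr2 om x'.
    by rewrite /pr2 /X /y (gp_Dr gp) (prNr gp) (gp_Dl gp) (prNl gp) rmorphM/=; ring.
  rewrite /C0 /Submission.ts /Submission.phi /=; move: (gZ _ _) (gG _ _ _ _) (pr2 om m) (pr2 om x') => r1 r2 q1 q2.
  by rewrite !rmorphM/=; ring.
set ph1 := pr ((x' + p).2 - z.2) ((x' + p).1 + hA (z.1 - (x' + p).1)).
set ph2 := pr (w.2 - (x' + q).2) (w.1 + hA ((x' + q).1 - w.1)).
have gE : gZ (pi / 2) (x' + p - z) * gZ (pi / 2) (w - (x' + q)) =
    gZ (pi / 4) (t1 - t2) * gG (prodN NA NB) (prodk kA kB) pi (x' - m).
  rewrite !gZE.
  have -> : x' + p - z = x' - t1 by rewrite /t1; zmod.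
  have -> : w - (x' + q) = - (x' - t2) by rewrite /t2; zmod.
  rewrite (gGN gAB) (gG_mid gAB).
  have -> : pi / 2 / 2 = pi / 4 :> R by field.
  by have -> : 2 * (pi / 2) = pi :> R by field.
have -> : (pr p.2 x'.1)^* * pr q.2 x'.1 * (am (x' + p) z * am w (x' + q)) =
    (c ^+ 2 * (gZ (pi / 4) (t1 - t2) * gG (prodN NA NB) (prodk kA kB) pi (x' - m)))%:C *
    (ph1 * ph2 * ((pr p.2 x'.1)^* * pr q.2 x'.1)).
  rewrite -gE !(amE gA gB gp) -/ph1 -/ph2.
  rewrite -[gG NA kA (pi / 2) ((x' + p).1 - z.1) * _]/(gZ (pi / 2) (x' + p - z)).
  rewrite -[gG NA kA (pi / 2) (w.1 - (x' + q).1) * _]/(gZ (pi / 2) (w - (x' + q))).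
  move: (gZ _ (x' + p - z)) (gZ _ (w - (x' + q))) => r1 r2.
  by rewrite !rmorphM/=; ring.
(* Outside the support of the Gaussian both sides are 0; inside it the displacement lies in kA and
   kB, as [phase] requires. *)
have [[kx ky]|k] := pselect (prodk kA kB (x' - m)); last first.
  by rewrite (gG_nkap _ _ k) !mulr0 !mul0r.
congr (_ * _).
rewrite -om1 -om2.
have h u : pr (a' - a) (hA u) = 1 by rewrite adE th2.
have := @phase a p.2 a' q.2 d m.1 d' m.1 y X ky kx h.
rewrite -/C1 => <-.
have xE : x'.1 = m.1 + X by rewrite /X; zmod.
congr (_ * _ * _).
- rewrite /ph1; congr pr.
    by rewrite /a /y /t1 /=; move: (m.2) => m2; zmod.
  rewrite /d -addrA -addrA.
  have -> : z.1 - (x' + p).1 = (t1.1 - m.1) - X by rewrite /X /t1 /=; move: (m.1) => m1; zmod.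
  have hX : hA (t1.1 - m.1 - X) = hA (t1.1 - m.1) - hA X by exact: hA_B.
  rewrite hX xE.
  move: (hA X) (hA (t1.1 - m.1)) (m.1) (p.1) => u u' u'' v; zmod.
- rewrite /ph2; congr pr.
    by rewrite /a' /y /t2 /=; move: (m.2) => m2; zmod.
  have -> : (x' + q).1 - w.1 = (m.1 - t2.1) + X by rewrite /X /t2 /=; move: (m.1) => m1; zmod.
  by rewrite hA_D /d'; zmod.
- by rewrite -xE.
Qed.

End Double.

Section Kernel.
Context (R : realType) (A B : tgroup).
Variables (mu : {sigma_finite_measure set (mt A) -> \bar R})
  (nu : {sigma_finite_measure set (mt B) -> \bar R})
  (NA : A -> R) (kA : set A) (hA : A -> A) (NB : B -> R) (kB : set B) (hB : B -> B).
Hypotheses (gA : gspace mu NA kA hA) (gB : gspace nu NB kB hB).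
Variables (pr : B -> A -> R[i]) (c c' : R).
Hypothesis gp : gpair mu nu NA kA NB kB pr c.
Hypothesis gp' : gpair nu mu NB kB NA kA (fun x y => pr y x) c'.
Hypothesis th1 : forall y x, kB y -> kA x -> pr y (x - hA x - hA x) = 1.
Hypothesis th2 : forall y x, pr (y - hB y - hB y) (hA x) = 1.
Local Notation Z := (tgprod A B).
Local Notation P := (gplane mu nu NA kA pr).
Local Notation inner := (inner mu).
Local Notation phi2 := (phi (prodN NA NB) (prodk kA kB)).
Local Notation phi := (phi NA kA).
Local Notation ts2 := (ts (pr2 pr)).
Local Notation ts := (ts pr).
Local Notation am := (am mu NA kA pr).
Local Notation gZ := (gZ NA kA NB kB).
Local Notation atoms := (atoms NA kA pr).
Local Notation Z2 := (tgprod B A).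
Local Notation P2 := (gplane (pmeas mu nu) (pmeas nu mu) (prodN NA NB) (prodk kA kB) (pr2 pr)).
Local Notation hZ := (prodh hA hB).
Implicit Types (z w v : Z).

Let gAB := prod_gspace gA gB.
Let sZ := std_prod (gs_std gA) (gs_std gB).
Let phiL := phi_L2 gA.
Let gBA := prod_gspace gB gA.
Let gp2 := gpair2 gA gB gp gp'.

(* The short-time Fourier transform of the function in the kernel [Kf z w] below
   concentrates at the time-frequency point [(mm i z w, omm i z w)]. *)
Definition mm (i : (R[i] * Z) * (R[i] * Z)) z w : Z :=
  let t1 := z - i.1.2 in let t2 := w - i.2.2 in t1 + hZ (t2 - t1).

Definition omm (i : (R[i] * Z) * (R[i] * Z)) z w : Z2 :=
  let t1 := z - i.1.2 in let t2 := w - i.2.2 in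
  (hB (t2.2 - t1.2) + i.2.2.2 - i.1.2.2,
    (z.1 - w.1) + (hA (t2.1 - t1.1) + hA (t2.1 - t1.1)) -
     (hA (hA (t2.1 - t1.1)) + hA (hA (t2.1 - t1.1)))).

Variables s1 s2 : seq (R[i] * Z).

(** Chosen so that [a (Kf z w)] is the matrix entry of the localization operator between the atoms
    at z and w, for the windows [atoms s1] and [atoms s2]. *)
Definition Kf z w : Z -> R[i] := fun x =>
  (inner (ts z phi) (ts x (atoms s1)))^* * inner (ts w phi) (ts x (atoms s2)).

Let ij := [seq (i, j) | i <- s1, j <- s2].

Lemma inner_ts_atoms z x s : inner (ts z phi) (ts x (atoms s)) =
  \sum_(p <- s) (p.1^* * pr p.2.2 x.1) * am z (x + p.2).
Proof.
have zL := tsL2 gA gp z phiL.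
have SA : SC P (ts x (atoms s)) by apply: (SC_ts gp); apply/SCP; exists s.
rewrite (inner_conj (SC_L2 gA gp SA) zL) (ts_atoms gp) (inner_atoms gA gp)//.
rewrite big_map rmorph_sum; apply: eq_bigr => p _ /=.
rewrite !rmorphM/= conjCK -(inner_conj _ zL)//; exact: (tsL2 gA gp).
Qed.

Lemma Kf_sum z w : exists b : (R[i] * Z) * (R[i] * Z) -> R[i],
  (forall i, cmod (b i) = cmod i.1.1 * cmod i.2.1 *
     (c ^+ 2 * gZ (pi / 4) (z - i.1.2 - (w - i.2.2)))) /\
  Kf z w = fun x => \sum_(i <- ij) b i * ts2 (mm i z w, omm i z w) phi2 x.
Proof.
have ch (i : (R[i] * Z) * (R[i] * Z)) := cid2 (prod_am gA gB gp th1 th2 i.1.2 i.2.2 z w 0).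
pose C0 i := s2val (ch i).
exists (fun i => i.1.1 * i.2.1^* * C0 i); split.
  by move=> i; rewrite !cmodM cmod_conj (s2valP (ch i)).
apply/funext => x; rewrite /Kf !inner_ts_atoms rmorph_sum big_allpairs mulr_suml.
apply: eq_bigr => p _; rewrite mulr_sumr; apply: eq_bigr => q _.
have := s2valP' (ch (p, q)) x; rewrite -/(C0 _) /= => E.
rewrite !rmorphM/= conjCK -[RHS]mulrA -E.
have -> : (am z (x + p.2))^* = am (x + p.2) z.
  by rewrite /Submission.am -inner_conj//; exact: (tsL2 gA gp).
by ring.
Qed.

Variable a : (Z -> R[i]) -> R[i].
Hypothesis aD : S0_dual P2 a.

(** The modulus of the Gaussian short-time Fourier transform of the symbol. The conjugation matches
    the linear functional of [S0_dual_lin]. *)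
Definition H2 (z : tgprod Z Z2) : R := cmod ((a (ts2 z phi2))^*).

Lemma kernel_bound z w : cmod (a (Kf z w)) <= \sum_(i <- ij)
  cmod i.1.1 * cmod i.2.1 * c ^+ 2 *
  (gZ (pi / 4) (z - i.1.2 - (w - i.2.2)) * H2 (mm i z w, omm i z w)).
Proof.
have [b [bE ->]] := Kf_sum z w; rewrite -cmod_conj.
have lD := S0_dual_lin gAB gBA gp2 aD.
have := fun_lsum (l := fun f => (a f)^*) lD ij b
  (g := fun i => ts2 (mm i z w, omm i z w) phi2) (fun i => SC_phi gp2 _).
move=> ->; apply: le_trans (cmod_sum _ _ _) _; apply: ler_sum => i _.
by rewrite cmodM bE !mulrA.
Qed.

End Kernel.

(** * The eigenvalue equation as a pointwise inequality *)

Section Eigen.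
Context (R : realType) (A B : tgroup).
Variables (mu : {sigma_finite_measure set (mt A) -> \bar R})
  (nu : {sigma_finite_measure set (mt B) -> \bar R})
  (NA : A -> R) (kA : set A) (hA : A -> A) (NB : B -> R) (kB : set B) (hB : B -> B).
Hypotheses (gA : gspace mu NA kA hA) (gB : gspace nu NB kB hB).
Variables (pr : B -> A -> R[i]) (c c' : R).
Hypothesis gp : gpair mu nu NA kA NB kB pr c.
Hypothesis gp' : gpair nu mu NB kB NA kA (fun x y => pr y x) c'.
Hypothesis th1 : forall y x, kB y -> kA x -> pr y (x - hA x - hA x) = 1.
Hypothesis th2 : forall y x, pr (y - hB y - hB y) (hA x) = 1.
Local Notation Z := (tgprod A B).
Local Notation mnu := (prod_measure mu nu).
Local Notation P := (gplane mu nu NA kA pr).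
Local Notation L2 := (cLspace mu 2%:E).
Local Notation inner := (inner mu).
Local Notation phi := (phi NA kA).
Local Notation ts := (ts pr).
Local Notation gZ := (gZ NA kA NB kB).
Local Notation nrm := (nrm mu).
Local Notation atoms := (atoms NA kA pr).
Local Notation vg := (vg mu NA kA pr).
Local Notation sn := (sn mu nu NA kA pr).
Local Notation Z2 := (tgprod B A).
Local Notation P2 := (gplane (pmeas mu nu) (pmeas nu mu) (prodN NA NB) (prodk kA kB) (pr2 pr)).
Implicit Types (z w v : Z).

Let gAB := prod_gspace gA gB.
Let sZ := std_prod (gs_std gA) (gs_std gB).
Let phiL := phi_L2 gA.
Let gBA := prod_gspace gB gA.
Let gp2 := gpair2 gA gB gp gp'.

Let c0 : 0 < c := gp_c gp.

Lemma V_ccont f : L2 f -> ccont (fun z : mt A * mt B => inner f (ts z phi)).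
Proof.
move=> fL; pose D z z' := nrm (fun t => ts z phi t - ts z' phi t).
have cD z : continuous (fun z' : mt A * mt B => D z z').
  have := @cont_comp (mt A * mt B)%type R R _ _ (nsq_shift_cont gA gB gp (p := 0) (z := z)) (@sqrt_continuous R).
  by rewrite (ts0 gp).
apply: ccontP => z e e0.
have e1 : 0 < e / (nrm f + 1) by rewrite divr_gt0// ltr_wpDl// nrm_ge0.
have Dz : D z z = 0.
  rewrite /D (_ : (fun t => _) = (fun=> 0)); last by apply/funext => t; rewrite subrr.
  rewrite /nrm /Submission.nrm /nsq /L2n.
  by under eq_integral do rewrite cmod0 expr0n/=; rewrite integral0 sqrtr0.
have n1 : nbhs (z : mt A * mt B) [set z' | D z z' < e / (nrm f + 1)].
  by apply: (cvgr_lt _ (cD z z)); rewrite Dz.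
apply: (@filterS _ _ (@nbhs_filter (mt A * mt B)%type z) _ _ _ n1) => z' /= h.
have tL x := tsL2 gA gp x phiL.
rewrite -innerBr//; apply: le_trans (cauchy_schwarz fL (L2B (tL _) (tL _))) _.
apply: le_trans (_ : (nrm f + 1) * (e / (nrm f + 1)) <= _).
  by apply: ler_pM; rewrite ?nrm_ge0 ?lerDl// ltW.
by rewrite mulrCA mulfV ?mulr1// gt_eqF// ltr_wpDl// nrm_ge0.
Qed.

(** The inversion formula with a bounded functional in place of an inner product. For l the pairing
    of the operator with an atom, it expands an entry at h into entries at atoms. *)
Lemma fun_inversion (l : (A -> R[i]) -> R[i]) (C : R) h :
  (forall a f g, SC P f -> SC P g -> l (fun t => a * f t + g t) = a * l f + l g) ->
  (forall f, SC P f -> ((cmod (l f))%:E <= C%:E * sn f)%E) -> 0 <= C -> SC P h ->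
  cintg mnu (fun z => inner h (ts z phi) * l (ts z phi)) /\
  cint mnu (fun z => inner h (ts z phi) * l (ts z phi)) = c%:C * l h.
Proof.
move=> lD lC C0 /SCP[s ->].
have M v := lin_reproducing gA gB gp lD lC C0 0 v [:: (1, 0)].
have E (z : mt A * mt B) : inner (atoms s) (ts z phi) * l (ts z phi) =
    \sum_(p <- s) p.1 * (vg 0 p.2 z * l (ts z (atoms [:: (1, 0)]))).
  rewrite (inner_atoms gA gp); last exact: (tsL2 gA gp).
  rewrite mulr_suml; apply: eq_bigr => p _; rewrite (vgE gA gp) (pr0l gp) mul1r addr0.
  by rewrite -(phi_atom gp) mulrA.
under eq_fun do rewrite E.
split; first by apply: cintg_sum => p; apply: cintgZ; exact: (M p.2).1.
rewrite cint_sum => [|p]; last by apply: cintgZ; exact: (M p.2).1.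
have -> : l (atoms s) = \sum_(p <- s) p.1 * l (ts p.2 phi).
  exact: (fun_lsum lD s (fun p => p.1) (g := fun p => ts p.2 phi) (fun p => SC_phi gp p.2)).
rewrite mulr_sumr; apply: eq_bigr => p _.
rewrite cintZ ?(M p.2).2; last exact: (M p.2).1.
by rewrite (kapS00 gA gB gp); ring.
Qed.

Variables (s1 s2 : seq (R[i] * Z)) (a : (Z -> R[i]) -> R[i]).
Hypothesis aD : S0_dual P2 a.
Variables (Aop : (A -> R[i]) -> (A -> R[i])) (lam : R[i]) (f : A -> R[i]).
Hypothesis Ab : bounded_L2_operator mu Aop.
Hypothesis Aa : forall f g, S0 P f -> S0 P g -> inner (Aop f) g =
  a (fun x : Z => (inner f (ts x (atoms s1)))^* * inner g (ts x (atoms s2))).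
Hypothesis lam0 : lam != 0.
Hypothesis fE : eigenfunction mu Aop lam f.

Let fL : L2 f. Proof. by case: fE. Qed.
Let AL h : L2 h -> L2 (Aop h). Proof. by case: Ab => h1 _ _; exact: h1. Qed.

Lemma Aop_nrm : exists2 K, 0 <= K & forall h, L2 h -> nrm (Aop h) <= K * nrm h.
Proof.
have [_ _ [K hK]] := Ab; exists `|K| => // h hL.
have := hK h hL; rewrite !cLnorm2_nrm//; last exact: AL.
rewrite -EFinM lee_fin => /le_trans; apply.
by rewrite ler_wpM2r ?nrm_ge0// ler_norm.
Qed.

(** The operator is linear up to equality almost everywhere, hence linear on the nose only after
    pairing. *)
Lemma Aop_lin k g h x : L2 g -> L2 h -> L2 x ->
  inner (Aop (fun t => k * g t + h t)) x = k * inner (Aop g) x + inner (Aop h) x.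
Proof.
move=> gL hL xL; have [_ lin _] := Ab.
have L1 : L2 (fun t => k * g t + h t) by apply: L2D => //; exact: L2Z.
have L3 : L2 (fun t => k * Aop g t) by apply: L2Z; exact: AL.
rewrite (inner_ae (lin k g h gL hL) (AL L1) (L2D L3 (AL hL)) xL).
by rewrite innerDl ?innerZl//; exact: AL.
Qed.

Lemma cvg0_le0 (x K : R) (u : nat -> R) : u @ \oo --> 0 ->
  (forall n, x <= K * u n) -> x <= 0.
Proof.
move=> u0 h; apply: (@lim_ge_cst _ (fun n => K * u n)) => //.
by rewrite -[X in _ --> X](mulr0 K); apply: cvgM => //; exact: cvg_cst.
Qed.

Lemma aop_zero : a (fun=> 0) = 0.
Proof. exact: (S0_dual0 gAB gBA gp2 aD). Qed.

(* The complement of the span of the atoms lies in S0 and is annihilated by the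
   operator, so an eigenfunction with a nonzero eigenvalue lies in the closure of
   the span. *)
Lemma eigen_approx : exists (s : nat -> A -> R[i]) (u : nat -> R),
  [/\ forall n, SC P (s n), u @ \oo --> 0 &
  forall n, nrm (fun t => s n t - f t) <= u n].
Proof.
have [s [Ph [Ss PhL lim] orth]] := projection (V := SC P) (fun h => @SC_L2 _ _ _ _ _ _ _ _ _ _ gA _ _ gp h)
  (SC_0 mu nu NA kA pr) (@SC_lin _ _ _ _ _ _ _ _) fL.
exists s, (fun n => nrm (fun t => s n t - Ph t)); split => //.
have sL n : L2 (s n) by exact: (SC_L2 gA gp).
have [K K0 hK] := Aop_nrm.
pose g t := f t - Ph t.
have gL : L2 g by exact: L2B.
(* Orthogonality to all atoms says that the short-time Fourier transform of g vanishes, so g belongs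
   to S0 and the weak definition of the operator may be evaluated at g. *)
have gS0 : S0 P g.
  split => //.
  have -> : stft P (tf_gauss P) g = (fun=> 0).
    by apply/funext => z; apply: orth; exact: (SC_phi gp).
  apply/L1P; exact: cintg0.
have SCa s' x : SC P (ts x (atoms s')) by apply: (SC_ts gp); apply/SCP; exists s'.
have o1 h : S0 P h -> inner (Aop h) g = 0.
  move=> hS; rewrite (Aa hS gS0) -[RHS]aop_zero; congr a; apply/funext => x.
  by rewrite [X in _ * X](orth _ (SCa s2 x)) mulr0.
have o2 h : S0 P h -> inner (Aop g) h = 0.
  move=> hS; rewrite (Aa gS0 hS) -[RHS]aop_zero; congr a; apply/funext => x.
  by rewrite [X in X^*](orth _ (SCa s1 x)) rmorph0 mul0r.
have i1 : inner (Aop Ph) g = 0.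
  apply/eqP; rewrite -cmod_eq0 eq_le cmod_ge0 andbT.
  apply: (cvg0_le0 (K := K * nrm g) lim) => n.
  have := Aop_lin (-1) PhL (sL n) gL.
  rewrite (o1 _ (SC_S0 gA gB gp (Ss n))) addr0 mulN1r => /(congr1 cmod); rewrite cmodN => <-.
  rewrite (_ : (fun t => _) = (fun t => s n t - Ph t)); last first.
    by apply/funext => t; rewrite mulN1r addrC.
  apply: le_trans (cauchy_schwarz (AL (L2B (sL n) PhL)) gL) _.
  by rewrite mulrAC ler_wpM2r ?nrm_ge0// hK//; exact: L2B.
(* lambda <f, g> = <A f, g>, and f = Ph + g splits the right-hand side into two vanishing terms. *)
have i2 : inner f g = 0.
  have [_ _ ae] := fE.
  apply: (mulfI lam0); rewrite mulr0 -(innerZl _ fL gL).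
  rewrite -(inner_ae ae (AL fL) (L2Z _ fL) gL).
  have := Aop_lin 1 PhL gL gL; rewrite i1 (o2 _ gS0) mulr0 addr0 => <-.
  congr (inner (Aop _) g); apply/funext => t; rewrite mul1r /g.
  by move: (f t) (Ph t) => x y; ring.
have i3 : inner Ph g = 0.
  apply/eqP; rewrite -cmod_eq0 eq_le cmod_ge0 andbT.
  apply: (cvg0_le0 (K := nrm g) lim) => n.
  have z0 : inner (s n) g = 0 by rewrite (inner_conj gL (sL n)) (orth _ (Ss n)) rmorph0.
  have := innerBl (sL n) PhL gL; rewrite z0 sub0r => /(congr1 cmod); rewrite cmodN => <-.
  by rewrite mulrC; apply: cauchy_schwarz => //; exact: L2B.
have ng : nrm g = 0.
  have := inner_self mu g; rewrite {1}/g innerBl// i2 i3 subr0 => h.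
  rewrite /Submission.nrm (_ : nsq mu g = 0) ?sqrtr0//.
  by apply: (@complexI R); rewrite -h.
move=> n; apply: le_trans (le_nrm_dist (sL n) fL PhL) _.
by rewrite [X in _ + X](nrm_distC mu Ph f) -/g ng addr0.
Qed.

Definition V z := cmod (inner f (ts z phi)).

Lemma V_cont : continuous (V : mt A * mt B -> R).
Proof. exact: (ccont_cmod (V_ccont fL)). Qed.

Lemma V_bound z : V z <= nrm f * nrm phi.
Proof.
by rewrite -(ts_nrm gA gp z phiL); apply: cauchy_schwarz => //; exact: (tsL2 gA gp).
Qed.

Local Notation K := (Kf mu NA kA pr s1 s2).

Lemma H2_bound : exists2 M, 0 <= M & forall z : tgprod Z Z2, H2 NA kA NB kB pr a z <= M.
Proof.
have [C C0 hC] := S0_dual_bound gAB gBA gp2 aD.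
pose l g := (a g)^*.
have lC g : SC P2 g -> ((cmod (l g))%:E <= C%:E * Submission.sn (pmeas mu nu) (pmeas nu mu) (prodN NA NB) (prodk kA kB) (pr2 pr) g)%E.
  by move=> gS; rewrite /l cmod_conj; apply: hC; exact: (SC_S0 gAB gBA gp2).
pose at1 := Submission.atoms (prodN NA NB) (prodk kA kB) (pr2 pr) [:: (1, 0)].
pose S := Submission.sn (pmeas mu nu) (pmeas nu mu) (prodN NA NB) (prodk kA kB) (pr2 pr) at1.
have Sf : S \is a fin_num.
  by rewrite ge0_fin_numE ?sn_ge0//; exact: (atoms_sn_fin gAB gBA gp2).
exists (C * fine S); first by rewrite mulr_ge0// fine_ge0// sn_ge0.
move=> z; rewrite -lee_fin EFinM (fineK Sf).
by rewrite /H2 (phi_atom gp2); exact: (fun_l_bound gAB gBA gp2 lC).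
Qed.

(** [fun_inversion] holds on the span of the atoms only, so it is applied to approximants of f, with
    l the pairing of the operator with the atom at w. The limit is controlled because the kernel is
    integrable in z. *)
Lemma eigen_ineq w : ((c * cmod lam * V w)%:E <=
  \int[mnu]_z (V z * cmod (a (K z w)))%:E)%E.
Proof.
have [s [u [Ss u0 su]]] := eigen_approx.
have [Ka Ka0 hK] := Aop_nrm.
have wL := tsL2 gA gp w phiL; have sL n : L2 (s n) by exact: (SC_L2 gA gp).
pose l h := inner (Aop h) (ts w phi).
have lD k g h : SC P g -> SC P h -> l (fun t => k * g t + h t) = k * l g + l h.
  by move=> /(SC_L2 gA gp) gL /(SC_L2 gA gp) hL; exact: Aop_lin.
pose C := Ka * nrm phi * (nrm phi / c).
have C0 : 0 <= C by rewrite !mulr_ge0 ?nrm_ge0// invr_ge0 ltW.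
have lb h : L2 h -> cmod (l h) <= Ka * nrm h * nrm phi.
  move=> hL; apply: le_trans (cauchy_schwarz (AL hL) wL) _.
  by rewrite (ts_nrm gA gp _ phiL) ler_wpM2r ?nrm_ge0// hK.
have lC h : SC P h -> ((cmod (l h))%:E <= C%:E * sn h)%E.
  move=> hS; have hL := SC_L2 gA gp hS.
  apply: (@le_trans _ _ ((Ka * nrm phi / c)%:E * (c * nrm h)%:E)%E).
    by rewrite -EFinM lee_fin mulrA divfK ?gt_eqF// mulrAC; exact: lb.
  apply: le_trans (lee_wpmul2l _ (nrm_SC_bound gA gB gp hS)) _.
    by rewrite lee_fin !mulr_ge0 ?nrm_ge0// invr_ge0 ltW.
  by rewrite muleA -EFinM /C; rewrite mulrAC -mulrA mulrA.
have lK z : l (ts z phi) = a (K z w).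
  by apply: Aa; apply: (SC_S0 gA gB gp); exact: (SC_phi gp).
have inv n := fun_inversion lD lC C0 (Ss n).
have mk : measurable_fun setT (fun z : mt A * mt B => (cmod (a (K z w)))%:E).
  have := fun_l_ccont gA gB gp lD lC C0 [:: (1, 0)]; rewrite -(phi_atom gp).
  move=> /(ccont_cmeas sZ) /cmeas_cmodE; apply: eq_measurable_fun => z _.
  by rewrite lK.
have [M M0 hM] := H2_bound.
(* By [kernel_bound] the kernel is a finite sum of Gaussians in z with bounded coefficients. *)
have kfin : (\int[mnu]_z (cmod (a (K z w)))%:E < +oo)%E.
  pose b (i : (R[i] * Z) * (R[i] * Z)) := cmod i.1.1 * cmod i.2.1 * c ^+ 2 * M.
  have b0 i : 0 <= b i by rewrite /b !mulr_ge0 ?cmod_ge0 ?(ltW c0).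
  pose sh (i : (R[i] * Z) * (R[i] * Z)) : Z := - i.1.2 - (w - i.2.2).
  have pi4 : 0 < pi / 4 :> R by rewrite divr_gt0// pi_gt0.
  have [I IE] := gZ_fin gA gB pi4.
  apply: (@le_lt_trans _ _ (\int[mnu]_z (\sum_(i <- [seq (i, j) | i <- s1, j <- s2])
      ((b i)%:E * (gZ (pi / 4) ((z : Z) + sh i))%:E)))%E).
    apply: ge0_le_integral_nomeas => z; first by rewrite lee_fin cmod_ge0.
    apply: le_trans (_ : (_)%:E <= _)%E; first by rewrite lee_fin; exact: (kernel_bound gA gB gp gp' th1 th2 s1 s2 aD).
    rewrite -sumEFin; apply: lee_sum => i _; rewrite -EFinM lee_fin /b.
    have -> : (z : Z) - i.1.2 - (w - i.2.2) = (z : Z) + sh i by rewrite /sh addrA.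
    rewrite -[leRHS]mulrA; apply: ler_wpM2l; first by rewrite !mulr_ge0 ?cmod_ge0 ?(ltW c0).
    by rewrite [leRHS]mulrC; apply: ler_wpM2l; [exact: gZ_ge0 | exact: hM].
  have mg i : measurable_fun setT (fun z : mt A * mt B => (gZ (pi / 4) ((z : Z) + sh i))%:E).
    apply/measurable_EFinP; apply: (cont_measurable sZ).
    apply: (cont_comp (g := gZ (pi / 4) : mt A * mt B -> R)); last exact: (gZ_cont gA gB).
    exact: (gs_addr gAB).
  rewrite ge0_integral_sum//; last 2 first.
  - by move=> i; apply: emeasurable_funM => //; exact: measurable_cst.
  - by move=> i z _; rewrite mule_ge0 ?lee_fin ?gZ_ge0.
  rewrite (_ : \sum_(i <- _) _ = \sum_(i <- [seq (i, j) | i <- s1, j <- s2]) (b i * I)%:E)%E.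
    by rewrite sumEFin ltry.
  apply: eq_bigr => i _; rewrite ge0_integralZl_EFin//; last by move=> z _; rewrite lee_fin gZ_ge0.
  by rewrite (gZ_int_shift gA gB _ pi4) IE.
pose I := fine (\int[mnu]_z (cmod (a (K z w)))%:E)%E.
have IE : (\int[mnu]_z (cmod (a (K z w)))%:E)%E = I%:E.
  by rewrite fineK// ge0_fin_numE// integral_ge0// => z _; rewrite lee_fin cmod_ge0.
set J := (X in (_ <= X)%E).
have mV : measurable_fun setT (fun z : mt A * mt B => (V z * cmod (a (K z w)))%:E).
  apply/measurable_EFinP/measurable_funM; last exact/measurable_EFinP.
  by apply: (cont_measurable sZ); exact: V_cont.
have lf : cmod (l f) = cmod lam * V w.
  have [_ _ ae] := fE.
  by rewrite /l (inner_ae ae (AL fL) (L2Z _ fL) wL) innerZl// cmodM.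
have [Joo|Jn] := eqVneq J +oo%E; first by rewrite Joo leey.
have J0 : (0 <= J)%E by apply: integral_ge0 => z _; rewrite lee_fin mulr_ge0 ?cmod_ge0.
have Jf : J \is a fin_num by rewrite ge0_fin_numE// ltey.
rewrite -(fineK Jf) lee_fin -subr_le0.
(* The total error is linear in [u n]: one term from replacing f by [s n] in l, one from doing so
   inside the integral. *)
apply: (cvg0_le0 (K := c * (Ka * nrm phi) + nrm phi * I) u0) => n.
have dn : nrm (fun t => s n t - f t) <= u n := su n.
have l1 : cmod (l f) <= cmod (l (s n)) + Ka * u n * nrm phi.
  have := Aop_lin (-1) fL (sL n) wL; rewrite -!/(l _) mulN1r => E.
  have -> : l f = l (s n) - l (fun t => -1 * f t + s n t) by rewrite E; move: (l f) (l (s n)) => x y; ring.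
  apply: le_trans (cmodB _ _) _; rewrite lerD2l.
  rewrite (_ : (fun t => _) = (fun t => s n t - f t)); last first.
    by apply/funext => t; rewrite mulN1r addrC.
  apply: le_trans (lb _ (L2B (sL n) fL)) _.
  by rewrite ler_wpM2r ?nrm_ge0// ler_wpM2l.
have l2 : c * cmod (l (s n)) <= fine J + u n * nrm phi * I.
  have [i1 i2] := inv n.
  rewrite -lee_fin EFinD (fineK Jf) EFinM.
  have -> : (c%:E * (cmod (l (s n)))%:E)%E = (cmod (c%:C * l (s n)))%:E.
    by rewrite cmodM cmod_real gtr0_norm.
  rewrite -i2; apply: le_trans (cmod_cint i1) _.
  have un0 : 0 <= u n * nrm phi by rewrite mulr_ge0 ?nrm_ge0// (le_trans (nrm_ge0 _ _) dn).
  rewrite EFinM -IE -ge0_integralZl_EFin//; last by move=> z _; rewrite lee_fin cmod_ge0.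
  rewrite -ge0_integralD//; last 3 first.
  - by move=> z _; rewrite lee_fin mulr_ge0 ?cmod_ge0.
  - by move=> z _; rewrite mule_ge0 ?lee_fin ?cmod_ge0.
  - by apply: emeasurable_funM => //; exact: measurable_cst.
  apply: ge0_le_integral_nomeas => z; first by rewrite lee_fin cmod_ge0.
  rewrite lK cmodM -EFinM -EFinD lee_fin -mulrDl ler_wpM2r ?cmod_ge0//.
  have zL := tsL2 gA gp z phiL.
  have -> : inner (s n) (ts z phi) = inner f (ts z phi) + inner (fun t => s n t - f t) (ts z phi).
    by rewrite innerBl// addrC subrK.
  apply: le_trans (cmodD _ _) _; rewrite lerD2l.
  apply: le_trans (cauchy_schwarz (L2B (sL n) fL) zL) _.
  by rewrite (ts_nrm gA gp z phiL) ler_wpM2r ?nrm_ge0.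
rewrite -mulrA -lf.
have := ler_wpM2l (ltW c0) l1; rewrite mulrDr => h.
rewrite lerBlDr; apply: le_trans h _; apply: le_trans (lerD l2 (lexx _)) _.
by rewrite le_eqVlt; apply/orP; left; apply/eqP; ring.
Qed.

End Eigen.

(** A sum is at most its length times its largest term. This gives one inequality for all r > 0,
    both below and above 1. *)
Lemma sum_pow (R : realType) I (s : seq I) (a : I -> R) (r : R) : 0 < r ->
  (forall i, 0 <= a i) ->
  (\sum_(i <- s) a i) `^ r <= (size s)%:R `^ r * \sum_(i <- s) (a i) `^ r.
Proof.
move=> r0 a0.
have [M [M0 h1 h2]] : exists M, [/\ 0 <= M, \sum_(i <- s) a i <= (size s)%:R * M &
    M `^ r <= \sum_(i <- s) (a i) `^ r].
  elim: s => [|i s [M [M0 h1 h2]]].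
    by exists 0; rewrite !big_nil mul0r powR0 ?gt_eqF.
  exists (Num.max (a i) M); split; first by rewrite le_max a0.
    rewrite big_cons /= -natr1 mulrDl mul1r addrC; apply: lerD.
      by apply: le_trans h1 _; rewrite ler_wpM2l// le_max lexx orbT.
    by rewrite le_max lexx.
  rewrite big_cons; case: (leP (a i) M) => _; first by rewrite (le_trans h2)// lerDr powR_ge0.
  by rewrite lerDl sumr_ge0// => j _; exact: powR_ge0.
apply: le_trans (ler_pow r0 _ h1) _; first exact: sumr_ge0.
by rewrite powRM// ler_wpM2l ?powR_ge0.
Qed.

(** * Decay of the eigenfunction *)

Section Iteration.
Context (R : realType) (A B : tgroup).
Variables (mu : {sigma_finite_measure set (mt A) -> \bar R})
  (nu : {sigma_finite_measure set (mt B) -> \bar R})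
  (NA : A -> R) (kA : set A) (hA : A -> A) (NB : B -> R) (kB : set B) (hB : B -> B).
Hypotheses (gA : gspace mu NA kA hA) (gB : gspace nu NB kB hB).
Variables (pr : B -> A -> R[i]) (c c' : R).
Hypothesis gp : gpair mu nu NA kA NB kB pr c.
Hypothesis gp' : gpair nu mu NB kB NA kA (fun x y => pr y x) c'.
Hypothesis th1 : forall y x, kB y -> kA x -> pr y (x - hA x - hA x) = 1.
Hypothesis th2 : forall y x, pr (y - hB y - hB y) (hA x) = 1.
Local Notation Z := (tgprod A B).
Local Notation mnu := (prod_measure mu nu).
Local Notation P := (gplane mu nu NA kA pr).
Local Notation L2 := (cLspace mu 2%:E).
Local Notation inner := (inner mu).
Local Notation phi := (phi NA kA).
Local Notation ts := (ts pr).
Local Notation gZ := (gZ NA kA NB kB).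
Local Notation nrm := (nrm mu).
Local Notation atoms := (atoms NA kA pr).
Local Notation Z2 := (tgprod B A).
Local Notation P2 := (gplane (pmeas mu nu) (pmeas nu mu) (prodN NA NB) (prodk kA kB) (pr2 pr)).
Local Notation hZ := (prodh hA hB).
Implicit Types (z w v : Z).

Let gAB := prod_gspace gA gB.
Let sZ := std_prod (gs_std gA) (gs_std gB).
Let phiL := phi_L2 gA.
Let gBA := prod_gspace gB gA.
Let gp2 := gpair2 gA gB gp gp'.

Let c0 : 0 < c := gp_c gp.
Variables (s1 s2 : seq (R[i] * Z)) (a : (Z -> R[i]) -> R[i]).
Hypothesis aD : S0_dual P2 a.
Variables (Aop : (A -> R[i]) -> (A -> R[i])) (lam : R[i]) (f : A -> R[i]).
Hypothesis Ab : bounded_L2_operator mu Aop.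
Hypothesis Aa : forall f g, S0 P f -> S0 P g -> inner (Aop f) g =
  a (fun x : Z => (inner f (ts x (atoms s1)))^* * inner g (ts x (atoms s2))).
Hypothesis lam0 : lam != 0.
Hypothesis fE : eigenfunction mu Aop lam f.
Let fL : L2 f. Proof. by case: fE. Qed.

Local Notation V := (V mu NA kA pr f).
Local Notation H := (H2 NA kA NB kB pr a).
Local Notation GZ := (gG (prodN NA NB) (prodk kA kB)).
Local Notation gboxZ := (gbox (prodN NA NB) (prodk kA kB)).
Local Notation N2 := (prodN (prodN NA NB) (prodN NB NA)).
Local Notation k2 := (prodk (prodk kA kB) (prodk kB kA)).
Local Notation gbox2 := (gbox N2 k2).
Let g2 := prod_gspace gAB gBA.
Let ij := [seq (i, j) | i <- s1, j <- s2].

(** The part of the point (mm, omm) that depends on the displacement h alone. It is additive and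
    maps boxes into boxes, so bounded changes of h move that point by a bounded amount. *)
Definition kernel_shift (h : Z) : tgprod Z Z2 :=
  (h + hZ (- h), (hB (- h.2), h.1 + (hA (- h.1) + hA (- h.1)) -
    (hA (hA (- h.1)) + hA (hA (- h.1))))).

Let Vc : continuous (V : mt A * mt B -> R) := V_cont gA gB gp fE.
Let V0 z : 0 <= V z. Proof. exact: cmod_ge0. Qed.
Let H0 (z : tgprod Z Z2) : 0 <= H z. Proof. exact: cmod_ge0. Qed.

Lemma Hc : continuous (H : (mt A * mt B) * (mt B * mt A) -> R).
Proof.
have [C C0 hC] := S0_dual_bound gAB gBA gp2 aD.
apply: (H_cont gAB gBA gp2 (l := fun g => (a g)^*) (C := C)) => //.
  exact: (S0_dual_lin gAB gBA gp2 aD).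
by move=> g gS; rewrite cmod_conj; apply: hC; exact: (SC_S0 gAB gBA gp2).
Qed.

Lemma TT_D x y : kernel_shift (x + y) = kernel_shift x + kernel_shift y.
Proof.
have hBN u : hB (- u) = - hB u := hA_N gB u.
have hAN u : hA (- u) = - hA u := hA_N gA u.
have hBD (u u' : B) : hB (u + u') = hB u + hB u' := hA_D gB u u'.
have hAD (u u' : A) : hA (u + u') = hA u + hA u' := hA_D gA u u'.
have e d : Z -> d = (d.1, d.2) :> Z by move=> _; case: d.
rewrite /kernel_shift; congr (_, (_, _)); rewrite /= ?(hAN, hAD, hBN, hBD).
- by rewrite /prodh; congr (_, _); rewrite /= ?(hAN, hAD, hBN, hBD); zmod.
- by zmod.
- by rewrite ?(hAN, hAD); zmod.
Qed.

Lemma TT_cont : continuous (kernel_shift : mt A * mt B -> (mt A * mt B) * (mt B * mt A)).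
Proof.
have cN : continuous (fun h : mt A * mt B => - (h : Z) : mt A * mt B).
  by apply: (gs_contN gAB); exact: cont_id.
have c1 : continuous (fun h : mt A * mt B => hA (- h.1) : mt A).
  apply: (cont_comp (g := hA : mt A -> mt A)); last exact: (gs_hfc gA).
  by apply: (gs_contN gA); exact: cont_fst.
have c2 : continuous (fun h : mt A * mt B => hB (- h.2) : mt B).
  apply: (cont_comp (g := hB : mt B -> mt B)); last exact: (gs_hfc gB).
  by apply: (gs_contN gB); exact: cont_snd.
have c3 : continuous (fun h : mt A * mt B => hA (hA (- h.1)) : mt A).
  by apply: (cont_comp (g := hA : mt A -> mt A)) => //; exact: (gs_hfc gA).
apply: (@cont_pair _ (mt A * mt B)%type (mt B * mt A)%type).
  apply: (gs_contD gAB); first exact: cont_id.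
  by apply: (@cont_pair _ (mt A) (mt B)).
apply: (@cont_pair _ (mt B) (mt A)); first exact: c2.
apply: (gs_contB gA); last exact: (gs_contD gA).
by apply: (gs_contD gA); [exact: cont_fst | exact: (gs_contD gA)].
Qed.

Lemma TT_box : exists R1, forall x, gboxZ 1 x -> gbox2 R1 (kernel_shift x).
Proof.
have NhA x : NA (hA x) <= NA x.
  by rewrite (gs_Nhf4 gA) ler_piMl ?(gs_N0 gA)// invf_le1// ler1n.
have NhB x : NB (hB x) <= NB x.
  by rewrite (gs_Nhf4 gB) ler_piMl ?(gs_N0 gB)// invf_le1// ler1n.
have NDA x y m n : NA x <= m -> NA y <= n -> NA (x + y) <= 2 * m + 2 * n.
  move=> h1 h2; apply: le_trans (gs_ND gA x y) _.
  by apply: lerD; rewrite ler_pM2l.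
have NDB x y m n : NB x <= m -> NB y <= n -> NB (x + y) <= 2 * m + 2 * n.
  move=> h1 h2; apply: le_trans (gs_ND gB x y) _.
  by apply: lerD; rewrite ler_pM2l.
(* Bounds for the four components in order; every sum of two terms doubles both bounds. *)
pose K : R := ((2 * 1 + 2 * 1) + (2 * 1 + 2 * 1) + (1 + (2 * (2 * 1 + 2 * (2 * 1 + 2 * 1)) + 2 * (2 * 1 + 2 * 1)))).
exists (K + 1) => x [[k1 k2'] /= Nx].
have n1 : NA x.1 <= 1.
  by apply: le_trans (ltW Nx); rewrite /prodN lerDl (gs_N0 gB).
have n2 : NB x.2 <= 1.
  by apply: le_trans (ltW Nx); rewrite /prodN lerDr (gs_N0 gA).
have kN u : kA u -> kA (- u) by exact: (gs_kN gA).
have kD u u' : kA u -> kA u' -> kA (u + u') by exact: (gs_kD gA).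
have kDB u u' : kB u -> kB u' -> kB (u + u') by exact: (gs_kD gB).
have kh u : kA (hA u) by exact: (gs_hfk gA).
have khB u : kB (hB u) by exact: (gs_hfk gB).
have m1 : NA (hA (- x.1)) <= 1 by apply: le_trans (NhA _) _; rewrite (gs_NN gA).
have m2 : NB (hB (- x.2)) <= 1 by apply: le_trans (NhB _) _; rewrite (gs_NN gB).
have m3 : NA (hA (hA (- x.1))) <= 1 by exact: le_trans (NhA _) m1.
split.
  split; split => /=; [exact: kD|exact: kDB|exact: khB|].
  apply: (gs_kB gA); apply (kD) => //; exact: kD.
rewrite /prodN /=.
apply: (@le_lt_trans _ _ K); last by rewrite ltrDl.
apply: lerD; apply: lerD => //; try exact: NDA; try exact: NDB.
apply: (NDA _ _ _ _); first by apply: (NDA _ _ _ _) => //; exact: NDA.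
by rewrite (gs_NN gA); exact: NDA.
Qed.

Variable p : R.
Hypothesis p0 : 0 < p.
Hypothesis am2 : forall r : R, 0 < r -> exists2 K : R, 0 <= K & forall om : Z2,
  (\int[mnu]_x bsup (gbox2 r) (fun z : tgprod Z Z2 => (H z `^ p)%:E) (x, om) <= K%:E)%E.

(** An index is a pair of atoms, one from each window. [cc] is its coefficient in [kernel_bound],
    [dd] the offset that centres its Gaussian at h = 0, and [kk] the constant part of its point in
    the plane. *)
Let I2 : Type := ((R[i] * Z) * (R[i] * Z))%type.
Let cc (i : I2) : R := cmod i.1.1 * cmod i.2.1 * c ^+ 2.
Let dd (i : I2) : Z := i.1.2 - i.2.2.
Let kk (i : I2) : tgprod Z Z2 :=
  (- i.2.2, (i.2.2.2 - i.1.2.2, i.1.2.1 - i.2.2.1)).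

(* [h] is the displacement between the two arguments of the kernel. For fixed [h]
   both factors are translates in [w], by an amount bounded on boxes. *)
Definition kernel_slice (i : I2) w h : R := V (h + (w + dd i)) * H (kernel_shift h + (((w, 0) : tgprod Z Z2) + kk i)).

(** For fixed h, only the position depends on w and the frequency is constant. This is where the
    mixed exponent (p, oo) of the symbol is exactly what is needed. *)
Lemma mm_TT (i : I2) w h : ((mm hA hB i (h + (w + dd i)) w, omm hA hB i (h + (w + dd i)) w) : tgprod Z Z2) =
  kernel_shift h + (((w, 0) : tgprod Z Z2) + kk i).
Proof.
have t1 : h + (w + dd i) - i.1.2 = h + (w - i.2.2) by rewrite /dd; zmod.
have e : (w - i.2.2) - (h + (w - i.2.2)) = - h by zmod.
have e1 : (w - i.2.2).1 - (h + (w - i.2.2)).1 = - h.1 by have := congr1 fst e.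
have e2 : (w - i.2.2).2 - (h + (w - i.2.2)).2 = - h.2 by have := congr1 snd e.
rewrite /mm /omm t1 e e1 e2; congr (_, (_, _)).
- by rewrite /= addrAC addrA.
- by rewrite /= add0r addrA.
- rewrite /= add0r; move: (hA (- h.1)) (hA (hA (- h.1))) => u u'; zmod.
Qed.

Lemma XX_ge0 i w h : 0 <= kernel_slice i w h. Proof. by rewrite mulr_ge0. Qed.

Lemma XX_cont i w : continuous (kernel_slice i w : mt A * mt B -> R).
Proof.
have h1 : continuous (fun h : mt A * mt B => V ((h : Z) + (w + dd i))).
  by apply: (cont_comp (g := V : mt A * mt B -> R)); [exact: (gs_addr gAB) | exact: Vc].
have h2 : continuous (fun h : mt A * mt B => H (kernel_shift h + (((w, 0) : tgprod Z Z2) + kk i))).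
  apply: (cont_comp (g := H : (mt A * mt B) * (mt B * mt A) -> R)); last exact: Hc.
  by apply: (gs_contD g2); [exact: TT_cont | exact: cont_cst].
by move=> h; apply: cvgM; [exact: h1 | exact: h2].
Qed.

Let pi4 : 0 < pi / 4 :> R. Proof. by rewrite divr_gt0// pi_gt0. Qed.

Let vv i w := (\int[mnu]_h (GZ (pi / 4) h * kernel_slice i w h)%:E)%E.

Let GX_meas i w : measurable_fun setT (fun h : mt A * mt B => (GZ (pi / 4) h * kernel_slice i w h)%:E).
Proof.
apply/measurable_EFinP/measurable_funM; first exact: (gG_meas gAB).
by apply: (cont_measurable sZ); exact: XX_cont.
Qed.

Let GX0 i w h : (0 <= (GZ (pi / 4) h * kernel_slice i w h)%:E)%E.
Proof. by rewrite lee_fin mulr_ge0 ?gG_ge0 ?XX_ge0. Qed.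

Lemma vv_fin i w : vv i w \is a fin_num.
Proof.
have [M M0 hM] := H2_bound gA gB gp gp' aD.
have L0 : 0 <= nrm f * nrm phi * M by rewrite !mulr_ge0 ?nrm_ge0.
rewrite ge0_fin_numE; last by apply: integral_ge0 => h _; exact: GX0.
apply: (@le_lt_trans _ _ (\int[mnu]_h ((nrm f * nrm phi * M)%:E * (GZ (pi / 4) h)%:E))%E).
  apply: ge0_le_integral_nomeas => h; first exact: GX0.
  rewrite -EFinM lee_fin mulrC ler_wpM2r ?gG_ge0//.
  by apply: ler_pM; [exact: V0|exact: H0|exact: (V_bound gA gp fE)|exact: hM].
rewrite ge0_integralZl_EFin//.
- by apply: lte_mul_pinfty; rewrite ?lee_fin//; exact: (gG_int gAB).
- by move=> h _; rewrite lee_fin gG_ge0.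
- by apply/measurable_EFinP; exact: (gG_meas gAB).
Qed.

(** [kernel_bound] inserted into [eigen_ineq], with the integration variable of each term translated
    so that its Gaussian is centred at 0. *)
Lemma V_le w : c * cmod lam * V w <= \sum_(i <- ij) cc i * fine (vv i w).
Proof.
pose Y i (z : Z) := GZ (pi / 4) (z - (w + dd i)) * kernel_slice i w (z - (w + dd i)).
have Y0 i z : (0 <= (Y i z)%:E)%E by exact: GX0.
have YE i z : (Y i ((z : Z) + (w + dd i))%R) = GZ (pi / 4) z * kernel_slice i w z by rewrite /Y addrK.
have mY i : measurable_fun setT (fun z : mt A * mt B => (Y i z)%:E).
  have := measurableT_comp (GX_meas i w) (gs_mshift gAB (- (w + dd i))).
  exact.
rewrite -lee_fin; apply: le_trans (eigen_ineq gA gB gp gp' th1 th2 aD Ab Aa lam0 fE w) _.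
apply: (@le_trans _ _ (\int[mnu]_z (\sum_(i <- ij) (cc i)%:E * (Y i z)%:E))%E).
  apply: ge0_le_integral_nomeas => z; first by rewrite lee_fin mulr_ge0 ?cmod_ge0.
  apply: (@le_trans _ _ (V z * \sum_(i <- ij) cc i * (gZ (pi / 4) (z - i.1.2 - (w - i.2.2)) *
      H (mm hA hB i z w, omm hA hB i z w)))%:E).
    by rewrite lee_fin ler_wpM2l//; exact: (kernel_bound gA gB gp gp' th1 th2 s1 s2 aD).
  rewrite mulr_sumr -sumEFin; apply: lee_sum => i _.
  rewrite -EFinM lee_fin le_eqVlt; apply/orP; left; apply/eqP.
  rewrite /Y; set h := z - (w + dd i).
  have zE : z = h + (w + dd i) by rewrite /h subrK.
  have -> : z - i.1.2 - (w - i.2.2) = h by rewrite /h /dd; zmod.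
  rewrite /kernel_slice -mm_TT -zE gZE.
  by move: (H _) (GZ _ _) (V _) => x y t; ring.
rewrite ge0_integral_sum//; last 2 first.
- by move=> i; apply: emeasurable_funM; [exact: measurable_cst | exact: mY].
- by move=> i z _; rewrite mule_ge0 ?lee_fin ?mulr_ge0 ?cmod_ge0 ?(ltW c0).
rewrite -sumEFin; apply: lee_sum => i _.
rewrite ge0_integralZl_EFin; last 4 first.
- by [].
- by move=> z _; exact: Y0.
- exact: mY.
- by rewrite !mulr_ge0 ?cmod_ge0 ?(ltW c0).
rewrite [leRHS]EFinM (fineK (vv_fin i w)) le_eqVlt; apply/orP; left; apply/eqP; congr (_ * _)%E.
rewrite -(Zint_shift gA gB (w + dd i) (mY i) (Y0 i)) /vv.
by apply: eq_integral => z _; rewrite YE.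
Qed.

(** The hypothesis on (V x * H y)^r separates the factors. The V part is then a translate of a known
    integrable function, and the H part is integrated in position at a frequency fixed by h; both
    bounds are uniform in h, so the Gaussian in h can be integrated last. The weights al and be let
    one statement serve the start and the induction. *)
Lemma amalgam_step (r r1 al be : R) : 0 < r -> 0 < r1 -> 0 <= al -> 0 <= be ->
  (forall x y, (V x * H y) `^ r <= (al * V x) `^ r1 + (be * H y) `^ p) ->
  (\int[mnu]_x bsup (gboxZ 1) (fun x => ((al * V x) `^ r1)%:E) x < +oo)%E ->
  (\int[mnu]_x bsup (gboxZ 1) (fun x => (V x `^ r)%:E) x < +oo)%E.
Proof.
move=> r0 r10 al0 be0 hVH fin1.
pose FV x := ((al * V x) `^ r1)%:E; pose FH (y : tgprod Z Z2) := ((be * H y) `^ p)%:E.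
have FV0 x : (0 <= FV x)%E by rewrite lee_fin powR_ge0.
have FH0 y : (0 <= FH y)%E by rewrite lee_fin powR_ge0.
have oFV : forall q : R, open ([set x | (q%:E < FV x)%E] : set (mt A * mt B)).
  apply: pow_open => //; first by move=> s; rewrite mulr_ge0.
  by move=> s; apply: cvgM; [exact: cvg_cst | exact: Vc].
have oFH : forall q : R, open ([set x | (q%:E < FH x)%E] : set ((mt A * mt B) * (mt B * mt A))).
  apply: pow_open => //; first by move=> s; rewrite mulr_ge0.
  by move=> s; apply: cvgM; [exact: cvg_cst | exact: Hc].
(* Two displacements of size 1 add up, one from the supremum at w and one from [int_pow]; 4 = 2 * 1
   + 2 * 1 as in [gboxD]. *)
have [sq hs] := bsup_cover gAB 4 (gbox_nbhs gAB ltr01).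
have [R0 hT0] := TT_box.
pose R1 := `|R0| + 1; have R10 : 0 < R1 by rewrite ltr_wpDl.
have hT x : gboxZ 1 x -> gbox2 R1 (kernel_shift x).
  move=> /hT0 [kx Nx]; split => //; apply: lt_le_trans Nx _.
  by apply: le_trans (ler_norm _) _; rewrite lerDl.
(* Size of a box containing the image of a displacement in h, of size R1, plus a displacement in w,
   of size 1. *)
pose R2 := 2 * R1 + 2 * 1 :> R; have R20 : 0 < R2 by rewrite addr_gt0// mulr_gt0.
have [K K0 hK] := am2 R20.
have [C1 C10 ip] := int_pow gAB pi4 r0.
set a' := pi / 4 / 4 * r in ip.
have a'0 : 0 < a' by rewrite mulr_gt0// divr_gt0.
have [I I0 IE] := gG_fin gAB a'0.
pose EV := bsup (gboxZ 1) FV; pose EH := bsup (gbox2 R2) FH.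
have oEV : forall q : R, open ([set x | (q%:E < EV x)%E] : set (mt A * mt B)).
  exact: (@gs_open_sup _ _ _ _ _ _ gAB (gboxZ 1) _ oFV).
have oEH : forall q : R, open ([set x | (q%:E < EH x)%E] : set ((mt A * mt B) * (mt B * mt A))).
  exact: (@gs_open_sup _ _ _ _ _ _ g2 (gbox2 R2) _ oFH).
have b1 : gboxZ 1 !=set0 by exists 0; exact: (gbox0 gAB).
have b2 : gbox2 R2 !=set0 by exists 0; exact: (gbox0 g2).
have EV0 x : (0 <= EV x)%E by exact: bsup_ge0.
have EH0 x : (0 <= EH x)%E by exact: bsup_ge0.
have mEV : measurable_fun setT (EV : mt A * mt B -> \bar R) by exact: (lsc_measurable sZ).
pose I1 := fine (\int[mnu]_x EV x)%E.
have I1E : (\int[mnu]_x EV x)%E = I1%:E by rewrite fineK// ge0_fin_numE// integral_ge0.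
have I10 : 0 <= I1 by rewrite fine_ge0// integral_ge0.
pose wz (w : Z) : tgprod Z Z2 := (w, 0).
pose G i w h := ((GZ a' h)%:E * (\sum_(t <- sq) EV (h + (w + dd i) + t)%R + EH (kernel_shift h + (wz w + kk i))%R))%E.
have S0 i w h : (0 <= \sum_(t <- sq) EV (h + (w + dd i) + t)%R + EH (kernel_shift h + (wz w + kk i))%R)%E.
  by apply: adde_ge0 => //; exact: sume_ge0.
have G0 i w h : (0 <= G i w h)%E by apply: mule_ge0; [rewrite lee_fin gG_ge0 | exact: S0].
pose cst i := (size ij)%:R `^ r * (cc i / (c * cmod lam)) `^ r * C1.
have cst0 i : 0 <= cst i by rewrite !mulr_ge0 ?powR_ge0.
have cl : 0 < c * cmod lam by rewrite mulr_gt0// lt0r cmod_eq0 lam0 cmod_ge0.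
have vv0 i w : 0 <= fine (vv i w).
  by rewrite fine_ge0// integral_ge0// => h _; exact: GX0.
have main w : (bsup (gboxZ 1) (fun x => (V x `^ r)%:E) w <=
    \sum_(i <- ij) (cst i)%:E * \int[mnu]_h G i w h)%E.
  apply: bsup_le => b bb.
  have V1 : V (w + b) <= \sum_(i <- ij) cc i / (c * cmod lam) * fine (vv i (w + b)).
    have -> : \sum_(i <- ij) cc i / (c * cmod lam) * fine (vv i (w + b)) =
       (c * cmod lam)^-1 * \sum_(i <- ij) cc i * fine (vv i (w + b)).
      by rewrite mulr_sumr; apply: eq_bigr => i _; rewrite mulrAC mulrC.
    by rewrite ler_pdivlMl//; exact: V_le.
  have bi0 i : 0 <= cc i / (c * cmod lam).
    by rewrite !mulr_ge0 ?cmod_ge0 ?(ltW c0)// invr_ge0 ltW.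
  apply: (@le_trans _ _ (\sum_(i <- ij) (size ij)%:R `^ r * (cc i / (c * cmod lam)) `^ r *
      (fine (vv i (w + b)) `^ r))%:E).
    rewrite lee_fin; apply: le_trans (ler_pow r0 (V0 _) V1) _.
    apply: le_trans (sum_pow _ r0 _) _; first by move=> i; rewrite mulr_ge0.
    rewrite mulr_sumr; apply: ler_sum => i _.
    by rewrite powRM// mulrA.
  rewrite -sumEFin; apply: lee_sum => i _.
  rewrite EFinM /cst [(_ * C1)%:E]EFinM -muleA.
  apply: lee_wpmul2l; first by rewrite lee_fin mulr_ge0 ?powR_ge0.
  have hv : ((fine (vv i (w + b)))%:E <= \int[mnu]_h (GZ (pi / 4) h * kernel_slice i (w + b) h)%:E)%E.
    by rewrite fineK//; exact: vv_fin.
  have := ip (kernel_slice i (w + b)) _ (XX_ge0 i (w + b)) (XX_cont (i := i) (w := w + b)) (vv0 _ _) hv.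
  move=> h; apply: le_trans h _; apply: lee_wpmul2l; first by rewrite lee_fin.
  apply: ge0_le_integral_nomeas => h.
    apply: mule_ge0; first by rewrite lee_fin gG_ge0.
    by apply: bsup_ge0 => // x; rewrite lee_fin powR_ge0.
  apply: lee_wpmul2l; first by rewrite lee_fin gG_ge0.
  apply: bsup_le => o oo; apply: le_trans (_ : (_)%:E <= _)%E; first by rewrite lee_fin; exact: hVH.
  rewrite EFinD; apply: leeD.
    rewrite -/(FV _); apply: le_trans (hs FV FV0 (h + (w + dd i))).
    have -> : h + o + (w + b + dd i) = h + (w + dd i) + (b + o) by zmod.
    apply: bsup_ub; have -> : 4 = 2 * 1 + 2 * 1 :> R by ring.
    exact: (gboxD gAB).
  rewrite -/(FH _) TT_D.
  have -> : kernel_shift h + kernel_shift o + (((w + b, 0) : tgprod Z Z2) + kk i) =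
      kernel_shift h + (wz w + kk i) + (kernel_shift o + wz b).
    have -> : ((w + b, 0) : tgprod Z Z2) = wz w + wz b by rewrite /wz; congr (_, _); rewrite addr0.
    by zmod.
  apply: bsup_ub; apply: (gboxD g2); first exact: hT.
  case: bb => kb Nb; split; first by split => //; split; [exact: (gs_k0 gB)|exact: (gs_k0 gA)].
  rewrite /wz /prodN /= (gs_N00 gA) (gs_N00 gB) !addr0; exact: Nb.
have sZZ := std_prod sZ sZ.
have mG i : measurable_fun setT (fun q : (mt A * mt B) * (mt A * mt B) => G i q.1 q.2).
  apply: emeasurable_funM.
    apply/measurable_EFinP; apply: (cont_measurable sZZ).
    exact: (cont_comp (@cont_snd _ _) (gG_cont gAB (a := a'))).
  apply: emeasurable_funD.
    apply: emeasurable_sum => t.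
    apply: (std_continuous_comp (f := fun q : (mt A * mt B) * (mt A * mt B) =>
      (q.2 : Z) + ((q.1 : Z) + dd i) + t : mt A * mt B) sZZ _ oEV).
    apply: (gs_contD gAB); last exact: cont_cst.
    apply: (gs_contD gAB); first exact: cont_snd.
    by apply: (gs_contD gAB); [exact: cont_fst | exact: cont_cst].
  apply: (std_continuous_comp (f := fun q : (mt A * mt B) * (mt A * mt B) =>
      kernel_shift q.2 + (wz q.1 + kk i) : (mt A * mt B) * (mt B * mt A)) sZZ _ oEH).
  apply: (gs_contD g2).
    by apply: (cont_comp (g := kernel_shift : mt A * mt B -> (mt A * mt B) * (mt B * mt A))); [exact: cont_snd | exact: TT_cont].
  apply: (gs_contD g2); last exact: cont_cst.
  by apply: (@cont_pair _ (mt A * mt B)%type (mt B * mt A)%type); [exact: cont_fst | exact: cont_cst].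
have mGw i : measurable_fun setT (fun w : mt A * mt B => \int[mnu]_h G i w h)%E.
  exact: (@measurable_fun_fubini_tonelli_F _ _ _ _ _ mnu _ (mG i) (fun q => G0 i q.1 q.2)).
have iG0 i w : (0 <= \int[mnu]_h G i w h)%E by apply: integral_ge0.
apply: (@le_lt_trans _ _ (\int[mnu]_w \sum_(i <- ij) (cst i)%:E * \int[mnu]_h G i w h)%E).
  apply: ge0_le_integral_nomeas => w; last exact: main.
  by apply: bsup_ge0 => // x; rewrite lee_fin powR_ge0.
rewrite ge0_integral_sum//; last 2 first.
- by move=> i; apply: emeasurable_funM; [exact: measurable_cst | exact: mGw].
- by move=> i w _; apply: mule_ge0; [rewrite lee_fin | exact: iG0].
apply: (@le_lt_trans _ _ (\sum_(i <- ij) (cst i * (I * ((size sq)%:R * I1 + be `^ p * K)))%:E)%E); last first.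
  by rewrite sumEFin ltry.
apply: lee_sum => i _; rewrite ge0_integralZl_EFin; last 4 first.
- by [].
- by move=> w _; exact: iG0.
- exact: mGw.
- exact: cst0.
rewrite [leRHS]EFinM; apply: lee_wpmul2l; first by rewrite lee_fin.
(* The integral over w is taken first, at fixed displacement h. *)
rewrite (tonelli mnu mnu (mG i) (fun q => G0 i q.1 q.2)) /=.
apply: (@le_trans _ _ (\int[mnu]_h ((GZ a' h)%:E * ((size sq)%:R * I1 + be `^ p * K)%:E))%E); last first.
  rewrite ge0_integralZr//.
  - by rewrite [X in (X * _)%E]IE EFinM.
  - by apply/measurable_EFinP; exact: (gG_meas gAB).
  - by move=> h _; rewrite lee_fin gG_ge0.
  - by rewrite lee_fin addr_ge0// mulr_ge0 ?powR_ge0.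
apply: ge0_le_integral_nomeas => h; first by apply: integral_ge0 => w _; exact: G0.
have mt1 t : measurable_fun setT (fun w : mt A * mt B => EV (h + ((w : Z) + dd i) + t)%R).
  apply: (std_continuous_comp (f := fun w : mt A * mt B =>
      (h : Z) + ((w : Z) + dd i) + t : mt A * mt B) sZ _ oEV).
  apply: (gs_contD gAB); last exact: cont_cst.
  by apply: (gs_contD gAB); [exact: cont_cst | exact: (gs_addr gAB)].
have mt2 : measurable_fun setT (fun w : mt A * mt B => EH (kernel_shift h + (wz w + kk i))%R).
  apply: (std_continuous_comp (f := fun w : mt A * mt B =>
      kernel_shift h + (wz w + kk i) : (mt A * mt B) * (mt B * mt A)) sZ _ oEH).
  apply: (gs_contD g2); first exact: cont_cst.
  apply: (gs_contD g2); last exact: cont_cst.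
  by apply: (@cont_pair _ (mt A * mt B)%type (mt B * mt A)%type); [exact: cont_id | exact: cont_cst].
have mts : measurable_fun setT (fun w : mt A * mt B => \sum_(t <- sq) EV (h + ((w : Z) + dd i) + t)%R)%E.
  by apply: emeasurable_sum => t; exact: mt1.
rewrite /G ge0_integralZl_EFin; last 4 first.
- by [].
- by move=> w _; exact: S0.
- exact: emeasurable_funD.
- exact: gG_ge0.
apply: lee_wpmul2l; first by rewrite lee_fin gG_ge0.
rewrite ge0_integralD//; last first.
  by move=> w _; apply: sume_ge0 => t _; exact: EV0.
rewrite EFinD; apply: leeD.
  rewrite ge0_integral_sum//.
  rewrite [leRHS](_ : _ = \sum_(t <- sq) I1%:E)%E; last first.
    by rewrite sumEFin big_const_seq count_predT iter_addr_0 mulr_natl.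
  apply: lee_sum => t _.
  rewrite (_ : (fun w => _) = (fun w : mt A * mt B => EV ((w : Z) + (h + dd i + t))%R)); last first.
    by apply/funext => w; congr EV; zmod.
  by rewrite (Zint_shift gA gB _ mEV EV0) I1E.
pose om : Z2 := (kernel_shift h + kk i).2; pose x0 : Z := (kernel_shift h + kk i).1.
have E w : kernel_shift h + (wz w + kk i) = ((w + x0, om) : tgprod Z Z2).
  rewrite (_ : ((w + x0, om) : tgprod Z Z2) = wz w + (kernel_shift h + kk i)); first by zmod.
  by rewrite /wz; congr (_, _); rewrite add0r.
under eq_integral do rewrite E.
have mo : measurable_fun setT (fun w : mt A * mt B => EH ((w, om) : tgprod Z Z2)).
  apply: (std_continuous_comp (f := fun w : mt A * mt B => (w, om) : (mt A * mt B) * (mt B * mt A)) sZ _ oEH).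
  by apply: (@cont_pair _ (mt A * mt B)%type (mt B * mt A)%type); [exact: cont_id | exact: cont_cst].
rewrite (Zint_shift gA gB x0 mo); last by move=> w; exact: EH0.
pose HH := bsup (gbox2 R2) (fun z : tgprod Z Z2 => (H z `^ p)%:E).
have HH0 x : (0 <= HH x)%E by apply: bsup_ge0 => // y; rewrite lee_fin powR_ge0.
have oHH : forall q : R, open ([set x | (q%:E < HH x)%E] : set ((mt A * mt B) * (mt B * mt A))).
  apply: (@gs_open_sup _ _ _ _ _ _ g2 (gbox2 R2) (fun z : tgprod Z Z2 => (H z `^ p)%:E)).
  by apply: pow_open => //; exact: Hc.
apply: (@le_trans _ _ (\int[mnu]_w ((be `^ p)%:E * HH (w, om)))%E).
  apply: ge0_le_integral_nomeas => w; first exact: EH0.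
  apply: bsup_le => o oo; rewrite /FH powRM// EFinM; apply: lee_wpmul2l; first by rewrite lee_fin powR_ge0.
  exact: bsup_ub.
rewrite ge0_integralZl_EFin; last 4 first.
- by [].
- by move=> w _; exact: HH0.
- apply: (std_continuous_comp (f := fun w : mt A * mt B => (w, om) : (mt A * mt B) * (mt B * mt A)) sZ _ oHH).
  by apply: (@cont_pair _ (mt A * mt B)%type (mt B * mt A)%type); [exact: cont_id | exact: cont_cst].
- exact: powR_ge0.
by rewrite EFinM; apply: lee_wpmul2l; [rewrite lee_fin powR_ge0 | exact: hK].
Qed.

(* By x^m y <= x^(m+1) + y^(m+1), each step passes from V^(p/m) to V^(p/(m+1)). *)
Lemma amalgam_iterate m : (\int[mnu]_x bsup (gboxZ 1) (fun x => (V x `^ (p / m.+1%:R))%:E) x < +oo)%E.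
Proof.
have Mf0 : 0 <= nrm f * nrm phi by rewrite mulr_ge0 ?nrm_ge0.
elim: m => [|m ih].
  (* The start: V is bounded, so it is absorbed into the weight of H, and the V part is switched off
     by weight 0. *)
  apply: (@amalgam_step _ 1 0 (nrm f * nrm phi)) => //; first by rewrite divr1.
    move=> x y; rewrite mul0r powR0 ?oner_neq0// add0r divr1.
    apply: ler_pow => //; first by rewrite mulr_ge0.
    by rewrite ler_wpM2r//; exact: (V_bound gA gp fE).
  rewrite (_ : bsup _ _ = cst 0%E) ?integral0//.
  apply/funext => x /=; apply/eqP; rewrite eq_le; apply/andP; split.
    by apply: bsup_le => b _; rewrite mul0r powR0 ?oner_neq0.
  by apply: bsup_ge0 => [|y]; [exists 0; exact: (gbox0 gAB) | rewrite lee_fin powR_ge0].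
have q0 n : 0 < p / n.+1%:R by rewrite divr_gt0.
apply: (amalgam_step (q0 m.+1) (q0 m) ler01 ler01); last first.
  by under [X in bsup _ X]eq_fun do rewrite mul1r.
move=> x y; rewrite !mul1r powRM//.
(* A common root: V^(p/(m+2)) = u^(m+1) and V^(p/(m+1)) = u^(m+2). *)
set u := V x `^ (p / (m.+1%:R * m.+2%:R)).
have u0 : 0 <= u by exact: powR_ge0.
set t := H y `^ (p / m.+2%:R); have t0 : 0 <= t by exact: powR_ge0.
have n0 n : n.+1%:R != 0 :> R by [].
have f1 (x' y' : R) : x' != 0 -> y' != 0 -> p / y' = p / (x' * y') * x'.
  by move=> hx hy; field; rewrite hx hy.
have f2 (x' y' : R) : x' != 0 -> y' != 0 -> p / x' = p / (x' * y') * y'.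
  by move=> hx hy; field; rewrite hx hy.
have -> : V x `^ (p / m.+2%:R) = u ^+ m.+1.
  by rewrite -powR_mulrn// -powRrM -(f1 _ _ (n0 m) (n0 m.+1)).
have -> : V x `^ (p / m.+1%:R) = u ^+ m.+2.
  by rewrite -powR_mulrn// -powRrM -(f2 _ _ (n0 m) (n0 m.+1)).
have -> : H y `^ p = t ^+ m.+2.
  by rewrite -powR_mulrn// -powRrM divfK.
have [ut|tu] := leP t u.
  apply: (@le_trans _ _ (u ^+ m.+2)); last by rewrite lerDl exprn_ge0.
  by rewrite [leRHS]exprSr ler_wpM2l// exprn_ge0.
apply: (@le_trans _ _ (t ^+ m.+2)); last by rewrite lerDr exprn_ge0.
rewrite [leRHS]exprSr ler_wpM2r//; apply: lerXn2r; rewrite ?nnegrE//; exact: ltW.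
Qed.

End Iteration.

Lemma precompact_cover (R : realType) (A : tgroup)
    (mu : {sigma_finite_measure set (mt A) -> \bar R}) N kap hf
    (gs : gspace mu N kap hf) (Q : set (mt A)) : precompact Q ->
  exists s : seq A, forall x : A, Q x -> exists2 t, t \in s & gbox N kap 1 (x - t).
Proof.
move=> [C QC [cC _]].
move: cC; rewrite compact_cover => /(_ A setT (fun t => [set x : A | gbox N kap 1 (x - t)])).
case.
- by move=> t _; apply: (gs_open_shift gs (U := gbox N kap 1)); exact: (gbox_open gs).
- by move=> x _; exists x => //=; rewrite subrr; exact: (gbox0 gs).
move=> D _ CD; exists (finmap.enum_fset D) => x Qx.
by have [t Dt xt] := CD x (QC x Qx); exists t.
Qed.

Lemma poweRVK (R : realType) (p : R) (I : \bar R) : 0 < p -> (0 <= I)%E ->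
  ((`|I `^ p^-1| `^ p) = I)%E.
Proof.
move=> p0 I0; rewrite gee0_abs ?poweR_ge0//; case: I I0 => [r r0| |//].
  by rewrite !poweR_EFin powRVK.
by rewrite !poweRyr ?invr_neq0 ?gt_eqF.
Qed.

(** * From local suprema to the modulation norm of the eigenfunction *)

Section Final.
Context (R : realType) (A B : tgroup).
Variables (mu : {sigma_finite_measure set (mt A) -> \bar R})
  (nu : {sigma_finite_measure set (mt B) -> \bar R})
  (NA : A -> R) (kA : set A) (hA : A -> A) (NB : B -> R) (kB : set B) (hB : B -> B).
Hypotheses (gA : gspace mu NA kA hA) (gB : gspace nu NB kB hB).
Variables (pr : B -> A -> R[i]) (c c' : R).
Hypothesis gp : gpair mu nu NA kA NB kB pr c.
Hypothesis gp' : gpair nu mu NB kB NA kA (fun x y => pr y x) c'.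
Hypothesis th1 : forall y x, kB y -> kA x -> pr y (x - hA x - hA x) = 1.
Hypothesis th2 : forall y x, pr (y - hB y - hB y) (hA x) = 1.
Local Notation Z := (tgprod A B).
Local Notation mnu := (prod_measure mu nu).
Local Notation P := (gplane mu nu NA kA pr).
Local Notation L2 := (cLspace mu 2%:E).
Local Notation inner := (inner mu).
Local Notation phi := (phi NA kA).
Local Notation ts := (ts pr).
Local Notation nrm := (nrm mu).
Local Notation atoms := (atoms NA kA pr).
Local Notation sn := (sn mu nu NA kA pr).
Local Notation Z2 := (tgprod B A).
Local Notation P2 := (gplane (pmeas mu nu) (pmeas nu mu) (prodN NA NB) (prodk kA kB) (pr2 pr)).
Implicit Types (z w v : Z).

Let gAB := prod_gspace gA gB.
Let sZ := std_prod (gs_std gA) (gs_std gB).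
Let phiL := phi_L2 gA.
Let gBA := prod_gspace gB gA.
Let gp2 := gpair2 gA gB gp gp'.

Let c0 : 0 < c := gp_c gp.
Variables (s1 s2 : seq (R[i] * Z)) (a : (Z -> R[i]) -> R[i]).
Hypothesis aD : S0_dual P2 a.
Variables (Aop : (A -> R[i]) -> (A -> R[i])) (lam : R[i]) (f : A -> R[i]).
Hypothesis Ab : bounded_L2_operator mu Aop.
Hypothesis Aa : forall f g, S0 P f -> S0 P g -> inner (Aop f) g =
  a (fun x : Z => (inner f (ts x (atoms s1)))^* * inner g (ts x (atoms s2))).
Hypothesis lam0 : lam != 0.
Hypothesis fE : eigenfunction mu Aop lam f.
Let fL : L2 f. Proof. by case: fE. Qed.

Local Notation V := (V mu NA kA pr f).
Local Notation gboxZ := (gbox (prodN NA NB) (prodk kA kB)).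
Let Vc : continuous (V : mt A * mt B -> R) := V_cont gA gB gp fE.
Let V0 z : 0 <= V z. Proof. exact: cmod_ge0. Qed.

(** [inner_SC_bound'] for the approximants of f survives the L^2 limit. It makes the pairing with f
    continuous on S0, although f is known to be square integrable only. *)
Lemma eigen_S0_bound h : S0 P h ->
  ((c * cmod (inner f h))%:E <= (nrm f * nrm phi)%:E * sn h)%E.
Proof.
move=> hS; have hL : L2 h := hS.1; have mh := S0_meas hS.
have [s [u [Ss u0 su]]] := eigen_approx gA gB gp gp' aD Ab Aa lam0 fE.
rewrite -(fineK (S0_sn hS)) -EFinM lee_fin -subr_le0.
have n0 := nrm_ge0 mu; have s0 : 0 <= fine (sn h) by rewrite fine_ge0// sn_ge0.
apply: (cvg0_le0 (K := nrm phi * fine (sn h) + c * nrm h) u0) => n.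
have sL : L2 (s n) by exact: (SC_L2 gA gp).
have b1 : c * cmod (inner (s n) h) <= nrm (s n) * nrm phi * fine (sn h).
  have := inner_SC_bound' gA gB gp (Ss n) hL mh.
  by rewrite -(fineK (S0_sn hS)) -EFinM lee_fin.
have b2 : cmod (inner f h) <= cmod (inner (s n) h) + u n * nrm h.
  have -> : inner f h = inner (s n) h - inner (fun t => s n t - f t) h.
    by rewrite innerBl// opprB addrC subrK.
  apply: le_trans (cmodB _ _) _; rewrite lerD2l.
  apply: le_trans (cauchy_schwarz (L2B sL fL) hL) _.
  by rewrite ler_wpM2r.
have b3 : nrm (s n) <= nrm f + u n.
  have := le_nrmD (L2B sL fL) fL.
  rewrite (_ : (fun x => _) = s n); last by apply/funext => x; rewrite subrK.
  by move=> /le_trans; apply; rewrite addrC lerD2l.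
have := ler_wpM2l (ltW c0) b2; rewrite mulrDr => b4.
have b5 : nrm (s n) * nrm phi * fine (sn h) <= (nrm f + u n) * (nrm phi * fine (sn h)).
  by rewrite -mulrA ler_wpM2r// mulr_ge0.
rewrite lerBlDr; apply: le_trans b4 _; apply: le_trans (lerD (le_trans b1 b5) (lexx _)) _.
by rewrite le_eqVlt; apply/orP; left; apply/eqP; ring.
Qed.

Lemma eigen_S0_dual : S0_dual P (distribution_of P f).
Proof.
split.
  move=> k g h gS hS; have gL : L2 g := gS.1; have hL : L2 h := hS.1.
  by rewrite /distribution_of /= innerDr ?innerZr//; exact: L2Z.
move=> g gS e e0; have gL : L2 g := gS.1.
have K0 : 0 <= nrm f * nrm phi by rewrite mulr_ge0 ?nrm_ge0.
exists (c * e / (nrm f * nrm phi + 1)).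
  by rewrite divr_gt0 ?mulr_gt0// ltr_wpDl.
move=> h hS; have hL : L2 h := hS.1.
pose k t := h t - g t; rewrite -/k => lt.
have kL : L2 k by exact: L2B.
have kE : stft P (tf_gauss P) k = (fun z => inner h (ts z phi) - inner g (ts z phi)).
  by apply/funext => z; rewrite -innerBl//; exact: (tsL2 gA gp).
have mk := cmeasB (S0_meas hS) (S0_meas gS).
have kS : S0 P k.
  split => //; split; rewrite ?kE; [exact: mk.1|exact: mk.2|].
  by rewrite -kE; apply: lt_le_trans lt _; rewrite leey.
rewrite /distribution_of /= -innerBr// -/k.
have := eigen_S0_bound kS; rewrite -snE => b.
have : ((c * cmod (inner f k))%:E <= (nrm f * nrm phi * (c * e / (nrm f * nrm phi + 1)))%:E)%E.
  apply: le_trans b _; rewrite [leRHS]EFinM lee_wpmul2l ?lee_fin//; exact: ltW.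
rewrite lee_fin -(ltr_pM2l c0) => /le_lt_trans; apply.
rewrite mulrA ltr_pdivrMr ?ltr_wpDl// mulrC ltr_pM2l ?mulr_gt0//.
by rewrite ltrDl.
Qed.

Variable p : R.
Hypothesis p0 : 0 < p.
Hypothesis am2 : forall r : R, 0 < r -> exists2 K : R, 0 <= K & forall om : Z2,
  (\int[mnu]_x bsup (gbox (prodN (prodN NA NB) (prodN NB NA)) (prodk (prodk kA kB) (prodk kB kA)) r)
    (fun z : tgprod Z Z2 => (H2 NA kA NB kB pr a z `^ p)%:E) (x, om) <= K%:E)%E.

(** V is bounded, so a small power q <= ga dominates: V^ga <= M^(ga - q) V^q. Exponents p / (m + 1)
    below ga are supplied by [amalgam_iterate]. *)
Lemma V_amalgam ga : 0 < ga ->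
  (\int[mnu]_x bsup (gboxZ 1) (fun x => (V x `^ ga)%:E) x < +oo)%E.
Proof.
(* With this m, m + 1 exceeds p / ga, so q is at most ga. *)
move=> ga0; pose m := Num.truncn (p / ga).
pose q := p / m.+1%:R.
have q0 : 0 < q by rewrite divr_gt0.
have qga : q <= ga.
  rewrite ler_pdivrMr// mulrC -ler_pdivrMr//; apply/ltW.
  by rewrite truncnS_gt.
have it := amalgam_iterate gA gB gp gp' th1 th2 aD Ab Aa lam0 fE p0 am2 m.
pose M := nrm f * nrm phi + 1; have M0 : 0 < M by rewrite ltr_wpDl ?mulr_ge0 ?nrm_ge0.
have Vq x : V x `^ ga <= M `^ (ga - q) * V x `^ q.
  have [->|Vn] := eqVneq (V x) 0; first by rewrite !powR0 ?gt_eqF// mulr0.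
  have Vp : 0 < V x by rewrite lt0r Vn V0.
  have VM : V x / M <= 1.
    rewrite ler_pdivrMr// mul1r; apply: le_trans (V_bound gA gp fE x) _.
    by rewrite lerDl.
  have h : (V x / M) `^ ga <= (V x / M) `^ q.
    by apply: ger_powR => //; rewrite divr_gt0.
  have VE : V x = M * (V x / M) by rewrite mulrCA mulfV ?mulr1// gt_eqF.
  have v0 : 0 <= V x / M by rewrite divr_ge0// ltW.
  move: h v0 VE; set v := V x / M => h v0 ->.
  have Mq : M `^ ga = M `^ (ga - q) * M `^ q.
    by rewrite -powRD ?subrK// (gt_eqF M0) implybT.
  rewrite (powRM ga (ltW M0) v0) (powRM q (ltW M0) v0) Mq mulrA.
  by apply: ler_wpM2l; rewrite ?mulr_ge0 ?powR_ge0.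
apply: (@le_lt_trans _ _ (\int[mnu]_x ((M `^ (ga - q))%:E * bsup (gboxZ 1) (fun x => (V x `^ q)%:E) x))%E).
  apply: ge0_le_integral_nomeas => x.
    by apply: bsup_ge0 => [|y]; [exists 0; exact: (gbox0 gAB) | rewrite lee_fin powR_ge0].
  apply: bsup_le => b bb; apply: (@le_trans _ _ ((M `^ (ga - q))%:E * (V (x + b) `^ q)%:E)%E).
    by rewrite -EFinM lee_fin.
  apply: lee_wpmul2l; first by rewrite lee_fin powR_ge0.
  exact: (bsup_ub (fun x => (V x `^ q)%:E)).
rewrite ge0_integralZl_EFin ?powR_ge0//.
- by apply: lte_mul_pinfty; rewrite ?lee_fin ?powR_ge0.
- move=> x _; apply: bsup_ge0 => [|y]; last by rewrite lee_fin powR_ge0.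
  by exists 0; exact: (gbox0 gAB).
- apply: (@bsup_meas _ _ _ _ _ _ gAB (gboxZ 1) (fun x => (V x `^ q)%:E)).
  by apply: pow_open.
Qed.

Variables (sg : seq (R[i] * Z)) (Q : set Z).
Hypothesis Qn : unit_nbhd P Q.

(** The window is a finite sum of atoms and Q is covered by finitely many unit boxes, so the ga-th
    power of the local maximum is below a finite sum of translates of one integrable function. *)
Lemma eigen_modulation ga : 0 < ga ->
  (modulation_norm (P := P) (atoms sg) Q ga%:E ga%:E (distribution_of P f) < +oo)%E.
Proof.
move=> ga0; have [_ pQ _] := Qn.
have [sq hq] := precompact_cover gAB pQ.
pose E := bsup (gboxZ 1) (fun x => (V x `^ ga)%:E).
have b1 : gboxZ 1 !=set0 by exists 0; exact: (gbox0 gAB).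
have E0 x : (0 <= E x)%E by apply: bsup_ge0 => // y; rewrite lee_fin powR_ge0.
have mE : measurable_fun setT (E : mt A * mt B -> \bar R).
  apply: (@bsup_meas _ _ _ _ _ _ gAB (gboxZ 1) (fun x => (V x `^ ga)%:E)).
  exact: pow_open.
pose n := (size sg)%:R `^ ga.
pose Big z := (\sum_(k <- sg) \sum_(t <- sq) (n * cmod k.1 `^ ga)%:E * E (z + (t + k.2))%R)%E.
have Big0 z : (0 <= Big z)%E.
  apply: sume_ge0 => k _; apply: sume_ge0 => t _.
  by apply: mule_ge0; [rewrite lee_fin mulr_ge0 ?powR_ge0 | exact: E0].
have mEs t : measurable_fun setT (fun z : mt A * mt B => E ((z : Z) + t)%R).
  exact: (measurableT_comp mE (gs_mshift gAB t)).
have mBig : measurable_fun setT (Big : mt A * mt B -> \bar R).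
  apply: emeasurable_sum => k; apply: emeasurable_sum => t.
  by apply: emeasurable_funM; [exact: measurable_cst | exact: mEs].
have BigI : (\int[mnu]_z Big z < +oo)%E.
  have [fin Ioo] : (\int[mnu]_x E x)%E \is a fin_num /\ True.
    by split => //; rewrite ge0_fin_numE ?integral_ge0//; exact: V_amalgam.
  rewrite ge0_integral_sum//; last 2 first.
  - move=> k; apply: emeasurable_sum => t.
    by apply: emeasurable_funM; [exact: measurable_cst | exact: mEs].
  - move=> k z _; apply: sume_ge0 => t _.
    by apply: mule_ge0; [rewrite lee_fin mulr_ge0 ?powR_ge0 | exact: E0].
  apply: lte_sum_pinfty => k _; rewrite ge0_integral_sum//; last 2 first.
  - by move=> t; apply: emeasurable_funM; [exact: measurable_cst | exact: mEs].
  - by move=> t z _; apply: mule_ge0; [rewrite lee_fin mulr_ge0 ?powR_ge0 | exact: E0].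
  apply: lte_sum_pinfty => t _; rewrite ge0_integralZl_EFin; last 4 first.
  - by [].
  - by move=> z _; exact: E0.
  - exact: mEs.
  - by rewrite mulr_ge0 ?powR_ge0.
  by rewrite (Zint_shift gA gB (t + k.2) mE E0) -(fineK fin) -EFinM ltry.
pose F (z : Z) := dstft P (atoms sg) (distribution_of P f) z.
have FV z : cmod (F z) <= \sum_(k <- sg) cmod k.1 * V (z + k.2).
  have zL := fL.
  have SA : SC P (ts z (atoms sg)) by apply: (SC_ts gp); apply/SCP; exists sg.
  rewrite /F /dstft /distribution_of /= (inner_conj (SC_L2 gA gp SA) fL) cmod_conj.
  rewrite (ts_atoms gp) (inner_atoms gA gp)// big_map.
  apply: le_trans (cmod_sum _ _ _) _; apply: ler_sum => k _.
  rewrite !cmodM cmod_conj (gp_norm gp) mulr1 ler_wpM2l ?cmod_ge0//.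
  by rewrite (inner_conj fL (tsL2 gA gp _ phiL)) cmod_conj.
have FB z q : Q q -> ((cmod (F (z + q)) `^ ga)%:E <= Big z)%E.
  move=> Qq; have [t ts' bt] := hq q Qq.
  apply: (@le_trans _ _ (\sum_(k <- sg) n * (cmod k.1 * V (z + q + k.2)) `^ ga)%:E).
    rewrite lee_fin -mulr_sumr; apply: le_trans (ler_pow ga0 (cmod_ge0 _) (FV _)) _.
    by apply: sum_pow => // k; rewrite mulr_ge0 ?cmod_ge0.
  rewrite -sumEFin; apply: lee_sum => k _.
  rewrite powRM ?cmod_ge0// mulrA EFinM.
  have Ek : ((V (z + q + k.2) `^ ga)%:E <= E (z + (t + k.2))%R)%E.
    have -> : z + q + k.2 = z + (t + k.2) + (q - t) by zmod.
    exact: (bsup_ub (fun x => (V x `^ ga)%:E)).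
  have nk0 : (0 <= (n * cmod k.1 `^ ga)%:E)%E by rewrite lee_fin mulr_ge0 ?powR_ge0.
  apply: le_trans (lee_wpmul2l nk0 Ek) _.
  elim: sq ts' {hq Big Big0 mBig BigI} => // t' sq ih; rewrite inE big_cons => /predU1P[->|h].
    by rewrite leeDl// sume_ge0// => t2 _; apply: mule_ge0; [exact: nk0 | exact: E0].
  by apply: le_trans (ih h) _; rewrite leeDr//; apply: mule_ge0; [exact: nk0 | exact: E0].
pose lm (z : Z) := local_max (P := P) Q F z.
have lm0 z : (0 <= lm z)%E.
  have : (0 < mnu setT)%E by apply: (gs_pos gAB); [exact: openT | exists (0 : Z)].
  move=> /ess_sup_gee; apply.
  apply: (@filterS _ _ _ setT); last exact: filterT.
  by move=> w _; rewrite patchE; case: ifP => // _; rewrite lee_fin cmod_ge0.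
have lmB z : (`|lm z| `^ ga <= Big z)%E.
  rewrite gee0_abs//.
  have lmr : (lm z <= Big z `^ ga^-1)%E.
    apply/ess_supP; apply: (@filterS _ _ _ setT); last exact: filterT.
    move=> w _; rewrite patchE; case: ifPn => [|_]; last exact: poweR_ge0.
    rewrite inE => -[q Qq <-].
    have := FB z q Qq; have := Big0 z; case: (Big z) => [b| |//].
      by rewrite poweR_EFin !lee_fin => b0; apply: le_root; rewrite ?cmod_ge0.
    by rewrite poweRyr ?leey// invr_neq0 ?gt_eqF.
  apply: (@le_trans _ _ ((Big z `^ ga^-1) `^ ga)%E).
    by apply: gt0_ler_poweR; rewrite ?(ltW ga0)// ?in_itv/= ?lm0 ?leey ?poweR_ge0.
  have := poweRVK ga0 (Big0 z); rewrite gee0_abs ?poweR_ge0// => ->.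
  by [].
(* For equal exponents the inner root and the outer power cancel, and the mixed norm is an iterated
   integral. *)
rewrite /modulation_norm /Lpq_norm Lnorm_finE; apply: poweR_lty.
apply: le_lt_trans BigI.
have -> : (\int[mnu]_z Big z = \int[nu]_y \int[mu]_x Big (x, y))%E.
  by rewrite tonelli1// tonelli.
apply: ge0_le_integral_nomeas => y; first exact: poweR_ge0.
rewrite Lnorm_finE poweRVK//; last by apply: integral_ge0 => x _; exact: poweR_ge0.
by apply: ge0_le_integral_nomeas => x; [exact: poweR_ge0 | exact: lmB].
Qed.

Lemma eigen_final ga : 0 < ga ->
  modulation_space P (atoms sg) Q ga%:E ga%:E (distribution_of P f).
Proof. by move=> ga0; split; [exact: eigen_S0_dual | exact: eigen_modulation]. Qed.

End Final.

Section Final.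
Context (R : realType) (A B : tgroup).
Variables (mu : {sigma_finite_measure set (mt A) -> \bar R})
  (nu : {sigma_finite_measure set (mt B) -> \bar R})
  (NA : A -> R) (kA : set A) (hA : A -> A) (NB : B -> R) (kB : set B) (hB : B -> B).
Hypotheses (gA : gspace mu NA kA hA) (gB : gspace nu NB kB hB).
Variables (pr : B -> A -> R[i]) (c c' : R).
Hypothesis gp : gpair mu nu NA kA NB kB pr c.
Hypothesis gp' : gpair nu mu NB kB NA kA (fun x y => pr y x) c'.
Hypothesis th1 : forall y x, kB y -> kA x -> pr y (x - hA x - hA x) = 1.
Hypothesis th2 : forall y x, pr (y - hB y - hB y) (hA x) = 1.
Local Notation Z := (tgprod A B).
Local Notation P := (gplane mu nu NA kA pr).
Local Notation Z2 := (tgprod B A).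
Local Notation P2 := (gplane (pmeas mu nu) (pmeas nu mu) (prodN NA NB) (prodk kA kB) (pr2 pr)).
Implicit Types (z w v : Z).

Let gAB := prod_gspace gA gB.
Let sZ := std_prod (gs_std gA) (gs_std gB).
Let phiL := phi_L2 gA.
Let gBA := prod_gspace gB gA.
Let gp2 := gpair2 gA gB gp gp'.

Variables (psi1 psi2 g : A -> R[i]) (Q : set Z) (g2 : Z -> R[i]) (Q2 : set (tgprod Z Z2)).
Hypotheses (psi1S : SC P psi1) (psi2S : SC P psi2) (gS : SC P g).
Hypothesis Qn : unit_nbhd P Q.
Hypothesis g2S : SC_nonzero P2 g2.
Hypothesis Q2n : unit_nbhd P2 Q2.
Variables (p : R) (a : (Z -> R[i]) -> R[i]).
Hypothesis p0 : 0 < p.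
Hypothesis aM : modulation_space P2 g2 Q2 p%:E +oo%E a.
Variables (Aop : (A -> R[i]) -> (A -> R[i])) (lam : R[i]) (f : A -> R[i]).
Hypothesis Ab : bounded_L2_operator mu Aop.
Hypothesis Aa : forall f g, S0 P f -> S0 P g ->
  distribution_of P (Aop f) g = a (fun x => (stft P psi1 f x)^* * stft P psi2 g x).
Hypothesis lam0 : lam != 0.
Hypothesis fE : eigenfunction mu Aop lam f.

(** The windows become lists of atoms, and [amalgam] is applied one level up, on the plane over Z,
    to the conjugate of the symbol, replacing the window g2 by the Gaussian. *)
Theorem eigen_plane ga : 0 < ga ->
  modulation_space P g Q ga%:E ga%:E (distribution_of P f).
Proof.
move=> ga0; have [/SCP[sg2 g2E] g2N] := g2S.
have /SCP[s1 p1E] := psi1S.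
have /SCP[s2 p2E] := psi2S.
have /SCP[sg gE] := gS.
have aD := aM.1; rewrite gE.
have [C C0 aC] := S0_dual_bound gAB gBA gp2 aD.
apply: (eigen_final gA gB gp gp' th1 th2 (s1 := s1) (s2 := s2) aD Ab _ lam0 fE p0 _ sg Qn ga0).
  by move=> f0 h0 fS hS; move: (Aa fS hS); rewrite p1E p2E.
move=> r r0.
have [_ _ nQ] := Q2n.
apply: (@amalgam R _ _ _ _ _ _ _ _ _ _ gAB gBA _ _ gp2 (fun h => (a h)^*) C _ _ C0 sg2 Q2 p _ p0 nQ _ r r0).
- exact: (S0_dual_lin gAB gBA gp2 aD).
- by move=> h hS; rewrite cmod_conj; apply: aC; exact: (SC_S0 gAB gBA gp2).
- by move=> h; apply: g2N; rewrite g2E.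
have := aM.2; rewrite /modulation_norm g2E.
congr (Lpq_norm _ _ _ < _)%E; apply/funext => z; rewrite /local_max.
congr (ess_sup _ _); apply/funext => w; rewrite !patchE; case: ifP => // _.
by rewrite cmod_conj.
Qed.

End Final.

(** * Gaussians on a locally compact abelian group *)

Section Dotv.
Context (R : realType) (n : nat).
Implicit Types u v w : 'rV[R]_n.

Lemma dotvC u v : dotv u v = dotv v u.
Proof. by apply: eq_bigr => i _; rewrite mulrC. Qed.

Lemma dotvDl u v w : dotv (u + v) w = dotv u w + dotv v w.
Proof. by rewrite /dotv -big_split; apply: eq_bigr => i _; rewrite mxE mulrDl. Qed.

Lemma dotvZl a u w : dotv (a *: u) w = a * dotv u w.
Proof. by rewrite /dotv mulr_sumr; apply: eq_bigr => i _; rewrite mxE mulrA. Qed.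

Lemma dotvNl u w : dotv (- u) w = - dotv u w.
Proof. by rewrite -scaleN1r dotvZl mulN1r. Qed.

Lemma dotvBl u v w : dotv (u - v) w = dotv u w - dotv v w.
Proof. by rewrite dotvDl dotvNl. Qed.

Lemma dotvDr u v w : dotv u (v + w) = dotv u v + dotv u w.
Proof. by rewrite dotvC dotvDl !(dotvC u). Qed.

Lemma dotvBr u v w : dotv u (v - w) = dotv u v - dotv u w.
Proof. by rewrite dotvC dotvBl !(dotvC u). Qed.

Lemma dotvZr a u w : dotv u (a *: w) = a * dotv u w.
Proof. by rewrite dotvC dotvZl dotvC. Qed.

Lemma dotv0l w : dotv 0 w = 0.
Proof. by rewrite -(scale0r w) dotvZl mul0r. Qed.

Lemma dotv_ge0 u : 0 <= dotv u u.
Proof. by apply: sumr_ge0 => i _; rewrite -expr2 sqr_ge0. Qed.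

Lemma dotv_coord u i : u 0 i ^+ 2 <= dotv u u.
Proof.
rewrite /dotv (bigD1 i)//= expr2 lerDl; apply: sumr_ge0 => j _.
by rewrite -expr2 sqr_ge0.
Qed.

Lemma dotv_eq0 u : dotv u u = 0 -> u = 0.
Proof.
move=> u0; apply/rowP => i; have := dotv_coord u i.
by rewrite u0 mxE => h; apply/eqP; rewrite -sqrf_eq0 eq_le h sqr_ge0.
Qed.

Lemma dotv_cauchy u v : 2 * dotv u v <= dotv u u + dotv v v.
Proof. have := dotv_ge0 (u - v); rewrite dotvBl !dotvBr (dotvC v u); lra. Qed.

Lemma dotv_cont (S : topologicalType) (f g : S -> 'rV[R]_n) :
  continuous f -> continuous g -> continuous (fun s => dotv (f s) (g s)).
Proof.
move=> cf cg; rewrite /dotv => s.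
elim: (index_enum _) => [|i r ih].
  rewrite (_ : (fun s0 : S => _) = fun=> 0); first exact: cvg_cst.
  by apply/funext => t; rewrite big_nil.
rewrite (_ : (fun s0 : S => _) = fun t => f t 0 i * g t 0 i + \sum_(i0 <- r) f t 0 i0 * g t 0 i0).
  apply: cvgD ih; apply: cvgM.
    exact: (@continuous_comp _ _ _ f (fun M : 'rV[R]_n => M 0 i) s (cf s) (@coord_continuous _ _ _ 0 i _)).
  exact: (@continuous_comp _ _ _ g (fun M : 'rV[R]_n => M 0 i) s (cg s) (@coord_continuous _ _ _ 0 i _)).
by apply/funext => t; rewrite big_cons.
Qed.

Lemma scalev_cont (a : R) : continuous (fun v : 'rV[R]_n => a *: v).
Proof. exact: scaler_continuous. Qed.

Lemma dotv_compact (r : R) : compact [set v : 'rV[R]_n | dotv v v <= r].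
Proof.
apply: bounded_closed_compact.
  exists (`|r| + 1); split; first exact: num_real.
  move=> x rx v /= vr; rewrite /Num.norm/= mx_normrE; apply: bigmax_le.
    by apply: ltW; apply: lt_trans rx; rewrite ltr_pwDr.
  move=> -[i j] _ /=; rewrite ord1; have := dotv_coord v j => h.
  rewrite leNgt; apply/negP => xv.
  have x1 : 1 < x by apply: le_lt_trans rx; rewrite lerDr.
  have : x < v 0 j ^+ 2.
    rewrite -real_normK ?num_real// (lt_trans xv)// expr2 ltr_pMl ?(lt_trans x1)//.
    by apply: lt_trans xv; lra.
  have := ler_norm r; lra.
apply: (@closed_comp _ _ (fun v : 'rV[R]_n => dotv v v) [set y | y <= r]).
  by move=> v _; apply: dotv_cont => s; exact: cvg_id.
exact: closed_le.
Qed.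

(** A net for one ball serves all radii by scaling, so its cardinality does not depend on r. *)
Lemma ball_cover : exists s : seq 'rV[R]_n, forall r v, 0 < r ->
  dotv v v <= 4 * r ^+ 2 -> exists2 t, t \in s & dotv (v - r *: t) (v - r *: t) <= r ^+ 2.
Proof.
have := @dotv_compact 4; rewrite compact_cover.
move=> /(_ _ setT (fun t => [set v | dotv (v - t) (v - t) < 1])).
case.
- move=> t _; apply: (@open_comp _ _ (fun v : 'rV[R]_n => dotv (v - t) (v - t)) [set y | y < 1]).
    have ct : continuous (fun v : 'rV[R]_n => v - t).
      by move=> s; apply: continuousB; [exact: (@cvg_id _ (nbhs s)) | exact: cst_continuous].
    by move=> v _; exact: dotv_cont.
  exact: open_lt.
- by move=> v _; exists v => //=; rewrite subrr dotv0l.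
move=> D _ CD; exists (finmap.enum_fset D) => r v r0 vr.
have [|t Dt /= vt] := CD (r^-1 *: v).
  by rewrite /= dotvZl dotvZr mulrA -expr2 exprVn ler_pdivrMl ?exprn_gt0// mulrC.
exists t => //.
have -> : v - r *: t = r *: (r^-1 *: v - t) by rewrite scalerBr scalerA mulfV ?gt_eqF// scale1r.
rewrite dotvZl dotvZr mulrA -expr2 ler_piMr ?exprn_ge0 ?(ltW r0)//; exact: ltW.
Qed.

End Dotv.

Lemma measure_cover_seq d (T : measurableType d) (R : realType)
    (m : {measure set T -> \bar R}) (I : eqType) (s : seq I) (U : I -> set T) (B : set T) :
  measurable B -> (forall t, measurable (U t)) ->
  (forall x, B x -> exists2 t, t \in s & U t x) ->
  (m B <= \sum_(t <- s) m (U t))%E.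
Proof.
move=> + mU; elim: s B => [|t s ih] B mB hB.
  rewrite big_nil (_ : B = set0) ?measure0//.
  by apply/seteqP; split => // x /hB[].
rewrite big_cons; have mBU : measurable (B `\` U t) by exact: measurableD.
apply: (@le_trans _ _ (m (U t `|` (B `\` U t)))).
  apply: le_measure; rewrite ?inE//; first exact: measurableU.
  by move=> x Bx; have [|] := pselect (U t x); [left | right].
apply: le_trans (measureU2 _ _ _) _ => //.
apply: leeD2l; apply: ih => // x [Bx nx].
by have [u] := hB x Bx; rewrite inE => /predU1P[->//|us ux]; exists u.
Qed.

(** * A Gaussian group from a projection onto R^n with a section *)

Section Builder.
Context (R : realType) (A : tgroup) (m : {sigma_finite_measure set (mt A) -> \bar R})
  (n : nat).
Variables (q : A -> 'rV[R]_n) (e : 'rV[R]_n -> A) (kap : set A).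
Hypothesis sA : std (mt A).
Hypothesis cA : continuous (fun z : mt A * mt A => ((z.1 : A) - (z.2 : A) : mt A)).
Hypothesis mA : forall U : set (mt A), measurable U = <<s @open (mt A) >> U.
Hypothesis iA : forall (a : A) (U : set (mt A)), measurable U ->
    m ([set x : A | U (x + a)] : set (mt A)) = m U.
Hypothesis posA : forall U : set (mt A), open U -> U !=set0 -> (0 < m U)%E.
Hypothesis finA : forall U : set (mt A), compact U -> (m U < +oo)%E.
Hypothesis qB : forall x y, q (x - y) = q x - q y.
Hypothesis qc : continuous (q : mt A -> 'rV[R]_n).
Hypothesis eB : forall x y, e (x - y) = e x - e y.
Hypothesis ec : continuous (e : 'rV[R]_n -> mt A).
Hypothesis qe : forall v, q (e v) = v.
Hypothesis ke : forall v, kap (e v).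
Hypothesis ko : open (kap : set (mt A)).
Hypothesis kB : forall x y, kap x -> kap y -> kap (x - y).
Let N x := dotv (q x) (q x).
Let box r : set (mt A) := [set x : A | kap x /\ N x <= r].
Hypothesis boxc : forall r, compact (box r).

Let Nc : continuous (N : mt A -> R).
Proof. exact: dotv_cont. Qed.

Let k0 : kap 0. Proof. by rewrite -(subrr (e 0)); exact: kB. Qed.

Let box_meas r : measurable (box r).
Proof.
rewrite (_ : box r = (kap : set (mt A)) `\` [set x : mt A | r < N x]).
  apply: measurableD; apply: sA.2 => //.
  by apply: (@open_comp _ _ (N : mt A -> R) [set y | r < y]) => [x _|]; [exact: Nc | exact: open_gt].
by apply/seteqP; split => x [kx /= h]; split => //=; [apply/negP|move/negP: h];
  rewrite -leNgt.
Qed.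

Let mshift (a : A) : measurable_fun setT (fun x : mt A => (x : A) + a : mt A).
Proof.
apply: (std_continuous_fun sA sA mA).
rewrite (_ : (fun x : mt A => _) = (fun x : mt A => (x : A) - (- a) : mt A)); last first.
  by apply/funext => x; rewrite opprK.
apply: (cont_comp (f := fun x : mt A => (x, - a : mt A)) (g := fun z : mt A * mt A => (z.1 : A) - (z.2 : A) : mt A)) => //.
by apply: (@cont_pair _ (mt A) (mt A)); [exact: cont_id | exact: cont_cst].
Qed.

(** The measure is known only to be invariant, so volumes of boxes are not computed. A box of twice
    the radius is covered by a fixed number of translates along the section e, which yields the
    doubling property. *)
Let box_double : exists C : nat, forall r : R, 0 < r ->
  (m (box (4 * r ^+ 2)%R) <= C%:R%:E * m (box (r ^+ 2)%R))%E.
Proof.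
have [s hs] := ball_cover R n; exists (size s) => r r0.
pose U t : set (mt A) := [set x : A | box (r ^+ 2) (x + - e (r *: t))].
have mU t : measurable (U t).
  by rewrite -[U t]setTI; apply: mshift.
apply: le_trans (measure_cover_seq m (s := s) (box_meas _) mU _) _.
  move=> x [kx Nx]; have [t ts ht] := hs _ _ r0 Nx; exists t => //.
  by split; [exact: kB | rewrite /N qB qe].
rewrite (eq_bigr (fun=> m (box (r ^+ 2)%R))); last first.
  by move=> t _; exact: (iA (- e (r *: t)) (box_meas _)).
elim: {hs mU} s => [|t s ih]; first by rewrite big_nil mul0e.
rewrite big_cons /= -natr1 EFinD ge0_muleDl// mul1e addeC.
exact: leeD2r.
Qed.

(** Doubling gives volumes of order C^k at N of order 4^k, which the Gaussian beats. The form D /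
    2^(k+1) is the one summed by [epsilon_trick0]. *)
Let exp_dom (a : R) (C : nat) : 0 < a -> exists2 D : R, 0 <= D &
  forall k : nat, C%:R ^+ k.+1 * expR (- (a * 4 ^+ k)) <= D / (2 ^ k.+1)%:R.
Proof.
(* An exponent with 2 C <= 2^M; the exponential is then bounded below by the M-th term of its
   series. *)
move=> a0; pose M := C.+1.
have CM : (2 * C%:R : R) <= 2 ^+ M.
  by rewrite exprS ler_pM2l// -natrX ler_nat ltnW// ltn_expl.
exists (2 ^+ M * (M`!%:R / a ^+ M)); first by rewrite mulr_ge0 ?exprn_ge0// divr_ge0// exprn_ge0// ltW.
move=> k; rewrite ler_pdivlMr ?ltr0n ?expn_gt0// natrX mulrAC -exprMn (mulrC C%:R).
have h1 : (2 * C%:R : R) ^+ k.+1 <= 2 ^+ M * (2 ^+ k) ^+ M.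
  by rewrite -exprM -exprD [(k * M)%N]mulnC -mulnS exprM lerXn2r// ?nnegrE ?mulr_ge0 ?exprn_ge0.
rewrite expRN ler_pdivrMr ?expR_gt0//; apply: le_trans h1 _.
rewrite -mulrA ler_wpM2l ?exprn_ge0//.
have a4 : 0 <= a * 4 ^+ k by rewrite mulr_ge0 ?exprn_ge0// ltW.
have h2 : (a * 4 ^+ k) ^+ M / M`!%:R <= expR (a * 4 ^+ k).
  by apply: le_trans (expR_ge1Dxn C a4); rewrite lerDr.
rewrite mulrAC ler_pdivlMr ?exprn_gt0// mulrC -ler_pdivrMl ?ltr0n ?fact_gt0//.
apply: le_trans h2; rewrite [leRHS]mulrC ler_wpM2l ?invr_ge0// exprMn ler_wpM2l ?exprn_ge0 ?(ltW a0)//.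
rewrite lerXn2r ?nnegrE ?exprn_ge0// lerXn2r ?nnegrE//; lra.
Qed.

(** The group is cut into the unit box and the shells 4^k < N <= 4^(k+1); on each shell the Gaussian
    is bounded by its largest value. *)
Lemma builder_gauss a : 0 < a ->
  (\int[m]_x (expR (- (a * N x)) * \1_kap x)%:E < +oo)%E.
Proof.
move=> a0; have [C hC] := box_double; have [D D0 hD] := exp_dom C a0.
have [M0 ME] : exists M : R, m (box 1) = M%:E.
  by exists (fine (m (box 1))); rewrite fineK// ge0_fin_numE// finA.
have M00 : 0 <= M0 by rewrite -lee_fin -ME.
pose F k (x : mt A) : \bar R := (expR (- (a * 4 ^+ k)) * \1_(box (4 ^+ k.+1)) x)%:E.
have F0 k x : (0 <= F k x)%E by rewrite lee_fin mulr_ge0// expR_ge0.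
have mF k : measurable_fun setT (F k).
  apply/measurable_EFinP; apply: measurable_funM; first exact: measurable_cst.
  exact: measurable_indic.
have mS : measurable_fun setT (fun x => (\sum_(k <oo) F k x)%E).
  by apply: ge0_emeasurable_sum => // *; exact: F0.
have S0 x : (0 <= \sum_(k <oo) F k x)%E by apply: nneseries_ge0.
have i1 : measurable_fun setT (fun x : mt A => (\1_(box 1) x : R)%:E).
  by apply/measurable_EFinP; exact: measurable_indic.
have mB k : (m (box (4 ^+ k)%R) <= (C%:R ^+ k * M0)%:E)%E.
  elim: k => [|k ih]; first by rewrite !expr0 mul1r ME.
  rewrite [X in box X](_ : _ = 4 * (2 ^+ k) ^+ 2); last first.
    by rewrite exprS -exprM mulnC exprM expr2 -natrM.
  apply: le_trans (hC _ (exprn_gt0 _ _)) _ => //.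
  rewrite (_ : (2 ^+ k) ^+ 2 = 4 ^+ k); last by rewrite -exprM mulnC exprM expr2 -natrM.
  by rewrite exprS -mulrA EFinM; apply: lee_wpmul2l ih; rewrite lee_fin.
apply: (@le_lt_trans _ _ (\int[m]_x ((\1_(box 1) x)%:E + \sum_(k <oo) F k x))%E).
  apply: ge0_le_integral_nomeas => x; first by rewrite lee_fin mulr_ge0// expR_ge0.
  have [kx|kx] := pselect (kap x); last first.
    by rewrite [X in _ * X]indicE memNset// mulr0 adde_ge0// lee_fin.
  rewrite [X in _ * X]indicE mem_set// mulr1.
  have [N1|N1] := leP (N x) 1.
    rewrite indicE mem_set//=; apply: (@le_trans _ _ 1%E); last by rewrite leeDl.
    by rewrite lee_fin -expR0 ler_expR oppr_le0 mulr_ge0// ?dotv_ge0 ?ltW.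
  have [k1 hk1] : exists k, N x <= 4 ^+ k.+1.
    exists (Num.truncn (N x)); apply: ltW; apply: lt_le_trans (truncnS_gt _) _.
    by rewrite -natrX ler_nat ltnW// ltn_expl.
  (* The least k with N x <= 4^(k+1) is the index of the shell containing x. *)
  have /ex_minnP[k hk kmin] : exists k, N x <= 4 ^+ k.+1 by exists k1.
  have Nk : 4 ^+ k < N x.
    case: k kmin {hk} => [|k] kmin; first by rewrite expr0.
    by rewrite ltNge; apply/negP => /kmin; rewrite ltnn.
  apply: (@le_trans _ _ (F k x)).
    rewrite lee_fin indicE mem_set//= mulr1 ler_expR lerN2 ler_wpM2l//; exact: ltW.
  apply: (@le_trans _ _ (\sum_(k <oo) F k x)%E); last by rewrite leeDr// lee_fin.
  rewrite (@nneseriesD1 _ (F^~ x) k xpredT (fun j _ => F0 j x) isT).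
  by rewrite leeDl// nneseries_ge0.
rewrite ge0_integralD//.
rewrite integral_indic// setIT [X in (X + _)%E]ME integral_nneseries//.
apply: (@le_lt_trans _ _ (M0%:E + (D * M0)%:E)%E); last by rewrite -EFinD ltry.
rewrite leeD2l//; apply: le_trans (epsilon_trick0 xpredT (mulr_ge0 D0 M00)).
apply: lee_nneseries => [k _ _|k _]; first by apply: integral_ge0.
rewrite /F; under eq_integral do rewrite EFinM.
rewrite ge0_integralZl_EFin ?expR_ge0//; last first.
  by apply/measurable_EFinP; exact: measurable_indic.
rewrite integral_indic// setIT.
apply: le_trans (lee_wpmul2l _ (mB k.+1)) _; first by rewrite lee_fin expR_ge0.
rewrite -EFinM lee_fin mulrA (mulrC (expR _)) [leRHS]mulrAC.
exact: ler_wpM2r (hD k).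
Qed.

Lemma builder_gspace : gspace m N kap (fun x => e (2^-1 *: q x)).
Proof.
split.
- exact: sA.
- exact: cA.
- exact: mshift.
- exact: iA.
- exact: posA.
- exact: Nc.
- by move=> x; exact: dotv_ge0.
- move=> x y; rewrite /N; have E z w : q (z + w) = q z + q w.
    by rewrite -{1}[w]opprK qB -[- w]sub0r qB -{1}(subrr (0 : A)) qB subrr sub0r opprK.
  rewrite E qB dotvBl !dotvBr dotvDl !dotvDr !(dotvC (q y) (q x)); lra.
- move=> t x y; rewrite /N !qB qe !dotvBl !dotvBr !dotvZl !dotvZr !dotvBl !dotvBr.
  rewrite !(dotvC (q y) (q x)) !(dotvC (q x) (q t)) !(dotvC (q y) (q t)); lra.
- by move=> x y; rewrite qB scalerBr eB.
- apply: (cont_comp (g := fun v => e (2^-1 *: v) : mt A)) => //.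
  by apply: (cont_comp (g := e : _ -> mt A)) => //; exact: scalev_cont.
- by [].
- exact: ko.
- exact: k0.
- exact: kB.
- exact: builder_gauss.
- move=> O r nO; move: (@boxc r); rewrite compact_cover.
  move=> /(_ A setT (fun t => [set x : A | O^° (x - t)])).
  case.
  + move=> t _; apply: (@open_comp _ _ (fun x : mt A => (x : A) - t : mt A)); last exact: open_interior.
    move=> x _; apply: (cont_comp (f := fun x : mt A => (x, t : mt A)) (g := fun z : mt A * mt A => (z.1 : A) - (z.2 : A) : mt A)) => //.
    by apply: (@cont_pair _ (mt A) (mt A)); [exact: cont_id | exact: cont_cst].
  + by move=> x _; exists x => //=; rewrite subrr.
  move=> D _ CD; exists (finmap.enum_fset D) => x kx Nx.
  have [t Dt xt] := CD x (conj kx Nx); exists t => //; exact: interior_subset xt.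
Qed.

End Builder.

(** * The dual group *)

Section DualTopology.
Context (R : realType) (G : topologicalZmodType).
Hypothesis lG : lca_group G.
Local Notation Gd := (dual R G).

Lemma dual_regular : @regular_space G.
Proof.
move=> x; have [hG lc] := lG.
have [B] := @lc x I; rewrite withinET => Bx [cB _].
exact: (@compact_regular _ x B hG cB).
Qed.

Lemma dual_co_cont : continuous (@dual_co R G).
Proof. exact: initial_continuous. Qed.

(** Joint continuity of the evaluation is where local compactness enters: on a locally compact
    regular space, continuous maps into the compact-open topology can be uncurried. *)
Lemma dual_eval_cont : continuous (fun z : Gd * G => (z.1 : Gd) z.2 : R[i]^o).
Proof.
have cu := @continuous_uncurry_regular Gd G R[i]^o (@dual_co R G) lG.2 dual_regular
  dual_co_cont (fun xi => @dual_cont R G xi).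
rewrite (_ : (fun z : Gd * G => _) = uncurry (@dual_co R G)); first exact: cu.
by apply/funext => -[xi x].
Qed.

(** The converse direction: continuity of a map into the dual is tested on the evaluated map of two
    variables, which avoids arguing with compact sets. *)
Lemma dual_curry_cont (S : topologicalType) (f : S -> Gd) :
  continuous (fun z : S * G => (f z.1) z.2 : R[i]^o) -> continuous f.
Proof.
move=> cf; apply: continuous_comp_initial.
exact: (@continuous_curry_fun S G R[i]^o _ cf).
Qed.

Lemma dual_eval_comp (S : topologicalType) (f : S -> Gd) (g : S -> G) :
  continuous f -> continuous g -> continuous (fun s => (f s) (g s) : R[i]^o).
Proof.
move=> cf cg; apply: (cont_comp (f := fun s => (f s, g s)) (g := fun z : Gd * G => (z.1 : Gd) z.2 : R[i]^o)).
  exact: cont_pair.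
exact: dual_eval_cont.
Qed.

Lemma dual_sub_cont : continuous (fun z : Gd * Gd => z.1 - z.2).
Proof.
apply: dual_curry_cont => -[[xi eta] x] /=.
apply: (@continuousM R[i] ((Gd * Gd) * G)%type (fun z => (z.1.1 : Gd) z.2 : R[i]^o) (fun z => ((z.1.2 : Gd) z.2)^-1 : R[i]^o)).
  apply: dual_eval_comp; last exact: cont_snd.
  exact: (cont_comp (@cont_fst _ _) (@cont_fst _ _)).
apply: (@continuousV R[i] ((Gd * Gd) * G)%type (fun z => (z.1.2 : Gd) z.2 : R[i]^o)); first exact: dual_neq0.
apply: dual_eval_comp; last exact: cont_snd.
exact: (cont_comp (@cont_fst _ _) (@cont_snd _ _)).
Qed.

Lemma dual_open (C : set G) (O : set R[i]^o) : compact C -> open O ->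
  open [set xi : Gd | forall x, C x -> O (xi x)].
Proof.
move=> cC Oo; rewrite (_ : [set xi : Gd | _] = @dual_co R G @^-1` [set g | g @` C `<=` O]).
  apply: open_comp => [xi _|]; first exact: dual_co_cont.
  exact: compact_open_open.
apply/seteqP; split => [xi h _ [x Cx <-]|xi h x Cx]; first exact: h.
by apply: h; exists x.
Qed.

Lemma dual_evalD (xi eta : Gd) x : (xi + eta) x = xi x * eta x.
Proof. by []. Qed.

Lemma dual_cmod (xi : Gd) x : cmod (xi x) = 1.
Proof. by have := dual_norm xi x; rewrite /cmod => ->. Qed.

Lemma dual_evalN (xi : Gd) x : (- xi) x = (xi x)^*.
Proof.
change ((xi x)^-1 = (xi x)^*).
apply: (mulfI (dual_neq0 xi x)); rewrite mulfV ?dual_neq0//.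
by rewrite mulr_conjc dual_cmod expr1n.
Qed.

Lemma dual_arg0 (xi : Gd) : xi 0 = 1.
Proof.
have := dual_add xi 0 0; rewrite addr0 => h.
by apply: (mulfI (dual_neq0 xi 0)); rewrite -h mulr1.
Qed.

Lemma dual_argN (xi : Gd) x : xi (- x) = (xi x)^*.
Proof.
apply: (mulfI (dual_neq0 xi x)); rewrite -dual_add subrr dual_arg0.
by rewrite mulr_conjc dual_cmod expr1n.
Qed.

End DualTopology.

(** * Topology of the complex numbers and second countability of the dual *)

Section ComplexTopology.
Context (R : realType).

Lemma nbhsCP (z : R[i]^o) (U : set R[i]^o) : nbhs z U <->
  exists2 e : R, 0 < e & forall w, cmod (z - w) < e -> U w.
Proof.
split.
  move=> /nbhs_ballP[e /= e0 eU].
  have [eR eE] : exists r : R, e = r%:C.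
    by exists (complex.Re e); move: e0; case: e {eU} => u w; rewrite ltcE /= => /andP[/eqP ->].
  exists eR; first by move: e0; rewrite eE ltcR.
  by move=> w we; apply: eU; rewrite -ball_normE /= normc_cmod eE ltcR.
move=> [e e0 eU]; apply/nbhs_ballP; exists e%:C; first by rewrite /= ltcR.
by move=> w; rewrite -ball_normE /= normc_cmod ltcR => /eU.
Qed.

Lemma ccont_contC (S : topologicalType) (f : S -> R[i]) :
  ccont f -> continuous (f : S -> R[i]^o).
Proof.
move=> [f1 f2] s U /nbhsCP[e e0 eU].
have e2 : 0 < e / 2 by rewrite divr_gt0.
have h1 := iffLR (@cvgrPdist_lt _ _ _ _ (@nbhs_filter S s) _ _) (f1 s) _ e2.
have h2 := iffLR (@cvgrPdist_lt _ _ _ _ (@nbhs_filter S s) _ _) (f2 s) _ e2.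
apply: (@filterS _ _ (@nbhs_filter S s) _ _ _ (filterI h1 h2)) => t [/= h3 h4]; apply: eU.
rewrite (splitr e); apply: le_lt_trans (cmod_le_ReIm _) _; apply: ltrD.
  by rewrite ReD ReN.
by rewrite ImD ImN.
Qed.

Lemma contC_ccont (S : topologicalType) (f : S -> R[i]) :
  continuous (f : S -> R[i]^o) -> ccont f.
Proof.
move=> cf; apply: ccontP => s e e0.
have /cf h : nbhs (f s : R[i]^o) [set w | cmod (f s - w) < e].
  by apply/nbhsCP; exists e.
apply: (@filterS _ _ (@nbhs_filter S s) _ _ _ h) => t /=; exact: ltW.
Qed.

Lemma second_countableC : @second_countable R[i]^o.
Proof.
pose code (k : nat) : rat * rat * nat := odflt (0, 0, 0%N) (unpickle k).
pose ctr (k : nat) : R[i] := ratr (code k).1.1 +i* ratr (code k).1.2.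
pose D (k : nat) : set R[i]^o := [set w | cmod (ctr k - w) < (code k).2.+1%:R^-1].
apply: (@second_countable_of_seq _ D) => [k|z U /nbhsCP[e e0 eU]].
  rewrite openE => w /= wk; apply/nbhsCP.
  exists ((code k).2.+1%:R^-1 - cmod (ctr k - w)); first by rewrite subr_gt0.
  move=> u wu; rewrite /D /=.
  rewrite -(subrKA w); apply: le_lt_trans (cmodD _ _) _.
  by rewrite addrC -ltrBrDr.
have [m hm] : exists m : nat, m.+1%:R^-1 < e / 2.
  exists (Num.truncn (2 / e)); rewrite -[e / 2]invrK ltf_pV2 ?posrE ?invr_gt0 ?divr_gt0//.
  by rewrite invf_div truncnS_gt.
set r : R := m.+1%:R^-1 in hm *.
have r0 : 0 < r / 2 by rewrite divr_gt0// invr_gt0.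
have [q1] : exists q, ratr q \in `](complex.Re z - r / 2), (complex.Re z + r / 2)[.
  by apply: rat_in_itvoo; lra.
rewrite in_itv /= => /andP[a1 a2].
have [q2] : exists q, ratr q \in `](complex.Im z - r / 2), (complex.Im z + r / 2)[.
  by apply: rat_in_itvoo; lra.
rewrite in_itv /= => /andP[b1 b2].
have zc : cmod ((ratr q1 +i* ratr q2 : R[i]) - z) < r.
  apply: le_lt_trans (cmod_le_ReIm _) _; rewrite ReD ReN ImD ImN /=.
  have -> : r = r / 2 + r / 2 by rewrite -splitr.
  by apply: ltrD; rewrite ltr_norml; apply/andP; split; lra.
exists (pickle (q1, q2, m)); rewrite /D /ctr /code pickleK //= => w wc.
apply: eU; rewrite -(subrKA (ratr q1 +i* ratr q2)); apply: le_lt_trans (cmodD _ _) _.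
rewrite cmod_distC; have := ltrD zc wc; rewrite -/r; move: (cmod _) (cmod _) => u u'; lra.
Qed.

End ComplexTopology.

Section SecondCountable.
Context (R : realType) (G : topologicalZmodType).
Hypothesis lG : lca_group G.
Local Notation Gd := (dual R G).

(** A basis is given by finite lists of conditions that xi maps a compact closure of a basic set of
    G into a basic set of the complex plane. *)
Lemma dual_second_countable : @second_countable G -> @second_countable Gd.
Proof.
move=> /second_countable_seq[b bo bb].
have [D Do DO] := second_countable_seq (second_countableC R).
(* A noncompact closure is replaced by the empty set, which imposes no condition. *)
pose C i : set G := if pselect (compact (closure (b i))) then closure (b i) else set0.
have cC i : compact (C i) by rewrite /C; case: pselect => //= _; exact: compact0.
pose code (k : nat) : seq (nat * nat) := odflt [::] (unpickle k).
pose W (s : seq (nat * nat)) : set Gd :=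
  [set xi | forall p, p \in s -> forall x, C p.1 x -> D p.2 (xi x)].
have Wo s : open (W s).
  elim: s => [|p s ih].
    by rewrite (_ : W [::] = setT); [exact: openT | apply/seteqP; split].
  rewrite (_ : W (p :: s) = [set xi : Gd | forall x, C p.1 x -> D p.2 (xi x)] `&` W s).
    by apply: openI ih; exact: dual_open.
  apply/seteqP; split => [xi h|xi [h1 h2] p'].
    by split => [|p' p's]; apply: h; rewrite inE ?eqxx ?p's ?orbT.
  by rewrite inE => /predU1P[->//|]; exact: h2.
apply: (@second_countable_of_seq _ (fun k => W (code k))) => [k|xi U]; first exact: Wo.
rewrite nbhsE => -[B [[V Vo VB] Bxi] BU].
(* The basic sets around xi generate a filter. Once it converges to xi in the compact-open topology,
   every neighbourhood of xi contains one of them. *)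
pose F := filter_from [set s | W s xi] (fun s => @dual_co R G @` (W s)).
have FF : Filter F.
  apply: filter_from_filter; first by exists [::].
  move=> s t /= sx tx; exists (s ++ t).
    by move=> p; rewrite mem_cat => /orP[]; [exact: sx | exact: tx].
  move=> _ [eta h <-]; split; exists eta => // p ps; apply: h; by rewrite mem_cat ps ?orbT.
have Fxi : F --> (dual_co xi : {compact-open, G -> R[i]^o}).
  apply/compact_open_cvgP => A Q cA Qo AQ.
  pose good (p : nat * nat) := [/\ b p.1 `<=` C p.1, D p.2 `<=` Q & forall x, C p.1 x -> D p.2 (xi x)].
  have cov x : A x -> exists2 p, good p & b p.1 x.
    move=> Ax; have Qx : nbhs (xi x : R[i]^o) Q.
      by apply: open_nbhs_nbhs; split => //; apply: AQ; exists x.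
    have [j jx jQ] := DO _ _ Qx.
    have nx : nbhs x ((xi : G -> R[i]^o) @^-1` D j).
      by apply: (@dual_cont R G xi x); apply: open_nbhs_nbhs.
    have [V' V'x V'D] := dual_regular lG nx.
    have [hG lc] := lG; have [K] := @lc x I; rewrite withinET => Kx [cK kK].
    have [i ix iV] := bb x _ (filterI V'x Kx).
    have iC : C i = closure (b i).
      rewrite /C; case: pselect => //= -[].
      apply: (subclosed_compact (@closed_closure _ _) cK).
      rewrite [K](iffLR (closure_id _))//; apply: closure_subset.
      exact: subset_trans iV (@subIsetr _ _ _).
    exists (i, j) => //; split => //=; first by rewrite iC; exact: subset_closure.
    rewrite iC => y /(closure_subset iV) h; apply: V'D.
    exact: closure_subset (@subIsetl _ _ _) _ h.
  have cA' : @compact (borel G) A := cA.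
  move: cA'; rewrite compact_cover => /(_ _ good (fun p => b p.1)).
  case => [p _|x /cov[p gp bp]|F' Fg AD]; [exact: bo | by exists p |].
  exists (finmap.enum_fset F').
    by move=> p pD; have := Fg p pD; rewrite inE => -[].
  move=> _ [eta h <-] _ [x Ax <-]; have [p pD bx] := AD x Ax.
  have := Fg p pD; rewrite inE => -[bC DQ _]; apply: DQ; apply: h => //; exact: bC.
have [s sx sV] : F V.
  apply: Fxi; apply: open_nbhs_nbhs; split => //.
  by move: Bxi; rewrite -VB.
exists (pickle s); rewrite /code pickleK //= => eta h; apply: BU; rewrite -VB.
by apply: sV; exists eta.
Qed.

End SecondCountable.

(** * Characters of the line and of R^n *)

Section Cexpi.
Context (R : realType).
Implicit Types s t : R.

Lemma cexpiD s t : cexpi (s + t) = cexpi s * cexpi t.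
Proof. by apply: complex_eq; rewrite /= ?cosD ?sinD //=; ring. Qed.

Lemma cexpi0 : cexpi (0 : R) = 1.
Proof. by rewrite /cexpi cos0 sin0. Qed.

Lemma cmod_cexpi t : cmod (cexpi t) = 1.
Proof. by rewrite cmodE /= cos2Dsin2 sqrtr1. Qed.

Lemma cexpiN t : cexpi (- t) = (cexpi t)^*.
Proof. by rewrite /cexpi cosN sinN. Qed.

Lemma cexpi_cont (S : topologicalType) (f : S -> R) : continuous f -> ccont (fun x => cexpi (f x)).
Proof.
move=> cf; split => /=.
  exact: (cont_comp cf (@continuous_cos R)).
exact: (cont_comp cf (@continuous_sin R)).
Qed.

Lemma cexpi_surj (z : R[i]) : cmod z = 1 -> 0 < complex.Re z ->
  exists2 t, z = cexpi t & - (pi / 2) < t < pi / 2.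
Proof.
move=> z1 z0; have := sqr_cmod z; rewrite z1 expr1n => zE.
have h : -1 <= complex.Im z <= 1.
  by rewrite -ler_norml -z1 Im_le_cmod.
have hs : complex.Im z ^+ 2 < 1 by rewrite zE ltrDr exprn_gt0.
have ce : cos (asin (complex.Im z)) = complex.Re z.
  by rewrite cos_asin// zE addrK sqrtr_sqr gtr0_norm.
have [h1 h2] : -1 < complex.Im z /\ complex.Im z < 1.
  by apply/andP; rewrite -ltr_norml -(@ltr_pXn2r _ 2) ?nnegrE// expr1n real_normK ?num_real.
exists (asin (complex.Im z)).
  by apply: complex_eq; rewrite /= ?ce // asinK.
by apply/andP; split; [apply: asin_gtNpi2; rewrite h1 ltW | apply: asin_ltpi2; rewrite h2 ltW].
Qed.

Section Hom.
Variable (chi : R -> R[i]).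
Hypothesis chi_mod : forall t, cmod (chi t) = 1.
Hypothesis chiD : forall s t, chi (s + t) = chi s * chi t.
Hypothesis chi_cont : ccont chi.

Lemma hom0 : chi 0 = 1.
Proof.
have n0 : chi 0 != 0 by rewrite -cmod_eq0 chi_mod oner_eq0.
by apply: (mulfI n0); rewrite -chiD addr0 mulr1.
Qed.

Lemma hom_nat t (k : nat) : chi (k%:R * t) = chi t ^+ k.
Proof.
by elim: k => [|k ih]; rewrite ?mul0r ?hom0// -natr1 mulrDl mul1r chiD ih exprSr.
Qed.

Lemma hom_near1 e : 0 < e -> exists2 d, 0 < d & forall t, `|t| < d -> cmod (chi t - 1) < e.
Proof.
move=> e0; have := @ccont_contC R _ _ chi_cont 0; rewrite /continuous_at hom0 => h.
have n1 : nbhs (1 : R[i]^o) [set w | cmod (1 - w) < e] by apply/nbhsCP; exists e.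
have /nbhs_ballP[d /= d0 hd] := h _ n1.
exists d => // t td; rewrite cmod_distC; apply: hd.
by rewrite -ball_normE /= sub0r normrN.
Qed.

(** Every t is within d / 2^k of an integer multiple of d / 2^k, where chi is 1; continuity at 0
    does the rest. *)
Lemma hom_dyadic d : 0 < d -> (forall k : nat, chi (d / 2 ^+ k) = 1) -> forall t, chi t = 1.
Proof.
move=> d0 h; suff pos t : 0 <= t -> chi t = 1.
  move=> t; have [/pos//|t0] := leP 0 t.
  have := chiD t (- t); rewrite subrr hom0 [chi (- t)]pos ?oppr_ge0 ?ltW// mulr1.
  exact: esym.
move=> t0; apply/eqP; rewrite -subr_eq0 -cmod_eq0; apply/eqP/le_anti; rewrite cmod_ge0 andbT.
apply/ler_addgt0Pr => e e0; rewrite add0r.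
have [r r0 hr] := hom_near1 e0.
pose k := Num.truncn (d / r).
have kr : d / 2 ^+ k < r.
  rewrite ltr_pdivrMr ?exprn_gt0// mulrC -ltr_pdivrMr//.
  apply: lt_le_trans (truncnS_gt _) _; rewrite -natrX ler_nat -/k.
  exact: ltn_expl.
set u := d / 2 ^+ k in kr; have u0 : 0 < u by rewrite divr_gt0// exprn_gt0.
have /andP[m1 m2] := truncn_itv (divr_ge0 t0 (ltW u0)).
set m := Num.truncn (t / u) in m1 m2.
have mu1 : m%:R * u <= t by rewrite -ler_pdivlMr.
have mu2 : t < m.+1%:R * u by rewrite -ltr_pdivrMr.
have -> : chi t = chi (t - m%:R * u).
  have : chi t = chi (t - m%:R * u) * chi (m%:R * u) by rewrite -chiD subrK.
  by rewrite hom_nat h expr1n mulr1.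
apply/ltW/hr; rewrite ger0_norm ?subr_ge0//; apply: lt_trans kr.
by rewrite ltrBlDl -[X in _ < _ + X]mul1r -mulrDl natr1.
Qed.

End Hom.

(* Uniqueness of square roots in the right half plane determines the character at
   the dyadic multiples of a small number. *)
Lemma hom_cexpi (chi : R -> R[i]) : (forall t, cmod (chi t) = 1) ->
  (forall s t, chi (s + t) = chi s * chi t) -> ccont chi ->
  exists b, forall t, chi t = cexpi (b * t).
Proof.
move=> cm cD cc.
(* Within distance 1 of 1 the real part is positive, so on this interval the values lie in the right
   half plane. *)
have [d d0 hd] := hom_near1 cm cD cc ltr01.
have hd2 t : `|t| < d -> 0 < complex.Re (chi t).
  move=> /hd h; have := le_lt_trans (Re_le_cmod _) h; rewrite ReD ReN /= ltr_norml.
  by move=> /andP[h1 _]; lra.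
have d2 : 0 < d / 2 by rewrite divr_gt0.
have dd : `|d / 2| < d by rewrite gtr0_norm//; lra.
have [th thE /andP[th1 th2]] := cexpi_surj (cm (d / 2)) (hd2 (d / 2) dd).
pose b := th / (d / 2); exists b.
have half (z w : R[i]) : z * z = w * w -> 0 < complex.Re z -> 0 < complex.Re w -> z = w.
  move=> zw z0 w0; have /eqP : (z - w) * (z + w) = 0 by rewrite -subr_sqr !expr2 zw subrr.
  rewrite mulf_eq0 subr_eq0 => /orP[/eqP//|/eqP h].
  have h' : complex.Re z + complex.Re w = 0 by rewrite -ReD h.
  exfalso; move: z0 w0 h'; move: (complex.Re z) (complex.Re w) => x y; clear; lra.
have dy k : chi (d / 2 / 2 ^+ k) = cexpi (th / 2 ^+ k).
  elim: k => [|k ih]; first by rewrite expr0 !divr1.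
  have k1 : (1 : R) <= 2 ^+ k.+1 by rewrite exprn_ege1// ler1n.
  have e2 (x : R) : x / 2 ^+ k = x / 2 ^+ k.+1 + x / 2 ^+ k.+1.
    by rewrite exprS; field; rewrite expf_neq0// pnatr_eq0.
  apply: half.
  - by rewrite -cD -cexpiD -!e2.
  - apply: hd2; rewrite gtr0_norm ?divr_gt0 ?exprn_gt0//.
    rewrite ltr_pdivrMr ?exprn_gt0//; apply: (@lt_le_trans _ _ (d * 1)); first lra.
    by rewrite ler_pM2l.
  - apply: cos_gt0_pihalf; rewrite ltr_pdivrMr ?exprn_gt0// ltr_pdivlMr ?exprn_gt0//.
    have p2 : 0 < pi / 2 :> R by rewrite divr_gt0// pi_gt0.
    have hp : pi / 2 <= pi / 2 * 2 ^+ k.+1 :> R by rewrite -{1}[pi / 2]mulr1 ler_pM2l.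
    move: th1 th2 hp p2; rewrite !mulNr; move: (pi / 2 * 2 ^+ k.+1 : R) (pi / 2 : R) => x y; clear => *.
    by apply/andP; split; lra.
pose psi t := chi t * (cexpi (b * t))^*.
have p1 t : psi t = 1.
  apply: (@hom_dyadic psi _ _ _ (d / 2) d2) => [s|s t'||k].
  - by rewrite cmodM cm cmod_conj cmod_cexpi mulr1.
  - by rewrite /psi mulrDr cexpiD cD rmorphM /= mulrACA.
  - apply: ccontM => //; apply: ccont_conj; apply: cexpi_cont.
    exact: mulrl_continuous.
  - rewrite /psi dy (_ : b * _ = th / 2 ^+ k); last by rewrite /b; field; rewrite ?expf_neq0 ?pnatr_eq0 ?gt_eqF.
    by rewrite mulr_conjc cmod_cexpi expr1n.
move=> t; have := p1 t; rewrite /psi => h.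
have c1 : (cexpi (b * t))^* * cexpi (b * t) = 1 by rewrite mulrC mulr_conjc cmod_cexpi expr1n.
by rewrite -[chi t]mulr1 -c1 mulrA h mul1r.
Qed.

Section Euclid.
Variable n : nat.
Implicit Types v w : 'rV[R]_n.

Lemma hom_rV (chi : 'rV[R]_n -> R[i]) : (forall v, cmod (chi v) = 1) ->
  (forall v w, chi (v + w) = chi v * chi w) -> ccont chi ->
  exists b, forall v, chi v = cexpi (2 * pi * dotv b v).
Proof.
move=> cm cD cc.
have chi0 : chi 0 = 1.
  have n0 : chi 0 != 0 by rewrite -cmod_eq0 cm oner_eq0.
  by apply: (mulfI n0); rewrite -cD addr0 mulr1.
have ex (i : 'I_n) : exists b, forall t : R, chi (t *: delta_mx 0 i) = cexpi (b * t).
  apply: hom_cexpi => [t|s t|]; [exact: cm | by rewrite scalerDl cD |].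
  by apply: (ccont_comp (h := fun t : R => t *: delta_mx 0 i)) => //; exact: scalel_continuous.
pose b i := projT1 (cid (ex i)); have bE i t := projT2 (cid (ex i)) t.
have p2 : 2 * pi != 0 :> R by rewrite mulf_neq0// ?gt_eqF ?pi_gt0.
exists (\row_i (b i / (2 * pi))) => v.
have -> : 2 * pi * dotv (\row_i (b i / (2 * pi))) v = \sum_i b i * v 0 i.
  rewrite /dotv mulr_sumr; apply: eq_bigr => i _; rewrite mxE mulrA mulrCA.
  by rewrite mulfV// mulr1.
rewrite {1}(row_sum_delta v) (big_morph chi cD chi0) (big_morph _ cexpiD cexpi0).
by apply: eq_bigr => i _; exact: bE.
Qed.

(** The multiple of b at which the exponential of frequency b equals -1. It detects a nonzero
    frequency, in [cexpi_inj] and in [dq_cont]. *)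
Lemma dotv_half (b : 'rV[R]_n) : b != 0 -> dotv b ((2 * dotv b b)^-1 *: b) = 2^-1.
Proof.
move=> b0; have d0 : dotv b b != 0 by apply: contraNneq b0 => /dotv_eq0/eqP.
by rewrite dotvZr invfM -mulrA mulVf// mulr1.
Qed.

Lemma cexpi_pi : cexpi (pi : R) = -1.
Proof. by rewrite /cexpi cospi sinpi; apply: complex_eq; rewrite /= ?oppr0. Qed.

Lemma cexpi_inj (b b' : 'rV[R]_n) : (forall v, cexpi (2 * pi * dotv b v) = cexpi (2 * pi * dotv b' v)) -> b = b'.
Proof.
move=> h; apply/eqP; rewrite -subr_eq0; apply/negPn/negP => n0.
have := h ((2 * dotv (b - b') (b - b'))^-1 *: (b - b')); set v := _ *: _ => e.
have : cexpi (2 * pi * dotv (b - b') v) = 1.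
  by rewrite dotvBl mulrBr cexpiD cexpiN e mulr_conjc cmod_cexpi expr1n.
rewrite dotv_half// mulrAC mulfV// mul1r cexpi_pi => /eqP.
by rewrite -subr_eq0 -opprD oppr_eq0 -mulr2n pnatr_eq0.
Qed.

End Euclid.

End Cexpi.

Section Disc.
Context (R : realType).

Lemma disc_open (z : R[i]) (r : R) : open ([set w | cmod (z - w) < r] : set R[i]^o).
Proof.
rewrite openE => w /= wk; apply/nbhsCP.
exists (r - cmod (z - w)); first by rewrite subr_gt0.
move=> u wu /=; rewrite -(subrKA w); apply: le_lt_trans (cmodD _ _) _.
by rewrite addrC -ltrBrDr.
Qed.

Lemma square_compact : compact ([set z | `|complex.Re z| <= 1 /\ `|complex.Im z| <= 1] : set R[i]^o).
Proof.
pose S : set R := `[-1, 1]%classic.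
rewrite (_ : [set z | _] = (fun z : R * R => z.1 +i* z.2 : R[i]^o) @` (S `*` S)).
  apply: continuous_compact; last by apply: compact_setX; exact: segment_compact.
  apply: continuous_subspaceT; apply: ccont_contC; split => /=; [exact: cont_fst | exact: cont_snd].
apply/seteqP; split => [[x y] /= [x1 y1]|_ [[x y] [/= x1 y1] <-] /=].
  by exists (x, y) => //; split; rewrite /S /= in_itv /= -ler_norml.
by move: x1 y1; rewrite /S /= !in_itv /= -!ler_norml.
Qed.

Lemma one_sub_cmod (z : R[i]) : cmod z = 1 -> cmod (1 - z) ^+ 2 = 2 * (1 - complex.Re z).
Proof.
move=> z1; have := sqr_cmod z; rewrite z1 expr1n !sqr_cmod ReD ImD ReN ImN /= sub0r sqrrN.
move: (complex.Re z) (complex.Im z) => x y h.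
have -> : y ^+ 2 = 1 - x ^+ 2 by rewrite h addrC addKr.
by ring.
Qed.

End Disc.

Lemma ultra_lim (T U : topologicalType) (F : set_system T) (f : T -> U) (K : set U) :
  UltraFilter F -> compact K -> F (f @^-1` K) -> exists2 z, K z & f @ F --> z.
Proof.
move=> FU cK FK; have FF : ProperFilter F := ultra_proper.
have [z [Kz zc]] := cK (f @ F) _ FK.
exists z => // W zW; have [//|FW] := in_ultra_setVsetC (f @^-1` W) FU.
by have [y []] := zc (~` W) W FW zW.
Qed.

(** * Coordinates on the dual group *)

Section Structure.
Context (R : realType) (G G0 : topologicalZmodType) (n : nat).
Hypothesis lG : lca_group G.
Hypothesis scG : @second_countable G.
Variables (Phi : G -> 'rV[R]_n * G0) (Phi' : 'rV[R]_n * G0 -> G).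
Hypothesis PhiD : {morph Phi : x y / x + y}.
Hypothesis Phic : continuous Phi.
Hypothesis PhiK : cancel Phi Phi'.
Hypothesis Phi'K : cancel Phi' Phi.
Hypothesis Phi'c : continuous Phi'.
Variable K : set G0.
Hypothesis K_sub : compact_open_subgroup K.
Local Notation Gd := (dual R G).

Definition gq (x : G) : 'rV[R]_n := (Phi x).1.
Definition ge (v : 'rV[R]_n) : G := Phi' (v, 0).
Definition gk : set G := [set x | K (Phi x).2].

Lemma PhiB x y : Phi (x - y) = Phi x - Phi y.
Proof. by apply/eqP; rewrite eq_sym subr_eq -PhiD subrK. Qed.

Lemma Phi'D z w : Phi' (z + w) = Phi' z + Phi' w.
Proof. by rewrite -{1}[z]Phi'K -{1}[w]Phi'K -PhiD PhiK. Qed.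

Lemma gqB x y : gq (x - y) = gq x - gq y. Proof. by rewrite /gq PhiB. Qed.

Lemma gq_cont : continuous gq.
Proof. exact: (cont_comp Phic (@cont_fst _ _)). Qed.

Lemma geB v w : ge (v - w) = ge v - ge w.
Proof.
rewrite /ge; apply/eqP; rewrite eq_sym subr_eq -Phi'D; apply/eqP; congr Phi'.
by apply: injective_projections => /=; rewrite ?subrK ?addr0.
Qed.

Lemma geD v w : ge (v + w) = ge v + ge w.
Proof. by rewrite /ge -Phi'D; congr Phi'; apply: injective_projections => //=; rewrite addr0. Qed.

Lemma ge_cont : continuous ge.
Proof.
apply: (cont_comp (f := fun v => (v, 0 : G0)) (g := Phi')) => //.
by apply: cont_pair; [exact: cont_id | exact: cont_cst].
Qed.

Lemma gqe v : gq (ge v) = v. Proof. by rewrite /gq /ge Phi'K. Qed.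

Lemma gke v : gk (ge v).
Proof. by rewrite /gk /ge /= Phi'K; case: K_sub. Qed.

Lemma gk_open : open gk.
Proof.
case: K_sub => _ Ko _ _; apply: (@open_comp _ _ (fun x => (Phi x).2)) => // x _.
exact: (cont_comp Phic (@cont_snd _ _)).
Qed.

Lemma gkB x y : gk x -> gk y -> gk (x - y).
Proof. by case: K_sub => _ _ _ h kx ky; rewrite /gk /= PhiB; exact: h. Qed.

Lemma gbox_compact r : compact [set x : G | gk x /\ dotv (gq x) (gq x) <= r].
Proof.
rewrite (_ : [set x | _] = Phi' @` ([set v | dotv v v <= r] `*` K)).
  case: K_sub => cK _ _ _.
  apply: continuous_compact; first exact: continuous_subspaceT.
  by apply: compact_setX => //; exact: dotv_compact.
apply/seteqP; split => [x [kx Nx]|_ [[v y] [/= vr Ky] <-]].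
  by exists (Phi x); rewrite ?PhiK.
by rewrite /gk /gq /= Phi'K.
Qed.

Section DualCoord.
Implicit Types xi eta : Gd.

(** [dual_coord] is defined by choice and needs an existing pair: the restriction of xi to R^n is an
    exponential by [hom_rV], and its restriction to G0 is the second component. *)
Lemma dual_coordP xi x :
  xi x = cexpi (2 * pi * dotv (dual_coord Phi xi).1 (gq x)) * (dual_coord Phi xi).2 (Phi x).2.
Proof.
have [b bE] : exists b, forall v, xi (ge v) = cexpi (2 * pi * dotv b v).
  apply: hom_rV => [v|v w|].
  - exact: dual_cmod.
  - rewrite -dual_add; congr (dual_fun xi _).
    exact: geD.
  - apply: (ccont_comp ge_cont); apply: contC_ccont; exact: dual_cont.
pose w2f (y : G0) := xi (Phi' (0, y)).
have w2n y : `|w2f y| = 1 by exact: dual_norm.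
have w2D x1 y : w2f (x1 + y) = w2f x1 * w2f y.
  rewrite /w2f -dual_add -Phi'D; congr (dual_fun xi (Phi' _)).
  by apply: injective_projections => //=; rewrite addr0.
have w2c : continuous (w2f : G0 -> R[i]^o).
  apply: (cont_comp (f := fun y => Phi' (0, y)) (g := xi : G -> R[i]^o)); last exact: dual_cont.
  apply: (cont_comp (f := fun y : G0 => (0 : 'rV[R]_n, y)) (g := Phi')) => //.
  by apply: cont_pair; [exact: cont_cst | exact: cont_id].
suff h y : xi y = cexpi (2 * pi * dotv b (Phi y).1) * (Character w2n w2D w2c) (Phi y).2.
  have ex : exists w : 'rV[R]_n * dual R G0, [set w : 'rV[R]_n * dual R G0 | forall x,
      xi x = cexpi (2 * pi * dotv w.1 (Phi x).1) * w.2 (Phi x).2] w.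
    by exists (b, Character w2n w2D w2c).
  exact: (getPex ex x).
rewrite /= -bE /w2f -dual_add -Phi'D -{1}[y]PhiK; congr (dual_fun xi (Phi' _)).
by apply: injective_projections => /=; rewrite ?addr0 ?add0r.
Qed.

Definition dq xi := (dual_coord Phi xi).1.
Definition dk : set Gd := [set xi | annihilator (R := R) K (dual_coord Phi xi).2].

Lemma dual_ge xi v : xi (ge v) = cexpi (2 * pi * dotv (dq xi) v).
Proof. by rewrite dual_coordP gqe /ge Phi'K dual_arg0 mulr1. Qed.

Lemma dual_snd xi y : xi (Phi' (0, y)) = (dual_coord Phi xi).2 y.
Proof. by rewrite dual_coordP /gq Phi'K /= dotvC dotv0l mulr0 cexpi0 mul1r. Qed.

Lemma dkP xi : dk xi <-> forall y, K y -> xi (Phi' (0, y)) = 1.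
Proof. by split => h y Ky; [rewrite dual_snd; exact: h | rewrite -dual_snd; exact: h]. Qed.

Lemma dk_gk xi x : dk xi -> gk x -> xi x = cexpi (2 * pi * dotv (dq xi) (gq x)).
Proof. by move=> kxi kx; rewrite dual_coordP kxi ?mulr1. Qed.

Lemma dqP xi b : (forall v, xi (ge v) = cexpi (2 * pi * dotv b v)) -> dq xi = b.
Proof. by move=> h; apply: cexpi_inj => v; rewrite -dual_ge. Qed.

Lemma dqB xi eta : dq (xi - eta) = dq xi - dq eta.
Proof.
apply: dqP => v; rewrite dual_evalD dual_evalN !dual_ge dotvBl mulrBr.
by rewrite cexpiD cexpiN.
Qed.

Fact de_norm v x : `|cexpi (2 * pi * dotv v (gq x))| = 1 :> R[i].
Proof. by rewrite normc_cmod cmod_cexpi. Qed.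
Fact de_add v x y : cexpi (2 * pi * dotv v (gq (x + y))) =
  cexpi (2 * pi * dotv v (gq x)) * cexpi (2 * pi * dotv v (gq y)).
Proof. by rewrite /gq PhiD dotvDr mulrDr cexpiD. Qed.

Lemma de_ccont (S : topologicalType) (f g : S -> 'rV[R]_n) : continuous f -> continuous g ->
  ccont (fun s => cexpi (2 * pi * dotv (f s) (g s))).
Proof.
move=> cf cg; apply: cexpi_cont => s; apply: cvgM; first exact: cvg_cst.
exact: dotv_cont.
Qed.

Fact de_cont v : continuous ((fun x => cexpi (2 * pi * dotv v (gq x))) : G -> R[i]^o).
Proof. by apply: ccont_contC; apply: de_ccont; [exact: cont_cst | exact: gq_cont]. Qed.
Definition de v : Gd := Character (de_norm v) (de_add v) (@de_cont v).

Lemma dqe v : dq (de v) = v.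
Proof. by apply: dqP => w /=; rewrite gqe. Qed.

Lemma deB v w : de (v - w) = de v - de w.
Proof.
by apply: dual_ext => x; rewrite dual_evalD dual_evalN /= dotvBl mulrBr cexpiD cexpiN.
Qed.

Lemma dke v : dk (de v).
Proof. by apply/dkP => y Ky /=; rewrite /gq Phi'K /= dotvC dotv0l mulr0 cexpi0. Qed.

Lemma de_continuous : continuous de.
Proof.
apply: dual_curry_cont; apply: ccont_contC; apply: de_ccont; first exact: cont_fst.
exact: (cont_comp (@cont_snd _ _) gq_cont).
Qed.

Lemma dkB xi eta : dk xi -> dk eta -> dk (xi - eta).
Proof.
move=> /dkP k1 /dkP k2; apply/dkP => y Ky.
by rewrite dual_evalD dual_evalN k1// k2// mul1r rmorph1.
Qed.

Lemma dual_shift_open (U : set Gd) xi : open U -> open [set eta | U (eta - xi)].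
Proof.
move=> Uo; apply: (@open_comp _ _ (fun eta : Gd => eta - xi)) => // eta _.
apply: (cont_comp (f := fun eta => (eta, xi)) (g := fun z : Gd * Gd => z.1 - z.2)).
  by apply: cont_pair; [exact: cont_id | exact: cont_cst].
exact: dual_sub_cont.
Qed.

(* The unit disc around 1 contains no nontrivial subgroup of the circle. *)
Lemma dk_open : open dk.
Proof.
have [cK _ _ _] := K_sub.
pose C := (fun y => Phi' (0, y)) @` K.
have cC : compact C.
  apply: continuous_compact => //; apply: continuous_subspaceT.
  apply: (cont_comp (f := fun y : G0 => (0 : 'rV[R]_n, y)) (g := Phi')) => //.
  by apply: cont_pair; [exact: cont_cst | exact: cont_id].
pose U : set Gd := [set eta | forall x, C x -> cmod (1 - eta x) < 1].
have Uo : open U := dual_open cC (@disc_open R 1 1).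
have Uk : U `<=` dk.
  move=> eta h; apply/dkP.
  have d0 y : 0 <= 1 - complex.Re (eta (Phi' (0, y))).
    by rewrite subr_ge0 (le_trans (ler_norm _))// (le_trans (Re_le_cmod _))// dual_cmod.
  have hy y : K y -> 1 - complex.Re (eta (Phi' (0, y))) <= 1 / 2.
    move=> Ky; have hy : cmod (1 - eta (Phi' (0, y))) < 1 by apply: h; exists y.
    have := one_sub_cmod (dual_cmod eta (Phi' (0, y))).
    have : cmod (1 - eta (Phi' (0, y))) ^+ 2 <= 1 by rewrite exprn_ile1 ?cmod_ge0// ltW.
    move: (cmod _ ^+ 2) => u; lra.
  (* For |z| = 1, 1 - Re z^2 = 2 (1 - Re z)(1 + Re z), which is at least 3 (1 - Re z) when 1 - Re z
     <= 1 / 2. Doubling y stays in K, so the defect would grow beyond 1 / 2 unless it is 0. *)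
  have key (k : nat) y : K y -> 3 ^+ k * (1 - complex.Re (eta (Phi' (0, y)))) <= 1 / 2.
    elim: k y => [|k ih] y Ky; first by rewrite expr0 mul1r; exact: hy.
    have Kyy : K (y + y).
      case: K_sub => _ _ K0 KB; rewrite -[X in _ + X]opprK; apply (KB) => //.
      by rewrite -sub0r; exact: KB.
    have := ih _ Kyy.
    have -> : Phi' (0, y + y) = Phi' (0, y) + Phi' (0, y).
      by rewrite -Phi'D; congr Phi'; apply: injective_projections => //=; rewrite addr0.
    rewrite dual_add ReM exprS.
    have := sqr_cmod (eta (Phi' (0, y))); rewrite dual_cmod expr1n.
    have := d0 y; have := hy _ Ky; have : 0 <= 3 ^+ k :> R by rewrite exprn_ge0.
    move: (complex.Re _) (complex.Im _) (3 ^+ k) => a b t t0 h1 h2 h3 h4.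
    have h5 : b * b = 1 - a * a by rewrite -!expr2 h3 addrC addKr.
    apply: le_trans h4; rewrite h5 (mulrC 3) -mulrA ler_wpM2l//; nra.
  move=> y Ky; have dy : 1 - complex.Re (eta (Phi' (0, y))) <= 0.
    rewrite leNgt; apply/negP => d1.
    have := key (Num.truncn (1 - complex.Re (eta (Phi' (0, y))))^-1) y Ky.
    set d := 1 - _ in d1 *; set k := Num.truncn _.
    have k1 : d^-1 < 3 ^+ k.
      apply: lt_le_trans (truncnS_gt _) _; rewrite -natrX ler_nat; exact: ltn_expl.
    have : d^-1 * d < 3 ^+ k * d by rewrite ltr_pM2r.
    rewrite mulVf ?gt_eqF//; lra.
  have := one_sub_cmod (dual_cmod eta (Phi' (0, y))).
  have -> : 1 - complex.Re (eta (Phi' (0, y))) = 0 by apply/le_anti; rewrite dy d0.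
  rewrite mulr0 => /eqP; rewrite sqrf_eq0 cmod_eq0 subr_eq0 => /eqP <-.
  by [].
have U0 : U 0 by move=> x _; rewrite subrr cmod0.
rewrite openE => xi kxi; apply: (@filterS _ _ _ [set eta | U (eta - xi)]).
  by move=> eta /Uk h; rewrite -(subrK xi eta) -[X in _ + X]opprK; apply: dkB => //;
    rewrite -sub0r; apply: dkB => //; exact: Uk.
by apply: open_nbhs_nbhs; split; [exact: dual_shift_open | rewrite /= subrr].
Qed.

(** A character of frequency b takes the value -1 at a point of squared length 1 / (4 |b|^2). If it
    stays at distance less than 2 from 1 on the ball of squared radius 1 / (4 r), then |b|^2 < r. *)
Lemma dq_cont : continuous dq.
Proof.
have add0 r : 0 < r -> exists U : set Gd, [/\ open U, U 0 & forall eta, U eta -> dotv (dq eta) (dq eta) < r].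
  move=> r0; pose C := ge @` [set v | dotv v v <= (4 * r)^-1].
  have cC : compact C.
    apply: continuous_compact; last exact: dotv_compact.
    apply: continuous_subspaceT; exact: ge_cont.
  exists [set eta | forall x, C x -> cmod (1 - eta x) < 2]; split.
  - exact: (dual_open cC (@disc_open R 1 2)).
  - by move=> x _; rewrite subrr cmod0.
  move=> eta h; rewrite ltNge; apply/negP => rd.
  have d0 : 0 < dotv (dq eta) (dq eta) by exact: lt_le_trans rd.
  have n0 : dq eta != 0 by apply: contraTneq d0 => ->; rewrite dotv0l ltxx.
  have inC : C (ge ((2 * dotv (dq eta) (dq eta))^-1 *: dq eta)).
    exists ((2 * dotv (dq eta) (dq eta))^-1 *: dq eta) => //=.
    rewrite dotvZl dotvZr; set d := dotv _ _ in d0 rd *.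
    have -> : (2 * d)^-1 * ((2 * d)^-1 * d) = (4 * d)^-1 by field; rewrite gt_eqF.
    by rewrite lef_pV2 ?posrE ?mulr_gt0// ler_pM2l.
  have := h _ inC.
  rewrite dual_ge dotv_half// mulrAC mulfV// mul1r cexpi_pi opprK -mulr2n.
  have -> : cmod (1 *+ 2 : R[i]) = 2.
    by rewrite (_ : 1 *+ 2 = (2 : R)%:C) ?cmod_real ?gtr0_norm// rmorphMn rmorph1.
  by rewrite ltxx.
move=> xi; apply: (iffRL (@cvgrPdist_lt _ _ _ _ (@nbhs_filter Gd xi) _ _)) => e e0.
have [U [Uo U0 Ue]] := add0 _ (exprn_gt0 2 e0).
have nU : nbhs xi [set eta | U (eta - xi)].
  by apply: open_nbhs_nbhs; split; [exact: dual_shift_open | rewrite /= subrr].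
apply: (@filterS _ _ (@nbhs_filter Gd xi) _ _ _ nU) => eta /= /Ue h.
rewrite -normrN opprB -dqB /Num.norm /= mx_normrE; apply: bigmax_lt => //= -[i j] _ /=.
rewrite -(@ltr_pXn2r _ 2) ?nnegrE// ?(ltW e0)// real_normK ?num_real//.
by apply: le_lt_trans h; rewrite ord1 dotv_coord.
Qed.

(* On [gk] a character of the box is determined by its frequency, so a pointwise
   limit along an ultrafilter is continuous and is attained locally uniformly. *)
Lemma dbox_compact r : compact [set xi : Gd | dk xi /\ dotv (dq xi) (dq xi) <= r].
Proof.
set B := [set xi | _]; rewrite compact_ultra => F FU FB.
have FF : ProperFilter F := ultra_proper.
(* Values of characters stay in a compact square, so the ultrafilter has a limit at each point x. *)
have ev x : exists z : R[i], (fun xi : Gd => xi x : R[i]^o) @ F --> (z : R[i]^o).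
  have [|z _ zP] := ultra_lim (f := fun xi : Gd => xi x : R[i]^o) FU (@square_compact R).
    apply: filterS FB => xi _ /=.
    by split; rewrite -(dual_cmod xi x); [exact: Re_le_cmod | exact: Im_le_cmod].
  by exists z.
pose f x := projT1 (cid (ev x)); have fP x : (fun xi : Gd => xi x : R[i]^o) @ F --> (f x : R[i]^o) := projT2 (cid (ev x)).
have [b0 b0r b0P] : exists2 b0 : 'rV[R]_n, dotv b0 b0 <= r & dq @ F --> b0.
  apply: (ultra_lim FU (@dotv_compact _ _ r)).
  by apply: filterS FB => xi -[].
have hausC : hausdorff_space R[i]^o := @norm_hausdorff _ R[i]^o.
have flim x (H : Gd -> R[i]) (z : R[i]) : (H : Gd -> R[i]^o) @ F --> (z : R[i]^o) ->
    (forall xi, B xi -> H xi = xi x) -> f x = z.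
  move=> Hz HE; apply: (cvg_unique hausC (fP x)).
  apply: cvg_trans Hz; apply: near_eq_cvg.
  by apply: filterS FB => xi /HE.
have f_mod x : cmod (f x) = 1.
  have near1 e : 0 < e -> exists xi : Gd, cmod (f x - xi x) < e.
    move=> e0; have : F [set xi | cmod (f x - xi x) < e].
      by apply: (fP x [set w | cmod (f x - w) < e]); apply/nbhsCP; exists e.
    by move=> /filter_ex[xi h]; exists xi.
  apply/le_anti/andP; split; apply/ler_addgt0Pr => e /near1[xi /ltW h].
    by rewrite -(dual_cmod xi x) addrC -{1}(subrK (xi x) (f x)) (le_trans (cmodD _ _))// lerD2r.
  by rewrite -(dual_cmod xi x) -{1}(subrK (f x) (xi x)) addrC (le_trans (cmodD _ _))// lerD2l cmod_distC.
have fD x y : f (x + y) = f x * f y.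
  apply: (flim _ (fun xi : Gd => xi x * xi y)).
    exact: (@cvgM R[i] _ F _ (fun xi : Gd => xi x : R[i]^o) (fun xi : Gd => xi y : R[i]^o) _ _ (fP x) (fP y)).
  by move=> xi _; rewrite dual_add.
have fk h : gk h -> f h = cexpi (2 * pi * dotv b0 (gq h)).
  move=> kh; apply: (flim _ (fun xi : Gd => cexpi (2 * pi * dotv (dq xi) (gq h)))).
    have := ccont_contC (de_ccont (@cont_id 'rV[R]_n) (@cont_cst _ _ (gq h))) (x := b0).
    exact: (cvg_comp _ _ b0P).
  by move=> xi [kxi _]; rewrite dk_gk.
have f_norm x : `|f x| = 1 by rewrite normc_cmod f_mod.
have subc x : continuous (fun y : G => y - x).
  apply: (cont_comp (f := fun y => (y, x)) (g := fun z : G * G => z.1 - z.2)).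
    by apply: cont_pair; [exact: cont_id | exact: cont_cst].
  exact: sub_continuous.
have gkn x : nbhs x [set y | gk (y - x)].
  apply: open_nbhs_nbhs; split; last by rewrite /= subrr -(subrr (ge 0)); apply: gkB; exact: gke.
  by apply: (@open_comp _ _ (fun y : G => y - x) gk) => [y _|]; [exact: subc | exact: gk_open].
have ce1 x : cexpi (2 * pi * dotv b0 (gq (x - x))) = 1.
  by rewrite gqB subrr dotvC dotv0l mulr0 cexpi0.
(* Near x the limit is f x times an exponential, since f is multiplicative and explicit on the open
   subgroup [gk]. *)
have f_cont : continuous (f : G -> R[i]^o).
  move=> x.
  have cc := ccont_contC (ccontM (ccont_cst (f x)) (de_ccont (@cont_cst _ _ b0) (cont_comp (subc x) gq_cont))) (x := x).
  rewrite /continuous_at; have fx : f x * cexpi (2 * pi * dotv b0 (gq (x - x))) = f x.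
    by rewrite ce1 mulr1.
  rewrite -[X in _ --> X]fx; apply: cvg_trans cc; apply: near_eq_cvg.
  by apply: filterS (gkn x) => y ky /=; rewrite -fk// -fD addrC subrK.
pose xi0 : Gd := Character f_norm fD f_cont.
have q0 : dq xi0 = b0 by apply: dqP => v; rewrite /= fk ?gqe//; exact: gke.
exists xi0; split; first split.
- by apply/dkP => y Ky /=; rewrite fk /gk /gq /= Phi'K//= dotvC dotv0l mulr0 cexpi0.
- by rewrite q0.
move=> U; rewrite nbhsE => -[W [[V Vo VW] Wxi] WU].
suff co : @dual_co R G @ F --> (dual_co xi0 : {compact-open, G -> R[i]^o}).
  have h : F (@dual_co R G @^-1` V).
    by apply: co; apply: open_nbhs_nbhs; split=> //; move: Wxi; rewrite -VW.
  by apply: filterS h => xi Vxi; apply: WU; rewrite -VW.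
apply/compact_open_cvgP => C O cC Oo CO.
(* By the near-covering form of compactness it suffices to let the point and the character vary
   together near each x; there xi y = xi x * xi (y - x), and the last factor is an exponential in
   the convergent frequency. *)
have h : F [set xi : Gd | forall x, C x -> O (xi x)].
  move/compact_near_coveringP : cC; apply=> x Cx.
  have FP : Filter (filter_prod (nbhs x) F) by exact: filter_prod_filter.
  have cv : (fun p : G * Gd => p.2 p.1 : R[i]^o) @ filter_prod (nbhs x) F --> (f x : R[i]^o).
    have c1 : (fun p : G * Gd => p.2 x : R[i]^o) @ filter_prod (nbhs x) F --> (f x : R[i]^o).
      exact: (cvg_comp _ _ cvg_snd (fP x)).
    have cc := ccont_contC (de_ccont (@cont_fst 'rV[R]_n G)
      (cont_comp (cont_comp (@cont_snd 'rV[R]_n G) (subc x)) gq_cont)) (x := (b0, x)).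
    have c2 : (fun p : G * Gd => cexpi (2 * pi * dotv (dq p.2) (gq (p.1 - x))) : R[i]^o) @
        filter_prod (nbhs x) F --> (1 : R[i]^o).
      have -> : (1 : R[i]) = cexpi (2 * pi * dotv b0 (gq (x - x))).
        by rewrite ce1.
      apply: (cvg_comp (fun p : G * Gd => (dq p.2, p.1)) _ _ cc).
      have c3 : (fun p : G * Gd => dq p.2) @ filter_prod (nbhs x) F --> b0 by exact: (cvg_comp _ _ cvg_snd b0P).
      exact: (cvg_pair c3 cvg_fst).
    rewrite -[f x]mulr1; apply: cvg_trans (@cvgM R[i] _ _ _ _ _ _ _ c1 c2).
    apply: near_eq_cvg; exists ([set y | gk (y - x)], B); first by split => //; exact: gkn.
    by move=> [y xi] [/= ky [kxi _]]; rewrite -dk_gk// -dual_add addrC subrK.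
  apply: cv; apply: open_nbhs_nbhs; split => //; apply: CO; by exists x.
have sub : [set xi : Gd | forall x, C x -> O (xi x)] `<=` @dual_co R G @^-1` [set g | g @` C `<=` O].
  by move=> xi hxi _ [x Cx <-]; exact: hxi.
exact: (@filterS _ F _ _ _ sub h).
Qed.

End DualCoord.
End Structure.

Definition tgB (X : PreTopologicalZmodule.type) : tgroup :=
  @TGroup X _ (MeasTop.class (borel X)).

Section Borel.
Context (R : realType) (X : PreTopologicalZmodule.type).

Lemma std_borel : @second_countable X -> std (mt (tgB X)).
Proof. by move=> sX; split=> // U Uo; exact: sub_gen_smallest. Qed.

Lemma haar_inv (m : {sigma_finite_measure set (borel X) -> \bar R}) : haar m ->
  forall (a : tgB X) (U : set (mt (tgB X))), measurable U ->
    m ([set x : tgB X | U (x + a)] : set (mt (tgB X))) = m U.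
Proof.
move=> [h _ _] a U mU; rewrite -(h (- (a : X)) U mU).
congr (m _); apply/seteqP; split => [x Ux|_ [y Uy <-] /=].
  by exists ((x : X) + a) => //; rewrite addrC addrK.
by change (U ((- (a : X) + y) + a)); rewrite addrC addrA subrr add0r.
Qed.

End Borel.

Section Spaces.
Context (R : realType) (G G0 : topologicalZmodType) (n : nat).
Hypothesis lG : lca_group G.
Hypothesis scG : @second_countable G.
Variables (Phi : G -> 'rV[R]_n * G0) (Phi' : 'rV[R]_n * G0 -> G).
Hypothesis PhiD : {morph Phi : x y / x + y}.
Hypothesis Phic : continuous Phi.
Hypothesis PhiK : cancel Phi Phi'.
Hypothesis Phi'K : cancel Phi' Phi.
Hypothesis Phi'c : continuous Phi'.
Variable K : set G0.
Hypothesis K_sub : compact_open_subgroup K.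
Local Notation Gd := (dual R G).
Variables (mu : {sigma_finite_measure set (borel G) -> \bar R})
    (nu : {sigma_finite_measure set (borel (dual R G)) -> \bar R}).
Hypothesis mu_haar : haar mu.
Hypothesis nu_dual : dual_haar mu nu.
Local Notation gq := (gq Phi).
Local Notation ge := (ge Phi').
Local Notation gk := (gk Phi K).
Local Notation dq := (dq Phi).
Local Notation de := (de PhiD Phic).
Local Notation dk := (dk Phi K).
Definition gN (x : G) : R := dotv (gq x) (gq x).
Definition gh (x : G) : G := ge (2^-1 *: gq x).
Definition dN (xi : Gd) : R := dotv (dq xi) (dq xi).
Definition dh (xi : Gd) : Gd := de (2^-1 *: dq xi).
Local Notation TG := (tgB G).
Local Notation TD := (tgB Gd).

Lemma gG_gspace : @gspace R TG mu gN gk gh.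
Proof.
have [m1 m2 m3] := mu_haar.
apply: (@builder_gspace R TG mu n gq ge gk).
- exact: std_borel.
- exact: sub_continuous.
- by [].
- exact: haar_inv.
- exact: m3.
- exact: m2.
- exact: gqB.
- exact: gq_cont.
- exact: (geB PhiD PhiK Phi'K).
- exact: ge_cont.
- exact: gqe.
- exact: (gke Phi'K K_sub).
- exact: gk_open.
- exact: gkB.
- by move=> r; exact: gbox_compact.
Qed.

Lemma gD_gspace : @gspace R TD nu dN dk dh.
Proof.
have [[m1 m2 m3] _] := nu_dual.
apply: (@builder_gspace R TD nu n dq de dk).
- by apply: std_borel; exact: dual_second_countable.
- exact: dual_sub_cont.
- by [].
- by apply: haar_inv.
- exact: m3.
- exact: m2.
- exact: (dqB PhiD PhiK Phi'K Phi'c).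
- exact: (dq_cont lG PhiD PhiK Phi'K Phi'c).
- exact: deB.
- exact: de_continuous.
- exact: (dqe PhiD Phic PhiK Phi'K Phi'c).
- exact: (dke PhiD Phic PhiK Phi'K Phi'c).
- exact: (dk_open lG PhiD PhiK Phi'K Phi'c K_sub).
- exact: (dkB PhiD PhiK Phi'K Phi'c).
- by move=> r; exact: (@dbox_compact R G G0 n Phi Phi' PhiD Phic PhiK Phi'K Phi'c K K_sub r).
Qed.

End Spaces.

(** * The Fourier transform of the Gaussian *)

Section GaussianFourier.
Context (R : realType) (A : tgroup).
Variables (mu : {sigma_finite_measure set (mt A) -> \bar R}) (n : nat) (q : A -> 'rV[R]_n)
  (e : 'rV[R]_n -> A) (kap : set A) (hf : A -> A).
Let N x := dotv (q x) (q x).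
Hypothesis gs : gspace mu N kap hf.
Hypothesis qD : forall x y, q (x + y) = q x + q y.
Hypothesis qc : continuous (q : mt A -> 'rV[R]_n).
Hypothesis qe : forall v, q (e v) = v.
Hypothesis ke : forall v, kap (e v).
Local Notation g := (gG N kap).

Lemma gauss_integrable (f : A -> R) (M a : R) : 0 < a -> 0 <= M -> continuous (f : mt A -> R) ->
  (forall x, `|f x| <= M * g a x) -> mu.-integrable setT (EFin \o (f : mt A -> R)).
Proof.
move=> a0 M0 cf fM.
have [I I0 IE] := gG_fin gs a0.
have mg : measurable_fun setT (fun x : mt A => (M * g a x)%:E).
  by apply/measurable_EFinP; apply: measurable_funM; [exact: measurable_cst | exact: (gG_meas gs)].
apply: (@le_integrable _ _ _ mu setT measurableT _ (fun x : mt A => (M * g a x)%:E)).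
- by apply/measurable_EFinP; exact: (cont_measurable (gs_std gs)).
- by move=> x _ /=; rewrite lee_fin [leRHS]ger0_norm// mulr_ge0// gG_ge0.
apply/integrableP; split => //.
under eq_integral do rewrite gee0_abs ?lee_fin ?mulr_ge0 ?gG_ge0// EFinM.
rewrite ge0_integralZl_EFin//.
- by rewrite IE -EFinM ltry.
- by move=> x _; rewrite lee_fin gG_ge0.
- by apply/measurable_EFinP; exact: (gG_meas gs).
Qed.

Lemma diff_under (f df : R -> A -> R) (t0 M a : R) : 0 < a -> 0 <= M ->
  (forall t, continuous (f t : mt A -> R)) ->
  (forall t x, `|t - t0| < 1 -> `|f t x| <= M * g a x) ->
  (forall t x, is_derive t (1 : R) (f^~ x) (df t x)) ->
  (forall t x, `|t - t0| < 1 -> `|df t x| <= M * g a x) ->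
  is_derive t0 (1 : R) (fun t => \int[mu]_x (f t x)) (\int[mu]_x (df t0 x)).
Proof.
move=> a0 M0 cf fM fd dfM.
have [I I0 IE] := gG_fin gs a0.
have Ia : (`]t0 - 1, t0 + 1[%classic : set R) t0 by rewrite /= in_itv /=; lra.
have itf t : (`]t0 - 1, t0 + 1[%classic : set R) t -> mu.-integrable setT (EFin \o (f t : mt A -> R)).
  rewrite /= in_itv /= => /andP[t1 t2]; apply: (gauss_integrable a0 M0 (cf t)) => x.
  by apply: fM; rewrite ltr_norml; lra.
have drf t (x : mt A) : (`]t0 - 1, t0 + 1[%classic : set R) t -> setT x -> derivable (f^~ x) t 1.
  by move=> _ _; have := fd t x => h; exact: ex_derive.
have M1 (x : mt A) : 0 <= M * g a x by rewrite mulr_ge0// gG_ge0.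
have iM : mu.-integrable setT (EFin \o (fun x : mt A => M * g a x)).
  apply: (gauss_integrable a0 M0) => [x|x]; last by rewrite ger0_norm.
  by apply: cvgM; [exact: cvg_cst | exact: (gG_cont gs)].
have dE t (x : mt A) : partial1of2 (f : R -> mt A -> R) t x = df t x.
  by rewrite partial1of2E; have h := fd t x; exact: derive_val.
have dM t (x : mt A) : (`]t0 - 1, t0 + 1[%classic : set R) t -> setT x -> `|partial1of2 (f : R -> mt A -> R) t x| <= M * g a x.
  rewrite /= in_itv /= => /andP[t1 t2] _; rewrite dE.
  by apply: dfM; rewrite ltr_norml; lra.
have h1 := @derivable_under_integral R _ (mt A) mu f setT measurableT t0 _ _ Ia itf drf _ M1 iM dM.
have h2 := @differentiation_under_integral R _ (mt A) mu f setT measurableT t0 _ _ Ia itf drf _ M1 iM dM.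
split => //; rewrite -derive1E h2; apply: eq_Rintegral => x _; exact: dE.
Qed.

Section Direction.
Variables (b : 'rV[R]_n) (a th : R).
Hypothesis a0 : 0 < a.
Let d := dotv b b.
Let be x := dotv b (q x).
Let d0 : 0 <= d. Proof. exact: dotv_ge0. Qed.
Let be_cont : continuous (be : mt A -> R).
Proof. by apply: dotv_cont => //; exact: cont_cst. Qed.
Let kappa : R := pi ^+ 2 * d / a.

Let be_le x : `|2 * be x| <= d + N x.
Proof.
rewrite ler_norml; apply/andP; split; last exact: dotv_cauchy.
have := dotv_ge0 (b + q x); rewrite dotvDl !dotvDr (dotvC (q x) b) /be /N /d; lra.
Qed.

(** The phase th handles both parts of the Fourier integral: 0 gives the cosine and pi / 2 minus the
    sine. *)
Let wave (t : R) (x : A) : R := g a x * cos (2 * pi * t * be x + th).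
Let dwave (t : R) (x : A) : R := - (2 * pi * (g a x * (be x * sin (2 * pi * t * be x + th)))).

Let exp_lin (z : R) : z * expR (- z) <= 2 * expR (- (z / 2)).
Proof.
have -> : expR (- z) = expR (- (z / 2)) * expR (- (z / 2)) by rewrite -expRD; congr expR; lra.
rewrite mulrA ler_wpM2r ?expR_ge0// expRN ler_pdivrMr ?expR_gt0//.
have := expR_ge1Dx (z / 2); lra.
Qed.

(** A factor linear in N is absorbed by halving the exponent; this supplies the dominating Gaussians
    for differentiation under the integral. *)
Let gauss_lin (c0 c1 : R) x : 0 <= c0 -> 0 <= c1 ->
  (c0 + c1 * N x) * g a x <= (c0 + c1 * (2 / a)) * g (a / 2) x.
Proof.
move=> h0 h1; have [k|k] := pselect (kap x); last by rewrite !gG_nkap// !mulr0.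
have N0 : 0 <= N x := dotv_ge0 _.
have aN : 0 <= a * N x by apply: mulr_ge0 => //; exact: ltW.
have E2 : a / 2 * N x = a * N x / 2 by rewrite mulrAC.
rewrite !gG_kap// E2 [leLHS]mulrDl [leRHS]mulrDl; apply: lerD.
  by apply: ler_wpM2l => //; rewrite ler_expR lerN2; move: (a * N x) aN => z z0; lra.
rewrite -(mulrA c1 (N x)) -(mulrA c1 (2 / a)); apply: ler_wpM2l => //.
rewrite -(ler_pM2l a0) (mulrA a); apply: le_trans (exp_lin _) _.
by rewrite [leRHS]mulrA (mulrCA a 2) mulfV ?gt_eqF// mulr1.
Qed.

Let lin_deriv (c k u : R) : is_derive u (1 : R) (fun t => c * t + k) c.
Proof.
rewrite (_ : (fun t => c * t + k) = (c *: (@id R)) + cst k).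
  by apply: is_derive_eq; rewrite addr0 /GRing.scale /= mulr1.
by apply/funext.
Qed.

Let quad_deriv (k c1 c2 c3 u : R) :
  is_derive u (1 : R) (fun s => k * (c1 + 2 * s * c2 + s ^+ 2 * c3)) (k * (2 * c2 + 2 * u * c3)).
Proof.
have h1 := lin_deriv (k * 2 * c2) (k * c1) u.
have h2 := is_deriveM (lin_deriv (k * c3) 0 u) (lin_deriv 1 0 u).
have h := is_deriveD h1 h2.
rewrite (_ : (fun s => _) = (fun s => k * 2 * c2 * s + k * c1) + (fun s => k * c3 * s + 0) * (fun s => 1 * s + 0)).
  by apply: (is_derive_eq h); rewrite /GRing.scale /=; ring.
apply/funext => s; change (k * (c1 + 2 * s * c2 + s ^+ 2 * c3) = k * 2 * c2 * s + k * c1 + (k * c3 * s + 0) * (1 * s + 0)).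
by ring.
Qed.

Lemma wave_deriv t : is_derive t (1 : R) (fun t => \int[mu]_x wave t x) (\int[mu]_x dwave t x).
Proof.
have p0 : 0 < pi :> R := pi_gt0 R.
have a2 : 0 < a / 2 by rewrite divr_gt0.
have c0 : 0 <= pi * d by rewrite mulr_ge0// ltW.
have c1 : 0 <= pi * (2 / a) by rewrite mulr_ge0 ?divr_ge0// ltW.
apply: (@diff_under wave dwave t (1 + pi * d + pi * (2 / a)) (a / 2) a2).
- by rewrite !addr_ge0.
- move=> u x; apply: cvgM; first exact: (gG_cont gs).
  apply: (cont_comp (f := fun x : mt A => 2 * pi * u * be x + th) (g := @cos R)); last exact: continuous_cos.
  by move=> y; apply: cvgD; [apply: cvgM; [exact: cvg_cst | exact: be_cont] | exact: cvg_cst].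
- move=> u x _; rewrite /wave normrM ger0_norm ?gG_ge0//.
  apply: (@le_trans _ _ ((1 + 0 * N x) * g a x)).
    by rewrite mul0r addr0 mul1r ler_piMr ?gG_ge0// cos_max.
  apply: le_trans (gauss_lin _ ler01 (lexx _)) _; rewrite mul0r addr0.
  by rewrite ler_wpM2r ?gG_ge0// -addrA lerDl addr_ge0.
- move=> u x; rewrite /wave /dwave.
  have h1 : is_derive u (1 : R) (@cos R \o (fun t => 2 * pi * be x * t + th))
      (- sin (2 * pi * be x * u + th) * (2 * pi * be x)).
    exact: (@is_derive1_comp _ (@cos R) (fun t => 2 * pi * be x * t + th)).
  rewrite (_ : (fun t => g a x * cos (2 * pi * t * be x + th)) = g a x *: (@cos R \o (fun t => 2 * pi * be x * t + th))).
    apply: (is_derive_eq (is_deriveZ _ _)); rewrite /GRing.scale /=.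
    by rewrite (mulrAC _ u) -/(be x); ring.
  by apply/funext => t'; rewrite /= (mulrAC _ t').
- move=> u x _; rewrite /dwave normrN.
  apply: (@le_trans _ _ ((pi * d + pi * N x) * g a x)).
    rewrite (_ : 2 * pi * _ = pi * (g a x * ((2 * be x) * sin (2 * pi * u * be x + th)))); last by ring.
    rewrite normrM (gtr0_norm p0) normrM (ger0_norm (gG_ge0 _ _ _ _)).
    rewrite [leRHS](_ : _ = pi * (g a x * (d + N x))); last by ring.
    apply: ler_wpM2l; first exact: ltW.
    apply: ler_wpM2l; first exact: gG_ge0.
    by rewrite normrM; apply: le_trans (be_le x); rewrite ler_piMr// sin_max.
  apply: le_trans (gauss_lin _ c0 (ltW p0)) _.
  by rewrite ler_wpM2r ?gG_ge0// -addrA lerDr.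
Qed.

Let beb x : `|be x| <= d + N x.
Proof. apply: le_trans (be_le x); rewrite normrM ger0_norm//; have := normr_ge0 (be x); lra. Qed.

Let phc t : continuous (fun x : mt A => 2 * pi * t * be x + th).
Proof. by move=> y; apply: cvgD; [apply: cvgM; [exact: cvg_cst | exact: be_cont] | exact: cvg_cst]. Qed.

Let Ic t : continuous (fun x : mt A => g a x * (be x * sin (2 * pi * t * be x + th))).
Proof.
move=> x; apply: cvgM; first exact: (gG_cont gs).
by apply: cvgM; [exact: be_cont | exact: (cont_comp (@phc t) (@continuous_sin R))].
Qed.

Let wave_int t : mu.-integrable setT (EFin \o (fun x : mt A => g a x * (be x * sin (2 * pi * t * be x + th)))).
Proof.
have a2 : 0 < a / 2 by rewrite divr_gt0.
apply: (gauss_integrable (M := d + 2 / a) a2 _ (@Ic t)) => [|x]; first by rewrite addr_ge0// divr_ge0// ltW.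
apply: (@le_trans _ _ ((d + 1 * N x) * g a x)).
  rewrite normrM (ger0_norm (gG_ge0 _ _ _ _)) mulrC; apply: ler_wpM2r; first exact: gG_ge0.
  rewrite mul1r; apply: le_trans (beb x); rewrite normrM; apply: ler_piMr => //; exact: sin_max.
by apply: le_trans (gauss_lin x d0 ler01) _; rewrite mul1r.
Qed.

(* The integral of a translate by [s *: b] does not depend on [s]; differentiate
   at [s = 0]. *)
Lemma wave_parts t :
  \int[mu]_x (g a x * (be x * sin (2 * pi * t * be x + th))) = pi * t * d / a * \int[mu]_x wave t x.
Proof.
have p0 : 0 < pi :> R := pi_gt0 R.
have a2 : 0 < a / 2 by rewrite divr_gt0.
have a4 : 0 < a / 2 / 2 by rewrite divr_gt0.
pose ph (x : A) := 2 * pi * t * be x + th.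
have sc : continuous (fun x : mt A => sin (ph x)) := cont_comp (@phc t) (@continuous_sin R).
have cc : continuous (fun x : mt A => cos (ph x)) := cont_comp (@phc t) (@continuous_cos R).
pose F x := g a x * sin (ph x).
(* The derivative of F in the direction b: the first term comes from the Gaussian, the second from
   the phase. *)
pose F1 x := - (2 * a) * (g a x * (be x * sin (ph x))) + 2 * pi * t * d * wave t x.
have Fc : continuous (F : mt A -> R) by move=> x; apply: cvgM; [exact: (gG_cont gs) | exact: sc].
have wc : continuous (wave t : mt A -> R) by move=> x; apply: cvgM; [exact: (gG_cont gs) | exact: cc].
have F1c : continuous (F1 : mt A -> R).
  by move=> x; apply: cvgD; apply: cvgM; [exact: cvg_cst | exact: (@Ic t) | exact: cvg_cst | exact: wc].
pose M1 := 1 + (a * d + 2 * pi * `|t| * d) + a * (2 / a).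
have aa : 0 <= a * (2 / a) by rewrite mulr_ge0 ?divr_ge0// ltW.
have c1 : 0 <= a * d + 2 * pi * `|t| * d.
  by rewrite addr_ge0 ?mulr_ge0// ltW.
have M10 : 0 <= M1 by rewrite /M1; apply: addr_ge0 => //; apply: addr_ge0.
have wb x : `|wave t x| <= g a x.
  by rewrite /wave normrM ger0_norm ?gG_ge0// ler_piMr ?gG_ge0// cos_max.
have g2 x : g a x <= g (a / 2) x.
  by have := gauss_lin x ler01 (lexx 0); rewrite !mul0r !addr0 !mul1r.
have Fb x : `|F x| <= M1 * g (a / 2) x.
  apply: (@le_trans _ _ (1 * g (a / 2) x)).
    rewrite mul1r; apply: le_trans (g2 x); rewrite normrM (ger0_norm (gG_ge0 _ _ _ _)).
    by apply: ler_piMr; [exact: gG_ge0 | exact: sin_max].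
  by apply: ler_wpM2r; [exact: gG_ge0 | rewrite /M1 -addrA lerDl; exact: addr_ge0].
have F1b x : `|F1 x| <= M1 * g (a / 2) x.
  apply: (@le_trans _ _ ((a * d + 2 * pi * `|t| * d + a * N x) * g a x)).
    have -> : F1 x = g a x * (2 * pi * t * d * cos (ph x) - a * ((2 * be x) * sin (ph x))).
      by rewrite /F1 /wave -/(ph x); ring.
    rewrite normrM (ger0_norm (gG_ge0 _ _ _ _)) mulrC; apply: ler_wpM2r; first exact: gG_ge0.
    apply: le_trans (ler_normB _ _) _; rewrite addrAC addrC; apply: lerD.
      rewrite !normrM (ger0_norm d0) (ger0_norm (ltW p0)) (ger0_norm (_ : 0 <= 2))//.
      apply: ler_piMr; last exact: cos_max.
      by rewrite !mulr_ge0// ltW.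
    rewrite -mulrDr normrM gtr0_norm//; apply: ler_wpM2l; first exact: ltW.
    by rewrite normrM; apply: le_trans (be_le x); apply: ler_piMr => //; exact: sin_max.
  apply: le_trans (gauss_lin x c1 (ltW a0)) _.
  apply: ler_wpM2r; first exact: gG_ge0.
  by rewrite /M1 -(addrA 1) lerDr.
have sh (H : A -> R) (v : 'rV[R]_n) : continuous (H : mt A -> R) -> \int[mu]_x H (x + e v) = \int[mu]_x H x.
  move=> cH; rewrite /Rintegral; congr fine.
  rewrite (gs_int_shift_fun gs (e v) (F := fun x => (H x)%:E))//.
  by apply/measurable_EFinP; exact: (cont_measurable (gs_std gs)).
have near s x : `|s - 0| < 1 -> M1 * g (a / 2) (x + e (s *: b)) <= M1 * expR (a / 2 * d) * g (a / 2 / 2) x.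
  rewrite subr0 => s1; rewrite -mulrA; apply: ler_wpM2l => //.
  have E1 : x + e (s *: b) - x = e (s *: b) by rewrite addrC addKr.
  apply: (gG_near gs (r := d)); rewrite ?E1 ?(ltW a2)//.
  rewrite /N qe dotvZl dotvZr mulrA -expr2 -real_normK ?num_real//.
  by apply: ler_piMl => //; rewrite expr_le1// ltW.
have M2 : 0 <= M1 * expR (a / 2 * d) by rewrite mulr_ge0 ?expR_ge0.
have dF u x : is_derive u (1 : R) (fun s => F (x + e (s *: b))) (F1 (x + e (u *: b))).
  have [k|k] := pselect (kap x); last first.
    have nk s : ~ kap (x + e (s *: b)).
      by move=> h; apply: k; rewrite -(addrK (e (s *: b)) x); exact: (gs_kB gs).
    rewrite (_ : (fun s => _) = cst 0); last first.
      by apply/funext => s; rewrite /F gG_nkap ?mul0r.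
    by apply: is_derive_eq; rewrite /F1 /wave gG_nkap// !mul0r !mulr0 addr0.
  have ks s : kap (x + e (s *: b)) by exact: (gs_kD gs).
  have NE s : N (x + e (s *: b)) = N x + 2 * s * be x + s ^+ 2 * d.
    rewrite /N qD qe dotvDl !dotvDr !dotvZl !dotvZr (dotvC (q x) b) -/(be x) -/d; ring.
  have bE s : be (x + e (s *: b)) = be x + s * d.
    by rewrite /be qD qe dotvDr dotvZr.
  pose u1 (s : R) := - a * (N x + 2 * s * be x + s ^+ 2 * d).
  pose u2 (s : R) := 2 * pi * t * (be x + s * d) + th.
  have FE : (fun s => F (x + e (s *: b))) = (expR \o u1) * (@sin R \o u2).
    apply/funext => s; change (F (x + e (s *: b)) = expR (u1 s) * sin (u2 s)).
    by rewrite /F gG_kap// NE /ph bE; congr (expR _ * _); rewrite /u1 mulNr.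
  have d1 : is_derive u (1 : R) u1 (- a * (2 * be x + 2 * u * d)).
    exact: quad_deriv.
  have d2 : is_derive u (1 : R) u2 (2 * pi * t * d).
    rewrite (_ : u2 = (fun s => 2 * pi * t * d * s + (2 * pi * t * be x + th))); first exact: lin_deriv.
    by apply/funext => s; rewrite /u2; ring.
  have e1 : is_derive u (1 : R) (expR \o u1) (expR (u1 u) * (- a * (2 * be x + 2 * u * d))).
    exact: is_derive1_comp.
  have e2 : is_derive u (1 : R) (@sin R \o u2) (cos (u2 u) * (2 * pi * t * d)).
    exact: is_derive1_comp.
  rewrite FE; apply: (is_derive_eq (is_deriveM e1 e2)).
  have uE : expR (- (a * (N x + 2 * u * be x + u ^+ 2 * d))) = expR (u1 u) by rewrite /u1 mulNr.
  rewrite /F1 /wave gG_kap// NE /ph bE -/(u2 u) uE /GRing.scale /=; ring.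
have D0 : is_derive (0 : R) (1 : R) (fun s => \int[mu]_x F (x + e (s *: b))) (\int[mu]_x F1 (x + e (0 *: b))).
  apply: (@diff_under (fun s x => F (x + e (s *: b))) (fun s x => F1 (x + e (s *: b))) 0 _ _ a4 M2).
  - move=> s; have c2 : continuous (fun x : mt A => (x : A) + e (s *: b) : mt A) by exact: (@gs_addr _ _ _ _ _ _ gs).
    exact: (cont_comp c2 Fc).
  - by move=> s x s1; apply: le_trans (Fb _) (near _ _ s1).
  - by move=> s x s1; apply: le_trans (F1b _) (near _ _ s1).
have I0 : \int[mu]_x F1 x = 0.
  rewrite -(sh F1 (0 *: b) F1c).
  have h := @derive_val _ _ _ _ _ _ _ D0; rewrite -h.
  rewrite (_ : (fun s => _) = cst (\int[mu]_x F x)); first exact: derive_cst.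
  by apply/funext => s; rewrite sh.
have iw : mu.-integrable setT (EFin \o (wave t : mt A -> R)).
  by apply: (gauss_integrable a0 ler01 wc) => x; rewrite mul1r.
move: I0; rewrite /F1 RintegralD//; last 2 first.
- exact: (integrableZl measurableT (- (2 * a)) (wave_int t)).
- exact: (integrableZl measurableT (2 * pi * t * d) iw).
rewrite !RintegralZl//; last exact: (wave_int t).
move: (\int[mu]_x (g a x * _)) (\int[mu]_x wave t x) => I J h.
have : 2 * a * I = 2 * pi * t * d * J by move: h; rewrite mulNr addrC => /eqP; rewrite subr_eq0 => /eqP.
move=> h2; apply: (mulfI (x := 2 * a)); first by rewrite mulf_neq0// gt_eqF.
by rewrite h2; field; rewrite gt_eqF.
Qed.

(** By [wave_parts] the integral J(t) satisfies J' = - 2 kappa t J. Multiplied by exp (kappa t^2) it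
    is constant, and its value at t = 0 is elementary. *)
Lemma wave_value : \int[mu]_x wave 1 x = expR (- kappa) * (cos th * \int[mu]_x g a x).
Proof.
pose J t := (\int[mu]_x wave t x) * expR (kappa * t ^+ 2).
have JE : J 1 = J 0.
  apply: is_derive_0_is_cst => t; rewrite /J.
  have h1 := wave_deriv t.
  have d1 : is_derive t (1 : R) (fun t => kappa * t ^+ 2) (kappa * (2 * t)).
    have := quad_deriv kappa 0 0 1 t; rewrite mulr0 add0r mulr1.
    by rewrite (_ : (fun s => _) = (fun t => kappa * t ^+ 2))//; apply/funext => s; rewrite mulr0 !add0r mulr1.
  have h2 : is_derive t (1 : R) (expR \o (fun t => kappa * t ^+ 2)) (expR (kappa * t ^+ 2) * (kappa * (2 * t))).
    exact: is_derive1_comp.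
  apply: (is_derive_eq (is_deriveM h1 h2)).
  have dwE : \int[mu]_x dwave t x = - (2 * pi) * \int[mu]_x (g a x * (be x * sin (2 * pi * t * be x + th))).
    rewrite -RintegralZl//.
    by apply: eq_Rintegral => x _; rewrite /dwave mulNr.
  rewrite dwE wave_parts /GRing.scale /= /kappa; move: (\int[mu]_x wave t x) (expR _) => P E.
  by field; rewrite gt_eqF.
move: JE; rewrite /J expr1n mulr1 expr0n /= mulr0 expR0 mulr1 => JE.
rewrite expRN; apply: (mulIf (lt0r_neq0 (expR_gt0 kappa))).
rewrite JE mulrAC mulVf ?gt_eqF ?expR_gt0// mul1r.
rewrite -RintegralZl//.
  by apply: eq_Rintegral => x _; rewrite /wave mulr0 mul0r add0r mulrC.
by apply: (gauss_integrable a0 ler01 (gG_cont gs (a := a))) => x; rewrite mul1r ger0_norm// gG_ge0.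
Qed.

End Direction.

Lemma gauss_fourier (b : 'rV[R]_n) (a : R) : 0 < a ->
  cint mu (fun x : mt A => (g a x)%:C * (cexpi (2 * pi * dotv b (q x)))^*) =
  ((\int[mu]_x g a x) * expR (- (pi ^+ 2 / a * dotv b b)))%:C.
Proof.
move=> a0.
have h0 := wave_value b 0 a0; have h1 := wave_value b (pi / 2) a0.
rewrite cos0 mul1r in h0; rewrite cos_pihalf mul0r mulr0 in h1.
have E : pi ^+ 2 / a * dotv b b = pi ^+ 2 * dotv b b / a by rewrite mulrAC.
apply: complex_eq => /=.
  rewrite E [RHS]mulrC -h0; apply: eq_Rintegral => x _.
  by rewrite mul0r subr0 mulr1 addr0.
rewrite -[RHS]h1; apply: eq_Rintegral => x _.
by rewrite mul0r addr0 mulr1 cosDpihalf.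
Qed.

Lemma gauss_mass_gt0 (a : R) : 0 < a -> 0 < \int[mu]_x g a x.
Proof.
move=> a0; have [I I0 IE] := gG_fin gs a0.
have -> : \int[mu]_x g a x = I by rewrite /Rintegral IE.
rewrite lt_neqAle I0 andbT eq_sym; apply/eqP => I00.
pose U : set (mt A) := [set x | 2^-1 < g a x].
have Uo : open U by apply: (@open_comp _ _ (g a : mt A -> R) [set y | 2^-1 < y]) => [x _|]; [exact: (gG_cont gs) | exact: open_gt].
have U0 : U !=set0.
  exists (0 : A); rewrite /U /= gG_kap ?(gs_N00 gs) ?mulr0 ?oppr0 ?expR0; last exact: (gs_k0 gs).
  by rewrite invf_lt1// ltr1n.
have := gs_pos gs Uo U0; apply/negP; rewrite -leNgt.
have : (2^-1%:E * mu U <= \int[mu]_x (g a x)%:E)%E.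
  have mU : measurable U by apply: (gs_std gs).2.
  rewrite -[U]setIT -integral_indic// -ge0_integralZl_EFin//; last first.
    by apply/measurable_EFinP; exact: measurable_indic.
  apply: ge0_le_integral_nomeas => x; first by rewrite mule_ge0// lee_fin.
  rewrite -EFinM lee_fin indicE; case: (boolP (x \in U)) => [|_]; rewrite ?mulr1 ?mulr0 ?gG_ge0//.
  by rewrite inE => /ltW.
rewrite IE I00 => h.
have h2 : (0 <= 2%:E :> \bar R)%E by rewrite lee_fin.
by have := lee_wpmul2l h2 h; rewrite mule0 muleA -EFinM divff// mul1e.
Qed.

End GaussianFourier.

Section Spaces.
Context (R : realType) (G G0 : topologicalZmodType) (n : nat).
Hypothesis lG : lca_group G.
Hypothesis scG : @second_countable G.
Variables (Phi : G -> 'rV[R]_n * G0) (Phi' : 'rV[R]_n * G0 -> G).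
Hypothesis PhiD : {morph Phi : x y / x + y}.
Hypothesis Phic : continuous Phi.
Hypothesis PhiK : cancel Phi Phi'.
Hypothesis Phi'K : cancel Phi' Phi.
Hypothesis Phi'c : continuous Phi'.
Variable K : set G0.
Hypothesis K_sub : compact_open_subgroup K.
Local Notation Gd := (dual R G).
Variables (mu : {sigma_finite_measure set (borel G) -> \bar R})
    (nu : {sigma_finite_measure set (borel (dual R G)) -> \bar R}).
Hypothesis mu_haar : haar mu.
Hypothesis nu_dual : dual_haar mu nu.
Local Notation gq := (gq Phi).
Local Notation ge := (ge Phi').
Local Notation gk := (gk Phi K).
Local Notation dq := (dq Phi).
Local Notation dk := (dk Phi K).

Local Notation gN := (gN Phi).
Local Notation gh := (gh Phi Phi').
Local Notation dN := (dN Phi).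
Local Notation dh := (dh PhiD Phic).
Local Notation TG := (tgB G).
Local Notation TD := (tgB Gd).
Let gsG : @gspace R TG mu gN gk gh := gG_gspace scG PhiD Phic PhiK Phi'K Phi'c K_sub mu_haar.
Let gsD : @gspace R TD nu dN dk dh := gD_gspace lG scG PhiD Phic PhiK Phi'K Phi'c K_sub nu_dual.
Local Notation gGa := (@gG R TG gN gk).
Local Notation gDa := (@gG R TD dN dk).
Definition gmass a : R := (\int[mu]_x gGa a x)%R.

Lemma gmass_gt0 a : 0 < a -> 0 < gmass a.
Proof. exact: (gauss_mass_gt0 (A := TG) (mu := mu) (q := gq) gsG). Qed.

Lemma gmeas_char (xi : Gd) : cmeas (xi : mt TG -> R[i]).
Proof. by apply: (ccont_cmeas (std_borel scG)); apply: contC_ccont; exact: dual_cont. Qed.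

Lemma dual_fourier a (xi : Gd) : 0 < a ->
  cint mu (fun x : mt TG => (gGa a x)%:C * ((xi : Gd) x)^*) =
  (gmass a * gDa (pi ^+ 2 / a) xi)%:C.
Proof.
move=> a0; have [k|k] := pselect (dk xi).
  rewrite gG_kap// -(gauss_fourier (A := TG) (mu := mu) (q := gq) (e := ge) gsG _ _ _ _ (dq xi) a0).
  - congr cint; apply/funext => x; have [kx|kx] := pselect (gk x).
      by rewrite (dk_gk PhiD PhiK Phi'K Phi'c k kx).
    by rewrite gG_nkap// !mul0r.
  - by move=> x y; rewrite /Submission.gq PhiD.
  - exact: gq_cont.
  - exact: gqe.
  - exact: (gke Phi'K K_sub).
rewrite gG_nkap// mulr0.
(* Here xi is nontrivial on K. Translating by an element h with xi h different from 1 leaves the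
   Gaussian unchanged and multiplies the integral by the conjugate of xi h, so the integral is 0. *)
have [y Ky xy] : exists2 y, K y & xi (Phi' (0, y)) != 1.
  apply: contrapT => h; apply: k; apply/(dkP PhiD PhiK Phi'K Phi'c) => y Ky.
  by apply/eqP/negPn/negP => h2; apply: h; exists y.
set h := Phi' (0, y) in xy.
have qh : gq h = 0 by rewrite /Submission.gq Phi'K.
have kh : gk h by rewrite /Submission.gk /= Phi'K.
pose f (x : mt TG) : R[i] := (gGa a x)%:C * ((xi : Gd) x)^*.
have mf : cmeas f.
  apply: cmeasM; last by apply: cmeas_conj; exact: gmeas_char.
  by apply: cmeas_real; exact: (gG_meas gsG).
have fh : (fun x : mt TG => f ((x : TG) + h)) = fun x => (xi h)^* * f x.
  apply/funext => x; rewrite /f (_ : gGa a ((x : TG) + h) = gGa a x).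
    by rewrite (dual_add xi x h) rmorphM /=; ring.
  have kE : gk ((x : G) + h) <-> gk x.
    by apply: (gs_kBE gsG (x := (x : TG) + h) (y := x)); rewrite addrC addKr.
  have [kx|kx] := pselect (gk x).
    rewrite !gG_kap//; last exact/kE.
    have qxh : gq ((x : G) + h) = gq x by rewrite -[RHS]addr0 -qh /Submission.gq PhiD.
    by rewrite /Submission.gN qxh.
  by rewrite !gG_nkap// => /kE.
have If : cintg mu f.
  apply: (gG_cintg gsG (M := 1) a0); first by apply: cmeas_conj; exact: gmeas_char.
  by move=> x; rewrite cmod_conj dual_cmod.
have := gs_cint_shift gsG h mf; rewrite fh cintZ// => e.
have : (1 - (xi h)^*) * cint mu f = 0 by rewrite mulrBl mul1r e subrr.
move=> /eqP; rewrite mulf_eq0 => /orP[|/eqP->//]; rewrite subr_eq0 => /eqP h1.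
by move: xy; rewrite -[xi h]conjCK -h1 rmorph1 eqxx.
Qed.

(** The inversion formula applied to the Gaussian, whose transform is again an integrable Gaussian.
    This is where the normalization of nu relative to mu enters. *)
Lemma dual_fourier_inv a x : 0 < a ->
  cint nu (fun xi : mt TD => (gDa (pi ^+ 2 / a) xi)%:C * (xi : Gd) x) = ((gmass a)^-1 * gGa a x)%:C.
Proof.
move=> a0; have [_ inv] := nu_dual.
have pa : 0 < pi ^+ 2 / a by rewrite divr_gt0 ?exprn_gt0 ?pi_gt0.
have C0 := gmass_gt0 a0.
have If : cintg nu (fun xi : mt TD => (gDa (pi ^+ 2 / a) xi)%:C * (xi : Gd) x).
  apply: (gG_cintg gsD (M := 1) pa) => [|xi]; last by rewrite dual_cmod.
  apply: (ccont_cmeas (gs_std gsD)); apply: contC_ccont.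
  exact: (dual_eval_comp lG (@cont_id (mt TD)) (@cont_cst _ _ x)).
have real1 (d : measure_display) (T : measurableType d) (m : {measure set T -> \bar R}) (h : T -> R) :
    measurable_fun setT h -> (forall t, 0 <= h t) -> (\int[m]_t (h t)%:E < +oo)%E -> cLspace m 1%:E (fun t => (h t)%:C).
  move=> mh h0 ih; apply/L1P; split; first exact: cmeas_real.
  by under eq_integral do rewrite cmod_real ger0_norm//.
pose f (t : G) : R[i] := (gGa a t)%:C.
have c1 : continuous (f : G -> R[i]^o).
  by apply: ccont_contC; apply: ccont_real; exact: (gG_cont gsG).
have c2 : cLspace mu 1%:E f.
  by apply: real1; [exact: (gG_meas gsG) | move=> t; exact: gG_ge0 | exact: (gG_int gsG)].
have c3 : cLspace nu 1%:E (fun xi : Gd => inner mu f xi).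
  rewrite (_ : (fun xi : Gd => _) = fun xi => (gmass a * gDa (pi ^+ 2 / a) xi)%:C); last first.
    by apply/funext => xi; exact: dual_fourier.
  apply: real1.
  - by apply: measurable_funM; [exact: measurable_cst | exact: (gG_meas gsD)].
  - by move=> t; rewrite mulr_ge0 ?gG_ge0// ltW.
  - under eq_integral do rewrite EFinM.
    rewrite ge0_integralZl_EFin ?(ltW C0)//.
    + by apply: lte_mul_pinfty; rewrite ?lee_fin ?(ltW C0)//; exact: (gG_int gsD).
    + by move=> t _; rewrite lee_fin gG_ge0.
    + by apply/measurable_EFinP; exact: (gG_meas gsD).
have h : (gGa a x)%:C = cint nu (fun xi : mt TD => inner mu f (xi : Gd) * (xi : Gd) x) := inv f c1 c2 c3 x.
rewrite rmorphM /= h (_ : (fun xi : mt TD => inner _ _ _ * _) =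
   (fun xi : mt TD => (gmass a)%:C * ((gDa (pi ^+ 2 / a) xi)%:C * (xi : Gd) x))); last first.
  by apply/funext => xi; rewrite [inner _ _ _]dual_fourier// rmorphM /= mulrA.
rewrite cintZ//.
by rewrite mulrA -rmorphM /= mulVf ?mul1r// gt_eqF.
Qed.

Lemma gpair_base : @gpair R TG TD mu nu gN gk dN dk (fun xi x => (xi : Gd) x) (gmass (2 * pi)).
Proof.
have p0 := pi_gt0 R; have p2 : 0 < 2 * pi :> R by rewrite mulr_gt0.
have E : pi ^+ 2 / (2 * pi) = pi / 2 :> R.
  by rewrite expr2 (mulrC 2) invfM mulrA mulfK ?gt_eqF.
split.
- exact: gmass_gt0.
- by move=> xi x; exact: dual_cmod.
- by [].
- by move=> xi x y; exact: dual_add.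
- by apply: contC_ccont; exact: dual_eval_cont.
- by move=> xi; rewrite dual_fourier// E.
- by move=> x; rewrite -(dual_fourier_inv x p2) E.
Qed.

(** The pair with the roles exchanged, obtained without forming a bidual: the direct and the inverse
    transform trade places, up to a reflection under which Gaussians are invariant. The constant is
    an inverse mass because it now comes from the inversion formula. *)
Lemma gpair_dual : @gpair R TD TG nu mu dN dk gN gk (fun x xi => (xi : Gd) x) (gmass (pi / 2))^-1.
Proof.
have p0 := pi_gt0 R; have p2 : 0 < pi / 2 :> R by rewrite divr_gt0.
have E : pi ^+ 2 / (pi / 2) = 2 * pi :> R.
  by rewrite invf_div expr2 mulrA mulrAC mulfK ?gt_eqF// mulrC.
split.
- by rewrite invr_gt0; exact: gmass_gt0.
- by move=> x xi; exact: dual_cmod.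
- by move=> x y xi; exact: dual_add.
- by [].
- apply: contC_ccont.
  exact: (dual_eval_comp lG (@cont_snd (mt TG) (mt TD)) (@cont_fst (mt TG) (mt TD))).
- move=> x; rewrite -(gGN gsG) -dual_fourier_inv// E; congr cint; apply/funext => xi.
  by rewrite dual_argN.
- move=> xi; rewrite invrK -(gGN gsD) -E -dual_fourier//; congr cint; apply/funext => x.
  by rewrite dual_evalN conjCK.
Qed.

Lemma half_base (xi : TD) (x : TG) : dk xi -> gk x -> (xi : Gd) ((x : G) - gh x - gh x) = 1.
Proof.
move=> kxi kx.
have gkh : gk (gh x) by exact: (gke Phi'K K_sub).
rewrite (dk_gk PhiD PhiK Phi'K Phi'c kxi); last by do 2 apply: (gkB PhiD K_sub) => //.
rewrite !(gqB PhiD) !(gqe Phi'K) -addrA -opprD -scalerDl (_ : 2^-1 + 2^-1 = 1); last by field.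
by rewrite scale1r subrr dotvC dotv0l mulr0 cexpi0.
Qed.

Lemma half_dual (xi : TD) (x : TG) : ((xi : Gd) - dh xi - dh xi) (gh x) = 1.
Proof.
rewrite (dual_ge PhiD PhiK Phi'K Phi'c) !(dqB PhiD PhiK Phi'K Phi'c) (dqe PhiD Phic PhiK Phi'K Phi'c).
rewrite -addrA -opprD -scalerDl (_ : 2^-1 + 2^-1 = 1); last by field.
by rewrite scale1r subrr dotv0l mulr0 cexpi0.
Qed.

End Spaces.

Section Planes.
Context (R : realType) (G G0 : topologicalZmodType) (n : nat)
  (Phi : G -> 'rV[R]_n * G0) (K : set G0).

Lemma gaussian_base : gaussian Phi K = fun x : G => (@gG R (tgB G) (gN Phi) (gk Phi K) pi x)%:C.
Proof. by apply/funext => x; rewrite /gaussian /gG !indicE. Qed.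

Lemma dotv_row_mx (u w : 'rV[R]_n) : dotv (row_mx u w) (row_mx u w) = dotv u u + dotv w w.
Proof.
rewrite /dotv big_split_ord /=; congr (_ + _); apply: eq_bigr => i _.
  by rewrite row_mxEl.
by rewrite row_mxEr.
Qed.

Lemma gaussian_double : gaussian (double_coord Phi) (K `*` annihilator (R := R) K) =
  fun z : G * dual R G => (@gG R (tgprod (tgB G) (tgB (dual R G)))
    (@prodN R (tgB G) (tgB (dual R G)) (gN Phi) (dN Phi))
    (@prodk (tgB G) (tgB (dual R G)) (gk Phi K) (dk Phi K)) pi z)%:C.
Proof. by apply/funext => z; rewrite /gaussian /gG !indicE /= dotv_row_mx. Qed.

End Planes.

Theorem theorem5p4 (R : realType)
    (* the group, its splitting G = R^n x G0 and the subgroup K of G0 *)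
    (G : topologicalZmodType)
    (G_lca : lca_group G) (G_sc : @second_countable G)
    (G_sigma : sigma_compact G)
    (n : nat) (G0 : topologicalZmodType) (G0_lca : lca_group G0)
    (Phi : G -> 'rV[R]_n * G0) (Phi_iso : topological_group_iso Phi)
    (K : set G0) (K_sub : compact_open_subgroup K)
    (* dual Haar measures *)
    (mu : {sigma_finite_measure set (borel G) -> \bar R})
    (nu : {sigma_finite_measure set (borel (dual R G)) -> \bar R})
    (mu_haar : haar mu) (nu_dual : dual_haar mu nu)
    (* windows and neighbourhoods fixing the modulation norms *)
    (g : G -> R[i]) (Q : set (G * dual R G))
    (g_SC : SC_nonzero (base_plane mu nu Phi K) g)
    (Q_nbhd : unit_nbhd (base_plane mu nu Phi K) Q)
    (g2 : G * dual R G -> R[i])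
    (Q2 : set ((G * dual R G) * (dual R G * G)))
    (g2_SC : SC_nonzero (double_plane mu nu Phi K) g2)
    (Q2_nbhd : unit_nbhd (double_plane mu nu Phi K) Q2)
    (* symbol and windows *)
    (p : R) (p_gt0 : 0 < p)
    (a : (G * dual R G -> R[i]) -> R[i])
    (a_M : modulation_space (double_plane mu nu Phi K) g2 Q2 p%:E +oo%E a)
    (psi1 psi2 : G -> R[i])
    (psi1_SC : SC_nonzero (base_plane mu nu Phi K) psi1)
    (psi2_SC : SC_nonzero (base_plane mu nu Phi K) psi2)
    (* the bounded extension of the localization operator to L^2 *)
    (A : (G -> R[i]) -> (G -> R[i]))
    (A_ext : L2_extension mu nu Phi K psi1 psi2 a A)
    (A_spec : point_spectrum mu A `\ 0 !=set0)
    (lambda : R[i]) (lambda_spec : (point_spectrum mu A `\ 0) lambda)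
    (f : G -> R[i]) (f_eigen : eigenfunction mu A lambda f) :
  (\bigcap_(gamma in [set t : R | 0 < t])
     modulation_space (base_plane mu nu Phi K) g Q gamma%:E gamma%:E)
  (distribution_of (base_plane mu nu Phi K) f).
Proof.
have [PhiD Phic [Phi' [PhiK Phi'K Phi'c]]] := Phi_iso.
(* With the Gaussians written through [gG], the planes of the statement agree with [gplane] over the
   group and over its time-frequency plane. *)
rewrite /base_plane (gaussian_base Phi K) in g_SC Q_nbhd psi1_SC psi2_SC *.
rewrite /double_plane (gaussian_double Phi K) in g2_SC Q2_nbhd a_M.
have [Ab Aa] := A_ext; rewrite /localization_operator /base_plane (gaussian_base Phi K) in Aa.
move=> ga /= ga0.
have lam0 : lambda != 0 by case: lambda_spec => _ /eqP.
have gs1 := gG_gspace G_sc PhiD Phic PhiK Phi'K Phi'c K_sub mu_haar.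
have gs2 := gD_gspace G_lca G_sc PhiD Phic PhiK Phi'K Phi'c K_sub nu_dual.
have gp1 := gpair_base G_lca G_sc PhiD Phic PhiK Phi'K Phi'c K_sub mu_haar nu_dual.
have gp2 := gpair_dual G_lca G_sc PhiD Phic PhiK Phi'K Phi'c K_sub mu_haar nu_dual.
have t1 := half_base PhiD PhiK Phi'K Phi'c K_sub.
have t2 := half_dual PhiD Phic PhiK Phi'K Phi'c.
have H1 := eigen_plane gs1 gs2 gp1 gp2 t1 t2.
have H2 := H1 psi1 psi2 g Q g2 Q2 psi1_SC.1 psi2_SC.1 g_SC.1.
have H3 := H2 Q_nbhd.
have H4 := H3 g2_SC.
have H5 := H4 Q2_nbhd p a p_gt0.
have H6 := H5 a_M.
have H7 := H6 A lambda f Ab Aa lam0 f_eigen ga ga0.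
exact: H7.
Qed.
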